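(* Let $W$ be a super-critical weight on $\mathbb{D}$. Then for any relatively compact subset $D\subset\mathbb{D}$, $$\lim_{s\to1^+}\sup_{z\in D}\mathbb{E}_{\mathbb{P}_{K_{\mathbb{D}}}}\Big(\sup_{f\in\mathcal{B}(W)}\Big|\frac{g_X(s,z;f)}{g_{\mathbb{P}_{K_{\mathbb{D}}}}(s)}-f(z)\Big|^2\Big)=0,\qquad\text{where } g_{\mathbb{P}_{K_{\mathbb{D}}}}(s):=\mathbb{E}_{\mathbb{P}_{K_{\mathbb{D}}}}[g_X(s,z)].$$ In particular, there exists a sequence $(s_n)_{n\ge1}$ in $(1,\infty)$ converging to $1$ such that for $\mathbb{P}_{K_{\mathbb{D}}}$-almost every $X\in\mathrm{Conf}(\mathbb{D})$, we have that for Lebesgue almost every $z\in\mathbb{D}$, $$f(z)=\lim_{n\to\infty}\frac{g_X(s_n,z;f)}{g_X(s_n,z)}\quad\text{simultaneously for all }f\in A^2(\mathbb{D},W),$$ where the convergence is uniform for $f$ in the unit ball $\mathcal{B}(W)$ of $A^2(\mathbb{D},W)$.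
   Context: $\mathbb{D}$ is the open unit disk in $\mathbb{C}$, $dA$ is Lebesgue measure on $\mathbb{D}$ normalized so that $A(\mathbb{D})=1$, and $K_{\mathbb{D}}(z,w)=(1-z\bar w)^{-2}$ is the Bergman kernel. $\mathrm{Conf}(\mathbb{D})$ is the space of (locally finite) configurations $X$ on $\mathbb{D}$, and $\mathbb{P}_{K_{\mathbb{D}}}$ is the determinantal point process induced by $K_{\mathbb{D}}$: the unique simple point process (Borel probability measure on $\mathrm{Conf}(\mathbb{D})$) whose $n$-th correlation function with respect to $dA$ is $\det(K_{\mathbb{D}}(x_i,x_j))_{1\le i,j\le n}$ for all $n\ge1$. The Poincaré metric is $d_{\mathbb{D}}(x,z)=\log\frac{1+|\varphi_x(z)|}{1-|\varphi_x(z)|}$ with $\varphi_x(z)=\frac{z-x}{1-\bar x z}$. For $k\in\mathbb{N}=\{0,1,2,\dots\}$, $z\in\mathbb{D}$: $\mathbb{A}_k(z)=\{x\in\mathbb{D}:k\le d_{\mathbb{D}}(z,x)<k+1\}$. The critical weight is $W_{\mathrm{cr}}(z)=\frac{1}{(1-|z|^2)\log^2\left(\frac{4}{1-|z|^2}\right)}$. A function $W\in L^1(\mathbb{D},dA)$ with $W(z)\ge0$ is a super-critical weight if $\lim_{|z|\to1^-}W(z)/W_{\mathrm{cr}}(z)=\infty$ ($W$ need not be radial). $A^2(\mathbb{D},W)$ is the space of holomorphic $f:\mathbb{D}\to\mathbb{C}$ with $\|f\|_W^2:=\int_{\mathbb{D}}|f|^2W\,dA<\infty$, and $\mathcal{B}(W)=\{f\in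 A^2(\mathbb{D},W):\|f\|_W<1\}$. For $s>1$: $g_X(s,z)=\sum_{x\in X}e^{-s d_{\mathbb{D}}(x,z)}$ (its expectation does not depend on $z$) and $g_X(s,z;f)=\sum_{k=0}^\infty\ \sum_{x\in X\cap\mathbb{A}_k(z)}e^{-s d_{\mathbb{D}}(z,x)}f(x)$; for fixed $s>1$, $z\in\mathbb{D}$ and $W$ super-critical, for $\mathbb{P}_{K_{\mathbb{D}}}$-almost every $X$ the outer series over $k$ converges simultaneously for all $f\in A^2(\mathbb{D},W)$. *)

(* Defs.v *)
(* MathComp world: MathComp-Analysis over an arbitrary R : realType, with the
   complex numbers R[i] of mathcomp-real-closed. *)
From HB Require Import structures.
From mathcomp Require Import all_boot all_order all_algebra.
From mathcomp Require Import complex.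
From mathcomp Require Import all_classical all_reals all_analysis.

Set Implicit Arguments.
Unset Strict Implicit.
Unset Printing Implicit Defensive.

Import Order.TTheory GRing.Theory Num.Theory numFieldNormedType.Exports.

Local Open Scope classical_set_scope.
Local Open Scope ring_scope.

(* R[i] as a one-dimensional normed space over itself: limits in R[i] are the
   usual ones and [derivable f z 1] is complex differentiability at z. *)
HB.instance Definition _ (R : rcfType) := PseudoPointedMetric.copy R[i] R[i]^o.
HB.instance Definition _ (R : rcfType) := NormedModule.copy R[i] R[i]^o.

(* The real-valued modulus; the norm `|z| of R[i] is R[i]-valued and equal to
   (cabs z)%:C. *)
Notation cabs := Normc.normc.

Section Disk.
Context {R : realType}.
Implicit Types (x z w : R[i]) (s : R) (k : nat).

Definition disk : set R[i] := [set z | cabs z < 1].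

Definition mobius x z : R[i] := (z - x) / (1 - conjc x * z).

Definition poincare x z : R :=
  ln ((1 + cabs (mobius x z)) / (1 - cabs (mobius x z))).

Definition annulus k z : set R[i] :=
  [set x | disk x /\ k%:R <= poincare z x < k.+1%:R].

Definition bergman_kernel z w : R[i] := (1 - z * conjc w) ^- 2.

Definition relatively_compact_in_disk (D : set R[i]) : Prop :=
  precompact D /\ closure D `<=` disk.

End Disk.

(* Measure theory on the complex plane is done in real coordinates (x, y), with
   the product of the Borel sigma-algebras; [to_complex] identifies R^2 with
   R[i]. *)
Definition plane (R : realType) : Type :=
  (measurableTypeR R * measurableTypeR R)%type.

HB.instance Definition _ (R : realType) := Measurable.on (plane R).

Section Area.
Context {R : realType}.

Definition to_complex (p : plane R) : R[i] := Complex p.1 p.2.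

Definition plane_disk : set (plane R) := to_complex @^-1` disk.

Lemma invr_pi_ge0 : 0 <= (pi : R)^-1.
Proof. by rewrite invr_ge0 pi_ge0. Qed.

(* Integrals and null sets are always restricted to [plane_disk], where this
   measure has total mass 1. *)
Definition area : {measure set (plane R) -> \bar R} :=
  mscale (NngNum invr_pi_ge0) (@lebesgue_measure R \x @lebesgue_measure R)%E.

(* Integral with respect to the n-fold product of the area measure on the n-th
   power of the disk. It is an iterated integral, which by Tonelli is the same
   thing for the nonnegative measurable integrands it is used with. *)
Fixpoint iterated_integral (n : nat) :
    (n.-tuple (plane R) -> \bar R) -> \bar R :=
  match n with
  | 0 => fun F => F [tuple]
  | m.+1 => fun F => (\int[area]_(p in plane_disk)
      iterated_integral (fun t : m.-tuple (plane R) => F [tuple of p :: t]))%E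
  end.

End Area.

(* A configuration is given by its multiplicity function: [conf_mult X x] is the
   number of particles of X at x. *)
Record conf (R : realType) := Conf_ {
  conf_mult :> R[i] -> nat;
  conf_disk : forall x, conf_mult x != 0%N -> disk x;
  conf_locally_finite : forall K : set R[i], compact K -> K `<=` disk ->
    finite_set (K `&` [set x | conf_mult x != 0%N])
}.

Section Configurations.
Context {R : realType}.

Definition conf0 : conf R.
Proof.
exists (fun=> 0%N) => [x //|K _ _].
by rewrite (_ : _ `&` _ = set0)// -subset0 => x [].
Defined.

HB.instance Definition _ := gen_eqMixin (conf R).
HB.instance Definition _ := gen_choiceMixin (conf R).
HB.instance Definition _ := isPointed.Build (conf R) conf0.

(* Continuous functions with compact support in the disk, extended by 0. *)
Record test_function := TestFunction {
  test_fun :> R[i] -> R;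
  test_continuous : continuous test_fun;
  test_support : exists K : set R[i],
    [/\ compact K, K `<=` disk & forall x, ~ K x -> test_fun x = 0]
}.

Definition vague_embedding (X : conf R) : {ptws test_function -> R} :=
  fun phi => \sum_(x \in [set: R[i]]) (X x)%:R * phi x.

(* The vague topology, the coarsest one making every
   X |-> \sum_(x in X) phi(x) continuous. *)
HB.instance Definition _ :=
  Topological.copy (conf R) (initial_topology vague_embedding).

End Configurations.

(* The space of configurations with its Borel sigma-algebra. *)
Definition Conf (R : realType) := g_sigma_algebraType (@open (conf R)).

HB.instance Definition _ (R : realType) := Measurable.on (Conf R).

Section PointProcess.
Context {R : realType}.
Implicit Types (P : probability (Conf R) R) (X : conf R).

Definition simple_conf X : Prop := forall x, (X x <= 1)%N.

Definition simple_process P : Prop := {ae P, forall X : Conf R, simple_conf X}.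

(* rho is the n-th correlation function of the simple process P with respect to
   the area measure: the expectation of the sum of phi(x_1, ..., x_n) over the
   ordered n-tuples of distinct particles is the integral of phi * rho. The
   multiplicities in the product are 0 or 1 for a simple configuration. *)
Definition correlation_function P (n : nat) (rho : n.-tuple (plane R) -> R) :=
  forall phi : n.-tuple (plane R) -> R,
    measurable_fun setT phi -> (forall t, 0 <= phi t) ->
    (\int[P]_X (\esum_(t in [set t : n.-tuple (plane R) | uniq t])
        (phi t * \prod_(i < n) ((X : conf R) (to_complex (tnth t i)))%:R)%:E)
     = iterated_integral (fun t => (phi t * rho t)%:E))%E.

(* The determinant is real because the kernels in use are Hermitian. *)
Definition kernel_det (K : R[i] -> R[i] -> R[i]) (n : nat)
    (t : n.-tuple (plane R)) : R :=
  complex.Re (\det (\matrix_(i < n, j < n)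
    K (to_complex (tnth t i)) (to_complex (tnth t j)))).

Definition determinantal_process P (K : R[i] -> R[i] -> R[i]) : Prop :=
  simple_process P /\
  forall n : nat, (0 < n)%N -> correlation_function P (@kernel_det K n).

End PointProcess.

Section Weights.
Context {R : realType}.
Implicit Types (W : R[i] -> R) (f : R[i] -> R[i]) (z : R[i]).

Definition critical_weight z : R :=
  ((1 - cabs z ^+ 2) * (ln (4 / (1 - cabs z ^+ 2))) ^+ 2)^-1.

Definition super_critical W : Prop :=
  [/\ area.-integrable plane_disk (fun p => (W (to_complex p))%:E),
      forall z, disk z -> 0 <= W z &
      forall M : R, exists2 r : R, r < 1 &
        forall z, r < cabs z < 1 -> M < W z / critical_weight z].

(* Only the values on the disk matter; the extension of f outside is
   arbitrary. *)
Definition holomorphic_on_disk f : Prop :=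
  forall z, disk z -> derivable f z 1.

Definition weighted_sqnorm W f : \bar R :=
  (\int[area]_(p in plane_disk)
     (cabs (f (to_complex p)) ^+ 2 * W (to_complex p))%:E)%E.

Definition weighted_bergman W : set (R[i] -> R[i]) :=
  [set f | holomorphic_on_disk f /\ (weighted_sqnorm W f < +oo)%E].

Definition weighted_norm W f : R := Num.sqrt (fine (weighted_sqnorm W f)).

Definition unit_ball W : set (R[i] -> R[i]) :=
  [set f | weighted_bergman W f /\ weighted_norm W f < 1].

End Weights.

Section PattersonSullivan.
Context {R : realType}.
Implicit Types (P : probability (Conf R) R) (X : conf R) (s : R) (z : R[i]).
Implicit Types (f : R[i] -> R[i]).

Definition g_sum X s z : \bar R :=
  (\esum_(x in [set: R[i]]) ((X x)%:R * expR (- s * poincare x z))%:E)%E.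

Definition g_mean P s z : \bar R := (\int[P]_X g_sum X s z)%E.

Definition g_shell X s z f (k : nat) : R[i] :=
  \sum_(x \in annulus k z)
    (real_complex R ((X x)%:R * expR (- s * poincare z x)) * f x).

Definition g_sum_converges X s z f : Prop :=
  cvgn (series (g_shell X s z f)).

(* Meaningful when [g_sum_converges X s z f] holds. *)
Definition g_sum_fun X s z f : R[i] := limn (series (g_shell X s z f)).

End PattersonSullivan.

(* Supremum in [0, +oo]: the supremum of the empty set is 0. *)
Definition sup_ge0 {R : realType} (A : set (\bar R)) : \bar R :=
  ereal_sup (0%E |` A).

(* Main.v *)
Require Import Defs.
From HB Require Import structures.
From mathcomp Require Import all_boot all_order all_algebra.
From mathcomp Require Import complex.
From mathcomp Require Import all_classical all_reals all_analysis.
From mathcomp Require finmap.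
From mathcomp Require Import measurable_realfun.
From mathcomp Require Import ring lra zify.
Import Order.TTheory GRing.Theory Num.Theory numFieldNormedType.Exports.
Local Open Scope classical_set_scope.
Local Open Scope ring_scope.
Set Implicit Arguments.
Unset Strict Implicit.
Unset Printing Implicit Defensive.


(** Write w(x) for the weight e^{-s d(z,x)} and S(f) for the sum of w(x) f(x)
    over the particles, so that g_X(s,z;f) = S(f). Three facts carry the
    theorem.

    (1) Means. The one-point intensity of the process is the hyperbolic area
    density (1-|x|^2)^{-2}, which is Moebius invariant, and w depends only on
    the hyperbolic distance to z. Moving z to 0 and using the mean value
    property of x^n composed with a Moebius map gives E S(x^n) = z^n E S(1)
    ([annulus_weight_mean]); so S(x^n) - z^n E S(1) is centred.

    (2) Variances. For a Hermitian kernel the two-point function is at most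
    the product of the one-point functions, because the 2 by 2 determinant
    loses |K(x,y)|^2. Hence the variance of S(u), u >= 0, is at most the
    integral of (w u)^2 against the intensity ([variance_nonneg]). Together
    with (1) this bounds the mean of |S(x^n) - z^n E S(1)|^2 by twice the
    integral of w^2 |x|^{2n} ([mean_monomial_dev2]).

    (3) The supremum over the unit ball. If f has Taylor coefficients a_n then
    S(f) - f(z) E S(1) is the sum of a_n (S(x^n) - z^n E S(1)). Cut the disk
    into the dyadic shells 2^{-j-1} < 1-|x|^2 <= 2^{-j}. Since W is
    super-critical, for every M it dominates M 2^j / (j+3)^2 on all shells
    j >= J, and Parseval on each shell gives
    sum |a_n|^2 c_n <= ||f||_W^2 with c_n of order M / (log_2 n + J)
    ([weighted_bessel]). By Cauchy-Schwarz the supremum over the unit ball of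
    |S(f) - f(z) E S(1)|^2 is at most the sum of
    c_n^{-1} |S(x^n) - z^n E S(1)|^2 ([clin_dev_bound]), whose mean is by (2) at
    most twice the integral of w^2 sum_n c_n^{-1} |x|^{2n}. On shell j the sum
    over n is of order 2^j (j+J)/M and w^2 of order 2^{-2sj}; adding up, the
    mean is of order (1/M) ((s-1)^{-2} + J (s-1)^{-1})
    ([variance_sum_le]), while E S(1) is of order (s-1)^{-1}
    ([mean_stat_exp_weight_ge]). So the normalised mean square is at most
    a constant times 1/M for s close to 1, locally uniformly in z, and M is
    arbitrary.

    The argument needs truncations: it is run on the bounded region
    a <= d(z,x) < b, where S is a finite sum, and the truncation is removed by
    Fatou's lemma. The outer series over the annuli converges because lowering
    the exponent from s to some s' in (1,s) costs a geometric factor on the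
    k-th annulus, so that the bounds over the annuli, summed with
    geometrically growing weights, have finite mean ([mean_shells_energy],
    [shells_converge]).

    For the almost sure statement, choose s_n so close to 1 that the bounds
    at s_n are summable. At each fixed z the errors tend to 0 almost surely;
    since the bounding sums are jointly measurable in (X,z), Fubini's theorem
    exchanges the two quantifiers ([ae_swap]). The denominator g_X(s_n,z) is
    g_X(s_n,z;1), and the constant 1 lies in A^2(D,W), so it is covered by the
    same estimate.

    The Taylor expansion of a function that is complex differentiable at
    every point of the disk comes from Goursat's theorem for rectangles,
    transported to circles by the exponential map, and from a Fourier argument
    on the circle through z ([taylor]). *)

(** * Change of variables on the line *)

Section Density.
Context d (T : measurableType d) (R : realType).
Variables (mu : {measure set T -> \bar R}) (h : T -> R).

(** The measure with density h with respect to mu; integrating against it is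
    multiplying the integrand by h, which turns a change of variables for
    measures into one for integrals. *)
Definition mdensity (_ : measurable_fun setT h) (_ : forall x, 0 <= h x)
  (A : set T) : \bar R := (\int[mu]_(x in A) (h x)%:E)%E.

Hypothesis mh : measurable_fun setT h.
Hypothesis h0 : forall x, 0 <= h x.

Let mdensity0 : mdensity mh h0 set0 = 0%E.
Proof. by rewrite /mdensity integral_set0. Qed.

Let mdensity_ge0 A : (0 <= mdensity mh h0 A)%E.
Proof. by apply: integral_ge0 => x _; rewrite lee_fin. Qed.

Let mdensity_sigma_additive : semi_sigma_additive (mdensity mh h0).
Proof.
move=> F mF tF mUF; apply: cvg_toP.
  apply: ereal_nondecreasing_is_cvgn => m n mn.
  apply: lee_sum_nneg_natr => // k _ _; exact: mdensity_ge0.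
rewrite /mdensity ge0_integral_bigcup//.
  by apply: measurable_funTS; exact/measurable_EFinP.
by move=> x _; rewrite lee_fin.
Qed.

HB.instance Definition _ := isMeasure.Build _ _ _ (mdensity mh h0)
  mdensity0 mdensity_ge0 mdensity_sigma_additive.

Import HBNNSimple.

Lemma ge0_integral_mdensity (f : T -> \bar R) : measurable_fun setT f ->
  (forall x, (0 <= f x)%E) ->
  (\int[mdensity mh h0]_x f x = \int[mu]_x (f x * (h x)%:E))%E.
Proof.
move=> mf f0; pose f_ := nnsfun_approx measurableT mf.
have f_cvg x : (f_ n x)%:E @[n --> \oo] --> f x by apply: cvg_nnsfun_approx.
have f_nd x n m : (n <= m)%N -> ((f_ n x)%:E <= (f_ m x)%:E)%E.
  by move=> mn; rewrite lee_fin; exact/lefP/nd_nnsfun_approx.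
transitivity (limn (fun n => \int[mdensity mh h0]_x (f_ n x)%:E))%E.
  rewrite -monotone_convergence//.
  - by apply: eq_integral => x _; apply/esym/cvg_lim => //; exact: f_cvg.
  - by move=> n; exact/measurable_EFinP.
  - by move=> n x _; rewrite lee_fin.
  - by move=> x _ n m; exact: f_nd.
transitivity (limn (fun n => \int[mu]_x ((f_ n x)%:E * (h x)%:E)))%E; last first.
  rewrite -monotone_convergence//.
  - apply: eq_integral => x _; apply/cvg_lim => //.
    by apply: cvgeZr => //; exact: f_cvg.
  - by move=> n; apply: emeasurable_funM => //; exact/measurable_EFinP.
  - by move=> n x _; rewrite mule_ge0// lee_fin.
  - by move=> x _ m n mn; rewrite lee_wpmul2r ?lee_fin//; exact: f_nd.
congr (limn _); apply/funext => n.
under [LHS]eq_integral do rewrite fimfunE -fsumEFin//.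
rewrite ge0_integral_fsum//; last 2 first.
  - by move=> r; exact/measurable_EFinP/measurableT_comp.
  - by move=> r x _; rewrite EFinM nnfun_muleindic_ge0.
under [RHS]eq_integral.
  move=> x _; rewrite fimfunE -fsumEFin// muleC ge0_mule_fsumr; last first.
    by move=> r; rewrite EFinM nnfun_muleindic_ge0.
  over.
rewrite [RHS]ge0_integral_fsum//; last 2 first.
  - move=> r; apply: emeasurable_funM; first exact/measurable_EFinP.
    by apply/measurable_EFinP/measurableT_comp.
  - move=> r x _; apply: mule_ge0; first by rewrite lee_fin.
    by rewrite EFinM nnfun_muleindic_ge0.
apply: eq_fsbigr => r _.
have [r0|r0] := ltP r 0.
  by rewrite !integral0_eq// => x _; rewrite preimage_nnfun0// indic0 mulr0 ?mule0.
under [LHS]eq_integral do rewrite EFinM.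
rewrite ge0_integralZl//; last exact/measurable_EFinP.
under [RHS]eq_integral do rewrite EFinM muleCA.
rewrite ge0_integralZl//; last 2 first.
  - by apply: emeasurable_funM; exact/measurable_EFinP.
  - by move=> x _; rewrite mule_ge0 ?lee_fin.
congr (_ * _)%E; rewrite integral_indic// setIT /mdensity [in LHS]/= [LHS]integral_mkcond.
apply: eq_integral => x _; rewrite /patch indicE.
by case: ifPn => xr; rewrite ?mule1 ?mule0.
Qed.
End Density.

Section OneDim.
Context {R : realType}.
Local Notation leb := (@lebesgue_measure R).

Lemma measurable_affine (a b : R) : 
  measurable_fun setT (fun x : measurableTypeR R => (a * x + b)%R : measurableTypeR R).
Proof. by apply: measurable_funD => //; apply: measurable_funM. Qed.

(** Both sides are measures agreeing on intervals, and Lebesgue measure is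
    determined by its values on intervals. *)
Lemma lebesgue_measure_affine (a b : R) (A : set R) : a != 0%R -> measurable A ->
  (leb A = `|a|%:E * leb ((fun x => a * x + b)%R @^-1` A))%E.
Proof.
move=> a0 mA.
pose F (x : measurableTypeR R) : measurableTypeR R := (a * x + b)%R.
have mF : measurable_fun setT F by exact: measurable_affine.
pose pF : {measure set (measurableTypeR R) -> \bar R} :=
  measure_function_pushforward__canonical__measure_function_Measure leb mF.
pose Fm : {measure set (measurableTypeR R) -> \bar R} :=
  mscale (NngNum (normr_ge0 a)) pF.
apply: (@lebesgue_measure_unique R Fm) mA => //= _ [[u v]] _ <-.
rewrite /Fm /mscale /= /pushforward.
have [vu|uv] := leP v u.
  rewrite set_itv_ge ?bnd_simp -?leNgt// preimage_set0.
  by rewrite !measure0 mule0.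
have [a_lt0|a_gt0|a_eq0] := ltgtP a 0%R; last by rewrite a_eq0 eqxx in a0.
  have -> : F @^-1` `]u, v] = `[(v - b) / a, (u - b) / a[%classic.
    apply/seteqP; split=> x /=; rewrite /F !in_itv/= => /andP[h1 h2].
      by rewrite ler_ndivrMr// ltr_ndivlMr//; apply/andP; split; lra.
    by rewrite ler_ndivrMr// ltr_ndivlMr// in h1 h2 *; apply/andP; split; lra.
  rewrite !lebesgue_measure_itv/= !lte_fin uv ltr_nM2r ?invr_lt0//.
  rewrite ltrD2r uv -EFinM -EFinD; congr (_%:E).
  by rewrite ltr0_norm//; field.
have -> : F @^-1` `]u, v] = `](u - b) / a, (v - b) / a]%classic.
  apply/seteqP; split=> x /=; rewrite /F !in_itv/= => /andP[h1 h2].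
    by rewrite ler_pdivlMr// ltr_pdivrMr//; apply/andP; split; lra.
  by rewrite ler_pdivlMr// ltr_pdivrMr// in h1 h2 *; apply/andP; split; lra.
rewrite !lebesgue_measure_itv/= !lte_fin uv ltr_pM2r ?invr_gt0//.
rewrite ltrD2r uv -EFinM -EFinD; congr (_%:E).
by rewrite gtr0_norm//; field.
Qed.

Lemma ge0_integral_affine (a b : R) (f : R -> \bar R) : a != 0%R ->
  measurable_fun setT f -> (forall x, 0 <= f x)%E ->
  (\int[leb]_x f x = `|a|%:E * \int[leb]_x f (a * x + b)%R)%E.
Proof.
move=> a0 mf f0.
pose F (x : measurableTypeR R) : measurableTypeR R := (a * x + b)%R.
have mF : measurable_fun setT F by exact: measurable_affine.
rewrite -[X in (_ * X)%E](ge0_integral_pushforward mF leb measurableT)//.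
rewrite -(@ge0_integral_mscale _ _ _ _ _ measurableT (NngNum (normr_ge0 a)))//.
by apply: eq_measure_integral => A mA _; exact: lebesgue_measure_affine.
Qed.


Lemma is_derive_oppV (x : R) : x != 0 ->
  is_derive x (1 : R) (fun x : R => - x^-1) (x ^- 2).
Proof.
move=> x0.
have d : is_derive x (1 : R) (fun x : R => x^-1) (- x ^- 2).
  apply: DeriveDef; first by apply: derivableV.
  by rewrite (@deriveV _ _ id)// derive_id /GRing.scale /= mulr1.
by rewrite -[x ^- 2]opprK; exact: is_deriveN.
Qed.

Lemma integral_inv_sqr (c d : R) : 0 < c -> c < d ->
  (\int[leb]_(x in `[(d^-1)%R, (c^-1)%R]) (x ^- 2)%:E = (d - c)%:E)%E.
Proof.
move=> c0 cd.
have d0 : (0 < d)%R by apply: lt_trans cd.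
have dc : d^-1 < c^-1 by rewrite ltf_pV2.
have nz x : d^-1 <= x -> x != 0 by move=> /(lt_le_trans _) h; rewrite gt_eqF// h// invr_gt0.
pose F (x : R) := - x^-1.
have dF (x : R) : x != 0 -> is_derive x 1 F (x ^- 2) by exact: is_derive_oppV.
rewrite (@continuous_FTC2 _ _ F)//.
- by rewrite -EFinD /F !invrK opprK addrC.
- apply: continuous_in_subspaceT => x /[!inE] /= /[!in_itv] /= /andP[/nz x0 _].
  by apply: cvgV; [rewrite expf_neq0|exact: exprn_continuous].
- have cF x : x != 0 -> {for x, continuous F}.
    by move=> x0; apply: differentiable_continuous; apply/derivable1_diffP; case: (dF _ x0).
  split.
  + move=> x /[!in_itv] /= /andP[/ltW /nz x0 _]; by case: (dF _ x0).
  + by apply: cvg_at_right_filter; apply: cF; apply: nz.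
  + by apply: cvg_at_left_filter; apply: cF; apply: nz; apply: ltW.
- move=> x /[!in_itv] /= /andP[/ltW /nz x0 _].
  by rewrite derive1E; apply: derive_val; apply: dF.
Qed.

Lemma integral_inv_sqry (d : R) : 0 < d ->
  (\int[leb]_(x in `[(d^-1)%R, +oo[) (x ^- 2)%:E = d%:E)%E.
Proof.
move=> d0.
have nz x : d^-1 <= x -> x != 0 by move=> /(lt_le_trans _) h; rewrite gt_eqF// h// invr_gt0.
pose F (x : R) := - x^-1.
have dF (x : R) : x != 0 -> is_derive x 1 F (x ^- 2) by exact: is_derive_oppV.
have cF x : x != 0 -> {for x, continuous F}.
  by move=> x0; apply: differentiable_continuous; apply/derivable1_diffP; case: (dF _ x0).
rewrite (@ge0_continuous_FTC2y _ _ F _ 0)//.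
- by rewrite -EFinD /F !invrK opprK add0r.
- by move=> x _; rewrite invr_ge0 sqr_ge0.
- apply: continuous_in_subspaceT => x /[!inE] /= /[!in_itv] /= /andP[/nz x0 _].
  by apply: cvgV; [rewrite expf_neq0|exact: exprn_continuous].
- rewrite /F -oppr0; apply: cvgN; apply/(@gtr0_cvgV0 _ _ _ _ id); last exact: cvg_id.
  by near=> x; near: x; exact: nbhs_pinfty_gt.
- by move=> x /ltW /nz x0; case: (dF _ x0).
- by apply: cvg_at_right_filter; apply: cF; apply: nz.
- move=> x /[!in_itv] /= /andP[/ltW /nz x0 _].
  by rewrite derive1E; apply: derive_val; apply: dF.
Unshelve. all: by end_near. Qed.


Lemma measurable_invr : measurable_fun setT (fun x : measurableTypeR R => x^-1 : measurableTypeR R).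
Proof.
rewrite (_ : setT = [set x : R | x != 0] `|` [set 0]); last first.
  by apply/seteqP; split=> // x _ /=; have [->|] := eqVneq x 0; [right|left].
have mD : measurable ([set x : R | x != 0] : set (measurableTypeR R)).
  by apply: open_measurable; exact: open_neq.
apply/measurable_funU => //; split; last exact: measurable_fun_set1.
apply: open_continuous_measurable_fun; first exact: open_neq.
by apply/in_setP => x /= x0; exact: inv_continuous.
Qed.

(** Push the measure with density x^{-2} forward by x -> 1/x. On a
    subinterval of the half-line it gives Lebesgue measure, by the integral of
    x^{-2}; completed by Lebesgue measure on the nonpositive half-line it is
    Lebesgue measure itself, by uniqueness. *)
Lemma ge0_integral_inv_pos (f : R -> \bar R) : measurable_fun setT f ->
  (forall x, (0 <= f x)%E) ->
  (\int[leb]_(x in `]0%R, +oo[) f x =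
   \int[leb]_(x in `]0%R, +oo[) (f (x^-1)%R * (x ^- 2)%:E))%E.
Proof.
move=> mf f0.
pose G (x : measurableTypeR R) : measurableTypeR R := x^-1.
have mG : measurable_fun setT G by exact: measurable_invr.
pose h (x : measurableTypeR R) : R := x ^- 2.
have mh : measurable_fun setT h.
  apply: (measurableT_comp mG); exact: measurable_funX.
have h0 x : 0 <= h x by rewrite invr_ge0 sqr_ge0.
pose mu1 : {measure set (measurableTypeR R) -> \bar R} := mdensity leb mh h0.
pose mu2 : {measure set (measurableTypeR R) -> \bar R} :=
  measure_function_pushforward__canonical__measure_function_Measure mu1 mG.
have mP : measurable (`]0%R, +oo[%classic : set (measurableTypeR R)) by [].
have mN : measurable (`]-oo, 0%R]%classic : set (measurableTypeR R)) by [].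
pose mu3 : {measure set (measurableTypeR R) -> \bar R} :=
  measure_add (mrestr leb mN) (mrestr mu2 mP).
have mu3E A : mu3 A = (leb (A `&` `]-oo, 0%R]) + mu2 (A `&` `]0%R, +oo[))%E.
  exact: measure_addE.
have key A : measurable A -> leb A = mu3 A.
  apply: lebesgue_measure_unique => _ [[u v]] _ <-.
  rewrite [(u, v).1]/= [(u, v).2]/=.
  have [vu|uv] := leP v u.
    by rewrite set_itv_ge ?bnd_simp -?leNgt// !measure0.
  rewrite mu3E.
  have [v0|v0] := leP v 0.
    rewrite (_ : `]u, v] `&` `]0, +oo[ = set0) ?measure0 ?adde0; last first.
      by apply/seteqP; split=> // x []/=; rewrite !in_itv/= => /andP[? ?]; lra.
    rewrite setIidl// => x /=; rewrite !in_itv/= => /andP[? ?]; lra.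
  have [u0|u0] := ltP 0 u.
    rewrite (_ : `]u, v] `&` `]-oo, 0] = set0) ?measure0 ?add0e; last first.
      by apply/seteqP; split=> // x []/=; rewrite !in_itv/= => /andP[? ?]; lra.
    rewrite setIidl; last by move=> x /=; rewrite !in_itv/= => /andP[? ?]; lra.
    rewrite /mu2/= /pushforward/= /mu1/= /mdensity.
    rewrite (_ : G @^-1` `]u, v] = `[v^-1%R, u^-1%R[%classic); last first.
      apply/seteqP; split=> x /=; rewrite !in_itv/= /G => /andP[h1 h2].
        have x0 : 0 < x by rewrite -invr_gt0; apply: lt_trans h1.
        by rewrite -[x]invrK lef_pV2 ?ltf_pV2 ?posrE ?invr_gt0// h1 h2.
      have x0 : 0 < x by apply: lt_le_trans h1; rewrite invr_gt0.
      by rewrite -[u]invrK -[v]invrK lef_pV2 ?ltf_pV2 ?posrE ?invr_gt0// h1 h2.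
    rewrite integral_itv_bndo_bndc; last by apply: measurable_funTS; exact/measurable_EFinP.
    by rewrite /h integral_inv_sqr// lebesgue_measure_itv/= lte_fin uv EFinB.
  rewrite (_ : `]u, v] `&` `]-oo, 0] = `]u, 0%R]%classic); last first.
    apply/seteqP; split=> x /=.
      by case; rewrite !in_itv/= => /andP[-> _] ->.
    by rewrite !in_itv/= => /andP[-> x0]; split=> //; lra.
  rewrite (_ : `]u, v] `&` `]0, +oo[ = `]0%R, v]%classic); last first.
    apply/seteqP; split=> x /=.
      by case; rewrite !in_itv/= => /andP[_ ->] /andP[->].
    by rewrite !in_itv/= => /andP[x0 ->]; rewrite x0 andbT; split=> //; lra.
  rewrite /mu2/= /pushforward/= /mu1/= /mdensity.
  rewrite (_ : G @^-1` `]0%R, v] = `[v^-1%R, +oo[%classic); last first.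
    apply/seteqP; split=> x /=; rewrite !in_itv/= /G.
      move=> /andP[x0 h2]; rewrite invr_gt0 in x0.
      by rewrite -[x]invrK lef_pV2 ?posrE ?invr_gt0// h2.
    rewrite andbT => h1.
    have x0 : 0 < x by apply: lt_le_trans h1; rewrite invr_gt0.
    by rewrite -[v]invrK lef_pV2 ?posrE ?invr_gt0// h1 x0.
  rewrite /h integral_inv_sqry// !lebesgue_measure_itv/= !lte_fin uv.
  case: ltgtP u0 => [u0|//|->] _; first by rewrite -!EFinD; congr (_%:E); ring.
  by rewrite sube0 add0e.
transitivity (\int[mu2]_(x in `]0%R, +oo[) f x)%E.
  apply: eq_measure_integral => A mA Apos; transitivity (mu3 A); first exact: key.
  rewrite mu3E.
  rewrite (_ : A `&` `]-oo, 0%R] = set0) ?measure0 ?add0e ?(setIidl Apos)//.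
  apply/seteqP; split=> // x [/Apos/=]; rewrite !in_itv/= andbT.
  by move=> x0 ?; lra.
rewrite integral_mkcond (ge0_integral_pushforward mG mu1 measurableT)//; last 2 first.
  - exact/(measurable_restrictT _ _).1/measurable_funTS.
  - by move=> x _; apply: erestrict_ge0.
rewrite preimage_setT ge0_integral_mdensity//; last 2 first.
  - apply: measurableT_comp => //.
    exact/(measurable_restrictT _ _).1/measurable_funTS.
  - by move=> x; apply: erestrict_ge0.
rewrite [RHS]integral_mkcond; apply: eq_integral => x _.
rewrite /patch /= (_ : (G x \in `]0%R, +oo[%classic) = (x \in `]0%R, +oo[%classic)); last first.
  by apply/idP/idP; rewrite !inE/= !in_itv/= !andbT /G invr_gt0.
by case: ifP => // _; rewrite mul0e.
Qed.

Lemma ge0_integral_inv (f : R -> \bar R) : measurable_fun setT f ->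
  (forall x, (0 <= f x)%E) ->
  (\int[leb]_x f x = \int[leb]_x (f (x^-1)%R * (x ^- 2)%:E))%E.
Proof.
have split (g : R -> \bar R) : measurable_fun setT g -> (forall x, (0 <= g x)%E) ->
    (\int[leb]_x g x = \int[leb]_(x in `]0%R, +oo[) g x + \int[leb]_(x in `]0%R, +oo[) g (- x)%R)%E.
  move=> mg g0.
  transitivity (\int[leb]_(x in `]0%R, +oo[) g x + \int[leb]_(x in `]-oo, 0%R[) g x)%E.
    rewrite [X in (_ + X)%E]integral_itv_bndo_bndc; last exact: measurable_funTS.
    rewrite -ge0_integral_setU//=.
    - congr integral; apply/seteqP; split=> // x _ /=; rewrite !in_itv/= andbT.
      by case: (ltP 0 x) => ?; [left|right].
    - exact: measurable_funTS.
    - rewrite disj_set2E; apply/eqP; rewrite -subset0 => x/= [].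
      by rewrite !in_itv/= andbT => ? ?; lra.
  congr (_ + _)%E.
  have oN : (-1 : R) != 0 by rewrite oppr_eq0 oner_eq0.
  rewrite integral_mkcond (ge0_integral_affine 0 oN)//; last 2 first.
  - exact/(measurable_restrictT _ _).1/measurable_funTS.
  - by move=> x; apply: erestrict_ge0.
  rewrite normrN1 mul1e [RHS]integral_mkcond; apply: eq_integral => x _.
  rewrite /patch mulN1r addr0.
  rewrite (_ : (- x \in `]-oo, 0%R[%classic) = (x \in `]0%R, +oo[%classic))//.
  by apply/idP/idP; rewrite !inE/= !in_itv/= !andbT oppr_lt0.
move=> mf f0.
have mG := measurable_invr.
rewrite split// [RHS]split//; last 2 first.
  - apply: emeasurable_funM; first exact: measurableT_comp.
    by apply/measurable_EFinP; apply: (measurableT_comp mG); exact: measurable_funX.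
  - by move=> x; rewrite mule_ge0// lee_fin invr_ge0 sqr_ge0.
rewrite ge0_integral_inv_pos//; congr (_ + _)%E.
rewrite ge0_integral_inv_pos//; last exact: measurableT_comp.
by apply: eq_integral => x _; rewrite invrN sqrrN.
Qed.

End OneDim.

(** * Change of variables in the plane; Moebius maps *)

Section PlaneMaps.
Context {R : realType}.
Local Notation leb := (@lebesgue_measure R).
Implicit Types (F : R[i] -> \bar R) (phi psi : R[i] -> R[i]).

Definition cmeasurable F :=
  measurable_fun setT (fun p : plane R => F (to_complex p)).

Definition cint F : \bar R :=
  (\int[@lebesgue_measure R \x @lebesgue_measure R]_p F (to_complex p))%E.

(** Measurability of a complex-valued map, coordinate by coordinate: the
    complex numbers carry no sigma-algebra of their own. *)
Definition cmap phi :=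
  measurable_fun setT (fun p : plane R => complex.Re (phi (to_complex p))) /\
  measurable_fun setT (fun p : plane R => complex.Im (phi (to_complex p))).

Lemma cmap_id : cmap id.
Proof. split; [exact: measurable_fst|exact: measurable_snd]. Qed.

Lemma cmap_cst c : cmap (fun=> c).
Proof. by split; exact: measurable_cst. Qed.

Lemma cmapD phi psi : cmap phi -> cmap psi -> cmap (fun z => phi z + psi z).
Proof.
move=> [h1 h2] [h3 h4]; split.
  by under eq_fun do rewrite raddfD; exact: measurable_funD.
by under eq_fun do rewrite raddfD; exact: measurable_funD.
Qed.

Lemma cmapM phi psi : cmap phi -> cmap psi -> cmap (fun z => phi z * psi z).
Proof.
have ReM (u v : R[i]) : complex.Re (u * v) = complex.Re u * complex.Re v - complex.Im u * complex.Im v.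
  by case: u v => [a b] [c d].
have ImM (u v : R[i]) : complex.Im (u * v) = complex.Re u * complex.Im v + complex.Im u * complex.Re v.
  by case: u v => [a b] [c d].
move=> [h1 h2] [h3 h4]; split.
  by under eq_fun do rewrite ReM; apply: measurable_funB; exact: measurable_funM.
by under eq_fun do rewrite ImM; apply: measurable_funD; exact: measurable_funM.
Qed.

Lemma cmapN phi : cmap phi -> cmap (fun z => - phi z).
Proof.
move=> h; have := cmapM (cmap_cst (-1)) h.
by under eq_fun do rewrite mulN1r.
Qed.

Lemma Re_conjc (z : R[i]) : complex.Re (conjc z) = complex.Re z.
Proof. by case: z. Qed.

Lemma Im_conjc (z : R[i]) : complex.Im (conjc z) = - complex.Im z.
Proof. by case: z. Qed.

Lemma Re_invc (z : R[i]) : complex.Re z^-1 =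
  complex.Re z * (complex.Re z ^+ 2 + complex.Im z ^+ 2)^-1.
Proof. by case: z. Qed.

Lemma Im_invc (z : R[i]) : complex.Im z^-1 =
  - (complex.Im z * (complex.Re z ^+ 2 + complex.Im z ^+ 2)^-1).
Proof. by case: z. Qed.

Lemma cabsE (z : R[i]) :
  cabs z = Num.sqrt (complex.Re z ^+ 2 + complex.Im z ^+ 2).
Proof. by case: z. Qed.

Lemma cabs2E (z : R[i]) : cabs z ^+ 2 = complex.Re z ^+ 2 + complex.Im z ^+ 2.
Proof. by rewrite cabsE sqr_sqrtr// addr_ge0 ?sqr_ge0. Qed.

Lemma cabsN (z : R[i]) : cabs (- z) = cabs z.
Proof. by rewrite !cabsE; case: z => x y /=; rewrite !sqrrN. Qed.

Lemma cabs_real (r : R) : cabs (real_complex R r) = `|r|.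
Proof. by rewrite cabsE /= expr0n/= addr0 sqrtr_sqr. Qed.

Lemma cabs1 : cabs (1 : R[i]) = 1.
Proof. by rewrite cabsE /= expr0n/= addr0 expr1n sqrtr1. Qed.

Lemma cmapV phi : cmap phi -> cmap (fun z => (phi z)^-1).
Proof.
move=> [h1 h2].
have m : measurable_fun setT (fun p : plane R => (complex.Re (phi (to_complex p)) ^+ 2 + complex.Im (phi (to_complex p)) ^+ 2)^-1).
  apply: (measurableT_comp measurable_invr).
  by apply: measurable_funD; exact: measurable_funX.
split; first by under eq_fun do rewrite Re_invc; exact: measurable_funM.
by under eq_fun do rewrite Im_invc; apply: measurable_funN; exact: measurable_funM.
Qed.

Lemma cmapX phi n : cmap phi -> cmap (fun z => phi z ^+ n).
Proof.
move=> h; elim: n => [|n ih]; first by under eq_fun do rewrite expr0; exact: cmap_cst.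
by under eq_fun do rewrite exprS; exact: cmapM.
Qed.

Lemma cmap_cabs phi : cmap phi ->
  measurable_fun setT (fun p : plane R => cabs (phi (to_complex p))).
Proof.
move=> [h1 h2].
under eq_fun do rewrite cabsE.
have ms : measurable_fun setT (Num.sqrt : measurableTypeR R -> measurableTypeR R).
  by apply: continuous_measurable_fun; exact: sqrt_continuous.
have m2 : measurable_fun setT (fun p : plane R => complex.Re (phi (to_complex p)) ^+ 2 + complex.Im (phi (to_complex p)) ^+ 2 : measurableTypeR R).
  by apply: measurable_funD; exact: measurable_funX.
exact: (measurableT_comp ms m2).
Qed.

Lemma cmeasurable_comp F phi : cmeasurable F -> cmap phi -> cmeasurable (F \o phi).
Proof.
move=> mF [h1 h2].
rewrite /cmeasurable (_ : (fun p => _) = (fun p : plane R => F (to_complex p)) \o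
   (fun p : plane R => (complex.Re (phi (to_complex p)), complex.Im (phi (to_complex p))))).
  by apply: measurableT_comp => //; exact: measurable_fun_pair.
by apply/funext => p /=; rewrite /to_complex/=; case: (phi _).
Qed.

Lemma cint_tonelli F : cmeasurable F -> (forall z, (0 <= F z)%E) ->
  cint F = (\int[leb]_x \int[leb]_y F (Complex x y))%E.
Proof. by move=> mF F0; rewrite /cint fubini_tonelli1. Qed.

Lemma cint_tonelliC F : cmeasurable F -> (forall z, (0 <= F z)%E) ->
  cint F = (\int[leb]_y \int[leb]_x F (Complex x y))%E.
Proof. by move=> mF F0; rewrite /cint fubini_tonelli2. Qed.

Lemma cmeasurable_y F x : cmeasurable F ->
  measurable_fun setT (fun y : measurableTypeR R => F (Complex x y)).
Proof.
move=> mF; rewrite (_ : (fun y => _) = (fun p : plane R => F (to_complex p)) \o (fun y => (x, y)))//.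
by apply: measurableT_comp => //; exact: measurable_pair1.
Qed.

Lemma cmeasurable_x F y : cmeasurable F ->
  measurable_fun setT (fun x : measurableTypeR R => F (Complex x y)).
Proof.
move=> mF; rewrite (_ : (fun x => _) = (fun p : plane R => F (to_complex p)) \o (fun x => (x, y)))//.
by apply: measurableT_comp => //; exact: measurable_pair2.
Qed.

Lemma measurable_cint_y F : cmeasurable F -> (forall z, (0 <= F z)%E) ->
  measurable_fun setT (fun x : measurableTypeR R => \int[leb]_y F (Complex x y))%E.
Proof.
move=> mF F0.
exact: (@measurable_fun_fubini_tonelli_F _ _ _ _ _ leb (fun p : plane R => F (to_complex p))).
Qed.

Lemma measurable_cint_x F : cmeasurable F -> (forall z, (0 <= F z)%E) ->
  measurable_fun setT (fun y : measurableTypeR R => \int[leb]_x F (Complex x y))%E.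
Proof.
move=> mF F0.
exact: (@measurable_fun_fubini_tonelli_G _ _ _ _ _ leb (fun p : plane R => F (to_complex p))).
Qed.

Lemma cint_shift F (b : R[i]) : cmeasurable F -> (forall z, (0 <= F z)%E) ->
  cint F = cint (fun z => F (z + b)).
Proof.
move=> mF F0.
have mG : cmeasurable (fun z => F (z + b)).
  by apply: (cmeasurable_comp mF); apply: cmapD; [exact: cmap_id|exact: cmap_cst].
have G0 z : (0 <= F (z + b)%R)%E by exact: F0.
rewrite (cint_tonelli mF F0) (cint_tonelli mG G0).
case: b mG {G0} => b1 b2 mG.
have o : (1 : R) != 0 by exact: oner_neq0.
pose H (x : R) := (\int[leb]_y F (Complex x y))%E.
have mH : measurable_fun setT H.
  exact: measurable_cint_y.
rewrite (ge0_integral_affine b1 o mH) ?normr1 ?mul1e; last first.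
  by move=> x; exact: integral_ge0.
apply: eq_integral => x _; rewrite /H mul1r.
rewrite (ge0_integral_affine b2 o)// ?normr1 ?mul1e; last exact: cmeasurable_y.
by apply: eq_integral => y _; rewrite mul1r.
Qed.

(** Multiplication by a with nonzero real part is a composition of shears and
    real dilations, so Tonelli and the one-dimensional affine change of
    variables suffice. *)
Lemma cint_scale_re F (a : R[i]) : complex.Re a != 0 -> cmeasurable F ->
  (forall z, (0 <= F z)%E) ->
  cint F = ((cabs a ^+ 2)%:E * cint (fun z => F (a * z)%R))%E.
Proof.
case: a => p q /= p0 mF F0.
have mG : cmeasurable (fun z => F (Complex p q * z)).
  by apply: (cmeasurable_comp mF); apply: cmapM; [exact: cmap_cst|exact: cmap_id].
have n0 : 0 < p ^+ 2 + q ^+ 2 by rewrite ltr_pwDl ?sqr_ge0// exprn_even_gt0.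
rewrite sqr_sqrtr ?(ltW n0)//.
rewrite [in RHS]cint_tonelliC//.
set c := (p ^+ 2 + q ^+ 2) / p.
have c0 : c != 0 by rewrite mulf_neq0 ?invr_eq0// gt_eqF.
pose H z := F (Complex (complex.Re z) (q / p * complex.Re z + c * complex.Im z)).
have mH : cmeasurable H.
  apply: (@cmeasurable_comp F (fun z => Complex (complex.Re z) (q / p * complex.Re z + c * complex.Im z))) => //.
  split=> /=; first exact: measurable_fst.
  by apply: measurable_funD; apply: measurable_funM.
transitivity (((p ^+ 2 + q ^+ 2) * `|p|^-1)%:E * cint H)%E; last first.
  rewrite EFinM -muleA; congr (_ * _)%E.
  have H0 z : (0 <= H z)%E by exact: F0.
  rewrite cint_tonelliC// -(ge0_integralZl leb measurableT (measurable_cint_x mH H0)); last 2 first.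
  - by move=> y _; exact: integral_ge0.
  - by rewrite lee_fin invr_ge0.
  apply: eq_integral => y _.
  rewrite (ge0_integral_affine (- q * y) p0)//; last exact: cmeasurable_x.
  rewrite muleA -EFinM mulVf ?normr_eq0// mul1e.
  apply: eq_integral => x _; rewrite /H /=; congr F.
  apply/eqP; rewrite eq_complex/= /c; apply/andP; split; apply/eqP; first by ring.
  by field.
have H0 z : (0 <= H z)%E by exact: F0.
rewrite cint_tonelli// [in RHS]cint_tonelli// -(ge0_integralZl leb measurableT (measurable_cint_y mH H0)); last 2 first.
- by move=> y _; exact: integral_ge0.
- by rewrite lee_fin mulr_ge0 ?invr_ge0// ltW.
apply: eq_integral => x _.
rewrite (ge0_integral_affine (q / p * x) c0)//; last exact: cmeasurable_y.
congr (_%:E * _)%E; first by rewrite normrM gtr0_norm// normfV.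
by apply: eq_integral => y _; rewrite /H/= addrC.
Qed.

(** A purely imaginary a is the product of a/(1+i) and 1+i, both of nonzero
    real part. *)
Lemma cint_scale F (a : R[i]) : a != 0 -> cmeasurable F ->
  (forall z, (0 <= F z)%E) ->
  cint F = ((cabs a ^+ 2)%:E * cint (fun z => F (a * z)%R))%E.
Proof.
move=> a0 mF F0.
have [ra0|] := eqVneq (complex.Re a) 0; last by move=> ?; exact: cint_scale_re.
pose b : R[i] := Complex 1 1.
have ab : complex.Re (a / b) != 0.
  move: a a0 {mF} ra0 => [a1 a2] a0 /= a10; rewrite a10 in a0 *.
  have : a2 != 0 by move: a0; rewrite eq_complex/= eqxx.
  by move=> a20; rewrite mul0r sub0r mulrN opprK mulf_neq0// mul1r invr_eq0 expr1n -mulr2n pnatr_eq0.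
rewrite (cint_scale_re ab)// (@cint_scale_re (fun z => F (a / b * z)) b) ?oner_neq0//; last first.
  by apply: (cmeasurable_comp mF); apply: cmapM; [exact: cmap_cst|exact: cmap_id].
rewrite muleA -EFinM -exprMn -Normc.normcM divfK; last first.
  by rewrite eq_complex/= oner_eq0.
by congr (_ * _)%E; apply: eq_integral => p _; rewrite mulrA divfK// eq_complex/= oner_eq0.
Qed.

Lemma cmeasurable_polar F : cmeasurable F ->
  cmeasurable (fun z => `|complex.Re z|%:E *
    F (Complex (complex.Re z) (complex.Re z * complex.Im z)%R))%E.
Proof.
move=> mF; apply: emeasurable_funM.
  by apply/measurable_EFinP; apply: measurableT_comp => //; exact: measurable_fst.
apply: (@cmeasurable_comp F (fun z => Complex (complex.Re z) (complex.Re z * complex.Im z))) => //.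
split=> /=; first exact: measurable_fst.
by apply: measurable_funM; [exact: measurable_fst|exact: measurable_snd].
Qed.

(** Substitute y = x t on each vertical line; the line x = 0 is null. In these
    coordinates z -> 1/z acts separately on x and t. *)
Lemma cint_polar F : cmeasurable F -> (forall z, (0 <= F z)%E) ->
  cint F = (\int[leb]_t \int[leb]_x (`|x|%:E * F (Complex x (x * t)%R)))%E.
Proof.
move=> mF F0.
have mG := cmeasurable_polar mF.
have G0 z : (0 <= `|complex.Re z|%:E * F (Complex (complex.Re z) (complex.Re z * complex.Im z)%R))%E.
  by rewrite mule_ge0// lee_fin.
rewrite -(cint_tonelliC mG G0) (cint_tonelli mG G0) (cint_tonelli mF F0).
apply: ge0_ae_eq_integral => //.
- exact: measurable_cint_y.
- exact: (measurable_cint_y mG).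
- by move=> x _; exact: integral_ge0.
- by move=> x _; apply: integral_ge0 => y _; exact: (G0 (Complex x y)).
exists [set 0]; split => //; first exact: lebesgue_measure_set1.
move=> x /=; apply: contra_notP => /eqP x0 _ /=.
rewrite (ge0_integral_affine 0 x0)//; last exact: cmeasurable_y.
rewrite ge0_integralZl//.
- by congr (_ * _)%E; apply: eq_integral => y _; rewrite addr0.
- under eq_fun do rewrite -[(x * _)%R]addr0.
  exact: (measurableT_comp (cmeasurable_y x mF) (measurable_affine x 0)).
Qed.

(** With z = x (1 + i t), the inverse is 1/(x (1+t^2)) (1 - i t). So it suffices to
    reflect t and to substitute x -> 1/(x (1+t^2)), both one-dimensional. *)
Lemma cint_inv F : cmeasurable F -> (forall z, (0 <= F z)%E) ->
  cint F = cint (fun z => F z^-1%R * (cabs z ^- 4)%:E)%E.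
Proof.
move=> mF F0.
have mG : cmeasurable (fun z => F z^-1%R * (cabs z ^- 4)%:E)%E.
  apply: emeasurable_funM.
    by apply: (cmeasurable_comp mF); apply: cmapV; exact: cmap_id.
  apply/measurable_EFinP; apply: (measurableT_comp measurable_invr).
  by apply: measurable_funX; exact: (cmap_cabs cmap_id).
have G0 z : (0 <= F z^-1%R * (cabs z ^- 4)%:E)%E.
  by rewrite mule_ge0// lee_fin invr_ge0 exprn_even_ge0.
have mP := cmeasurable_polar mF.
have P0 z : (0 <= `|complex.Re z|%:E * F (Complex (complex.Re z) (complex.Re z * complex.Im z)%R))%E.
  by rewrite mule_ge0// lee_fin.
have N0 : (-1 : R) != 0 by rewrite oppr_eq0 oner_eq0.
rewrite (cint_polar mF F0) (cint_polar mG G0).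
rewrite (ge0_integral_affine 0 N0)//; first last.
- by move=> t; apply: integral_ge0 => x _; exact: (P0 (Complex x t)).
- exact: (measurable_cint_x mP).
rewrite normrN1 mul1e; apply: eq_integral => t _; rewrite mulN1r addr0.
have t0 : 0 < 1 + t ^+ 2 by rewrite ltr_pwDl// sqr_ge0.
have k0 : (1 + t ^+ 2)^-1 != 0 by rewrite invr_eq0 gt_eqF.
have mx : measurable_fun setT (fun x : measurableTypeR R => `|x|%:E * F (Complex x (x * - t)%R))%E.
  exact: (cmeasurable_x (- t) mP).
have mk := measurableT_comp mx (measurable_affine (1 + t ^+ 2)^-1 0).
rewrite (ge0_integral_affine 0 k0)//; last by move=> x; rewrite mule_ge0// lee_fin.
rewrite (ge0_integral_inv mk)//; last by move=> x /=; rewrite mule_ge0// lee_fin.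
rewrite -ge0_integralZl//; last 2 first.
- apply: emeasurable_funM.
    exact: (measurableT_comp mk measurable_invr).
  by apply/measurable_EFinP; apply: (measurableT_comp measurable_invr); exact: measurable_funX.
- by move=> x _ /=; rewrite mule_ge0 ?lee_fin// ?invr_ge0 ?sqr_ge0// mule_ge0// lee_fin.
apply: eq_integral => x _ /=; rewrite addr0.
have [->|x0] := eqVneq x 0.
  by rewrite normr0 mul0e expr0n/= invr0 mule0 mule0.
have n0 : x ^+ 2 + (x * t) ^+ 2 = x ^+ 2 * (1 + t ^+ 2) by ring.
have -> : ((1 + t ^+ 2)^-1 / x +i* ((1 + t ^+ 2)^-1 / x * - t))%C = (x +i* (x * t))%C^-1.
  apply/eqP; rewrite eq_complex/= n0; apply/andP; split; apply/eqP; field.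
    by rewrite x0 gt_eqF.
  by rewrite x0 gt_eqF.
have -> : Num.sqrt (x ^+ 2 + (x * t) ^+ 2) ^+ 4 = (x ^+ 2 * (1 + t ^+ 2)) ^+ 2.
  by rewrite -n0 (exprM _ 2 2) sqr_sqrtr// addr_ge0// sqr_ge0.
case: (F _) (F0 (x +i* (x * t))%C^-1) => [r| |//] _.
  rewrite -!EFinM; congr (_%:E).
  rewrite normrM !normfV (gtr0_norm t0) -(real_normK (num_real x)).
  by field; rewrite normr_eq0 x0 gt_eqF.
have p1 : 0 < `|(1 + t ^+ 2)^-1 / x| by rewrite normr_gt0 mulf_neq0// invr_neq0.
have p2 : 0 < x ^- 2 by rewrite invr_gt0 exprn_even_gt0.
have p3 : 0 < ((x ^+ 2 * (1 + t ^+ 2)) ^+ 2)^-1.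
  by rewrite invr_gt0 exprn_gt0// mulr_gt0// exprn_even_gt0.
rewrite gt0_muley ?lte_fin// gt0_mulye ?lte_fin// gt0_muley ?lte_fin ?normr_gt0//.
by rewrite gt0_mulye ?lte_fin// gt0_muley ?lte_fin ?normr_gt0.
Qed.

Lemma cabs_ge0 (z : R[i]) : 0 <= cabs z.
Proof. by rewrite cabsE sqrtr_ge0. Qed.

Lemma cabs2_mobius_num (a z : R[i]) :
  cabs (1 - conjc a * z) ^+ 2 - cabs (z - a) ^+ 2 =
  (1 - cabs a ^+ 2) * (1 - cabs z ^+ 2).
Proof. by rewrite !cabs2E; case: a z => [a1 a2] [z1 z2] /=; ring. Qed.

Lemma cabs_conjc (z : R[i]) : cabs (conjc z) = cabs z.
Proof. by rewrite !cabsE; case: z => x y /=; rewrite sqrrN. Qed.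

Lemma disk_cabs2 (z : R[i]) : (cabs z < 1) = (cabs z ^+ 2 < 1).
Proof. by rewrite expr_lt1// cabs_ge0. Qed.

Lemma mobius_den_neq0 (a z : R[i]) : disk a -> disk z -> 1 - conjc a * z != 0.
Proof.
rewrite /disk /= => a1 z1; apply/eqP => /(congr1 (@Normc.normc R)); rewrite Normc.normc0 => h.
have := cabs2_mobius_num a z; rewrite h expr0n/= sub0r => {}h.
have : 0 < (1 - cabs a ^+ 2) * (1 - cabs z ^+ 2).
  by rewrite mulr_gt0// subr_gt0 -disk_cabs2.
by rewrite -h oppr_gt0 ltNge sqr_ge0.
Qed.

Lemma cabs_neq0 (z : R[i]) : z != 0 -> cabs z != 0.
Proof. by apply: contra_neq; exact: Normc.eq0_normc. Qed.

(** The classical identity behind the Moebius invariance of the hyperbolic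
    metric and area. *)
Lemma one_sub_cabs2_mobius (a z : R[i]) : 1 - conjc a * z != 0 ->
  1 - cabs (mobius a z) ^+ 2 =
  (1 - cabs a ^+ 2) * (1 - cabs z ^+ 2) / cabs (1 - conjc a * z) ^+ 2.
Proof.
move=> d0; rewrite -cabs2_mobius_num /mobius Normc.normcM Normc.normcV.
by field; exact: cabs_neq0.
Qed.

Lemma disk_mobius (a z : R[i]) : disk a -> 1 - conjc a * z != 0 ->
  (cabs (mobius a z) < 1) = (cabs z < 1).
Proof.
rewrite /disk /= => a1 d0; rewrite !disk_cabs2 -[LHS]subr_gt0 -[RHS]subr_gt0.
rewrite one_sub_cabs2_mobius// pmulr_lgt0; last first.
  by rewrite invr_gt0 exprn_even_gt0//= cabs_neq0.
by rewrite pmulr_rgt0// subr_gt0 -disk_cabs2.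
Qed.

Lemma cmap_mobius a : cmap (mobius a).
Proof.
apply: cmapM.
  by apply: (cmapD cmap_id); exact: cmap_cst.
apply: cmapV; apply: cmapD; first exact: cmap_cst.
by apply: cmapN; apply: cmapM; [exact: cmap_cst|exact: cmap_id].
Qed.

(** For a <> 0 the Moebius map is c / (1 - conj(a) z) + b, a composition of
    affine maps and one inversion; the Jacobians multiply up. *)
Lemma cint_mobius F a : disk a -> cmeasurable F -> (forall z, (0 <= F z)%E) ->
  cint F = cint (fun z => F (mobius a z) *
    ((1 - cabs a ^+ 2) ^+ 2 * cabs (1 - conjc a * z)%R ^- 4)%:E)%E.
Proof.
move=> a1 mF F0.
have [->|a0] := eqVneq a 0.
  apply: eq_integral => p _.
  have -> : cabs (1 - conjc 0 * to_complex p) = 1.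
    by rewrite conjc0 mul0r subr0; exact: cabs1.
  rewrite /mobius conjc0 mul0r !subr0 divr1.
  by rewrite Normc.normc0 expr0n/= !subr0 !expr1n invr1 mulr1 mule1.
have ca0 : conjc a != 0 by rewrite conjc_eq0.
set b := - (conjc a)^-1; set c := (1 - (cabs a ^+ 2)%:C)%C / conjc a.
have r0 : 0 < 1 - cabs a ^+ 2 by rewrite subr_gt0 -disk_cabs2.
have c0 : c != 0.
  rewrite mulf_neq0 ?invr_neq0//; apply/eqP => /(congr1 (@complex.Re R)) /= h.
  by move: r0; rewrite h ltxx.
have mb : cmeasurable (fun z => F (z + b)).
  by apply: (cmeasurable_comp mF); apply: cmapD; [exact: cmap_id|exact: cmap_cst].
have mcb : cmeasurable (fun z => F (c * z + b)).
  apply: (cmeasurable_comp mF); apply: cmapD; last exact: cmap_cst.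
  by apply: cmapM; [exact: cmap_cst|exact: cmap_id].
have mi : cmeasurable (fun z => F (c * z^-1 + b)%R * (cabs z ^- 4)%:E)%E.
  apply: emeasurable_funM.
    by apply: (cmeasurable_comp mcb); apply: cmapV; exact: cmap_id.
  apply/measurable_EFinP; apply: (measurableT_comp measurable_invr).
  by apply: measurable_funX; exact: (cmap_cabs cmap_id).
have i0 z : (0 <= F (c * z^-1 + b)%R * (cabs z ^- 4)%:E)%E.
  by rewrite mule_ge0// lee_fin invr_ge0 exprn_even_ge0.
have ms : cmeasurable (fun z => F (c * (z + 1)^-1 + b)%R * (cabs (z + 1)%R ^- 4)%:E)%E.
  apply: (cmeasurable_comp mi); apply: cmapD; [exact: cmap_id|exact: cmap_cst].
rewrite (cint_shift b mF F0) (cint_scale c0 mb)//.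
rewrite (cint_inv mcb)// (cint_shift 1 mi)//.
rewrite (@cint_scale (fun z => F (c * (z + 1)^-1 + b)%R * (cabs (z + 1)%R ^- 4)%:E)%E (- conjc a)) ?oppr_eq0//.
have mz : cmeasurable (fun z => F (c * (- conjc a * z + 1)^-1 + b)%R * (cabs (- conjc a * z + 1)%R ^- 4)%:E)%E.
  by apply: (cmeasurable_comp ms); apply: cmapM; [exact: cmap_cst|exact: cmap_id].
rewrite muleA -EFinM -exprMn -Normc.normcM.
have -> : cabs (c * - conjc a) = 1 - cabs a ^+ 2.
  rewrite /c mulrN divfK// cabsN -(rmorph1 (real_complex R)) -rmorphB cabs_real.
  by rewrite gtr0_norm.
rewrite -(ge0_integralZl _ measurableT mz)//.
- apply: eq_integral => p _; rewrite muleCA -EFinM.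
  set z := to_complex p.
  have -> : - conjc a * z + 1 = 1 - conjc a * z by rewrite mulNr addrC.
  have [->|d0] := eqVneq (1 - conjc a * z) 0.
    have e : cabs (0 : R[i]) ^- 4 = 0 by rewrite Normc.normc0 expr0n/= invr0.
    by rewrite e mulr0 !mule0.
  congr (F _ * _)%E; rewrite /mobius /c /b.
  have -> : ((cabs a ^+ 2)%:C)%C = a * conjc a.
    apply/eqP; rewrite eq_complex; case: (a) => a2 a3 /=; rewrite sqr_sqrtr ?addr_ge0 ?sqr_ge0//.
    by apply/andP; split; apply/eqP; ring.
  by field; rewrite d0 ca0.
- by rewrite lee_fin sqr_ge0.
Qed.

End PlaneMaps.

(** * Convergence of complex sequences *)

Section ComplexTopology.
Context {R : realType}.

Lemma normcC (z : R[i]) : `|z| = (real_complex R (cabs z)).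
Proof. by []. Qed.

Lemma le_cabsD (z w : R[i]) : cabs (z + w) <= cabs z + cabs w.
Proof. exact: le_normcD. Qed.

Lemma cabs_distC (z w : R[i]) : cabs (z - w) = cabs (w - z).
Proof. by rewrite -cabsN opprB. Qed.

Lemma cabsM (z w : R[i]) : cabs (z * w) = cabs z * cabs w.
Proof. exact: Normc.normcM. Qed.

Lemma cabsV (z : R[i]) : cabs z^-1 = (cabs z)^-1.
Proof. exact: Normc.normcV. Qed.

Lemma cabs0 : cabs (0 : R[i]) = 0.
Proof. exact: Normc.normc0. Qed.

Lemma cabsX (z : R[i]) n : cabs (z ^+ n) = cabs z ^+ n.
Proof.
elim: n => [|n ih]; first by rewrite !expr0; exact: cabs1.
by rewrite !exprS cabsM ih.
Qed.

Lemma le_cabs_sum (I : Type) (r : seq I) (P : pred I) (F : I -> R[i]) :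
  cabs (\sum_(i <- r | P i) F i) <= \sum_(i <- r | P i) cabs (F i).
Proof.
elim/big_ind2 : _ => //; first by rewrite cabs0.
by move=> x x' y y' hx hy; apply: le_trans (le_cabsD _ _) _; exact: lerD.
Qed.

Lemma ler_Re_cabs (z : R[i]) : `|complex.Re z| <= cabs z.
Proof. by have := normc_ge_Re z; rewrite lecR. Qed.

Lemma ler_Im_cabs (z : R[i]) : `|complex.Im z| <= cabs z.
Proof.
rewrite cabsE -(sqrtr_sqr (complex.Im z)) ler_wsqrtr// lerDr sqr_ge0 //.
Qed.

Lemma cabs_le_ReIm (z : R[i]) : cabs z <= `|complex.Re z| + `|complex.Im z|.
Proof.
have -> : z = real_complex R (complex.Re z) + real_complex R (complex.Im z) * Complex 0 1.
  by case: z => x y; apply/eqP; rewrite eq_complex/=; apply/andP; split; apply/eqP; ring.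
apply: le_trans (le_cabsD _ _) _; rewrite cabsM !cabs_real.
have -> : cabs (Complex (0 : R) 1) = 1 by rewrite cabsE /= expr0n/= add0r expr1n sqrtr1.
by case: z => x y /=; rewrite mulr1 !(mulr0,mul0r,mulr1,subr0,add0r,addr0).
Qed.

Lemma cvgcP (T : Type) (F : set_system T) (FF : Filter F) (u : T -> R[i]) (l : R[i]) :
  (u @ F --> l) <-> (cabs (u t - l) @[t --> F] --> (0 : R)).
Proof.
split.
  move=> /cvgrPdist_lt h; apply/cvgrPdist_lt => e e0.
  have /h : 0 < real_complex R e by rewrite ltcR.
  apply: filterS => t; rewrite normcC ltcR cabs_distC sub0r normrN.
  by rewrite ger0_norm// cabs_ge0.
move=> /cvgrPdist_lt h; apply/cvgrPdist_lt => e e0.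
have : e = real_complex R (complex.Re e) by case: e e0 => a b /=; rewrite ltcE/= => /andP[/eqP -> _].
move=> ee; rewrite ee ltcR in e0; have := h _ e0.
apply: filterS => t; rewrite sub0r normrN ger0_norm ?cabs_ge0// => h1.
by rewrite ee normcC ltcR cabs_distC.
Qed.

Lemma cvg_Re (T : Type) (F : set_system T) (FF : Filter F) (u : T -> R[i]) (l : R[i]) :
  u @ F --> l -> complex.Re (u t) @[t --> F] --> complex.Re l.
Proof.
move=> /cvgcP/cvgrPdist_lt h; apply/cvgrPdist_lt => e /h.
apply: filterS => t; rewrite sub0r normrN ger0_norm ?cabs_ge0//.
by apply: le_lt_trans; rewrite -raddfB cabs_distC ler_Re_cabs.
Qed.

Lemma cvg_Im (T : Type) (F : set_system T) (FF : Filter F) (u : T -> R[i]) (l : R[i]) :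
  u @ F --> l -> complex.Im (u t) @[t --> F] --> complex.Im l.
Proof.
move=> /cvgcP/cvgrPdist_lt h; apply/cvgrPdist_lt => e /h.
apply: filterS => t; rewrite sub0r normrN ger0_norm ?cabs_ge0//.
by apply: le_lt_trans; rewrite -raddfB cabs_distC ler_Im_cabs.
Qed.

Lemma cvg_ReIm (T : Type) (F : set_system T) (FF : Filter F) (u : T -> R[i]) (l : R[i]) :
  complex.Re (u t) @[t --> F] --> complex.Re l ->
  complex.Im (u t) @[t --> F] --> complex.Im l -> u @ F --> l.
Proof.
move=> h1 h2; apply/cvgcP.
have h : `|complex.Re (u t) - complex.Re l| + `|complex.Im (u t) - complex.Im l| @[t --> F] --> (0 : R).
  have -> : (0 : R) = `|complex.Re l - complex.Re l| + `|complex.Im l - complex.Im l|.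
    by rewrite !subrr normr0 addr0.
  by apply: cvgD; apply: cvg_norm; apply: cvgB => //; exact: cvg_cst.
apply: (squeeze_cvgr _ (cvg_cst 0) h).
by apply: nearW => t; rewrite cabs_ge0/= -!raddfB cabs_le_ReIm.
Qed.

Lemma le_dist_cabs (z w : R[i]) : `|cabs z - cabs w| <= cabs (z - w).
Proof.
have h1 := le_cabsD (z - w) w; have h2 := le_cabsD (w - z) z.
rewrite !subrK in h1 h2; rewrite (cabs_distC w z) in h2.
by rewrite ler_norml; apply/andP; split; lra.
Qed.

Lemma cvg_cabs (T : Type) (F : set_system T) (FF : Filter F) (u : T -> R[i]) (l : R[i]) :
  u @ F --> l -> cabs (u t) @[t --> F] --> cabs l.
Proof.
move=> /cvgcP/cvgrPdist_lt h; apply/cvgrPdist_lt => e /h.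
apply: filterS => t; rewrite sub0r normrN ger0_norm ?cabs_ge0//.
by apply: le_lt_trans; rewrite cabs_distC le_dist_cabs.
Qed.

Lemma cvgc_expr (q : R[i]) : cabs q < 1 -> q ^+ n @[n --> \oo] --> (0 : R[i]).
Proof.
move=> q1; apply/cvgcP; under eq_cvg do rewrite subr0 cabsX.
by apply: cvg_expr; rewrite ger0_norm// cabs_ge0.
Qed.

End ComplexTopology.

(** * Rotations and the hyperbolic area *)

Section RadialIntegrals.
Context {R : realType}.
Implicit Types (F : R[i] -> \bar R) (z w : R[i]).
Local Notation lam := (@lebesgue_measure R \x @lebesgue_measure R)%E.

Lemma funepos_compE (S T : Type) (F : T -> \bar R) (phi : S -> T) :
  (fun x => funepos F (phi x)) = funepos (fun x => F (phi x)).
Proof. by apply/funext => x; rewrite !funeposE. Qed.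

Lemma funeneg_compE (S T : Type) (F : T -> \bar R) (phi : S -> T) :
  (fun x => funeneg F (phi x)) = funeneg (fun x => F (phi x)).
Proof. by apply/funext => x; rewrite !funenegE. Qed.

Lemma cmeasurable_pos F : cmeasurable F -> cmeasurable (funepos F).
Proof. by move=> /measurable_funepos; rewrite /cmeasurable funepos_compE. Qed.

Lemma cmeasurable_neg F : cmeasurable F -> cmeasurable (funeneg F).
Proof. by move=> /measurable_funeneg; rewrite /cmeasurable funeneg_compE. Qed.

Lemma cint_posneg F : cint F = (cint F^\+ - cint F^\-)%E.
Proof.
rewrite /cint integralE; congr (_ - _)%E; apply: eq_integral => p _.
  by rewrite !funeposE.
by rewrite !funenegE.
Qed.

Lemma cint_rot F w : cabs w = 1 -> cmeasurable F ->
  cint F = cint (fun z => F (w * z)).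
Proof.
move=> w1 mF.
have w0 : w != 0 by apply/eqP => w0; move: w1; rewrite w0 cabs0 => /eqP; rewrite eq_sym oner_eq0.
have scal G : cmeasurable G -> (forall z, (0 <= G z)%E) -> cint G = cint (fun z => G (w * z)).
  by move=> mG G0; rewrite (cint_scale w0 mG)// w1 expr1n mul1e.
have mp := cmeasurable_pos mF; have mn := cmeasurable_neg mF.
rewrite cint_posneg [RHS]cint_posneg (scal _ mp)// (scal _ mn)//.
congr (cint _ - cint _)%E; apply/funext => z.
  by rewrite !funeposE.
by rewrite !funenegE.
Qed.

Definition cintegrable F := lam.-integrable setT (fun p => F (to_complex p)).

Definition rint (u : R[i] -> R) : R := fine (cint (EFin \o u)).

(** Rotating by w turns x^n into -x^n, which makes integrals of x^n against
    radial functions vanish without polar coordinates. *)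
Lemma exists_rotation_root (n : nat) : (0 < n)%N ->
  exists2 w : R[i], cabs w = 1 & w ^+ n = -1.
Proof.
move=> n0; exists (n.-root (-1)); last by rewrite rootCK.
have h : cabs (n.-root (-1 : R[i])) ^+ n = 1.
  by rewrite -cabsX rootCK// cabsN cabs1.
by apply/eqP; rewrite -(pexpr_eq1 n0) ?cabs_ge0// h.
Qed.

Lemma rint_odd (u : R[i] -> R) w : cabs w = 1 -> cintegrable (EFin \o u) ->
  (forall z, u (w * z) = - u z) -> rint u = 0.
Proof.
move=> w1 iu uw; have mu := measurable_int _ iu.
have : cint (EFin \o u) = (- cint (EFin \o u))%E.
  rewrite {1}(cint_rot w1 mu) /cint -integralN/=; last exact: integrable_add_def iu.
  by apply: eq_integral => p _ /=; rewrite uw EFinN.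
have := integrable_fin_num measurableT iu.
rewrite -/(cint (EFin \o u)) /rint; case: (cint _) => //= r _ [h].
by lra.
Qed.


(** The density of hyperbolic area, which is also the one-point intensity of
    the process, extended by 0 outside the disk. *)
Definition hypdens z : R := (cabs z < 1)%R%:R * (1 - cabs z ^+ 2) ^- 2.

Lemma hypdens_ge0 z : 0 <= hypdens z.
Proof. by rewrite mulr_ge0// invr_ge0 sqr_ge0. Qed.

Lemma measurable_cabs_lt (r : R) : measurable_fun setT (fun p : plane R => (cabs (to_complex p) < r)%R%:R : R).
Proof.
rewrite (_ : (fun p => _) = \1_[set p : plane R | cabs (to_complex p) < r]); last first.
  by apply/funext => p; rewrite indicE mem_setE.
apply: measurable_indic.
rewrite -[X in measurable X]setTI.
exact: (measurable_fun_ltr (cmap_cabs cmap_id) (measurable_cst r) measurableT (Y := [set true])).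
Qed.

Lemma measurable_hypdens : measurable_fun setT (fun p : plane R => hypdens (to_complex p)).
Proof.
apply: measurable_funM; first exact: measurable_cabs_lt.
apply: (measurableT_comp measurable_invr); apply: measurable_funX.
by apply: measurable_funB => //; apply: measurable_funX; exact: (cmap_cabs cmap_id).
Qed.

(** The Jacobian of the Moebius map is cancelled by the change of the
    density, by [one_sub_cabs2_mobius]. *)
Lemma ge0_cint_hyp_mobius F a : disk a -> cmeasurable F -> (forall z, (0 <= F z)%E) ->
  cint (fun z => F z * (hypdens z)%:E)%E = cint (fun z => F (mobius a z) * (hypdens z)%:E)%E.
Proof.
move=> a1 mF F0.
have mG : cmeasurable (fun z => F z * (hypdens z)%:E)%E.
  by apply: emeasurable_funM => //; apply/measurable_EFinP; exact: measurable_hypdens.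
rewrite (cint_mobius a1 mG); last by move=> z; rewrite mule_ge0// lee_fin hypdens_ge0.
apply: eq_integral => p _; rewrite -muleA -EFinM; set z := to_complex p.
have [d0|d0] := eqVneq (1 - conjc a * z) 0.
  have nz : ~~ (cabs z < 1).
    by apply/negP => z1; have := mobius_den_neq0 a1 z1; rewrite d0 eqxx.
  have -> : hypdens z = 0 by rewrite /hypdens (negbTE nz) mul0r.
  by rewrite d0 cabs0 expr0n/= invr0 !mulr0.
congr (_ * _%:E)%E; rewrite /hypdens disk_mobius//.
have [z1|] := boolP (cabs z < 1); last by rewrite !mul0r.
rewrite one_sub_cabs2_mobius//.
have h1 : 1 - cabs a ^+ 2 != 0 by rewrite gt_eqF// subr_gt0 -disk_cabs2.
have h2 : 1 - cabs z ^+ 2 != 0 by rewrite gt_eqF// subr_gt0 -disk_cabs2.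
by field; rewrite h1 h2 cabs_neq0.
Qed.

Lemma cint_hyp_mobius F a : disk a -> cmeasurable F ->
  cint (fun z => F z * (hypdens z)%:E)%E = cint (fun z => F (mobius a z) * (hypdens z)%:E)%E.
Proof.
move=> a1 mF.
have posE G : funepos (fun z => G z * (hypdens z)%:E)%E = (fun z => (funepos G z) * (hypdens z)%:E)%E.
  by apply/funext => z; rewrite !funeposE maxeMl ?mul0e// lee_fin hypdens_ge0.
have negE G : funeneg (fun z => G z * (hypdens z)%:E)%E = (fun z => (funeneg G z) * (hypdens z)%:E)%E.
  by apply/funext => z; rewrite !funenegE -mulNe maxeMl ?mul0e// lee_fin hypdens_ge0.
rewrite cint_posneg [RHS]cint_posneg !posE !negE.
have mp := cmeasurable_pos mF; have mn := cmeasurable_neg mF.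
rewrite (ge0_cint_hyp_mobius a1 mp)// (ge0_cint_hyp_mobius a1 mn)//.
congr (cint _ - cint _)%E; apply/funext => z.
  by rewrite !funeposE.
by rewrite !funenegE.
Qed.

(** The Lebesgue area of the unit disk. Its positivity and finiteness come from an
    inscribed and a circumscribed square. *)
Definition disk_area : \bar R := cint (fun z => ((cabs z < 1)%R%:R : R)%:E).

(** By dilation; this gives the area of every dyadic shell. *)
Lemma cint_disk_radius (r : R) : 0 <= r ->
  cint (fun z => ((cabs z < r)%R%:R : R)%:E) = ((r ^+ 2)%:E * disk_area)%E.
Proof.
rewrite le_eqVlt => /orP[/eqP <-|r0].
  rewrite expr0n/= mul0e; apply: integral0_eq => p _.
  by rewrite ltNge cabs_ge0.
have rr : real_complex R r != 0 by rewrite eq_complex/= eqxx andbT gt_eqF.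
rewrite (cint_scale rr) ?cabs_real ?gtr0_norm//.
- congr (_ * _)%E; apply: eq_integral => p _.
  by rewrite cabsM cabs_real gtr0_norm// gtr_pMr.
- by apply/measurable_EFinP; exact: measurable_cabs_lt.
Qed.

Lemma disk_area_gt0 : (0 < disk_area)%E.
Proof.
(* a square inscribed in the disk *)
pose S : set (plane R) := `[0%R, (1/2)%R]%classic `*` `[0%R, (1/2)%R]%classic.
have mS : measurable S by apply: measurableX.
have S4 : (lam S = (1/4)%:E)%E.
  rewrite /S product_measure1E//= !lebesgue_measure_itv/= !lte_fin.
  by rewrite ifT ?subr0 -?EFinM; [congr (_%:E); lra|lra].
apply: (@lt_le_trans _ _ (lam S)); first by rewrite S4 lte_fin.
rewrite -[S]setIT -integral_indic//; apply: ge0_le_integral => //.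
- exact/measurable_EFinP/measurable_indic.
- by apply/measurable_EFinP; exact: measurable_cabs_lt.
move=> [x y] _; rewrite lee_fin indicE; case: (boolP (_ \in S)) => // /set_mem[/=].
rewrite !in_itv/= => /andP[x0 x1] /andP[y0 y1].
change (1 <= ((cabs (Complex x y) < 1)%R%:R : R)).
rewrite disk_cabs2 cabs2E (_ : _ < 1)//=.
have h1 : x ^+ 2 <= (1/2) ^+ 2 by rewrite ler_pXn2r// nnegrE; lra.
have h2 : y ^+ 2 <= (1/2) ^+ 2 by rewrite ler_pXn2r// nnegrE; lra.
by lra.
Qed.

Lemma disk_area_fin : disk_area \is a fin_num.
Proof.
(* a square containing the disk *)
pose S : set (plane R) := `[(-1)%R, 1%R]%classic `*` `[(-1)%R, 1%R]%classic.
have mS : measurable S by apply: measurableX.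
have S4 : (lam S = 4%:E)%E.
  rewrite /S product_measure1E//= !lebesgue_measure_itv/= !lte_fin.
  by rewrite ifT -?EFinB -?EFinM; [congr (_%:E); lra|lra].
rewrite ge0_fin_numE ?ltW ?disk_area_gt0//; apply: (@le_lt_trans _ _ (lam S)); last by rewrite S4 ltry.
rewrite -[S in leRHS]setIT -integral_indic//; apply: ge0_le_integral => //.
- by apply/measurable_EFinP; exact: measurable_cabs_lt.
- exact/measurable_EFinP/measurable_indic.
move=> [x y] _; rewrite lee_fin indicE; case: (boolP (_ \in S)) => // nS.
  by case: (_ < _).
rewrite (_ : (_ < _) = false)//; apply/negP => h; move/negP: nS; apply; apply/mem_set.
have hx := le_lt_trans (ler_Re_cabs _) h; have hy := le_lt_trans (ler_Im_cabs _) h.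
by move: hx hy; rewrite /= !ltr_norml => /andP[x0 x1] /andP[y0 y1]; split; rewrite /= in_itv/= ?ltW.
Qed.

End RadialIntegrals.

(** * The mean value property on hyperbolic circles *)

Section MeanValue.
Context {R : realType}.
Implicit Types (F : R[i] -> \bar R) (z w : R[i]).
Local Notation lam := (@lebesgue_measure R \x @lebesgue_measure R)%E.

Lemma cintegrable_cmeas F : cintegrable F -> cmeasurable F.
Proof. by move=> h; exact: (measurable_int _ h). Qed.

Lemma cmap_Re phi : @cmap R phi -> cmeasurable (fun z => (complex.Re (phi z))%:E).
Proof. by move=> [h _]; apply/measurable_EFinP. Qed.

Lemma cmap_poly (p : {poly R[i]}) : cmap (fun z => p.[z]).
Proof.
elim/poly_ind : p => [|p c ih].
  by under eq_fun do rewrite horner0; exact: cmap_cst.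
under eq_fun do rewrite !hornerE.
by apply: cmapD; [apply: cmapM => //; exact: cmap_id|exact: cmap_cst].
Qed.

Lemma cintegrable_dominated (g u : R[i] -> R) (C : R) :
  cintegrable (EFin \o g) -> (forall z, 0 <= g z) ->
  cmeasurable (EFin \o u) -> (forall z, g z != 0 -> `|u z| <= C) ->
  cintegrable (fun z => (g z * u z)%:E).
Proof.
move=> ig g0 mu uC.
have mg := cintegrable_cmeas ig.
apply: (@le_integrable _ _ _ lam setT _ _ (fun p => (C * g (to_complex p))%:E)) => //.
- apply/measurable_EFinP; apply: measurable_funM; exact/measurable_EFinP.
- move=> p _ /=; rewrite lee_fin normrM (ger0_norm (g0 _)).
  have [->|h] := eqVneq (g (to_complex p)) 0; first by rewrite mul0r mulr0 normr0.
  have := uC _ h => h1.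
  have C0 : 0 <= C by apply: le_trans h1.
  by rewrite [leRHS]ger0_norm ?mulr_ge0// mulrC ler_wpM2r.
- under eq_fun do rewrite EFinM; exact: integrableZl.
Qed.

Lemma rint_monomial (g : R[i] -> R) (rho : R) (b : R[i]) l :
  (0 < l)%N -> rho < 1 ->
  cintegrable (EFin \o g) -> (forall z, 0 <= g z) ->
  (forall z, rho <= cabs z -> g z = 0) ->
  (forall w z, cabs w = 1 -> g (w * z) = g z) ->
  rint (fun z => g z * complex.Re (b * z ^+ l)) = 0.
Proof.
move=> l0 rho1 ig g0 gs grot; have [w w1 wl] := @exists_rotation_root R l l0.
apply: (rint_odd w1).
  apply: (@cintegrable_dominated _ _ (cabs b)) => //.
    apply: cmap_Re; apply: cmapM; [exact: cmap_cst|exact: (cmapX _ cmap_id)].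
  move=> z gz; apply: le_trans (ler_Re_cabs _) _.
  rewrite cabsM ler_piMr ?cabs_ge0// cabsX exprn_ile1 ?cabs_ge0//.
  apply: ltW; apply: lt_trans rho1; rewrite ltNge; apply: contra gz => /gs ->//.
by move=> z; rewrite grot// exprMn wl mulN1r mulrN raddfN mulrN.
Qed.

Lemma cintegrableD (u v : R[i] -> R) : cintegrable (EFin \o u) -> cintegrable (EFin \o v) ->
  cintegrable (EFin \o (fun z => u z + v z)).
Proof. by move=> iu iv; exact: (integrableD measurableT iu iv). Qed.

Lemma rintD (u v : R[i] -> R) : cintegrable (EFin \o u) -> cintegrable (EFin \o v) ->
  rint (fun z => u z + v z) = rint u + rint v.
Proof.
move=> iu iv; rewrite /rint /cint -fineD ?(integrable_fin_num _ iu) ?(integrable_fin_num _ iv)//.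
by rewrite -(integralD measurableT iu iv).
Qed.

Lemma rintZ (c : R) (u : R[i] -> R) : cintegrable (EFin \o u) ->
  rint (fun z => c * u z) = c * rint u.
Proof.
move=> iu; rewrite /rint /cint /=; under eq_integral do rewrite EFinM.
by rewrite integralZl// fineM// (integrable_fin_num _ iu).
Qed.

(** All nonconstant monomials integrate to 0 against a radial function, so a
    polynomial integrates like its value at 0. *)
Lemma rint_poly (g : R[i] -> R) (rho : R) (p : {poly R[i]}) : rho < 1 ->
  cintegrable (EFin \o g) -> (forall z, 0 <= g z) ->
  (forall z, rho <= cabs z -> g z = 0) ->
  (forall w z, cabs w = 1 -> g (w * z) = g z) ->
  cintegrable (EFin \o (fun z => g z * complex.Re p.[z])) /\
  rint (fun z => g z * complex.Re p.[z]) = complex.Re p.[0] * rint g.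
Proof.
move=> rho1 ig g0 gs grot.
have g1 z : g z != 0 -> cabs z <= 1.
  by move=> gz; apply: ltW; apply: lt_trans rho1; rewrite ltNge; apply: contra gz => /gs ->.
have i1 b l : cintegrable (EFin \o (fun z => g z * complex.Re (b * z ^+ l))).
  apply: (@cintegrable_dominated _ _ (cabs b)) => //.
    apply: cmap_Re; apply: cmapM; [exact: cmap_cst|exact: (cmapX _ cmap_id)].
  move=> z gz; apply: le_trans (ler_Re_cabs _) _.
  by rewrite cabsM ler_piMr ?cabs_ge0// cabsX exprn_ile1 ?cabs_ge0// g1.
have key (q : {poly R[i]}) k :
  cintegrable (EFin \o (fun z => g z * complex.Re (z ^+ k * q.[z]))) /\
  rint (fun z => g z * complex.Re (z ^+ k * q.[z])) =
    (if k is 0%N then complex.Re q.[0] * rint g else 0).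
  elim/poly_ind : q k => [|q c ih] k.
    under eq_fun do rewrite horner0 mulr0 /= mulr0.
    rewrite horner0 /= mul0r; split; first exact: integrable0.
    by rewrite /rint /cint integral0; case: k.
  have -> : (fun z => g z * complex.Re (z ^+ k * (q * 'X + c%:P).[z])) =
    (fun z => g z * complex.Re (z ^+ k.+1 * q.[z]) + g z * complex.Re (c * z ^+ k)).
    apply/funext => z; rewrite !hornerE -mulrDr -raddfD; congr (_ * complex.Re _).
    by rewrite mulrDr exprS; ring.
  have [ih1 ih2] := ih k.+1.
  split; first exact: cintegrableD.
  rewrite rintD// ih2 add0r; case: k {ih1 ih2} => [|k].
    rewrite (_ : (q * 'X + c%:P).[0] = c); last by rewrite hornerD hornerMX hornerC mulr0 add0r.
    rewrite -(rintZ (complex.Re c) ig).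
    by congr rint; apply/funext => z; rewrite expr0 mulr1 mulrC.
  exact: (@rint_monomial _ rho).
have [k1 k2] := key p 0%N.
have e : (fun z => g z * complex.Re p.[z]) = (fun z => g z * complex.Re (z ^+ 0 * p.[z])).
  by apply/funext => z; rewrite expr0 mul1r.
by rewrite e.
Qed.


Lemma mobiusNK a w : disk a -> disk w -> mobius a (mobius (- a) w) = w.
Proof.
move=> da dw; have dNa : disk (- a) by rewrite /disk /= cabsN.
have h1 := mobius_den_neq0 dNa dw.
have h0 : 1 - conjc a * a != 0 by exact: mobius_den_neq0.
have h1' : 1 + conjc a * w != 0 by move: h1; rewrite rmorphN mulNr opprK.
rewrite /mobius rmorphN mulNr !opprK.
have -> : (w + a) / (1 + conjc a * w) - a = w * (1 - conjc a * a) / (1 + conjc a * w).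
  by field.
have -> : 1 - conjc a * ((w + a) / (1 + conjc a * w)) = (1 - conjc a * a) / (1 + conjc a * w).
  by field.
by field; rewrite h1' h0.
Qed.

(** Polynomial approximations of the Moebius map w -> (w+z)/(1+conj(z) w),
    from the truncated geometric series of its denominator. *)
Definition mobius_poly (z : R[i]) m : {poly R[i]} :=
  ('X + z%:P) * \sum_(i < m) (- conjc z) ^+ i *: 'X^i.

Lemma disk0 : disk (0 : R[i]).
Proof. by change (cabs (0 : R[i]) < 1); rewrite cabs0. Qed.

Lemma cvgcX (T : Type) (F : set_system T) (FF : Filter F) (u : T -> R[i]) (l : R[i]) n :
  u @ F --> l -> u t ^+ n @[t --> F] --> l ^+ n.
Proof.
move=> ul; elim: n => [|n ih]; first by under eq_cvg do rewrite expr0; rewrite expr0; exact: cvg_cst.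
under eq_cvg do rewrite exprS; rewrite exprS; exact: (cvgM ul ih).
Qed.

Lemma horner_mobius_poly z m w : disk z -> disk w ->
  (mobius_poly z m).[w] = mobius (- z) w * (1 - (- conjc z * w) ^+ m).
Proof.
move=> dz dw; have dNz : disk (- z) by rewrite /disk /= cabsN.
have h1 := mobius_den_neq0 dNz dw.
rewrite /mobius_poly hornerM hornerD hornerX hornerC horner_sum.
rewrite /mobius opprK; move: h1; rewrite rmorphN => h1.
under eq_bigr do rewrite hornerZ hornerXn -exprMn.
have -> : 1 - (- conjc z * w) ^+ m = (1 - - conjc z * w) * \sum_(i < m) (- conjc z * w) ^+ i.
  by rewrite -(opprB _ 1) subrX1 -mulNr opprB.
by field.
Qed.

(** Powers of the Moebius map are limits of polynomials, uniformly bounded on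
    the disk, to which [rint_poly] applies; the constant term is the value at
    the origin, which the map sends to z. *)
Lemma mean_value_mobius (g : R[i] -> R) (rho : R) (z b : R[i]) n : rho < 1 -> disk z ->
  cintegrable (EFin \o g) -> (forall z, 0 <= g z) ->
  (forall z, rho <= cabs z -> g z = 0) ->
  (forall w z, cabs w = 1 -> g (w * z) = g z) ->
  rint (fun w => g w * complex.Re (b * mobius (- z) w ^+ n)) =
  complex.Re (b * z ^+ n) * rint g.
Proof.
move=> rho1 dz ig g0 gs grot.
have dNz : disk (- z) by rewrite /disk /= cabsN.
have g1 w : g w != 0 -> disk w.
  by move=> gz; apply: lt_trans rho1; rewrite ltNge; apply: contra gz => /gs ->.
pose P m := b *: mobius_poly z m ^+ n.
have P0 m : (0 < m)%N -> (P m).[0] = b * z ^+ n.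
  move=> m0; rewrite /P hornerZ horner_exp horner_mobius_poly//; last exact: disk0.
  rewrite mulr0 expr0n gtn_eqF// subr0 mulr1 /mobius opprK add0r.
  by rewrite mulr0 subr0 divr1.
have step m : (0 < m)%N -> rint (fun w => g w * complex.Re (P m).[w]) = complex.Re (b * z ^+ n) * rint g.
  by move=> m0; have [_ ->] := rint_poly (P m) rho1 ig g0 gs grot; rewrite P0.
pose C := cabs b * 2 ^+ n.
have PC m w : g w != 0 -> `|complex.Re (P m).[w]| <= C.
  move=> /g1 dw; apply: le_trans (ler_Re_cabs _) _.
  rewrite /P hornerZ horner_exp horner_mobius_poly// cabsM ler_wpM2l ?cabs_ge0//.
  rewrite cabsX lerXn2r ?nnegrE ?cabs_ge0// cabsM.
  have h1 : cabs (mobius (- z) w) <= 1.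
    by apply/ltW; rewrite disk_mobius//; exact: mobius_den_neq0.
  apply: le_trans (_ : 1 * cabs (1 - (- conjc z * w) ^+ m) <= _); first by rewrite ler_wpM2r// cabs_ge0.
  rewrite mul1r; apply: le_trans (le_cabsD _ _) _; rewrite cabs1 cabsN -lerBrDl.
  rewrite (_ : 2 - 1 = 1 :> R); last by lra.
  rewrite cabsX exprn_ile1 ?cabs_ge0// cabsM cabsN cabs_conjc.
  by rewrite mulr_ile1 ?cabs_ge0//; apply: ltW.
have cv w : g w * complex.Re (P m).[w] @[m --> \oo] --> g w * complex.Re (b * mobius (- z) w ^+ n).
  have [->|exp_weight] := eqVneq (g w) 0; first by rewrite mul0r; under eq_cvg do rewrite mul0r; exact: cvg_cst.
  apply: cvgMr; apply: cvg_Re.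
  have dw := g1 _ exp_weight.
  under eq_cvg do rewrite /P hornerZ horner_exp horner_mobius_poly//.
  rewrite -[X in b * X ^+ n]mulr1 -[X in _ * (_ * X) ^+ n]subr0.
  apply: cvgM; first exact: cvg_cst.
  apply: cvgcX; apply: cvgM; first exact: cvg_cst.
  apply: cvgB; first exact: cvg_cst.
  apply: cvgc_expr; rewrite cabsM cabsN cabs_conjc.
  by rewrite -(mulr1 1) ltr_pM ?cabs_ge0.
have mg := cintegrable_cmeas ig.
have mgP m : cmeasurable (fun w => (g w * complex.Re (P m).[w])%:E).
  apply/measurable_EFinP; apply: measurable_funM; first exact/measurable_EFinP.
  by have [] := cmap_poly (P m).
have [] := @dominated_convergence _ _ _ lam setT measurableT
  (fun m p => (g (to_complex p) * complex.Re (P m).[to_complex p])%:E)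
  (fun p => (g (to_complex p) * complex.Re (b * mobius (- z) (to_complex p) ^+ n))%:E)
  (fun p => (C * g (to_complex p))%:E).
- by move=> m; exact: mgP.
- apply/measurable_EFinP; apply: measurable_funM; first exact/measurable_EFinP.
  have [] // : cmap (fun w => b * mobius (- z) w ^+ n).
  by apply: cmapM; [exact: cmap_cst|apply: cmapX; exact: cmap_mobius].
- by apply: aeW => p _; apply: cvg_EFin; [exact: nearW|exact: cv].
- by under eq_fun do rewrite EFinM; exact: integrableZl.
- apply: aeW => p m _; rewrite lee_fin normrM (ger0_norm (g0 _)) mulrC.
  have [->|gp] := eqVneq (g (to_complex p)) 0; first by rewrite !mulr0.
  by rewrite ler_wpM2r// PC.
move=> i1 _ h.
have h2 : rint (fun w => g w * complex.Re (P m).[w]) @[m --> \oo] --> rint (fun w => g w * complex.Re (b * mobius (- z) w ^+ n)).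
  by apply: fine_cvg; rewrite /rint fineK//; exact: integrable_fin_num i1.
apply/esym; apply: (cvg_unique _ _ h2) => //.
apply: cvg_near_cst.
by near=> m; rewrite step//; near: m; exists 1%N.
Unshelve. all: by end_near. Qed.


(** Moving z to 0 by a Moebius map turns the weight into a radial one, and
    x^n into the n-th power of a Moebius map. *)
Lemma mean_value (eta : R -> R) (C rho : R) (z b : R[i]) n : rho < 1 -> disk z ->
  measurable_fun setT eta -> (forall r, 0 <= eta r) -> (forall r, eta r <= C) ->
  (forall r, rho <= r -> eta r = 0) ->
  [/\ cintegrable (fun x => (eta (cabs (mobius z x)) * hypdens x)%:E),
     cintegrable (fun x => (eta (cabs (mobius z x)) * hypdens x * complex.Re (b * x ^+ n))%:E) &
  rint (fun x => eta (cabs (mobius z x)) * hypdens x * complex.Re (b * x ^+ n)) =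
  complex.Re (b * z ^+ n) * rint (fun x => eta (cabs (mobius z x)) * hypdens x)].
Proof.
move=> rho1 dz meta eta0 etaC etas.
have dNz : disk (- z) by rewrite /disk /= cabsN.
have C0 : 0 <= C by apply: le_trans (etaC 0).
pose g w := eta (cabs w) * hypdens w.
have g0 w : 0 <= g w by rewrite mulr_ge0 ?hypdens_ge0.
have gs w : rho <= cabs w -> g w = 0 by move=> h; rewrite /g etas// mul0r.
have grot w y : cabs w = 1 -> g (w * y) = g y by move=> w1; rewrite /g /hypdens cabsM w1 mul1r.
have meta1 phi : cmap phi -> measurable_fun setT (fun p : plane R => eta (cabs (phi (to_complex p)))).
  by move=> hphi; exact: (measurableT_comp meta (cmap_cabs hphi)).
have mg : cmeasurable (EFin \o g).
  apply/measurable_EFinP; apply: measurable_funM; last exact: measurable_hypdens.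
  exact: (meta1 _ cmap_id).
have ig : cintegrable (EFin \o g).
  apply: (@le_integrable _ _ _ lam setT measurableT _
    (fun p => ((C * (1 - rho ^+ 2) ^- 2) * (cabs (to_complex p) < 1)%R%:R)%:E)) => //.
  - move=> p _ /=; rewrite lee_fin (ger0_norm (g0 _)) ger0_norm; last first.
      by rewrite mulr_ge0// mulr_ge0// invr_ge0 sqr_ge0.
    have [h|h] := leP rho (cabs (to_complex p)).
      by rewrite gs// mulr_ge0// mulr_ge0// invr_ge0 sqr_ge0.
    rewrite /g /hypdens (lt_trans h rho1) mul1r mulr1.
    have r0 : 0 <= rho by apply: le_trans (ltW h); exact: cabs_ge0.
    apply: ler_pM => //; first by rewrite invr_ge0 sqr_ge0.
    have r2 : 0 < 1 - rho ^+ 2 by rewrite subr_gt0 expr_lt1.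
    have h2 : 1 - rho ^+ 2 <= 1 - cabs (to_complex p) ^+ 2.
      by rewrite lerB// lerXn2r ?nnegrE ?cabs_ge0// ltW.
    rewrite lef_pV2 ?posrE ?exprn_gt0//; last exact: lt_le_trans h2.
    by rewrite lerXn2r ?nnegrE// ?ltW// (lt_le_trans r2 h2).
  - under eq_fun do rewrite EFinM; apply: integrableZl => //.
    apply/integrableP; split; first by apply/measurable_EFinP; exact: measurable_cabs_lt.
    under eq_integral do rewrite gee0_abs ?lee_fin//.
    by rewrite -ge0_fin_numE; [exact: disk_area_fin|rewrite ltW// disk_area_gt0].
have trans (u : R[i] -> R) : cmeasurable (EFin \o u) ->
  cint (fun x => (eta (cabs (mobius z x)) * hypdens x * u x)%:E) =
  cint (fun w => (g w * u (mobius (- z) w))%:E).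
  move=> mu.
  have mF : cmeasurable (fun x => (eta (cabs (mobius z x)) * u x)%:E).
    apply/measurable_EFinP; apply: measurable_funM; last exact/measurable_EFinP.
    by apply: meta1; exact: cmap_mobius.
  have := cint_hyp_mobius dNz mF.
  move=> e; transitivity (cint (fun x => (eta (cabs (mobius z x)) * u x)%:E * (hypdens x)%:E)%E).
    by apply: eq_integral => p _; rewrite -EFinM mulrAC.
  rewrite e; apply: eq_integral => p _; rewrite -EFinM; congr (_%:E).
  have [dw|ndw] := boolP (cabs (to_complex p) < 1).
    by rewrite mobiusNK// /g mulrAC.
  by rewrite /g /hypdens (negbTE ndw) mul0r !mulr0 mul0r.
have i1 : cintegrable (fun x => (eta (cabs (mobius z x)) * hypdens x)%:E).
  apply/integrableP; split.
    apply/measurable_EFinP; apply: measurable_funM; last exact: measurable_hypdens.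
    by apply: meta1; exact: cmap_mobius.
  have /integrableP[_] := ig; apply: le_lt_trans.
  have := @trans (fun=> 1) (measurable_cst _).
  rewrite /cint; under eq_integral do rewrite mulr1; move=> h.
  have ph x : 0 <= eta (cabs (mobius z x)) * hypdens x by rewrite mulr_ge0 ?hypdens_ge0.
  rewrite le_eqVlt; apply/orP; left; apply/eqP.
  transitivity (\int[lam]_p ((eta (cabs (mobius z (to_complex p))) * hypdens (to_complex p))%:E))%E.
    by apply: eq_integral => p _; rewrite gee0_abs ?lee_fin.
  rewrite h; apply: eq_integral => p _; rewrite mulr1 gee0_abs ?lee_fin//.
have r1 : rint (fun x => eta (cabs (mobius z x)) * hypdens x) = rint g.
  have := @trans (fun=> 1) (measurable_cst _).
  rewrite /rint /cint; under eq_integral do rewrite mulr1; move=> ->.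
  by under eq_integral do rewrite mulr1.
have mR : cmeasurable (fun x => (complex.Re (b * x ^+ n))%:E).
  apply: cmap_Re; apply: cmapM; [exact: cmap_cst|exact: (cmapX _ cmap_id)].
split => //.
  apply: (@cintegrable_dominated _ (fun x => complex.Re (b * x ^+ n)) (cabs b)) => //.
    by move=> x; rewrite mulr_ge0 ?hypdens_ge0.
  move=> x; rewrite mulf_eq0 negb_or /hypdens => /andP[_].
  have [x1 _|] := boolP (cabs x < 1); last by rewrite mul0r eqxx.
  apply: le_trans (ler_Re_cabs _) _.
  by rewrite cabsM ler_piMr ?cabs_ge0// cabsX exprn_ile1 ?cabs_ge0// ltW.
rewrite r1 -(mean_value_mobius b n rho1 dz ig g0 gs grot).
exact: (congr1 fine (trans (fun x => complex.Re (b * x ^+ n)) mR)).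
Qed.

End MeanValue.

From mathcomp Require Import finmap.
HB.instance Definition _ (R : realType) := gen_eqMixin (@test_function R).

(** * Linear statistics of a configuration *)

Section LinearStatistics.
Context {R : realType}.
Implicit Types (X : conf R) (z x : R[i]) (phi psi : R[i] -> R).

Definition cdisk (rho : R) : set R[i] := [set z | cabs z <= rho].

Lemma continuous_cabs : continuous (@Normc.normc R : R[i] -> R).
Proof. by move=> z; apply: (@cvg_cabs R _ (nbhs z) _ id z); exact: cvg_id. Qed.

Lemma closed_cdisk rho : closed (cdisk rho).
Proof.
have -> : cdisk rho = (@Normc.normc R : R[i] -> R) @^-1` [set x : R | x <= rho] by [].
apply: preimage_closed; last exact: closed_le.
by move=> z _; exact: continuous_cabs.
Qed.

Lemma compact_cdisk rho : compact (cdisk rho).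
Proof.
pose f (p : R * R) : R[i] := Complex p.1 p.2.
have cf : continuous f.
  by move=> p; apply: cvg_ReIm; [exact: cvg_fst|exact: cvg_snd].
apply: (@subclosed_compact _ _ (f @` (`[- rho, rho]%classic `*` `[- rho, rho]%classic))).
- exact: closed_cdisk.
- apply: continuous_compact; first exact: continuous_subspaceT.
  by apply: compact_setX; exact: segment_compact.
- move=> z; rewrite /cdisk /= => h; exists (complex.Re z, complex.Im z); last by case: (z).
  have h1 := le_trans (ler_Re_cabs z) h; have h2 := le_trans (ler_Im_cabs z) h.
  by split; rewrite /= in_itv/= -ler_norml.
Qed.

Lemma cdisk_sub_disk rho : rho < 1 -> cdisk rho `<=` disk.
Proof. by move=> r1 z /= /le_lt_trans; apply. Qed.

Definition supp_in rho phi := forall x, rho < cabs x -> phi x = 0.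

Definition pts X rho : seq R[i] :=
  finmap.enum_fset (fset_set (cdisk rho `&` [set x | X x != 0%N])).

Lemma finite_pts X rho : rho < 1 -> finite_set (cdisk rho `&` [set x | X x != 0%N]).
Proof.
by move=> r1; apply: conf_locally_finite; [exact: compact_cdisk|exact: cdisk_sub_disk].
Qed.

Lemma mem_pts X rho x : rho < 1 -> (x \in pts X rho) = (cabs x <= rho) && (X x != 0%N).
Proof.
move=> r1; rewrite /pts.
have -> : (x \in finmap.enum_fset (fset_set (cdisk rho `&` [set x | X x != 0%N]))) =
  (x \in (fset_set (cdisk rho `&` [set x | X x != 0%N]))) by [].
rewrite in_fset_set; last exact: finite_pts.
by apply/idP/andP => [/set_mem[]|[h1 h2]]; last by apply/mem_set.
Qed.

Lemma uniq_pts X rho : uniq (pts X rho).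
Proof. exact: finmap.fset_uniq. Qed.

(** The linear statistic of a test function. It is a finitely supported sum in
    every use below, since the functions are supported in smaller disks. *)
Definition lin_stat phi X : R := \sum_(x \in [set: R[i]]) (X x)%:R * phi x.

Lemma fsbig_pts (V : nmodType) X rho (F : R[i] -> V) (A : set R[i]) : rho < 1 ->
  (forall x, A x -> X x != 0%N -> cabs x <= rho) ->
  (forall x, X x = 0%N -> F x = 0) ->
  \sum_(x \in A) F x = \sum_(x <- pts X rho | x \in A) F x.
Proof.
move=> r1 Arho F0.
transitivity (\sum_(x \in cdisk rho `&` [set x | X x != 0%N]) (if x \in A then F x else 0)).
  rewrite -(fsbig_widen (A `&` (cdisk rho `&` [set x | X x != 0%N])) A)//.
    rewrite -[RHS](fsbig_widen (A `&` (cdisk rho `&` [set x | X x != 0%N])) (cdisk rho `&` [set x | X x != 0%N]))//.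
    - by apply: eq_fsbigr => x /set_mem[Ax _]; rewrite mem_set.
    - by move=> x [h1 h2] /=; case: ifPn => // /set_mem Ax; exfalso; apply: h2.
  move=> x [Ax h] /=; apply: F0; apply/eqP; apply/negP => /negP xx.
  by apply: h; split => //; split => //; exact: Arho.
rewrite fsbig_finite; last exact: finite_pts.
by rewrite [RHS]big_mkcond.
Qed.

Lemma lin_stat_pts phi X rho : rho < 1 -> supp_in rho phi ->
  lin_stat phi X = \sum_(x <- pts X rho) (X x)%:R * phi x.
Proof.
move=> r1 sphi; rewrite /lin_stat.
transitivity (\sum_(x \in cdisk rho) (X x)%:R * phi x).
  apply/esym/fsbig_widen => // x [_ /negP]; rewrite -ltNge => h /=.
  by rewrite sphi// mulr0.
rewrite (@fsbig_pts _ X rho)//; last by move=> x ->; rewrite mul0r.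
rewrite big_seq_cond [RHS]big_seq; apply: eq_bigl => x.
by rewrite mem_pts//; case: (boolP (cabs x <= rho)) => h //=; rewrite mem_set// andbT.
Qed.


(** By definition of the vague topology, the statistic of a continuous
    compactly supported function is continuous. *)
Lemma measurable_lin_stat_test phi rho : rho < 1 -> supp_in rho phi -> continuous phi ->
  measurable_fun setT (fun X : Conf R => lin_stat phi X).
Proof.
move=> r1 sphi cphi.
have sK : exists K : set R[i], [/\ compact K, K `<=` disk & forall x, ~ K x -> phi x = 0].
  exists (cdisk rho); split; [exact: compact_cdisk|exact: cdisk_sub_disk|].
  by move=> x /negP; rewrite -ltNge => /sphi.
pose T := TestFunction cphi sK.
apply: (measurability (@RGenOInfty.G R)); first exact: RGenOInfty.measurableE.
move=> _ [_ [a ->] <-]; rewrite setTI.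
apply: sub_sigma_algebra.
have -> : (fun X : Conf R => lin_stat phi X) @^-1` `]a, +oo[ =
  (@vague_embedding R) @^-1` ((fun f : {ptws (@test_function R) -> R} => f T) @^-1` `]a, +oo[) by [].
apply: open_comp; first by move=> X _; exact: initial_continuous.
apply: open_comp; last exact: interval_open.
by move=> f _; exact: (@proj_continuous _ (fun=> R) T).
Qed.

Lemma measurable_lin_stat_lim (phi_ : nat -> R[i] -> R) phi rho : rho < 1 ->
  (forall m, supp_in rho (phi_ m)) -> (forall x, phi_ m x @[m --> \oo] --> phi x) ->
  (forall m, measurable_fun setT (fun X : Conf R => lin_stat (phi_ m) X)) ->
  measurable_fun setT (fun X : Conf R => lin_stat phi X).
Proof.
move=> r1 sm cm mm.
have sphi : supp_in rho phi.
  move=> x hx; apply: (cvg_unique _ (cm x)) => //.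
  have -> : (fun m => phi_ m x) = (fun=> 0) by apply/funext => m; rewrite sm.
  exact: cvg_cst.
apply: (measurable_fun_cvg mm) => // X _.
rewrite (lin_stat_pts X r1 sphi).
have -> : (fun m => lin_stat (phi_ m) X) = (fun m => \sum_(x <- pts X rho) (X x)%:R * phi_ m x).
  by apply/funext => m; rewrite (lin_stat_pts X r1 (sm _)).
elim: (pts X rho) => [|x l ih].
  by rewrite big_nil; under eq_cvg do rewrite big_nil; exact: cvg_cst.
rewrite big_cons; under eq_cvg do rewrite big_cons.
by apply: cvgD => //; apply: cvgM; [exact: cvg_cst|exact: cm].
Qed.

Lemma lin_statD phi psi X rho : rho < 1 -> supp_in rho phi -> supp_in rho psi ->
  lin_stat (fun x => phi x + psi x) X = lin_stat phi X + lin_stat psi X.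
Proof.
move=> r1 s1 s2; rewrite !(@lin_stat_pts _ X rho)//; last by move=> x hx; rewrite s1// s2// addr0.
by rewrite -big_split/=; apply: eq_bigr => x _; rewrite mulrDr.
Qed.

Lemma lin_statZ c phi X rho : rho < 1 -> supp_in rho phi ->
  lin_stat (fun x => c * phi x) X = c * lin_stat phi X.
Proof.
move=> r1 s1; rewrite !(@lin_stat_pts _ X rho)//; last by move=> x hx; rewrite s1// mulr0.
by rewrite mulr_sumr; apply: eq_bigr => x _; rewrite mulrCA.
Qed.

Lemma lin_stat_ge0 phi X rho : rho < 1 -> supp_in rho phi -> (forall x, 0 <= phi x) -> 0 <= lin_stat phi X.
Proof. by move=> r1 s1 p0; rewrite (@lin_stat_pts _ X rho)// sumr_ge0// => x _; rewrite mulr_ge0. Qed.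

End LinearStatistics.

(** * Hyperbolic balls and their continuous approximations *)

Section Shells.
Context {R : realType}.
Implicit Types (x z : R[i]) (s b r : R) (m : nat) (q : R[i] -> R).

Definition pdist r : R := ln ((1 + r) / (1 - r)).

Lemma poincareE z x : poincare z x = pdist (cabs (mobius z x)).
Proof. by []. Qed.

Lemma cabs_mobiusC z x : cabs (mobius z x) = cabs (mobius x z).
Proof.
rewrite /mobius !cabsM !cabsV cabs_distC; congr (_ / _).
by rewrite -cabs_conjc rmorphB rmorph1 rmorphM /= conjcK mulrC.
Qed.

Lemma poincareC z x : poincare z x = poincare x z.
Proof. by rewrite !poincareE cabs_mobiusC. Qed.

Lemma pdist_arg_gt0 r : 0 <= r < 1 -> 0 < (1 + r) / (1 - r).
Proof. by move=> /andP[r0 r1]; rewrite divr_gt0//; lra. Qed.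

Lemma pdist_ge0 r : 0 <= r < 1 -> 0 <= pdist r.
Proof.
move=> /andP[r0 r1]; rewrite /pdist ln_ge0// ler_pdivlMr; lra.
Qed.

Lemma expR_pdist r : 0 <= r < 1 -> expR (pdist r) = (1 + r) / (1 - r).
Proof. by move=> h; rewrite lnK// posrE pdist_arg_gt0. Qed.

(** The Euclidean radius of a hyperbolic ball of radius b centred at 0. *)
Definition rad b : R := (expR b - 1) / (expR b + 1).

Lemma pdist_lt b r : 0 <= r < 1 -> (pdist r < b) = (r < rad b).
Proof.
move=> h; have /andP[r0 r1] := h; rewrite -ltr_expR expR_pdist// /rad.
have e0 := expR_gt0 b.
rewrite ltr_pdivrMr ?subr_gt0// ltr_pdivlMr; last by lra.
by apply/idP/idP => ?; nra.
Qed.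

Lemma rad_lt1 b : rad b < 1.
Proof. by have e0 := expR_gt0 b; rewrite /rad ltr_pdivrMr ?mul1r; lra. Qed.

Lemma rad_ge0 b : 0 <= b -> 0 <= rad b.
Proof. by move=> b0; have e0 := expR_ge1Dx b; rewrite /rad divr_ge0//; lra. Qed.

(** A Euclidean radius below 1 such that the hyperbolic b-ball around any z
    with |z| <= t stays in the Euclidean disk of that radius. It turns
    truncation in hyperbolic distance into finite sums, uniformly in z. *)
Definition safe_radius t b : R := 1 - (1 - rad b ^+ 2) * (1 - t) / 4.

Lemma safe_radius_lt1 t b : 0 <= b -> 0 <= t < 1 -> safe_radius t b < 1.
Proof.
move=> b0 /andP[t0 t1]; rewrite /safe_radius ltrBlDr ltrDl.
by rewrite !mulr_gt0 ?subr_gt0 ?invr_gt0// expr_lt1 ?rad_ge0 ?rad_lt1.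
Qed.

Lemma one_sub_cabs2_mobius_le z x : disk z -> disk x ->
  1 - cabs (mobius z x) ^+ 2 <= (1 - cabs x ^+ 2) * (2 / (1 - cabs z)).
Proof.
move=> dz dx; rewrite one_sub_cabs2_mobius; last exact: mobius_den_neq0.
have z0 := cabs_ge0 z; have z1 : cabs z < 1 := dz.
have x0 := cabs_ge0 x; have x1 : cabs x < 1 := dx.
have d1 : 1 - cabs z <= cabs (1 - conjc z * x).
  have := le_cabsD (1 - conjc z * x) (conjc z * x); rewrite subrK cabs1 cabsM cabs_conjc.
  by nra.
have d2 : (1 - cabs z) ^+ 2 <= cabs (1 - conjc z * x) ^+ 2 by rewrite lerXn2r ?nnegrE ?cabs_ge0//; lra.
have p1 : 0 < (1 - cabs z) ^+ 2 by rewrite exprn_gt0; lra.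
have p2 : 0 < 1 - cabs x ^+ 2 by rewrite subr_gt0 -disk_cabs2.
rewrite -mulrA mulrCA ler_wpM2l ?(ltW p2)// ler_pdivrMr ?(lt_le_trans p1)//.
apply: le_trans (_ : 2 / (1 - cabs z) * (1 - cabs z) ^+ 2 <= _); last first.
  by rewrite ler_wpM2l// divr_ge0//; lra.
by rewrite expr2 mulrA divfK; [nra|lra].
Qed.

Lemma one_sub_cabs2_mobius_ge z x : disk z -> disk x ->
  (1 - cabs x ^+ 2) * ((1 - cabs z) / 4) <= 1 - cabs (mobius z x) ^+ 2.
Proof.
move=> dz dx; rewrite one_sub_cabs2_mobius; last exact: mobius_den_neq0.
have z0 := cabs_ge0 z; have z1 : cabs z < 1 := dz.
have x0 := cabs_ge0 x; have x1 : cabs x < 1 := dx.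
have d1 : cabs (1 - conjc z * x) <= 2.
  by apply: le_trans (le_cabsD _ _) _; rewrite cabs1 cabsN cabsM cabs_conjc; nra.
have d0 : 0 < cabs (1 - conjc z * x) ^+ 2 by rewrite exprn_gt0// lt_neqAle eq_sym cabs_ge0 cabs_neq0//; exact: mobius_den_neq0.
have d2 : cabs (1 - conjc z * x) ^+ 2 <= 4.
  by rewrite (_ : 4 = 2 ^+ 2) ?lerXn2r ?nnegrE ?cabs_ge0//; lra.
have p2 : 0 < 1 - cabs x ^+ 2 by rewrite subr_gt0 -disk_cabs2.
rewrite -[leRHS]mulrA [leRHS]mulrCA ler_wpM2l ?(ltW p2)// ler_pdivlMr//.
by nra.
Qed.

Lemma safe_radiusP t b z x : 0 <= b -> cabs z <= t < 1 -> disk x ->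
  cabs (mobius z x) <= rad b -> cabs x <= safe_radius t b.
Proof.
move=> b0 /andP[zt t1] dx h.
have dz : disk z by exact: le_lt_trans t1.
have := one_sub_cabs2_mobius_le dz dx.
have z0 := cabs_ge0 z; have x0 := cabs_ge0 x; have x1 : cabs x < 1 := dx.
have h2 : cabs (mobius z x) ^+ 2 <= rad b ^+ 2 by rewrite lerXn2r ?nnegrE ?cabs_ge0 ?rad_ge0.
have r2 : rad b ^+ 2 < 1 by rewrite expr_lt1 ?rad_ge0 ?rad_lt1.
rewrite mulrA ler_pdivlMr ?subr_gt0; last exact: le_lt_trans t1.
rewrite /safe_radius => h3.
have h4 : (1 - rad b ^+ 2) * (1 - t) <= (1 - cabs (mobius z x) ^+ 2) * (1 - cabs z) by apply: ler_pM; lra.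
have h5 : (1 - cabs x ^+ 2) * 2 <= (1 - cabs x) * 4 by nra.
by lra.
Qed.

(** A continuous approximation, from below and increasing in m, of the
    indicator of r < rad b. *)
Definition cut m b r : R := Num.min 1 (m%:R * Num.max 0 (rad b - r)).

Lemma cut_eq0 m b r : rad b <= r -> cut m b r = 0.
Proof. by move=> h; rewrite /cut max_l ?subr_le0// mulr0 min_r. Qed.

Lemma cvg_cut b r : cut m b r @[m --> \oo] --> ((r < rad b)%R%:R : R).
Proof.
have [h|h] := ltP r (rad b); last by under eq_cvg do rewrite cut_eq0//; exact: cvg_cst.
apply: cvg_near_cst.
near=> m; rewrite /cut max_r ?subr_ge0 ?(ltW h)// min_l//.
rewrite -ler_pdivrMr ?subr_gt0//; near: m; exact: nbhs_infty_ger.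
Unshelve. all: by end_near. Qed.

Lemma cvgr_min (T : Type) (F : set_system T) (FF : Filter F) (u v : T -> R) (a b : R) :
  u @ F --> a -> v @ F --> b -> Num.min (u t) (v t) @[t --> F] --> Num.min a b.
Proof.
move=> ha hb; under eq_cvg do rewrite minr_absE; rewrite minr_absE.
apply: cvgM; last exact: cvg_cst.
by apply: cvgB; [exact: cvgD|apply: cvg_norm; exact: cvgB].
Qed.

Lemma cvgr_max (T : Type) (F : set_system T) (FF : Filter F) (u v : T -> R) (a b : R) :
  u @ F --> a -> v @ F --> b -> Num.max (u t) (v t) @[t --> F] --> Num.max a b.
Proof.
move=> ha hb; under eq_cvg do rewrite maxr_absE; rewrite maxr_absE.
apply: cvgM; last exact: cvg_cst.
by apply: cvgD; [exact: cvgD|apply: cvg_norm; exact: cvgB].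
Qed.

Lemma cvgcM (T : Type) (F : set_system T) (FF : Filter F) (u v : T -> R[i]) z x :
  u @ F --> z -> v @ F --> x -> u t * v t @[t --> F] --> z * x.
Proof. by move=> hu hv; exact: (cvgM hu hv). Qed.

Lemma cvgcB (T : Type) (F : set_system T) (FF : Filter F) (u v : T -> R[i]) z x :
  u @ F --> z -> v @ F --> x -> u t - v t @[t --> F] --> z - x.
Proof. by move=> hu hv; exact: (cvgB hu hv). Qed.

Lemma cvgcD (T : Type) (F : set_system T) (FF : Filter F) (u v : T -> R[i]) z x :
  u @ F --> z -> v @ F --> x -> u t + v t @[t --> F] --> z + x.
Proof. by move=> hu hv; exact: (cvgD hu hv). Qed.

Lemma cvgcV (T : Type) (F : set_system T) (FF : Filter F) (u : T -> R[i]) z :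
  z != 0 -> u @ F --> z -> (u t)^-1 @[t --> F] --> z^-1.
Proof. by move=> z0 hu; exact: (cvgV z0 hu). Qed.

Lemma cvgr_cut (T : Type) (F : set_system T) (FF : Filter F) (u : T -> R) r m b :
  u @ F --> r -> cut m b (u t) @[t --> F] --> cut m b r.
Proof.
move=> h; apply: cvgr_min; first exact: cvg_cst.
apply: cvgM; first exact: cvg_cst.
by apply: cvgr_max; [exact: cvg_cst|apply: cvgB => //; exact: cvg_cst].
Qed.

Lemma cvg_conjc (T : Type) (F : set_system T) (FF : Filter F) (u : T -> R[i]) z :
  u @ F --> z -> conjc (u t) @[t --> F] --> conjc z.
Proof.
move=> h; apply: cvg_ReIm.
  by under eq_cvg do rewrite Re_conjc; rewrite Re_conjc; exact: cvg_Re.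
by under eq_cvg do rewrite Im_conjc; rewrite Im_conjc; apply: cvgN; exact: cvg_Im.
Qed.

Lemma cvg_mobius (T : Type) (F : set_system T) (FF : Filter F) (u v : T -> R[i]) z x :
  disk z -> disk x -> u @ F --> z -> v @ F --> x ->
  mobius (u t) (v t) @[t --> F] --> mobius z x.
Proof.
move=> dz dx hu hv; apply: cvgcM; first exact: cvgcB.
apply: cvgcV; first exact: mobius_den_neq0.
apply: cvgcB; first exact: cvg_cst.
exact: (cvgcM FF (cvg_conjc FF hu) hv).
Qed.

Lemma cvgr_comp (T : Type) (F : set_system T) (FF : Filter F) (h : R -> R) (u : T -> R) a :
  {for a, continuous h} -> u @ F --> a -> h (u t) @[t --> F] --> h a.
Proof. by move=> ch hu; exact: (cvg_comp _ _ hu ch). Qed.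

Lemma cvg_pdist (T : Type) (F : set_system T) (FF : Filter F) (u : T -> R) r :
  0 <= r < 1 -> u @ F --> r -> pdist (u t) @[t --> F] --> pdist r.
Proof.
move=> h hu; have /andP[r0 r1] := h.
apply: (@cvgr_comp _ _ _ (@ln R) (fun t => (1 + u t) / (1 - u t))).
  by apply: continuous_ln; exact: pdist_arg_gt0.
apply: cvgM; first exact: (cvgD (cvg_cst _) hu).
apply: cvgV; first by rewrite subr_eq0 gt_eqF.
exact: (cvgB (cvg_cst _) hu).
Qed.

(** The continuous approximations of the truncated exponential weight times q.
    They are test functions, so their statistics are measurable. *)
Definition approx m s b q z x : R :=
  (cabs x < 1)%R%:R * (cut m b (cabs (mobius z x)) * expR (- s * poincare z x)) * q x.

Definition ballw s b q z x : R :=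
  (cabs x < 1)%R%:R * ((poincare z x < b)%R%:R * expR (- s * poincare z x)) * q x.

Lemma mobius_itv z x : disk z -> disk x -> 0 <= cabs (mobius z x) < 1.
Proof. by move=> dz dx; rewrite cabs_ge0 disk_mobius//; exact: mobius_den_neq0. Qed.

Lemma ball_support s b q t z : 0 <= b -> cabs z <= t < 1 -> supp_in (safe_radius t b) (ballw s b q z).
Proof.
move=> b0 /[dup] h /andP[zt t1] x hx; rewrite /ballw.
have dz : disk z by exact: le_lt_trans t1.
have [dx|] := boolP (cabs x < 1); last by rewrite !mul0r.
rewrite poincareE pdist_lt ?mobius_itv//.
have [h2|] := ltP (cabs (mobius z x)) (rad b); last by rewrite mul0r mulr0 mul0r.
by have := safe_radiusP b0 h dx (ltW h2); rewrite leNgt hx.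
Qed.

Lemma approx_support m s b q t z : 0 <= b -> cabs z <= t < 1 -> supp_in (safe_radius t b) (approx m s b q z).
Proof.
move=> b0 /[dup] h /andP[zt t1] x hx; rewrite /approx.
have dz : disk z by exact: le_lt_trans t1.
have [dx|] := boolP (cabs x < 1); last by rewrite !mul0r.
have [h2|h2] := ltP (cabs (mobius z x)) (rad b); last by rewrite cut_eq0// !(mul0r,mulr0).
by have := safe_radiusP b0 h dx (ltW h2); rewrite leNgt hx.
Qed.

Lemma cvg_approx_m s b q z x : disk z ->
  approx m s b q z x @[m --> \oo] --> ballw s b q z x.
Proof.
move=> dz; rewrite /approx /ballw.
have [dx|ndx] := boolP (cabs x < 1); last first.
  by under eq_cvg do rewrite !mul0r; rewrite !mul0r; exact: cvg_cst.
rewrite poincareE pdist_lt ?mobius_itv//.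
apply: cvgM; last exact: cvg_cst.
apply: cvgM; first exact: cvg_cst.
by apply: cvgM; [exact: cvg_cut|exact: cvg_cst].
Qed.

(** Joint continuity in (z,x), needed both for measurability in the
    configuration (z fixed) and for joint measurability (z varying). *)
Lemma cvg_core (T : Type) (F : set_system T) (FF : Filter F) (u v : T -> R[i]) z x m s b :
  disk z -> disk x -> u @ F --> z -> v @ F --> x ->
  cut m b (cabs (mobius (u t) (v t))) * expR (- s * poincare (u t) (v t)) @[t --> F] -->
  cut m b (cabs (mobius z x)) * expR (- s * poincare z x).
Proof.
move=> dz dx hu hv.
have h : cabs (mobius (u t) (v t)) @[t --> F] --> cabs (mobius z x).
  by apply: cvg_cabs; exact: cvg_mobius.
apply: cvgM; first exact: cvgr_cut.
apply: (@cvgr_comp _ _ _ (@expR R)); first exact: continuous_expR.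
by apply: cvgM; [exact: cvg_cst|apply: cvg_pdist => //; exact: mobius_itv].
Qed.

Lemma open_disk : open (@disk R).
Proof.
have -> : @disk R = (@Normc.normc R : R[i] -> R) @^-1` [set x : R | x < 1] by [].
by apply: open_comp; [move=> z _; exact: continuous_cabs|exact: open_lt].
Qed.

Lemma continuous_approx m s b q z : 0 <= b -> disk z -> continuous q ->
  continuous (approx m s b q z).
Proof.
move=> b0 dz cq x.
have [dx|ndx] := pselect (disk x).
  have FF := nbhs_filter x.
  have h1 : ((cabs y < 1)%R%:R : R) @[y --> x] --> ((cabs x < 1)%R%:R : R).
    apply: cvg_near_cst.
    have := open_nbhs_nbhs (conj open_disk dx); apply: filterS => y dy.
    by rewrite (dy : cabs y < 1) (dx : cabs x < 1).
  have hz : (fun=> z) @ nbhs x --> z by exact: cvg_cst.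
  have hx : id @ nbhs x --> x by exact: cvg_id.
  have h2 := @cvg_core _ _ FF (fun=> z) id z x m s b dz dx hz hx.
  exact: (cvgM (cvgM h1 h2) (cq x)).
have ht : cabs z <= cabs z < 1 by rewrite lexx.
have s1 := safe_radius_lt1 b0 (_ : 0 <= cabs z < 1); rewrite cabs_ge0 in s1; have {}s1 := s1 dz.
have hx : safe_radius (cabs z) b < cabs x by apply: lt_le_trans s1 _; rewrite leNgt; apply/negP.
have op : open [set y : R[i] | safe_radius (cabs z) b < cabs y].
  have -> : [set y : R[i] | safe_radius (cabs z) b < cabs y] = (@Normc.normc R : R[i] -> R) @^-1` [set x : R | safe_radius (cabs z) b < x] by [].
  by apply: open_comp; [move=> y _; exact: continuous_cabs|exact: open_gt].
have h3 : \forall y \near nbhs x, approx m s b q z y = approx m s b q z x.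
  apply: filterS (open_nbhs_nbhs (conj op hx)) => y hy.
  by rewrite !(approx_support _ _ _ b0 ht).
have FF := nbhs_filter x.
have h4 : approx m s b q z y @[y --> nbhs x] --> approx m s b q z x by apply: cvg_near_cst.
exact: h4.
Qed.

Lemma measurable_lin_stat_ball s b q z : 0 <= b -> disk z -> continuous q ->
  measurable_fun setT (fun X : Conf R => lin_stat (ballw s b q z) X).
Proof.
move=> b0 dz cq.
have ht : cabs z <= cabs z < 1 by rewrite lexx.
have s1 : safe_radius (cabs z) b < 1 by apply: safe_radius_lt1; rewrite ?cabs_ge0.
apply: (@measurable_lin_stat_lim _ (fun m => approx m s b q z) _ (safe_radius (cabs z) b)) => //.
- by move=> m; exact: approx_support.
- by move=> x; exact: cvg_approx_m.
- move=> m; apply: (@measurable_lin_stat_test _ _ (safe_radius (cabs z) b)) => //; first exact: approx_support.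
  exact: continuous_approx.
Qed.

End Shells.

(** * First and second moments of linear statistics *)

(** The integral of f is the difference of two suprema over simple functions,
    so f and g may fail to be measurable. This is what allows integrating a
    supremum over the unit ball. *)
Lemma le_lower_integral d (T : measurableType d) (R : realType)
  (mu : {measure set T -> \bar R}) (D : set T) (f g : T -> \bar R) :
  (forall x, D x -> (f x <= g x)%E) -> (forall x, D x -> (0 <= g x)%E) ->
  (\int[mu]_(x in D) f x <= \int[mu]_(x in D) g x)%E.
Proof.
move=> fg g0; rewrite integralE.
apply: (@le_trans _ _ (\int[mu]_(x in D) f^\+ x)%E).
  by rewrite -[leRHS]sube0 leeB// integral_ge0.
rewrite !ge0_integralE//; apply: le_ereal_sup => _ [h hf <-].
exists h => // x; apply: le_trans (hf x) _.
rewrite /patch; case: ifPn => // /set_mem Dx.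
by rewrite funeposE ge_max fg// g0.
Qed.

Section Moments.
Context {R : realType}.
Implicit Types (X : conf R) (z x : R[i]) (u phi : R[i] -> R).
Local Notation lam := (@lebesgue_measure R \x @lebesgue_measure R)%E.

Definition bergman_density z : R := (1 - cabs z ^+ 2) ^- 2.

(** The mean of the linear statistic of u >= 0: the integral of u against the
    one-point intensity, taken with respect to normalised area. *)
Definition mean_stat u : \bar R := ((pi^-1)%:E * cint (fun x => (u x * hypdens x)%:E))%E.

Lemma measurable_plane_disk : measurable (@plane_disk R).
Proof.
rewrite (_ : plane_disk = setT `&` (fun p : plane R => cabs (to_complex p)) @^-1` `]-oo, 1[%classic).
  exact: (cmap_cabs cmap_id).
apply/seteqP; split => p; first by move=> h; split => //=; rewrite in_itv.
by move=> [_ /=]; rewrite in_itv.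
Qed.

(** The intensity K(z,z) = (1-|z|^2)^{-2} is the hyperbolic density. *)
Lemma area_integral u : cmeasurable (EFin \o u) -> (forall x, 0 <= u x) ->
  (\int[area]_(p in plane_disk) (u (to_complex p) * bergman_density (to_complex p))%:E = mean_stat u)%E.
Proof.
move=> mu u0; have mD := measurable_plane_disk.
have mr : measurable_fun setT (fun p : plane R => bergman_density (to_complex p)).
  apply: (measurableT_comp measurable_invr); apply: measurable_funX.
  by apply: measurable_funB => //; apply: measurable_funX; exact: (cmap_cabs cmap_id).
rewrite ge0_integral_mscale//; last 2 first.
- apply/measurable_EFinP; apply: measurable_funTS; apply: measurable_funM => //.
  exact/measurable_EFinP.
- by move=> p _; rewrite lee_fin mulr_ge0// invr_ge0 sqr_ge0.
congr (_ * _)%E; rewrite integral_mkcond; apply: eq_integral => p _.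
rewrite /patch /hypdens; case: ifPn => [/set_mem h|/negP h].
  by rewrite (h : cabs (to_complex p) < 1) mul1r.
have -> : (cabs (to_complex p) < 1) = false.
  by apply/negP => h2; apply: h; apply/mem_set.
by rewrite mul0r mulr0.
Qed.

Definition of_complex z : plane R := (complex.Re z, complex.Im z).

Lemma of_complexK : cancel of_complex to_complex.
Proof. by case. Qed.

Lemma to_complexK : cancel to_complex of_complex.
Proof. by case. Qed.

Lemma Re_bergman_diag z : complex.Re (bergman_kernel z z) = bergman_density z.
Proof.
rewrite /bergman_kernel /bergman_density.
have -> : 1 - z * conjc z = real_complex R (1 - cabs z ^+ 2).
  by apply/eqP; rewrite eq_complex cabs2E; case: z => a b /=; apply/andP; split; apply/eqP; ring.
by rewrite -rmorphXn -fmorphV.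
Qed.

Variable P : probability (Conf R) R.
Hypothesis hP : determinantal_process P bergman_kernel.

(** The first correlation function applied to u, after identifying particles
    with 1-tuples. *)
Lemma first_moment u : cmeasurable (EFin \o u) -> (forall x, 0 <= u x) ->
  (\int[P]_X (\esum_(x in [set: R[i]]) ((X x)%:R * u x)%:E) = mean_stat u)%E.
Proof.
move=> mu u0.
have := hP.2 1%N isT (fun t => u (to_complex (tnth t ord0))).
have mphi : measurable_fun setT (fun t : 1.-tuple (plane R) => u (to_complex (tnth t ord0))).
  have mu' : measurable_fun setT (fun p : plane R => u (to_complex p)) by exact/measurable_EFinP.
  exact: (measurableT_comp mu' (measurable_tnth ord0)).
move=> /(_ mphi (fun t => u0 _)) h.
transitivity (\int[P]_X \esum_(t in [set t : 1.-tuple (plane R) | uniq t])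
  (u (to_complex (tnth t ord0)) * \prod_(i < 1) (X (to_complex (tnth t i)))%:R)%:E)%E.
  apply: eq_integral => X _.
  rewrite (@reindex_esum _ _ _ [set: R[i]] _ (fun z => [tuple of_complex z])).
    by apply: eq_esum => z _; rewrite big_ord1 !(tnth_nth (of_complex 0))/= of_complexK mulrC.
  split.
  - by move=> z _.
  - by move=> z w _ _ /(congr1 val)/= [] e1 e2; apply/eqP; rewrite eq_complex e1 e2 !eqxx.
  - move=> t _; exists (to_complex (tnth t ord0)) => //.
    by apply/val_inj => /=; rewrite to_complexK; case: t => -[//|p [|//]] i.
rewrite h /= -area_integral//; apply: eq_integral => p _.
rewrite !(tnth_nth p)/=; congr (_ * _)%:E.
have e (i : 'I_1) : tnth [tuple p] i = p by rewrite (tnth_nth p) (ord1 i).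
by rewrite /kernel_det det_mx11 mxE e Re_bergman_diag.
Qed.

Lemma esum_lin_stat X u rho : rho < 1 -> supp_in rho u -> (forall x, 0 <= u x) ->
  (\esum_(x in [set: R[i]]) ((X x)%:R * u x)%:E = (lin_stat u X)%:E)%E.
Proof.
move=> r1 su u0.
have fS := finite_pts X r1.
transitivity (\esum_(x in cdisk rho `&` [set x | X x != 0%N]) ((X x)%:R * u x)%:E)%E.
  rewrite [RHS]esum_mkcond; apply: eq_esum => x _.
  case: ifPn => // /negP h.
  have [hx|hx] := ltP rho (cabs x); first by rewrite su// mulr0.
  have [->|hX] := eqVneq (X x) 0%N; first by rewrite mul0r.
  by exfalso; apply: h; apply/mem_set.
rewrite esum_fset//; last by move=> x _; rewrite lee_fin mulr_ge0.
rewrite fsumEFin// (lin_stat_pts X r1 su); congr (_%:E).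
by rewrite fsbig_finite.
Qed.

Lemma first_moment_lin_stat u rho : rho < 1 -> supp_in rho u -> cmeasurable (EFin \o u) -> (forall x, 0 <= u x) ->
  (\int[P]_X (lin_stat u X)%:E = mean_stat u)%E.
Proof.
move=> r1 su mu u0; rewrite -first_moment//; apply: eq_integral => X _.
by rewrite (esum_lin_stat _ r1).
Qed.


Lemma det22 (M : 'M[R[i]]_2) : \det M = M ord0 ord0 * M ord_max ord_max - M ord0 ord_max * M ord_max ord0.
Proof.
rewrite (expand_det_row _ ord0) !big_ord_recl big_ord0 /cofactor !det_mx11 !mxE/=.
have e0 : lift ord0 (ord0 : 'I_1) = ord_max :> 'I_2 by apply/val_inj.
have e1 : lift (ord_max : 'I_2) (ord0 : 'I_1) = ord0 :> 'I_2 by apply/val_inj.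
by rewrite e0 e1 /= !expr0 !mul1r expr1 mulN1r mulrN addr0.
Qed.

Lemma Im_bergman_diag z : complex.Im (bergman_kernel z z) = 0.
Proof.
rewrite /bergman_kernel.
have -> : 1 - z * conjc z = real_complex R (1 - cabs z ^+ 2).
  by apply/eqP; rewrite eq_complex cabs2E; case: z => a b /=; apply/andP; split; apply/eqP; ring.
by rewrite -rmorphXn -fmorphV.
Qed.

Lemma bergman_herm z w : bergman_kernel w z = conjc (bergman_kernel z w).
Proof.
by rewrite /bergman_kernel fmorphV rmorphXn rmorphB rmorph1 rmorphM /= conjcK mulrC.
Qed.

(** The off-diagonal entries are conjugate, so the determinant is the product
    of the diagonal entries minus a squared modulus. *)
Lemma kernel_det2_le (p q : plane R) :
  kernel_det bergman_kernel [tuple p; q] <= bergman_density (to_complex p) * bergman_density (to_complex q).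
Proof.
have e0 : tnth [tuple p; q] ord0 = p by [].
have e1 : tnth [tuple p; q] ord_max = q by [].
rewrite /kernel_det det22 !mxE e0 e1.
set z := to_complex p; set w := to_complex q.
rewrite (bergman_herm z w).
have := Re_bergman_diag z; have := Im_bergman_diag z.
have := Re_bergman_diag w; have := Im_bergman_diag w.
case: (bergman_kernel z z) => a1 a2; case: (bergman_kernel w w) => b1 b2.
case: (bergman_kernel z w) => c1 c2 /= -> -> -> ->.
by have := sqr_ge0 c1; have := sqr_ge0 c2; lra.
Qed.

Definition pair_sum u X : \bar R :=
  (\esum_(t in [set t : 2.-tuple (plane R) | uniq t])
    (u (to_complex (tnth t ord0)) * u (to_complex (tnth t ord_max)) *
     \prod_(i < 2) (X (to_complex (tnth t i)))%:R)%:E)%E.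

Lemma second_moment u : cmeasurable (EFin \o u) -> (forall x, 0 <= u x) ->
  (\int[P]_X pair_sum u X <= mean_stat u * mean_stat u)%E.
Proof.
move=> mu u0.
have mu' : measurable_fun setT (fun p : plane R => u (to_complex p)) by exact/measurable_EFinP.
have := hP.2 2%N isT (fun t => u (to_complex (tnth t ord0)) * u (to_complex (tnth t ord_max))).
have mphi : measurable_fun setT (fun t : 2.-tuple (plane R) => u (to_complex (tnth t ord0)) * u (to_complex (tnth t ord_max))).
  apply: measurable_funM; first exact: (measurableT_comp mu' (measurable_tnth ord0)).
  exact: (measurableT_comp mu' (measurable_tnth ord_max)).
move=> /(_ mphi (fun t => mulr_ge0 (u0 _) (u0 _))) h.
rewrite /pair_sum h /=.
have r0 z : 0 <= bergman_density z by rewrite invr_ge0 sqr_ge0.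
have mD := measurable_plane_disk.
have mr : measurable_fun setT (fun p : plane R => bergman_density (to_complex p)).
  apply: (measurableT_comp measurable_invr); apply: measurable_funX.
  by apply: measurable_funB => //; apply: measurable_funX; exact: (cmap_cabs cmap_id).
have mur : measurable_fun plane_disk (fun p : plane R => (u (to_complex p) * bergman_density (to_complex p))%:E).
  by apply/measurable_funTS/measurable_EFinP; exact: measurable_funM.
apply: (@le_trans _ _ (\int[area]_(p in plane_disk) \int[area]_(q in plane_disk)
   ((u (to_complex p) * bergman_density (to_complex p))%:E * (u (to_complex q) * bergman_density (to_complex q))%:E))%E).
  apply: le_lower_integral => [p _|p _]; last first.
    by apply: integral_ge0 => q _; rewrite mule_ge0// lee_fin mulr_ge0.
  apply: le_lower_integral => [q _|q _]; last by rewrite mule_ge0// lee_fin mulr_ge0.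
  rewrite -EFinM lee_fin (tnth_nth p) (tnth_nth p _ ord_max)/=.
  by rewrite [leRHS]mulrACA ler_wpM2l ?mulr_ge0// kernel_det2_le.
rewrite le_eqVlt; apply/orP; left; apply/eqP.
transitivity (\int[area]_(p in plane_disk) ((u (to_complex p) * bergman_density (to_complex p))%:E * mean_stat u))%E.
  apply: eq_integral => p _; rewrite -area_integral// -ge0_integralZl//.
  - by move=> q _; rewrite lee_fin mulr_ge0.
  - by rewrite lee_fin mulr_ge0.
rewrite ge0_integralZr ?area_integral//.
- by move=> q _; rewrite lee_fin mulr_ge0.
- rewrite -area_integral//; apply: integral_ge0 => q _; by rewrite lee_fin mulr_ge0.
Qed.


Lemma mean_stat_ge0 u : (forall x, 0 <= u x) -> (0 <= mean_stat u)%E.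
Proof.
move=> u0; apply: mule_ge0; first by rewrite lee_fin invr_ge0 pi_ge0.
by apply: integral_ge0 => p _; rewrite lee_fin mulr_ge0// hypdens_ge0.
Qed.

(** For a simple configuration, expanding the square leaves the diagonal
    terms u(x)^2 and the sum over distinct pairs. *)
Lemma sqr_lin_stat_le X u rho : rho < 1 -> supp_in rho u -> (forall x, 0 <= u x) -> simple_conf X ->
  (((lin_stat u X) ^+ 2 - lin_stat (fun x => u x ^+ 2) X)%:E <= pair_sum u X)%E.
Proof.
move=> r1 su u0 sX.
have su2 : supp_in rho (fun x => u x ^+ 2) by move=> x hx; rewrite su// expr0n.
rewrite (lin_stat_pts X r1 su) (lin_stat_pts X r1 su2).
set s := pts X rho; have us : uniq s := uniq_pts X rho.
have Xs x : x \in s -> X x = 1%N.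
  rewrite mem_pts// => /andP[_]; have := sX x; by case: (X x) => [|[|]].
have -> : \sum_(x <- s) (X x)%:R * u x = \sum_(x <- s) u x.
  by rewrite big_seq [RHS]big_seq; apply: eq_bigr => x /Xs ->; rewrite mul1r.
have -> : \sum_(x <- s) (X x)%:R * u x ^+ 2 = \sum_(x <- s) u x ^+ 2.
  by rewrite big_seq [RHS]big_seq; apply: eq_bigr => x /Xs ->; rewrite mul1r.
pose prs := [seq xy <- [seq (x, y) | x <- s, y <- s] | xy.1 != xy.2].
pose e (xy : R[i] * R[i]) : 2.-tuple (plane R) := [tuple of_complex xy.1; of_complex xy.2].
have uprs : uniq prs by rewrite filter_uniq// allpairs_uniq// => -[a b] [c d] _ _ /=.
have ei : injective e.
  move=> [a b] [c d] /(congr1 val)/= [] e1 e2 e3 e4; congr pair.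
    by apply/eqP; rewrite eq_complex e1 e2 !eqxx.
  by apply/eqP; rewrite eq_complex e3 e4 !eqxx.
have -> : (\sum_(x <- s) u x) ^+ 2 - \sum_(x <- s) u x ^+ 2 = \sum_(xy <- prs) u xy.1 * u xy.2.
  rewrite big_filter [RHS]big_mkcond [RHS]big_allpairs/= expr2 mulr_suml -sumrB.
  rewrite big_seq [RHS]big_seq; apply: eq_bigr => x xs.
  rewrite mulr_sumr (big_rem x xs)/= [RHS](big_rem x xs)/= eqxx add0r -expr2 addrAC subrr add0r.
  rewrite big_seq [RHS]big_seq; apply: eq_bigr => y.
  by rewrite mem_rem_uniq// inE eq_sym => /andP[-> _].
apply: esum_ge; exists [set` [seq e xy | xy <- prs]].
  split; first exact: finite_seq.
  move=> t /= /mapP[[x y]]; rewrite mem_filter/= => /andP[xy _] ->.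
  rewrite /= andbT inE; apply: contra xy => /eqP[h1 h2].
  by rewrite eq_complex h1 h2 !eqxx.
rewrite -fsbig_seq; last by rewrite map_inj_uniq.
rewrite big_map -sumEFin le_eqVlt; apply/orP; left; apply/eqP.
rewrite big_seq [RHS]big_seq; apply: eq_bigr => -[x y]; rewrite mem_filter => /andP[_].
move=> /allpairsP[[a b] /= [as_ bs [-> ->]]].
rewrite big_ord_recl big_ord1/=.
have -> : tnth (e (a, b)) (lift ord0 ord0) = of_complex b by [].
have -> : tnth (e (a, b)) ord0 = of_complex a by [].
have -> : tnth (e (a, b)) ord_max = of_complex b by [].
by rewrite !of_complexK !Xs// !mulr1.
Qed.

(** Negative correlation: the pairs contribute at most the square of the mean
    ([second_moment]), so only the diagonal is left. *)
Lemma variance_nonneg u rho : rho < 1 -> supp_in rho u -> cmeasurable (EFin \o u) ->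
  (forall x, 0 <= u x) ->
  measurable_fun setT (fun X : Conf R => lin_stat u X) ->
  measurable_fun setT (fun X : Conf R => lin_stat (fun x => u x ^+ 2) X) ->
  mean_stat u \is a fin_num ->
  (\int[P]_X ((lin_stat u X - fine (mean_stat u)) ^+ 2)%:E <= mean_stat (fun x => (u x ^+ 2)%R))%E.
Proof.
move=> r1 su mu u0 mL mL2 fin.
set m := fine (mean_stat u).
have m0 : 0 <= m by rewrite fine_ge0// mean_stat_ge0.
have su2 : supp_in rho (fun x => u x ^+ 2) by move=> x hx; rewrite su// expr0n.
have u20 x : 0 <= u x ^+ 2 by exact: sqr_ge0.
have mu2 : cmeasurable (EFin \o (fun x => u x ^+ 2)).
  by apply/measurable_EFinP; apply: measurable_funX; exact/measurable_EFinP.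
have e1 : (\int[P]_X (lin_stat u X)%:E = m%:E)%E by rewrite (first_moment_lin_stat r1)// fineK.
have e2 : (\int[P]_X (lin_stat (fun x => u x ^+ 2) X)%:E = mean_stat (fun x => (u x ^+ 2)%R))%E by rewrite (first_moment_lin_stat r1).
(* the sum over pairs may not be measurable; D is, and lies below it almost surely *)
pose D X := Num.max 0 ((lin_stat u X) ^+ 2 - lin_stat (fun x => u x ^+ 2) X).
have mD : measurable_fun setT (fun X : Conf R => D X).
  by apply: measurable_maxr => //; apply: measurable_funB => //; exact: measurable_funX.
have D0 X : 0 <= D X by rewrite le_max lexx.
have iD : (\int[P]_X (D X)%:E <= (m * m)%:E)%E.
  have [N [mN PN0 hN]] := hP.1.
  apply: (@le_trans _ _ (\int[P]_(X in ~` N) (D X)%:E)%E).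
    rewrite -(setTD N) -ge0_negligible_integral//; first exact/measurable_EFinP.
    by move=> X _; rewrite lee_fin.
  apply: (@le_trans _ _ (\int[P]_X pair_sum u X)%E); last first.
    by apply: le_trans (second_moment mu u0) _; rewrite -(fineK fin) -EFinM.
  have pos X : (0 <= pair_sum u X)%E.
    apply: esum_ge0 => t _; rewrite lee_fin !mulr_ge0// prodr_ge0// => i _.
  rewrite integral_mkcond; apply: le_lower_integral => [X _|X _]; last exact: pos.
  rewrite /patch; case: ifPn => [/set_mem h|_]; last exact: pos.
  rewrite /D EFin_max ge_max pos/=; apply: (sqr_lin_stat_le r1) => //.
  by apply: contrapT => hs; apply: h; apply: hN.
have iq : (\int[P]_X ((lin_stat u X) ^+ 2)%:E <= (m * m)%:E + mean_stat (fun x => (u x ^+ 2)%R))%E.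
  apply: (@le_trans _ _ (\int[P]_X ((D X)%:E + (lin_stat (fun x => u x ^+ 2) X)%:E))%E).
    apply: le_lower_integral => X _; last first.
      by rewrite -EFinD lee_fin addr_ge0// (lin_stat_ge0 _ r1).
    rewrite -EFinD lee_fin -lerBlDr /D le_max lexx orbT//.
  rewrite ge0_integralD//.
  - by rewrite e2 leeD2r.
  - by move=> X _; rewrite lee_fin.
  - exact/measurable_EFinP.
  - by move=> X _; rewrite lee_fin (lin_stat_ge0 _ r1).
  - exact/measurable_EFinP.
(* only integrals of nonnegative functions are split, hence the cross term stands on the left *)
have key : (\int[P]_X ((lin_stat u X - m) ^+ 2)%:E + (2 * m * m)%:E = \int[P]_X ((lin_stat u X) ^+ 2)%:E + (m * m)%:E)%E.
  have -> : ((2 * m * m)%:E = \int[P]_X ((2 * m) * lin_stat u X)%:E)%E.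
    under [RHS]eq_integral do rewrite EFinM.
    rewrite ge0_integralZl//; last 3 first.
    - exact/measurable_EFinP.
    - by move=> X _; rewrite lee_fin (lin_stat_ge0 _ r1).
    - by rewrite lee_fin mulr_ge0.
    by rewrite e1 -EFinM.
  have -> : ((m * m)%:E = \int[P]_X (cst (m * m)%:E X))%E.
    have PT : P setT = 1%E by exact: probability_setT.
    rewrite integral_cst//; transitivity ((m * m)%:E * 1)%E; first by rewrite mule1.
    by congr (_ * _)%E; exact/esym/PT.
  rewrite -ge0_integralD//; last 4 first.
  - by move=> X _; rewrite lee_fin sqr_ge0.
  - by apply/measurable_EFinP; apply: measurable_funX; exact: measurable_funB.
  - by move=> X _; rewrite lee_fin mulr_ge0 ?mulr_ge0// (lin_stat_ge0 _ r1).
  - by apply/measurable_EFinP; exact: measurable_funM.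
  rewrite -ge0_integralD//; last 3 first.
  - by move=> X _; rewrite lee_fin sqr_ge0.
  - by apply/measurable_EFinP; exact: measurable_funX.
  - by move=> X _; rewrite lee_fin mulr_ge0.
  by apply: eq_integral => X _; rewrite -!EFinD; congr (_%:E); ring.
have {}key : (\int[P]_X ((lin_stat u X - m) ^+ 2)%:E + (2 * m * m)%:E <= mean_stat (fun x => (u x ^+ 2)%R) + (2 * m * m)%:E)%E.
  rewrite key; apply: le_trans (leeD2r _ iq) _.
  by rewrite addeAC -EFinD addeC (_ : m * m + m * m = 2 * m * m)//; ring.
by move: key; rewrite leeD2rE.
Qed.

End Moments.

(** * Monomial statistics: means and variances *)

Section MonomialStatistics.
Context {R : realType}.
Implicit Types (X : conf R) (z x : R[i]) (q u : R[i] -> R) (s a b : R).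
Local Notation lam := (@lebesgue_measure R \x @lebesgue_measure R)%E.

Definition annulus_weight s a b z x : R := (cabs x < 1)%R%:R *
  (((a <= poincare z x) && (poincare z x < b))%R%:R * expR (- s * poincare z x)).

Lemma annulus_weight_ge0 s a b z x : 0 <= annulus_weight s a b z x.
Proof. by rewrite !mulr_ge0// expR_ge0. Qed.

Lemma annulus_weightE s a b q z x : a <= b ->
  annulus_weight s a b z x * q x = ballw s b q z x + -1 * ballw s a q z x.
Proof.
move=> ab; rewrite /annulus_weight /ballw; have [h|h] := ltP (poincare z x) a.
  by rewrite (lt_le_trans h ab)/=; ring.
by rewrite /=; ring.
Qed.

Lemma annulus_weight_support s a b t z : 0 <= b -> cabs z <= t < 1 -> supp_in (safe_radius t b) (annulus_weight s a b z).
Proof.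
move=> b0 h x hx; rewrite /annulus_weight.
have := @ball_support _ s b (fun=> 1) t z b0 h x hx; rewrite /ballw mulr1.
have [/= _|//] := boolP (cabs x < 1); last by rewrite !mul0r.
rewrite !mul1r => /eqP; rewrite mulf_eq0 (gt_eqF (expR_gt0 _)) orbF.
by case: (_ < b); rewrite ?andbF ?mul0r// oner_eq0.
Qed.

Lemma supp_inM rho u q : supp_in rho u -> supp_in rho (fun x => u x * q x).
Proof. by move=> su x hx; rewrite su// mul0r. Qed.

(** A half-open annulus is a difference of two balls, whose statistics are
    limits of statistics of test functions. *)
Lemma lin_stat_annulus_weight_ball s a b q z X : 0 <= a <= b -> disk z ->
  lin_stat (fun x => annulus_weight s a b z x * q x) X = lin_stat (ballw s b q z) X + -1 * lin_stat (ballw s a q z) X.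
Proof.
move=> /andP[a0 ab] dz; have b0 := le_trans a0 ab.
have ht : cabs z <= cabs z < 1 by rewrite lexx.
have sb : safe_radius (cabs z) b < 1 by apply: safe_radius_lt1; rewrite ?cabs_ge0.
have sa : safe_radius (cabs z) a < 1 by apply: safe_radius_lt1; rewrite ?cabs_ge0.
have h1 := @ball_support _ s b q _ _ b0 ht.
have h2 := @ball_support _ s a q _ _ a0 ht.
have h3 x : safe_radius (cabs z) a < cabs x -> -1 * ballw s a q z x = 0 by move=> hx; rewrite h2// mulr0.
pose m := Num.max (safe_radius (cabs z) a) (safe_radius (cabs z) b).
have m1 : m < 1 by rewrite gt_max sa sb.
rewrite -(@lin_statZ _ (-1) (ballw s a q z) X m)//; last by move=> x; rewrite gt_max => /andP[hx _]; exact: h2.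
rewrite -(@lin_statD _ (ballw s b q z) (fun x => -1 * ballw s a q z x) X m)//.
- by congr (lin_stat _ X); apply/funext => x; rewrite annulus_weightE.
- by move=> x; rewrite gt_max => /andP[_ hx]; exact: h1.
- by move=> x; rewrite gt_max => /andP[hx _]; exact: h3.
Qed.

Lemma measurable_lin_stat_annulus_weight s a b q z : 0 <= a <= b -> disk z -> continuous q ->
  measurable_fun setT (fun X : Conf R => lin_stat (fun x => annulus_weight s a b z x * q x) X).
Proof.
move=> /[dup] ab0 /andP[a0 ab] dz cq; have b0 := le_trans a0 ab.
under eq_fun do rewrite (lin_stat_annulus_weight_ball _ _ _ ab0 dz).
apply: measurable_funD; first exact: measurable_lin_stat_ball.
by apply: measurable_funM => //; exact: measurable_lin_stat_ball.
Qed.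

(** The annular weight as a function of the Euclidean modulus of the Moebius
    image, which makes it radial after moving z to 0. *)
Definition profile s a b r : R :=
  ((0 <= r) && (r < rad b))%R%:R * (rad a <= r)%R%:R * expR (- s * pdist r).

Lemma measurable_itvb (f : R -> bool) (i : interval R) : (forall r, f r = (r \in i)) ->
  measurable_fun setT (fun r : measurableTypeR R => (f r)%:R : R).
Proof.
move=> fi; rewrite (_ : (fun r => _) = \1_[set` i]); last first.
  apply/funext => r; rewrite indicE fi.
  have -> // : (r \in [set` i]) = (r \in i).
  by apply/idP/idP => [/set_mem//|h]; exact/mem_set.
exact: measurable_indic.
Qed.

Lemma measurable_pdist : measurable_fun setT (@pdist R : measurableTypeR R -> measurableTypeR R).
Proof.
have h : measurable_fun setT (fun r : measurableTypeR R => (1 + r) / (1 - r) : measurableTypeR R).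
  apply: measurable_funM; first exact: measurable_funD.
  by apply: (measurableT_comp measurable_invr); exact: measurable_funB.
exact: (measurableT_comp (@measurable_ln R) h).
Qed.

Lemma measurable_profile s a b : measurable_fun setT (profile s a b).
Proof.
apply: measurable_funM; last first.
  apply: (measurableT_comp (@measurable_expR R)).
  by apply: measurable_funM => //; exact: measurable_pdist.
apply: measurable_funM.
  by apply: (@measurable_itvb _ `[0%R, rad b[) => r; rewrite in_itv.
by apply: (@measurable_itvb _ `[rad a, +oo[) => r; rewrite in_itv/= andbT.
Qed.

Lemma profile_ge0 s a b r : 0 <= profile s a b r.
Proof. by rewrite !mulr_ge0// expR_ge0. Qed.

Lemma profile_le1 s a b r : 0 <= s -> profile s a b r <= 1.
Proof.
move=> s0; rewrite /profile.
have [/andP[r0 rb]|] := boolP ((0 <= r) && (r < rad b)); last by rewrite !mul0r.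
rewrite mul1r; case: (rad a <= r); last by rewrite mul0r.
rewrite mul1r -expR0 ler_expR mulNr oppr_le0 mulr_ge0// pdist_ge0// r0/=.
exact: lt_trans rb (rad_lt1 _).
Qed.

Lemma profileE s a b z x : disk z -> annulus_weight s a b z x * hypdens x = profile s a b (cabs (mobius z x)) * hypdens x.
Proof.
move=> dz; rewrite /annulus_weight /hypdens; have [dx|] := boolP (cabs x < 1); last by rewrite !mul0r mulr0.
rewrite !mul1r; congr (_ * _); rewrite /profile poincareE.
have h := mobius_itv dz dx.
rewrite pdist_lt// leNgt pdist_lt// -leNgt cabs_ge0/=.
by case: (_ < rad b); case: (rad a <= _); rewrite /= ?(mul1r,mul0r).
Qed.

Lemma cmeasurable_annulus_weight s a b z : cmeasurable (EFin \o annulus_weight s a b z).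
Proof.
apply/measurable_EFinP.
have h : measurable_fun setT (fun p : plane R => poincare z (to_complex p)).
  by apply: (measurableT_comp measurable_pdist); exact: (cmap_cabs (cmap_mobius z)).
apply: measurable_funM; first exact: measurable_cabs_lt.
apply: measurable_funM.
  have := measurableT_comp (@measurable_itvb (fun r => (a <= r) && (r < b)) `[a, b[ (fun r => _)) h.
  by apply => r; rewrite in_itv.
by apply: (measurableT_comp (@measurable_expR R)); exact: measurable_funM.
Qed.

Definition mean_statr u : R := fine (mean_stat u).

Definition hyp_integrable u := cintegrable (fun x => (u x * hypdens x)%:E).

Lemma mean_statr_rint u : hyp_integrable u -> mean_statr u = pi^-1 * rint (fun x => u x * hypdens x).
Proof.
by move=> iu; rewrite /mean_statr /mean_stat fineM//; exact: integrable_fin_num iu.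
Qed.

Lemma mean_stat_fin u : hyp_integrable u -> mean_stat u \is a fin_num.
Proof. by move=> iu; rewrite /mean_stat fin_numM//; exact: integrable_fin_num iu. Qed.

(** The mean value property ([mean_value]) in terms of statistics: the mean of
    w(x) x^n is z^n times the mean of w. *)
Lemma annulus_weight_mean s a b z (c : R[i]) n : 0 <= s -> 0 <= b -> disk z ->
  [/\ hyp_integrable (annulus_weight s a b z),
      hyp_integrable (fun x => annulus_weight s a b z x * complex.Re (c * x ^+ n)) &
      mean_statr (fun x => annulus_weight s a b z x * complex.Re (c * x ^+ n)) =
      complex.Re (c * z ^+ n) * mean_statr (annulus_weight s a b z)].
Proof.
move=> s0 b0 dz.
have pz r : rad b <= r -> profile s a b r = 0.
  by move=> h; rewrite /profile ltNge h andbF !mul0r.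
have [i1 i2 e] := mean_value c n (rad_lt1 b) dz (measurable_profile s a b)
  (profile_ge0 s a b) (fun r => profile_le1 a b r s0) pz.
have e1 : (fun x => annulus_weight s a b z x * hypdens x) = (fun x => profile s a b (cabs (mobius z x)) * hypdens x).
  by apply/funext => x; exact: profileE.
have e2 : (fun x => annulus_weight s a b z x * complex.Re (c * x ^+ n) * hypdens x) = (fun x => profile s a b (cabs (mobius z x)) * hypdens x * complex.Re (c * x ^+ n)).
  by apply/funext => x; rewrite -profileE// mulrAC.
have j1 : hyp_integrable (annulus_weight s a b z).
  by rewrite /hyp_integrable (_ : (fun x => _) = EFin \o (fun x => annulus_weight s a b z x * hypdens x))// e1.
have j2 : hyp_integrable (fun x => annulus_weight s a b z x * complex.Re (c * x ^+ n)).
  by rewrite /hyp_integrable (_ : (fun x => _) = EFin \o (fun x => annulus_weight s a b z x * complex.Re (c * x ^+ n) * hypdens x))// e2.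
by split => //; rewrite !mean_statr_rint// e1 e2 e mulrCA.
Qed.


Lemma continuous_monomial (c : R[i]) n : continuous (fun x : R[i] => complex.Re (c * x ^+ n)).
Proof.
move=> x; have FF := nbhs_filter x.
have h1 : (fun=> c) @ nbhs x --> c by exact: cvg_cst.
have h2 : id @ nbhs x --> x by exact: cvg_id.
have h3 := cvgcX (n := n) FF h2.
have h4 := cvgcM FF h1 h3.
have h5 := cvg_Re FF h4.
exact: h5.
Qed.

(** Variance bounds are available for nonnegative functions only, so real
    functions are split into their positive and negative parts. *)
Definition posp q x : R := Num.max 0 (q x).
Definition negp q x : R := Num.max 0 (- q x).

Lemma posnegE q x : q x = posp q x - negp q x.
Proof.
rewrite /posp /negp; have [h|h] := leP 0 (q x); have [h2|h2] := leP 0 (- q x); lra.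
Qed.

Lemma posneg2E q x : q x ^+ 2 = posp q x ^+ 2 + negp q x ^+ 2.
Proof.
rewrite /posp /negp; have [h|h] := leP 0 (q x); have [h2|h2] := leP 0 (- q x); nra.
Qed.

Lemma posp_ge0 q x : 0 <= posp q x. Proof. by rewrite le_max lexx. Qed.
Lemma negp_ge0 q x : 0 <= negp q x. Proof. by rewrite le_max lexx. Qed.

Lemma continuous_posp q : continuous q -> continuous (posp q).
Proof.
move=> cq x; have FF := nbhs_filter x.
have h1 : (fun=> (0 : R)) @ nbhs x --> (0 : R) by exact: cvg_cst.
exact: (cvgr_max FF h1 (cq x)).
Qed.

Lemma continuous_negp q : continuous q -> continuous (negp q).
Proof.
move=> cq x; have FF := nbhs_filter x.
have h1 : (fun=> (0 : R)) @ nbhs x --> (0 : R) by exact: cvg_cst.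
exact: (cvgr_max FF h1 (cvgN (cq x))).
Qed.

Lemma cmeasurable_posp q : cmeasurable (EFin \o q) -> cmeasurable (EFin \o posp q).
Proof.
by move=> /measurable_EFinP mq; apply/measurable_EFinP; exact: measurable_maxr.
Qed.

Lemma cmeasurable_negp q : cmeasurable (EFin \o q) -> cmeasurable (EFin \o negp q).
Proof.
by move=> /measurable_EFinP mq; apply/measurable_EFinP; apply: measurable_maxr => //; exact: measurable_funN.
Qed.

Lemma mean_stat_D u q : cmeasurable (EFin \o u) -> cmeasurable (EFin \o q) ->
  (forall x, 0 <= u x) -> (forall x, 0 <= q x) ->
  mean_stat (fun x => u x + q x) = (mean_stat u + mean_stat q)%E.
Proof.
move=> /measurable_EFinP mu /measurable_EFinP mq u0 q0.
have mh := @measurable_hypdens R.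
rewrite /mean_stat -ge0_muleDr.
- congr (_ * _)%E; rewrite /cint -ge0_integralD//.
  + by apply: eq_integral => p _; rewrite -EFinD mulrDl.
  + by move=> p _; rewrite lee_fin mulr_ge0 ?hypdens_ge0.
  + by apply/measurable_EFinP; exact: measurable_funM.
  + by move=> p _; rewrite lee_fin mulr_ge0 ?hypdens_ge0.
  + by apply/measurable_EFinP; exact: measurable_funM.
- by apply: integral_ge0 => p _; rewrite lee_fin mulr_ge0 ?hypdens_ge0.
- by apply: integral_ge0 => p _; rewrite lee_fin mulr_ge0 ?hypdens_ge0.
Qed.

Lemma annulus_weight_sq s a b z x : annulus_weight s a b z x ^+ 2 = annulus_weight (2 * s) a b z x.
Proof.
rewrite /annulus_weight !exprMn -expRM_natl -!natrX.
have -> : 2%:R * (- s * poincare z x) = - (2 * s) * poincare z x by ring.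
by case: (cabs x < 1); case: (_ && _).
Qed.

Variable P : probability (Conf R) R.
Hypothesis hP : determinantal_process P bergman_kernel.

(** The factor 2 is the price for treating the positive and negative parts
    separately. *)
Lemma variance_shell s a b z (c : R[i]) n : 0 <= s -> 0 <= a <= b -> disk z ->
  (\int[P]_X ((lin_stat (fun x => annulus_weight s a b z x * complex.Re (c * x ^+ n)) X - complex.Re (c * z ^+ n) * mean_statr (annulus_weight s a b z)) ^+ 2)%:E
    <= 2%:E * mean_stat (fun x => (annulus_weight s a b z x * complex.Re (c * x ^+ n)) ^+ 2)%R)%E.
Proof.
move=> s0 /[dup] hab /andP[a0 ab] dz; have b0 := le_trans a0 ab.
pose q x := complex.Re (c * x ^+ n).
have ht : cabs z <= cabs z < 1 by rewrite lexx.
have sb : safe_radius (cabs z) b < 1 by apply: safe_radius_lt1; rewrite ?cabs_ge0.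
have [i1 i2 e] := annulus_weight_mean a c n s0 b0 dz.
have cq : continuous q by exact: continuous_monomial.
have mq : cmeasurable (EFin \o q).
  by apply: cmap_Re; apply: cmapM; [exact: cmap_cst|exact: (cmapX _ cmap_id)].
pose w := annulus_weight s a b z.
have w0 x : 0 <= w x by exact: annulus_weight_ge0.
have mw : cmeasurable (EFin \o w) by exact: cmeasurable_annulus_weight.
have sw : supp_in (safe_radius (cabs z) b) w by exact: annulus_weight_support.
(* the weight is nonnegative, so only the sign of q matters *)
pose up x := w x * posp q x; pose un x := w x * negp q x.
have up0 x : 0 <= up x by rewrite mulr_ge0// posp_ge0.
have un0 x : 0 <= un x by rewrite mulr_ge0// negp_ge0.
have cmM u v : cmeasurable (EFin \o u) -> cmeasurable (EFin \o v) -> cmeasurable (EFin \o (fun x => u x * v x)).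
  by move=> /measurable_EFinP h1 /measurable_EFinP h2; apply/measurable_EFinP; exact: measurable_funM.
have mup : cmeasurable (EFin \o up) by apply: cmM => //; exact: cmeasurable_posp.
have mun : cmeasurable (EFin \o un) by apply: cmM => //; exact: cmeasurable_negp.
have sup : supp_in (safe_radius (cabs z) b) up by exact: supp_inM.
have sun : supp_in (safe_radius (cabs z) b) un by exact: supp_inM.
have dom u : cmeasurable (EFin \o u) -> (forall x, 0 <= u x <= w x * `|q x|) -> hyp_integrable u.
  move=> mu hu.
  apply: (@le_integrable _ _ _ lam setT measurableT _ (fun p => ((w (to_complex p) * q (to_complex p)) * hypdens (to_complex p))%:E)) => //.
    by apply: cmM => //; apply/measurable_EFinP; exact: measurable_hypdens.
  move=> p _ /=; have /andP[h1 h2] := hu (to_complex p).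
  rewrite lee_fin normrM [leRHS]normrM ler_wpM2r// (ger0_norm h1) normrM.
  by rewrite (ger0_norm (w0 (to_complex p))).
have posn x : posp q x <= `|q x| by rewrite /posp ge_max normr_ge0 ler_norm.
have negn x : negp q x <= `|q x| by rewrite /negp ge_max normr_ge0 -normrN ler_norm.
have iup : hyp_integrable up by apply: dom => // x; rewrite up0 ler_wpM2l.
have iun : hyp_integrable un by apply: dom => // x; rewrite un0 ler_wpM2l.
have qE x : w x * q x = up x - un x by rewrite (posnegE q) mulrBr.
have mean_statrE : complex.Re (c * z ^+ n) * mean_statr w = mean_statr up - mean_statr un.
  rewrite -e !mean_statr_rint// -mulrBr; congr (_ * _).
  have iun' : cintegrable (EFin \o (fun x => -1 * (un x * hypdens x))).
    by rewrite /cintegrable /=; under eq_fun do rewrite EFinM; exact: integrableZl.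
  rewrite -mulN1r -rintZ// -rintD//.
  by congr rint; apply/funext => x; rewrite qE; ring.
have msq v : continuous v -> measurable_fun setT (fun X : Conf R => lin_stat (fun x => (w x * v x) ^+ 2) X).
  move=> cv; rewrite (_ : (fun X : Conf R => _) = (fun X : Conf R => lin_stat (fun x => annulus_weight (2 * s) a b z x * v x ^+ 2) X)); last first.
    by apply/funext => X; congr (lin_stat _ X); apply/funext => x; rewrite exprMn annulus_weight_sq.
  apply: measurable_lin_stat_annulus_weight => // x.
  have FF := nbhs_filter x.
  exact: (cvgM (cv x) (cv x)).
have mL v : continuous v -> measurable_fun setT (fun X : Conf R => lin_stat (fun x => w x * v x) X).
  by move=> cv; apply: measurable_lin_stat_annulus_weight.
have cp := continuous_posp cq; have cn := continuous_negp cq.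
have vp : (\int[P]_X ((lin_stat up X - mean_statr up) ^+ 2)%:E <= mean_stat (fun x => (up x ^+ 2)%R))%E.
  by apply: (variance_nonneg hP sb) => //; [exact: mL|exact: msq|exact: mean_stat_fin].
have vn : (\int[P]_X ((lin_stat un X - mean_statr un) ^+ 2)%:E <= mean_stat (fun x => (un x ^+ 2)%R))%E.
  by apply: (variance_nonneg hP sb) => //; [exact: mL|exact: msq|exact: mean_stat_fin].
apply: (@le_trans _ _ (\int[P]_X (2%:E * (((lin_stat up X - mean_statr up) ^+ 2)%:E + ((lin_stat un X - mean_statr un) ^+ 2)%:E)))%E).
  apply: le_lower_integral => X _; last by rewrite -EFinD -EFinM lee_fin mulr_ge0// addr_ge0// sqr_ge0.
  rewrite -/w -/q mean_statrE.
  have -> : lin_stat (fun x => w x * q x) X = lin_stat up X - lin_stat un X.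
    rewrite -mulN1r -(lin_statZ _ _ sb sun) -(lin_statD _ sb sup); last by move=> x hx; rewrite sun// mulr0.
    by congr (lin_stat _ X); apply/funext => x; rewrite qE mulN1r.
  rewrite -EFinD -EFinM lee_fin.
  set A := lin_stat up X; set B := lin_stat un X; set A' := mean_statr up; set B' := mean_statr un.
  by have := sqr_ge0 ((A - A') + (B - B')); nra.
have m1 : measurable_fun setT (fun X : Conf R => ((lin_stat up X - mean_statr up) ^+ 2)%:E).
  by apply/measurable_EFinP; apply: measurable_funX; apply: measurable_funB => //; exact: mL.
have m2 : measurable_fun setT (fun X : Conf R => ((lin_stat un X - mean_statr un) ^+ 2)%:E).
  by apply/measurable_EFinP; apply: measurable_funX; apply: measurable_funB => //; exact: mL.
rewrite ge0_integralZl//; last 2 first.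
- exact: emeasurable_funD.
- by move=> X _; rewrite -EFinD lee_fin addr_ge0 ?sqr_ge0.
rewrite lee_wpmul2l// ge0_integralD//; last 2 first.
- by move=> X _; rewrite lee_fin sqr_ge0.
- by move=> X _; rewrite lee_fin sqr_ge0.
apply: le_trans (leeD vp vn) _.
have cm2 v : cmeasurable (EFin \o v) -> cmeasurable (EFin \o (fun x => v x ^+ 2)).
  by move=> /measurable_EFinP h; apply/measurable_EFinP; exact: measurable_funX.
rewrite -mean_stat_D//; last 4 first.
- exact: cm2.
- exact: cm2.
- by move=> x; exact: sqr_ge0.
- by move=> x; exact: sqr_ge0.
rewrite le_eqVlt; apply/orP; left; apply/eqP; congr mean_stat; apply/funext => x.
by rewrite !exprMn -mulrDr -posneg2E.
Qed.

(** The squared modulus of S(x^n) - z^n E S(1), by real and imaginary parts. *)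
Definition monomial_dev2 s a b z n X : R :=
  (lin_stat (fun x => annulus_weight s a b z x * complex.Re (x ^+ n)) X - complex.Re (z ^+ n) * mean_statr (annulus_weight s a b z)) ^+ 2 +
  (lin_stat (fun x => annulus_weight s a b z x * complex.Im (x ^+ n)) X - complex.Im (z ^+ n) * mean_statr (annulus_weight s a b z)) ^+ 2.

Lemma ImE_Re (w : R[i]) : complex.Im w = complex.Re (Complex 0 (-1) * w).
Proof. by case: w => x y /=; ring. Qed.

Lemma monomial_dev2_ge0 s a b z n X : 0 <= monomial_dev2 s a b z n X.
Proof. by rewrite addr_ge0 ?sqr_ge0. Qed.

Lemma measurable_monomial_dev2 s a b z n : 0 <= a <= b -> disk z ->
  measurable_fun setT (fun X : Conf R => monomial_dev2 s a b z n X).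
Proof.
move=> hab dz.
have h c : measurable_fun setT (fun X : Conf R => lin_stat (fun x => annulus_weight s a b z x * complex.Re (c * x ^+ n)) X).
  by apply: measurable_lin_stat_annulus_weight => //; exact: continuous_monomial.
apply: measurable_funD; apply: measurable_funX; apply: measurable_funB => //.
- rewrite (_ : (fun x => _ * _) = (fun x => annulus_weight s a b z x * complex.Re (1 * x ^+ n))); first exact: h.
  by apply/funext => x; rewrite mul1r.
- rewrite (_ : (fun x => _ * _) = (fun x => annulus_weight s a b z x * complex.Re (Complex 0 (-1) * x ^+ n))); first exact: h.
  by apply/funext => x; rewrite -ImE_Re.
Qed.

(** Apply [variance_shell] to the real and imaginary parts; the two bounds add
    up to |x^n|^2. *)
Lemma mean_monomial_dev2 s a b z n : 0 <= s -> 0 <= a <= b -> disk z ->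
  (\int[P]_X (monomial_dev2 s a b z n X)%:E <=
   2%:E * mean_stat (fun x => (annulus_weight s a b z x ^+ 2 * cabs x ^+ (2 * n))%R))%E.
Proof.
move=> s0 hab dz.
have h c : measurable_fun setT (fun X : Conf R => lin_stat (fun x => annulus_weight s a b z x * complex.Re (c * x ^+ n)) X).
  by apply: measurable_lin_stat_annulus_weight => //; exact: continuous_monomial.
pose T c X := (lin_stat (fun x => annulus_weight s a b z x * complex.Re (c * x ^+ n)) X - complex.Re (c * z ^+ n) * mean_statr (annulus_weight s a b z)) ^+ 2.
have TE X : monomial_dev2 s a b z n X = T 1 X + T (Complex 0 (-1)) X.
  rewrite /monomial_dev2 /T; congr (_ ^+ 2 + _ ^+ 2).
    by congr (lin_stat _ X - complex.Re _ * _); [apply/funext => x|]; rewrite mul1r.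
  rewrite -ImE_Re; congr (lin_stat _ X - _).
  by apply/funext => x; rewrite -ImE_Re.
under eq_integral do rewrite TE EFinD.
have mT c : measurable_fun setT (fun X : Conf R => (T c X)%:E).
  by apply/measurable_EFinP; apply: measurable_funX; exact: measurable_funB.
rewrite ge0_integralD//; last 2 first.
- by move=> X _; rewrite lee_fin sqr_ge0.
- by move=> X _; rewrite lee_fin sqr_ge0.
apply: le_trans (leeD (variance_shell 1 n s0 hab dz) (variance_shell (Complex 0 (-1)) n s0 hab dz)) _.
have cm c : cmeasurable (EFin \o (fun x => (annulus_weight s a b z x * complex.Re (c * x ^+ n)) ^+ 2)).
  apply/measurable_EFinP; apply: measurable_funX; apply: measurable_funM.
    by apply/measurable_EFinP; exact: cmeasurable_annulus_weight.
  by have [] : cmap (fun x => c * x ^+ n) by apply: cmapM; [exact: cmap_cst|exact: (cmapX _ cmap_id)].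
rewrite -ge0_muleDr ?mean_stat_ge0//; try by move=> x; exact: sqr_ge0.
rewrite lee_wpmul2l// -mean_stat_D//; try by move=> x; exact: sqr_ge0.
rewrite le_eqVlt; apply/orP; left; apply/eqP; congr mean_stat; apply/funext => x.
rewrite mul1r -ImE_Re !exprMn -mulrDr -cabs2E cabsX -exprM mulnC.
by [].
Qed.

End MonomialStatistics.

(** * Complex integrals over a segment *)

Section SegmentIntegral.
Context {R : realType}.
Implicit Types (a b : R) (h g : R -> R[i]).
Local Notation leb := (@lebesgue_measure R).

(** Continuity at every point of [a,b] as a function on the whole line, so
    that restrictions to subsegments are immediate. *)
Definition ccont a b h := forall x, a <= x <= b -> h y @[y --> x] --> h x.

Definition seg_int a b (u : R -> R) : R := \int[leb]_(x in `[a, b]) u x.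

Definition seg_cint a b h : R[i] :=
  Complex (seg_int a b (fun x => complex.Re (h x))) (seg_int a b (fun x => complex.Im (h x))).

Definition rcont a b (u : R -> R) := forall x, a <= x <= b -> u y @[y --> x] --> u x.

Lemma rcont_int a b u : rcont a b u -> leb.-integrable `[a, b] (EFin \o u).
Proof.
move=> cu; apply: continuous_compact_integrable; first exact: segment_compact.
apply: continuous_in_subspaceT => x /set_mem/=; rewrite in_itv/=; exact: cu.
Qed.

Lemma ccont_Re a b h : ccont a b h -> rcont a b (fun x => complex.Re (h x)).
Proof. by move=> ch x /ch; exact: cvg_Re. Qed.

Lemma ccont_Im a b h : ccont a b h -> rcont a b (fun x => complex.Im (h x)).
Proof. by move=> ch x /ch; exact: cvg_Im. Qed.

Lemma eq_seg_int a b u v : (forall x, a <= x <= b -> u x = v x) -> seg_int a b u = seg_int a b v.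
Proof.
move=> uv; apply: eq_Rintegral => x /set_mem/=; rewrite in_itv/=; exact: uv.
Qed.

Lemma eq_seg_cint a b h g : (forall x, a <= x <= b -> h x = g x) -> seg_cint a b h = seg_cint a b g.
Proof. by move=> hg; congr Complex; apply: eq_seg_int => x /hg ->. Qed.

Lemma seg_intD a b u v : rcont a b u -> rcont a b v ->
  seg_int a b (fun x => u x + v x) = seg_int a b u + seg_int a b v.
Proof. by move=> /rcont_int ? /rcont_int ?; exact: RintegralD. Qed.

Lemma seg_intZ a b k u : rcont a b u -> seg_int a b (fun x => k * u x) = k * seg_int a b u.
Proof. by move=> /rcont_int ?; exact: RintegralZl. Qed.

Lemma rcontZ a b k u : rcont a b u -> rcont a b (fun x => k * u x).
Proof. by move=> cu x xab; exact: (cvgM (cvg_cst k) (cu _ xab)). Qed.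

Lemma seg_cintD a b h g : ccont a b h -> ccont a b g ->
  seg_cint a b (fun x => h x + g x) = seg_cint a b h + seg_cint a b g.
Proof.
move=> ch cg; rewrite /seg_cint; apply/eqP; rewrite eq_complex/=; apply/andP; split; apply/eqP.
  rewrite -seg_intD; [|exact: ccont_Re|exact: ccont_Re].
  by apply: eq_seg_int => x _; case: (h x) (g x) => ? ? [].
rewrite -seg_intD; [|exact: ccont_Im|exact: ccont_Im].
by apply: eq_seg_int => x _; case: (h x) (g x) => ? ? [].
Qed.

Lemma seg_cintZ a b k h : ccont a b h -> seg_cint a b (fun x => k * h x) = k * seg_cint a b h.
Proof.
move=> ch; case: k => k l; rewrite /seg_cint.
have cR := ccont_Re ch; have cM := ccont_Im ch.
apply/eqP; rewrite eq_complex/=; apply/andP; split; apply/eqP.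
  rewrite -mulNr -!seg_intZ// -seg_intD; [|exact: rcontZ|exact: rcontZ].
  by apply: eq_seg_int => x _; case: (h x) => u v /=; rewrite mulNr.
rewrite -!seg_intZ// -seg_intD; [|exact: rcontZ|exact: rcontZ].
by apply: eq_seg_int => x _; case: (h x) => u v /=.
Qed.

Lemma ccontM a b h g : ccont a b h -> ccont a b g -> ccont a b (fun x => h x * g x).
Proof.
by move=> ch cg x xab; have FF := nbhs_filter x; exact: (cvgcM FF (ch _ xab) (cg _ xab)).
Qed.

Lemma ccont_cst a b k : ccont a b (fun=> k).
Proof. by move=> x _; exact: cvg_cst. Qed.

Lemma ccontZ a b k h : ccont a b h -> ccont a b (fun x => k * h x).
Proof. by move=> ch; exact: (ccontM (@ccont_cst a b k) ch). Qed.

Lemma ccontB a b h g : ccont a b h -> ccont a b g -> ccont a b (fun x => h x - g x).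
Proof. move=> ch cg x xab; exact: (cvgB (ch _ xab) (cg _ xab)). Qed.

Lemma ccontJ a b h : ccont a b h -> ccont a b (fun x => conjc (h x)).
Proof. by move=> ch x xab; have FF := nbhs_filter x; exact: (cvg_conjc FF (ch _ xab)). Qed.

Lemma seg_cintB a b h g : ccont a b h -> ccont a b g ->
  seg_cint a b (fun x => h x - g x) = seg_cint a b h - seg_cint a b g.
Proof.
move=> ch cg; rewrite (_ : (fun x => _) = (fun x => h x + (-1) * g x)); last first.
  by apply/funext => x; rewrite mulN1r.
by rewrite (seg_cintD ch (@ccontZ a b (-1) g cg)) (seg_cintZ _ cg) mulN1r.
Qed.

Lemma seg_cintJ a b h : ccont a b h -> seg_cint a b (fun x => conjc (h x)) = conjc (seg_cint a b h).
Proof.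
move=> ch; rewrite /seg_cint /=; congr Complex.
  by apply: eq_seg_int => x _; case: (h x).
rewrite -mulN1r -seg_intZ; last exact: ccont_Im.
by apply: eq_seg_int => x _; rewrite mulN1r; case: (h x).
Qed.

Lemma seg_int_cst a b (k : R) : a <= b -> seg_int a b (fun=> k) = k * (b - a).
Proof.
move=> ab; rewrite /seg_int Rintegral_cst//; congr (_ * _).
have := lebesgue_measure_itv `[a, b]; rewrite /= lte_fin => h.
apply: (etrans (congr1 fine h)); by case: ltgtP ab => // e _; rewrite ?e ?subrr.
Qed.

Lemma seg_cint_cst a b (k : R[i]) : a <= b -> seg_cint a b (fun=> k) = k * (real_complex R (b - a)).
Proof.
move=> ab; rewrite /seg_cint !seg_int_cst//; case: k => x y.
by apply/eqP; rewrite eq_complex/= !mulr0 subr0 add0r !eqxx.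
Qed.

Lemma seg_int_split a m b u : a <= m -> m <= b -> rcont a b u ->
  seg_int a b u = seg_int a m u + seg_int m b u.
Proof.
move=> am mb cu; rewrite /seg_int.
have iu := rcont_int cu.
have := @Rintegral_itvB R u (BLeft a) (BRight b) m iu.
rewrite !bnd_simp => /(_ am mb) /eqP; rewrite subr_eq addrC => /eqP ->.
congr (_ + _); rewrite Rintegral_itv_obnd_cbnd//.
by apply: integrableS iu => //; apply: subset_itvr; rewrite bnd_simp.
Qed.

Lemma seg_cint_split a m b h : a <= m -> m <= b -> ccont a b h ->
  seg_cint a b h = seg_cint a m h + seg_cint m b h.
Proof.
move=> am mb ch; rewrite /seg_cint (seg_int_split am mb (ccont_Re ch)) (seg_int_split am mb (ccont_Im ch)).
by apply/eqP; rewrite eq_complex/= !eqxx.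
Qed.

Lemma seg_int_bound a b u M : a <= b -> rcont a b u -> (forall x, a <= x <= b -> `|u x| <= M) ->
  `|seg_int a b u| <= M * (b - a).
Proof.
move=> ab cu uM; rewrite -seg_int_cst//.
apply: (le_trans (le_normr_Rintegral _ (rcont_int cu))) => //.
have i1 : leb.-integrable `[a, b] (EFin \o (fun x => `|u x|)).
  by apply: rcont_int => x xab; exact: (cvg_norm (cu _ xab)).
have i2 : leb.-integrable `[a, b] (EFin \o (fun=> M)).
  by apply: rcont_int => x xab; exact: cvg_cst.
by apply: (le_Rintegral _ i1 i2) => // x /=; rewrite in_itv/=; exact: uM.
Qed.

Lemma seg_cint_bound a b h M : a <= b -> ccont a b h ->
  (forall x, a <= x <= b -> cabs (h x) <= M) -> cabs (seg_cint a b h) <= M * (b - a) *+ 2.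
Proof.
move=> ab ch hM; apply: (le_trans (cabs_le_ReIm _)); rewrite mulr2n lerD//=.
  apply: (seg_int_bound ab (ccont_Re ch)) => x /hM; apply: le_trans; exact: ler_Re_cabs.
apply: (seg_int_bound ab (ccont_Im ch)) => x /hM; apply: le_trans; exact: ler_Im_cabs.
Qed.

Lemma seg_cint_Re_ge0 a b h : (forall x, 0 <= complex.Re (h x)) -> 0 <= complex.Re (seg_cint a b h).
Proof. by move=> h0 /=; apply: Rintegral_ge0. Qed.

End SegmentIntegral.

(** * Complex differentiability through slopes *)

Section ComplexDerivative.
Context {R : realType}.
Implicit Types (p w z : R[i]) (f g G : R[i] -> R[i]).

Lemma near_cabs p (P : R[i] -> Prop) :
  (\forall w \near p, P w) <-> exists2 d : R, 0 < d & forall w, cabs (w - p) < d -> P w.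
Proof.
have FF := nbhs_filter p; split.
  move=> /nbhs_ballP[e /= e0 h].
  have ee : e = real_complex R (complex.Re e).
    by case: e e0 {h} => a b; rewrite ltcE/= => /andP[/eqP -> _].
  exists (complex.Re e); first by rewrite -(@ltcR R) -ee.
  by move=> w wp; apply: h; rewrite -ball_normE/= ee normcC ltcR cabs_distC.
move=> [d d0 h]; have /(@cvgcP R _ _ FF)/cvgrPdist_lt : w @[w --> p] --> p by exact: cvg_id.
move=> /(_ d d0); apply: filterS => w; rewrite sub0r normrN ger0_norm ?cabs_ge0//.
exact: h.
Qed.

(** Caratheodory's form of differentiability: G w = G p + Q w (w - p) with Q
    continuous at p. It makes the product and chain rules algebraic. *)
Definition cdiff G p := exists2 Q : R[i] -> R[i],
  Q w @[w --> p] --> Q p & forall w, G w = G p + Q w * (w - p).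

Lemma cdiff_near G p (Q : R[i] -> R[i]) : Q w @[w --> p] --> Q p ->
  (\forall w \near p, G w = G p + Q w * (w - p)) -> cdiff G p.
Proof.
move=> cQ nQ; have FF := nbhs_filter p.
exists (fun w => if w == p then Q p else (G w - G p) / (w - p)).
  rewrite eqxx; apply: cvg_trans cQ; apply: near_eq_cvg.
  apply: filterS nQ => w ->; case: eqVneq => [->//|wp].
  by rewrite addrAC subrr add0r mulfK// subr_eq0.
move=> w; case: eqVneq => [->|wp]; first by rewrite subrr mulr0 addr0.
by rewrite divfK ?subr_eq0// addrC subrK.
Qed.

Lemma cdiff_continuous G p : cdiff G p -> G w @[w --> p] --> G p.
Proof.
move=> [Q cQ GQ]; have FF := nbhs_filter p.
have : (G p + Q w * (w - p)) @[w --> p] --> G p + Q p * (p - p).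
  apply: (cvgcD FF (cvg_cst _)); apply: (cvgcM FF cQ).
  exact: (cvgcB FF (@cvg_id _ _) (cvg_cst _)).
rewrite subrr mulr0 addr0; apply: cvg_trans; apply: near_eq_cvg.
by apply: nearW => w; rewrite -GQ.
Qed.

Lemma cdiff_cst (k : R[i]) p : cdiff (fun=> k) p.
Proof.
have FF := nbhs_filter p; exists (fun=> 0); first exact: cvg_cst.
by move=> w; rewrite mul0r addr0.
Qed.

Lemma cdiff_id p : cdiff id p.
Proof.
have FF := nbhs_filter p; exists (fun=> 1); first exact: cvg_cst.
by move=> w; rewrite mul1r addrC subrK.
Qed.

Lemma cdiffM f g p : cdiff f p -> cdiff g p -> cdiff (fun w => f w * g w) p.
Proof.
move=> cf cg; have cgp := cdiff_continuous cg; move: cf cg => [Q cQ fQ] [S cS gS].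
have FF := nbhs_filter p.
exists (fun w => Q w * g w + f p * S w).
  by apply: (cvgcD FF); [exact: (cvgcM FF cQ cgp)|exact: (cvgcM FF (cvg_cst _) cS)].
move=> w; rewrite mulrDl addrCA -[X in _ + (_ + X)]mulrA.
rewrite [in RHS](_ : _ * (w - p) = g w * (Q w * (w - p))); last by ring.
by rewrite -(mulrDr (f p)) -gS (fQ w); ring.
Qed.

Lemma cdiffD f g p : cdiff f p -> cdiff g p -> cdiff (fun w => f w + g w) p.
Proof.
move=> [Q cQ fQ] [S cS gS]; have FF := nbhs_filter p.
exists (fun w => Q w + S w); first exact: (cvgcD FF cQ cS).
by move=> w; rewrite fQ gS; ring.
Qed.

Lemma cdiffX f p n : cdiff f p -> cdiff (fun w => f w ^+ n) p.
Proof.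
move=> cf; elim: n => [|n ih].
  by rewrite (_ : (fun w => _) = fun=> 1); [exact: cdiff_cst|apply/funext => w; rewrite expr0].
rewrite (_ : (fun w => _) = (fun w => f w * f w ^+ n)); first exact: cdiffM.
by apply/funext => w; rewrite exprS.
Qed.

Lemma cdiff_comp f g p : cdiff g p -> cdiff f (g p) -> cdiff (fun w => f (g w)) p.
Proof.
move=> cg; have cgp := cdiff_continuous cg; move: cg => [S cS gS] [Q cQ fQ].
have FF := nbhs_filter p.
exists (fun w => Q (g w) * S w).
  by apply: (cvgcM FF _ cS); exact: (cvg_comp _ _ cgp cQ).
by move=> w; rewrite fQ [in X in _ * X](gS w); ring.
Qed.

Lemma cdiff_inv p : p != 0 -> cdiff (fun w => w^-1) p.
Proof.
move=> p0; have FF := nbhs_filter p.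
apply: (@cdiff_near _ _ (fun w => - (w^-1 * p^-1))).
  have h := cvgcV FF p0 (@cvg_id _ (nbhs p)).
  exact: (cvgN (cvgcM FF h (cvg_cst _))).
apply/near_cabs; exists (cabs p); first by rewrite lt_neqAle cabs_ge0 andbT eq_sym cabs_neq0.
move=> w; have [->|w0 _] := eqVneq w 0; first by rewrite sub0r cabsN ltxx.
by field; rewrite w0 p0.
Qed.

Lemma cdiff_approx G p : cdiff G p -> exists l, forall e : R, 0 < e ->
  exists2 d : R, 0 < d & forall w, cabs (w - p) < d ->
    cabs (G w - (G p + l * (w - p))) <= e * cabs (w - p).
Proof.
move=> [Q cQ GQ]; exists (Q p) => e e0; have FF := nbhs_filter p.
move/(@cvgcP R _ _ FF)/cvgrPdist_lt : cQ => /(_ e e0)/near_cabs[d d0 h].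
exists d => // w /h; rewrite sub0r normrN ger0_norm ?cabs_ge0// => h1.
rewrite GQ (_ : _ - _ = (Q w - Q p) * (w - p)); last by ring.
by rewrite cabsM ler_wpM2r ?cabs_ge0// ltW.
Qed.

Lemma derivable_cdiff f z : derivable f z 1 -> cdiff f z.
Proof.
move=> /cvg_ex[l dl]; have FF := nbhs_filter z.
apply: (@cdiff_near _ _ (fun w => if w == z then l else (f w - f z) / (w - z))); last first.
  apply: (@filterE _ _ FF) => w; case: eqVneq => [->|wp]; first by rewrite subrr mulr0 addr0.
  by rewrite divfK ?subr_eq0// addrC subrK.
rewrite eqxx; apply/(@cvgcP R _ _ FF)/cvgrPdist_lt => e e0.
have FD : ProperFilter (0 : R[i])^'.
  exact: Proper_dnbhs_numFieldType.
move/(@cvgcP R _ _ _)/cvgrPdist_lt : dl => /(_ e e0).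
rewrite near_withinE => /near_cabs[d d0 h].
apply/near_cabs; exists d => // w wz; case: eqVneq => [_|wz0].
  by rewrite subrr cabs0 subrr normr0.
have := h (w - z); rewrite subr0 => /(_ wz); rewrite subr_eq0 => /(_ wz0).
rewrite [(f \o shift z) _](_ : _ = f w); last first.
  by rewrite /= -[_ *: _]/(_ * _) mulr1 subrK.
by rewrite -[_ *: _]/(_ * _) mulrC.
Qed.

End ComplexDerivative.

(** * The complex exponential *)

Section ComplexExponential.
Context {R : realType}.
Implicit Types (p w z : R[i]).

(** The real counterpart of [cdiff] at 0, from which the exponential is
    differentiated coordinatewise. *)
Lemma real_slope (u : R -> R) (l : R) : is_derive (0 : R) (1 : R) u l ->
  exists q : R -> R, [/\ q t @[t --> (0 : R)] --> l, q 0 = l & forall t, u t = u 0 + q t * t].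
Proof.
move=> ul.
exists (fun t => if t == 0 then l else (u t - u 0) / t); split; last first.
- move=> t; case: eqVneq => [->|t0]; first by rewrite mulr0 addr0.
  by rewrite divfK// addrC subrK.
- by rewrite eqxx.
have := @ex_derive _ _ _ _ _ _ _ ul; rewrite /derivable => /cvg_ex[m dm].
have lm : l = m.
  have := @derive_val _ _ _ _ _ _ _ ul; rewrite /derive => <-.
  by apply/(@cvg_lim _ (@Rhausdorff R)).
rewrite -lm in dm; apply/cvgrPdist_lt => e e0.
move/cvgrPdist_lt : dm => /(_ e e0); rewrite near_withinE.
apply: filterS => t h; case: eqVneq => [_|t0]; first by rewrite subrr normr0.
have := h t0; rewrite /= addr0 -[_ *: _]/(_ * _) mulrC.
by rewrite -[_ *: 1]/(_ * _) mulr1.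
Qed.

(** The exponential is defined from its real and imaginary parts; it maps the
    rectangle with sides on Re w = log r, log r' and Im w = -pi, pi onto an
    annulus. *)
Definition cexp w : R[i] :=
  Complex (expR (complex.Re w) * cos (complex.Im w)) (expR (complex.Re w) * sin (complex.Im w)).

Lemma cexpD w z : cexp (w + z) = cexp w * cexp z.
Proof.
rewrite /cexp; case: w z => a b [c d] /=; rewrite expRD cosD sinD.
by apply/eqP; rewrite eq_complex/=; apply/andP; split; apply/eqP; ring.
Qed.

Lemma cabs_cexp w : cabs (cexp w) = expR (complex.Re w).
Proof.
apply/eqP; rewrite -(@eqrXn2 _ 2) ?cabs_ge0 ?expR_ge0//; apply/eqP.
by rewrite cabs2E /= !exprMn -mulrDr cos2Dsin2 mulr1.
Qed.

Lemma cexp0 : cexp 0 = 1.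
Proof. by rewrite /cexp /= expR0 cos0 sin0 mulr0 mulr1. Qed.

Lemma cexp_neq0 w : cexp w != 0.
Proof.
apply/eqP => e; have := expR_gt0 (complex.Re w).
by rewrite -cabs_cexp e cabs0 ltxx.
Qed.

Lemma cexp_period (x : R) : cexp (Complex x pi) = cexp (Complex x (- pi)).
Proof. by rewrite /cexp /= cosN sinN sinpi oppr0. Qed.

Lemma cdiff_cexp0 : cdiff cexp 0.
Proof.
have FF := nbhs_filter (0 : R[i]).
have [q1 [c1 q10 h1]] := real_slope (is_derive_expR (0 : R)).
have [q2 [c2 q20 h2]] := real_slope (is_derive_cos (0 : R)).
have [q3 [c3 q30 h3]] := real_slope (is_derive_sin (0 : R)).
rewrite expR0 in q10 c1 h1; rewrite sin0 oppr0 cos0 in q20 c2 h2.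
rewrite cos0 sin0 in q30 c3 h3.
have cx : complex.Re w @[w --> (0 : R[i])] --> (0 : R).
  exact: (cvg_Re FF (@cvg_id _ (nbhs (0 : R[i])))).
have cy : complex.Im w @[w --> (0 : R[i])] --> (0 : R).
  exact: (cvg_Im FF (@cvg_id _ (nbhs (0 : R[i])))).
pose S w := `|q1 (complex.Re w) - 1| + (`|q2 (complex.Im w)| + (`|q3 (complex.Im w) - 1|
  + `|complex.Im w| * (`|q1 (complex.Re w)| * (`|q2 (complex.Im w)| + `|q3 (complex.Im w)|)))).
have cS : S w @[w --> (0 : R[i])] --> (0 : R).
  have d1 : q1 (complex.Re w) @[w --> (0 : R[i])] --> (1 : R) by exact: (cvg_comp _ _ cx c1).
  have d2 : q2 (complex.Im w) @[w --> (0 : R[i])] --> (0 : R) by exact: (cvg_comp _ _ cy c2).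
  have d3 : q3 (complex.Im w) @[w --> (0 : R[i])] --> (1 : R) by exact: (cvg_comp _ _ cy c3).
  have -> : (0 : R) = `|1 - 1 : R| + (`|0 : R| + (`|1 - 1 : R| + `|0 : R| * (`|1 : R| * (`|0 : R| + `|1 : R|)))).
    by rewrite !(subrr, normr0, mul0r, addr0).
  have e1 : q1 (complex.Re w) - 1 @[w --> (0 : R[i])] --> (1 - 1 : R).
    by exact: (cvgB d1 (cvg_cst (1 : R))).
  have e3 : q3 (complex.Im w) - 1 @[w --> (0 : R[i])] --> (1 - 1 : R).
    by exact: (cvgB d3 (cvg_cst (1 : R))).
  exact: (cvgD (cvg_norm e1) (cvgD (cvg_norm d2) (cvgD (cvg_norm e3) (cvgM (cvg_norm cy)
    (cvgM (cvg_norm d1) (cvgD (cvg_norm d2) (cvg_norm d3))))))).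
apply: (@cdiff_near _ _ _ (fun w => if w == 0 then 1 else (cexp w - 1) / w)); last first.
  apply: (@filterE _ _ FF) => w; rewrite cexp0 subr0; case: eqVneq => [->|w0].
    by rewrite mulr0 addr0 cexp0.
  by rewrite divfK// addrC subrK.
rewrite eqxx; apply/(@cvgcP R _ _ FF); apply: (squeeze_cvgr _ (cvg_cst 0) cS).
apply: (@filterE _ _ FF) => w; rewrite cabs_ge0/=; case: eqVneq => [_|w0].
  by rewrite subrr cabs0 /S !addr_ge0// !mulr_ge0// addr_ge0.
have -> : (cexp w - 1) / w - 1 = (cexp w - 1 - w) / w by field; rewrite w0.
rewrite cabsM cabsV ler_pdivrMr; last by rewrite lt_neqAle cabs_ge0 andbT eq_sym cabs_neq0.
have := ler_Re_cabs w; have := ler_Im_cabs w.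
have := cabs_ge0 w; rewrite /S; move: (cabs w); case: w w0 => x y _ r.
rewrite [complex.Re (Complex x y)]/= [complex.Im (Complex x y)]/= => r0 yr xr.
rewrite (_ : cexp _ = Complex (expR x * cos y) (expR x * sin y))// (h1 x) (h2 y) (h3 y) add0r.
have -> : Complex ((1 + q1 x * x) * (1 + q2 y * y)) ((1 + q1 x * x) * (q3 y * y)) - 1 - Complex x y =
  real_complex R ((q1 x - 1) * x) + (real_complex R (q2 y * y) +
   (Complex 0 ((q3 y - 1) * y) + Complex (y * (q1 x * q2 y) * x) (y * (q1 x * q3 y) * x))).
  by apply/eqP; rewrite eq_complex/=; apply/andP; split; apply/eqP; ring.
have rM (a b t : R) : `|a| <= t -> `|b| <= r -> `|a * b| <= t * r.
  by move=> h k; rewrite normrM ler_pM.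
apply: (le_trans (le_cabsD _ _)); rewrite [in X in _ <= X]mulrDl lerD//.
  by rewrite cabs_real rM.
apply: (le_trans (le_cabsD _ _)); rewrite [in X in _ <= X]mulrDl lerD//.
  by rewrite cabs_real rM.
apply: (le_trans (le_cabsD _ _)); rewrite [in X in _ <= X]mulrDl lerD//.
  by apply: (le_trans (cabs_le_ReIm _)); rewrite /= normr0 add0r rM.
apply: (le_trans (cabs_le_ReIm _)) => /=.
by rewrite (mulrDr `|q1 x|) (mulrDr `|y|) [in X in _ <= X]mulrDl lerD// rM// !normrM.
Qed.

Lemma cdiff_cexp p : cdiff cexp p.
Proof.
rewrite (_ : cexp = fun w => cexp p * cexp (w - p)); last first.
  by apply/funext => w; rewrite -cexpD addrC subrK.
apply: cdiffM; first exact: cdiff_cst.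
apply: cdiff_comp; first by apply: cdiffD; [exact: cdiff_id|exact: cdiff_cst].
by rewrite subrr; exact: cdiff_cexp0.
Qed.

End ComplexExponential.

(** * Goursat's theorem for rectangles *)

Section Goursat.
Context {R : realType}.
Implicit Types (G : R[i] -> R[i]) (a b c d : R).

Lemma cvg_horizontal (x c : R) : Complex t c @[t --> x] --> Complex x c.
Proof.
have FF := nbhs_filter x; apply: (cvg_ReIm FF) => /=; last exact: cvg_cst.
exact: cvg_id.
Qed.

Lemma cvg_vertical (x c : R) : Complex x t @[t --> c] --> Complex x c.
Proof.
have FF := nbhs_filter c; apply: (cvg_ReIm FF) => /=; first exact: cvg_cst.
exact: cvg_id.
Qed.

Definition hedge G a b c := seg_cint a b (fun x => G (Complex x c)).
Definition vedge G a c d := seg_cint c d (fun y => G (Complex a y)).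

(** The integral of G along the boundary of the rectangle [a,b] x [c,d]; the
    factor i accounts for dz on the vertical sides. *)
Definition contour G a b c d : R[i] :=
  hedge G a b c - hedge G a b d + Complex 0 1 * (vedge G b c d - vedge G a c d).

Definition cdiff_on_rect G a b c d :=
  forall x y, a <= x <= b -> c <= y <= d -> cdiff G (Complex x y).

Lemma sub_cdiff_on_rect G a b c d a' b' c' d' : cdiff_on_rect G a b c d ->
  a <= a' -> b' <= b -> c <= c' -> d' <= d -> cdiff_on_rect G a' b' c' d'.
Proof.
move=> h aa bb cc dd x y /andP[x1 x2] /andP[y1 y2]; apply: h; apply/andP; split; lra.
Qed.

Lemma ccont_h G a b c d y : cdiff_on_rect G a b c d -> c <= y <= d ->
  ccont a b (fun x => G (Complex x y)).
Proof.
move=> h yc x xab; have := cdiff_continuous (h x y xab yc).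
exact: (cvg_comp _ _ (@cvg_horizontal x y)).
Qed.

Lemma ccont_v G a b c d x : cdiff_on_rect G a b c d -> a <= x <= b ->
  ccont c d (fun y => G (Complex x y)).
Proof.
move=> h xab y yc; have := cdiff_continuous (h x y xab yc).
exact: (cvg_comp _ _ (@cvg_vertical x y)).
Qed.

Lemma contour_splith G a m b c d : a <= m <= b -> c <= d -> cdiff_on_rect G a b c d ->
  contour G a b c d = contour G a m c d + contour G m b c d.
Proof.
move=> /andP[am mb] cd h; rewrite /contour /hedge.
rewrite (seg_cint_split am mb (ccont_h h _)) ?lexx ?cd//.
rewrite (seg_cint_split am mb (@ccont_h G a b c d d h _)) ?lexx ?cd//; ring.
Qed.

Lemma contour_splitv G a b c m d : c <= m <= d -> a <= b -> cdiff_on_rect G a b c d ->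
  contour G a b c d = contour G a b c m + contour G a b m d.
Proof.
move=> /andP[cm md] ab h; rewrite /contour /vedge.
rewrite (seg_cint_split cm md (ccont_v h _)) ?lexx ?ab//.
rewrite (seg_cint_split cm md (@ccont_v G a b c d a h _)) ?lexx ?ab//; ring.
Qed.

(** The contour integral of an affine function vanishes, so only the error
    term is integrated, along a contour of length 2 (b - a) + 2 (d - c). *)
Lemma contour_affine_bound G a b c d e (k l : R[i]) : a <= b -> c <= d ->
  cdiff_on_rect G a b c d ->
  (forall x y, a <= x <= b -> c <= y <= d ->
    cabs (G (Complex x y) - (k + l * Complex x y)) <= e) ->
  cabs (contour G a b c d) <= 4 * e * ((b - a) + (d - c)).
Proof.
move=> ab cd h he.
have cc : c <= c <= d by rewrite lexx. have dd : c <= d <= d by rewrite lexx andbT.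
have aa : a <= a <= b by rewrite lexx. have bb : a <= b <= b by rewrite lexx andbT.
have cdc := ccont_h h cc. have cdd := ccont_h h dd.
have cda := ccont_v h aa. have cdb := ccont_v h bb.
pose u := l * Complex 0 (c - d); pose v := l * real_complex R (b - a).
have -> : contour G a b c d =
   (seg_cint a b (fun x => (G (Complex x c) - G (Complex x d)) - u)) +
   Complex 0 1 * (seg_cint c d (fun y => (G (Complex b y) - G (Complex a y)) - v)).
  rewrite (@seg_cintB _ a b _ (fun=> u) (ccontB cdc cdd) (@ccont_cst _ a b u)) (seg_cintB cdc cdd) (seg_cint_cst u ab).
  rewrite (@seg_cintB _ c d _ (fun=> v) (ccontB cdb cda) (@ccont_cst _ c d v)) (seg_cintB cdb cda) (seg_cint_cst v cd).
  rewrite /contour /hedge /vedge /u /v.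
  rewrite [Complex 0 (c - d)](_ : _ = - (Complex 0 1 * real_complex R (d - c))).
    by ring.
  by apply/eqP; rewrite eq_complex/=; apply/andP; split; apply/eqP; ring.
have rem (w w' k' : R[i]) : cabs (w - (k + l * k')) <= e ->
   forall k'', cabs (w' - (k + l * k'')) <= e -> cabs (w - w' - l * (k' - k'')) <= 2 * e.
  move=> h1 k'' h2; rewrite (_ : w - w' - l * (k' - k'') = (w - (k + l * k')) - (w' - (k + l * k''))); last by ring.
  by apply: (le_trans (le_cabsD _ _)); rewrite cabsN mulr_natl mulr2n lerD.
apply: (le_trans (le_cabsD _ _)); rewrite cabsM.
have -> : cabs (Complex (0 : R) 1) = 1 by rewrite cabsE /= expr0n/= add0r expr1n sqrtr1.
rewrite mul1r mulrDr lerD//.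
  apply: (le_trans (@seg_cint_bound _ a b _ (2 * e) ab _ _)).
  - exact: (ccontB (ccontB cdc cdd) (@ccont_cst _ a b u)).
  - move=> x xab; have := rem _ _ _ (he x c xab cc) _ (he x d xab dd).
    rewrite /u (_ : Complex x c - Complex x d = Complex 0 (c - d))//.
    by apply/eqP; rewrite eq_complex/=; apply/andP; split; apply/eqP; ring.
  - by rewrite -mulr_natl; lra.
apply: (le_trans (@seg_cint_bound _ c d _ (2 * e) cd _ _)).
- exact: (ccontB (ccontB cdb cda) (@ccont_cst _ c d v)).
- move=> x xab; have := rem _ _ _ (he b x bb xab) _ (he a x aa xab).
  rewrite /v (_ : Complex b x - Complex a x = real_complex R (b - a))//.
  by apply/eqP; rewrite eq_complex/=; apply/andP; split; apply/eqP; ring.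
- by rewrite -mulr_natl; lra.
Qed.

(** Bisection: if badness of a rectangle passes to one of its four quarters,
    there is a point all of whose dyadic neighbourhoods contain bad
    rectangles. The lower left corners are nondecreasing and bounded, and the
    point is their supremum. *)
Lemma bisection_rect (bad : R -> R -> R -> R -> Prop) a c l h :
  0 <= l -> 0 <= h -> bad a c l h ->
  (forall a' c' l' h', 0 <= l' -> 0 <= h' -> a <= a' -> c <= c' ->
     a' + l' <= a + l -> c' + h' <= c + h -> bad a' c' l' h' ->
     [\/ bad a' c' (l' / 2) (h' / 2), bad (a' + l' / 2) c' (l' / 2) (h' / 2),
         bad a' (c' + h' / 2) (l' / 2) (h' / 2) |
         bad (a' + l' / 2) (c' + h' / 2) (l' / 2) (h' / 2)]) ->
  exists x y, [/\ a <= x <= a + l, c <= y <= c + h & forall n : nat, exists a' c',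
    [/\ bad a' c' (l / 2 ^+ n) (h / 2 ^+ n), a <= a' /\ a' + l / 2 ^+ n <= a + l,
        c <= c' /\ c' + h / 2 ^+ n <= c + h,
        a' <= x <= a' + l / 2 ^+ n & c' <= y <= c' + h / 2 ^+ n]].
Proof.
move=> l0 h0 bad0 step.
pose nxt n (p : R * R) : R * R :=
  let l' := l / 2 ^+ n.+1 in let h' := h / 2 ^+ n.+1 in
  if `[< bad p.1 p.2 l' h' >] then p else
  if `[< bad (p.1 + l') p.2 l' h' >] then (p.1 + l', p.2) else
  if `[< bad p.1 (p.2 + h') l' h' >] then (p.1, p.2 + h') else (p.1 + l', p.2 + h').
pose s := fix s n := if n is m.+1 then nxt m (s m) else (a, c).
have l2 n : l / 2 ^+ n = l / 2 ^+ n.+1 + l / 2 ^+ n.+1.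
  by rewrite exprS; field.
have h2 n : h / 2 ^+ n = h / 2 ^+ n.+1 + h / 2 ^+ n.+1.
  by rewrite exprS; field.
have ln n : 0 <= l / 2 ^+ n by rewrite divr_ge0// exprn_ge0.
have hn n : 0 <= h / 2 ^+ n by rewrite divr_ge0// exprn_ge0.
have mono n : [/\ (s n).1 <= (s n.+1).1, (s n).2 <= (s n.+1).2,
    (s n.+1).1 + l / 2 ^+ n.+1 <= (s n).1 + l / 2 ^+ n &
    (s n.+1).2 + h / 2 ^+ n.+1 <= (s n).2 + h / 2 ^+ n].
  have l3 := l2 n; have h3 := h2 n; have l4 := ln n.+1; have h4 := hn n.+1.
  by rewrite /= /nxt; case: ifP => _; [|case: ifP => _; [|case: ifP => _]];
    split; rewrite /=; lra.
have mon n m : [/\ (s n).1 <= (s (n + m)%N).1, (s n).2 <= (s (n + m)%N).2,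
    (s (n + m)%N).1 + l / 2 ^+ (n + m) <= (s n).1 + l / 2 ^+ n &
    (s (n + m)%N).2 + h / 2 ^+ (n + m) <= (s n).2 + h / 2 ^+ n].
  elim: m => [|m [i1 i2 i3 i4]]; first by rewrite addn0.
  rewrite addnS; have [j1 j2 j3 j4] := mono (n + m)%N.
  by split; [exact: le_trans j1|exact: le_trans j2|exact: le_trans i3|exact: le_trans i4].
have inn n : [/\ a <= (s n).1, c <= (s n).2, (s n).1 + l / 2 ^+ n <= a + l &
    (s n).2 + h / 2 ^+ n <= c + h].
  by have := mon 0%N n; rewrite add0n expr0 !divr1.
have sbad n : bad (s n).1 (s n).2 (l / 2 ^+ n) (h / 2 ^+ n).
  elim: n => [|n ih]; first by rewrite expr0 !divr1.
  have [i1 i2 i3 i4] := inn n.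
  have := step _ _ _ _ (ln n) (hn n) i1 i2 i3 i4 ih.
  have -> : l / 2 ^+ n / 2 = l / 2 ^+ n.+1 by rewrite exprS; field.
  have -> : h / 2 ^+ n / 2 = h / 2 ^+ n.+1 by rewrite exprS; field.
  rewrite /= /nxt; case: asboolP => // n1; case: asboolP => // n2.
  by case: asboolP => // n3 [].
have cross n m : (s n).1 <= (s m).1 + l / 2 ^+ m /\ (s n).2 <= (s m).2 + h / 2 ^+ m.
  have [nm|mn] := leqP n m.
    have [i1 i2 _ _] := mon n (m - n)%N; rewrite subnKC// in i1 i2.
    by have := ln m; have := hn m; split; lra.
  have [_ _ i1 i2] := mon m (n - m)%N; rewrite subnKC ?(ltnW mn)// in i1 i2.
  by have := ln n; have := hn n; split; lra.
pose X := range (fun n => (s n).1); pose Y := range (fun n => (s n).2).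
have bX n : (s n).1 <= sup X <= (s n).1 + l / 2 ^+ n.
  apply/andP; split.
    apply: ub_le_sup; last by exists n.
    by exists (a + l / 2 ^+ 0) => _ [m _ <-]; exact: (cross m 0%N).1.
  by apply: ge_sup; [exists (s 0%N).1, 0%N|move=> _ [m _ <-]; exact: (cross m n).1].
have bY n : (s n).2 <= sup Y <= (s n).2 + h / 2 ^+ n.
  apply/andP; split.
    apply: ub_le_sup; last by exists n.
    by exists (c + h / 2 ^+ 0) => _ [m _ <-]; exact: (cross m 0%N).2.
  by apply: ge_sup; [exists (s 0%N).2, 0%N|move=> _ [m _ <-]; exact: (cross m n).2].
exists (sup X), (sup Y); split.
- by have := bX 0%N; rewrite /= expr0 divr1.
- by have := bY 0%N; rewrite /= expr0 divr1.
- move=> n; exists (s n).1, (s n).2; have [i1 i2 i3 i4] := inn n.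
  by split.
Qed.

(** Goursat's argument. Call a rectangle bad if the integral exceeds
    e times the square of its half-perimeter. Badness passes to a quarter, so
    bad rectangles would shrink to a point; there G is affine up to a small
    relative error, contradicting [contour_affine_bound]. *)
Lemma contour_eq0 G a b c d : a <= b -> c <= d -> cdiff_on_rect G a b c d ->
  contour G a b c d = 0.
Proof.
move=> ab cd H.
set l := b - a; set h := d - c.
have l0 : 0 <= l by rewrite subr_ge0. have h0 : 0 <= h by rewrite subr_ge0.
have al : a + l = b by rewrite addrC subrK. have ch : c + h = d by rewrite addrC subrK.
suff bnd e : 0 < e -> cabs (contour G a b c d) <= e * (l + h) ^+ 2.
  apply/eqP; case: eqVneq => // /cabs_neq0 n0.
  have n1 : 0 < cabs (contour G a b c d) by rewrite lt_neqAle cabs_ge0 eq_sym n0.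
  set t := cabs _ in n1; set q := (l + h) ^+ 2 in bnd.
  have q0 : 0 <= q by rewrite sqr_ge0.
  have q1 : 0 < q + 1 by lra.
  have := bnd (t / (2 * (q + 1))); rewrite divr_gt0// ?mulr_gt0// => /(_ isT).
  rewrite -/t mulrAC ler_pdivlMr ?mulr_gt0//.
  by rewrite ler_pM2l// => hh; suff : q < q by [rewrite ltxx]; lra.
move=> e0.
pose bad a' c' l' h' := e * (l' + h') ^+ 2 < cabs (contour G a' (a' + l') c' (c' + h')).
rewrite leNgt; apply/negP => nb0; have nb : bad a c l h by rewrite /bad al ch.
have sub a' c' l' h' : a <= a' -> c <= c' -> a' + l' <= a + l -> c' + h' <= c + h ->
    cdiff_on_rect G a' (a' + l') c' (c' + h').
  by move=> *; apply: (sub_cdiff_on_rect H) => //; rewrite -?al -?ch.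
have [] := @bisection_rect bad a c l h l0 h0 nb.
  move=> a' c' l' h' l'0 h'0 aa cc ll hh bb.
  have H' := sub a' c' l' h' aa cc ll hh.
  set q := e * ((l' / 2) + (h' / 2)) ^+ 2.
  have qq : e * (l' + h') ^+ 2 = q + q + (q + q) by rewrite /q; field.
  have la : a' + l' = a' + l' / 2 + l' / 2 by field.
  have hc : c' + h' = c' + h' / 2 + h' / 2 by field.
  have spl : contour G a' (a' + l') c' (c' + h') =
    (contour G a' (a' + l' / 2) c' (c' + h' / 2) +
      contour G a' (a' + l' / 2) (c' + h' / 2) (c' + h' / 2 + h' / 2)) +
    (contour G (a' + l' / 2) (a' + l' / 2 + l' / 2) c' (c' + h' / 2) +
      contour G (a' + l' / 2) (a' + l' / 2 + l' / 2) (c' + h' / 2) (c' + h' / 2 + h' / 2)).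
    rewrite (@contour_splith _ _ (a' + l' / 2)) //; [|lra|lra].
    rewrite (@contour_splitv _ a' _ _ (c' + h' / 2)) //; [|lra|lra|]; last first.
      by apply: (sub_cdiff_on_rect H'); lra.
    rewrite (@contour_splitv _ (a' + l' / 2) _ _ (c' + h' / 2)) //; [|lra|lra|]; last first.
      by apply: (sub_cdiff_on_rect H'); lra.
    by rewrite -la -hc.
  apply: contrapT => nn.
  move: bb; rewrite /bad spl qq ltNge => /negP; apply.
  have n1 : cabs (contour G a' (a' + l' / 2) c' (c' + h' / 2)) <= q by rewrite leNgt; apply/negP => n0; apply: nn; apply: Or41.
  have n2 : cabs (contour G (a' + l' / 2) (a' + l' / 2 + l' / 2) c' (c' + h' / 2)) <= q
    by rewrite leNgt; apply/negP => n0; apply: nn; apply: Or42.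
  have n3 : cabs (contour G a' (a' + l' / 2) (c' + h' / 2) (c' + h' / 2 + h' / 2)) <= q
    by rewrite leNgt; apply/negP => n0; apply: nn; apply: Or43.
  have n4 : cabs (contour G (a' + l' / 2) (a' + l' / 2 + l' / 2) (c' + h' / 2) (c' + h' / 2 + h' / 2)) <= q
    by rewrite leNgt; apply/negP => n0; apply: nn; apply: Or44.
  by apply: (le_trans (le_cabsD _ _)); apply: lerD; apply: (le_trans (le_cabsD _ _)); apply: lerD.
move=> x [y [xab ycd nest]].
rewrite al in xab; rewrite ch in ycd.
have [k happ] := cdiff_approx (H x y xab ycd).
have [dl dl0 {}happ] := happ (e / 4) (divr_gt0 e0 (ltr0n _ 4)).
have [n hn] : exists n, (l + h) / 2 ^+ n < dl.
  have : (l + h) * (2^-1 ^+ n) @[n --> \oo] --> (l + h) * (0 : R).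
    by apply: cvgM; [exact: cvg_cst|apply: cvg_expr; rewrite ger0_norm ?invr_ge0//; lra].
  rewrite mulr0 => /cvgrPdist_lt/(_ _ dl0)[n _ /(_ n (leqnn n))/=].
  move=> hn; exists n; apply: le_lt_trans hn; rewrite sub0r normrN -exprVn.
  exact: ler_norm.
have [a' [c' [bb [aa ll] [cc hh] xa yc]]] := nest n.
have l'0 : 0 <= l / 2 ^+ n by rewrite divr_ge0// exprn_ge0.
have h'0 : 0 <= h / 2 ^+ n by rewrite divr_ge0// exprn_ge0.
have lh := mulrDl l h (2 ^+ n)^-1; rewrite lh in hn.
move: bb ll hh xa yc hn l'0 h'0 {lh}.
move: (l / 2 ^+ n) (h / 2 ^+ n) => l' h' bb ll hh xa yc hn l'0 h'0.
have := @contour_affine_bound G a' (a' + l') c' (c' + h') (e / 4 * (l' + h'))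
  (G (Complex x y) - k * Complex x y) k.
have -> : 4 * (e / 4 * (l' + h')) * (a' + l' - a' + (c' + h' - c')) = e * (l' + h') ^+ 2.
  by field.
move=> bnd; move: bb; rewrite /bad ltNge => /negP; apply; apply: bnd.
- by rewrite lerDl.
- by rewrite lerDl.
- exact: sub.
move=> u v /andP[u1 u2] /andP[v1 v2]; move: xa yc => /andP[x1 x2] /andP[y1 y2].
have dist : cabs (Complex u v - Complex x y) <= l' + h'.
  apply: (le_trans (cabs_le_ReIm _)) => /=.
  by apply: lerD; rewrite ler_norml; apply/andP; split; lra.
rewrite (_ : _ - _ = G (Complex u v) - (G (Complex x y) + k * (Complex u v - Complex x y))); last by ring.
apply: (le_trans (happ _ (le_lt_trans dist hn))).
by rewrite ler_wpM2l// divr_ge0// ltW.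
Qed.

End Goursat.

(** * Cauchy's theorem for circles *)

Section FourierCircle.
Context {R : realType}.
Implicit Types (g h : R -> R[i]) (F f : R[i] -> R[i]).

Let pi0 : 0 < (pi : R) := pi_gt0 R.

(** Continuity on a full period, for functions on the circle. *)
Definition cper g := ccont (- pi) pi g.

Definition caverage g : R[i] := real_complex R ((2 * pi)^-1) * seg_cint (- pi) pi g.

Definition unitc (y : R) : R[i] := cexp (Complex 0 y).

Lemma pi_sym : (- pi : R) <= pi. Proof. by have := pi0; lra. Qed.

Lemma cexp_polar (rho y : R) : cexp (Complex rho y) = real_complex R (expR rho) * unitc y.
Proof.
rewrite /unitc (_ : Complex rho y = Complex rho 0 + Complex 0 y).
  by rewrite cexpD; congr (_ * _); rewrite /cexp/= cos0 sin0 mulr1 mulr0.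
by apply/eqP; rewrite eq_complex/= addr0 add0r !eqxx.
Qed.

Lemma cabs_unitc y : cabs (unitc y) = 1.
Proof. by rewrite cabs_cexp expR0. Qed.

Lemma mul_conjc_cabs (z : R[i]) : z * conjc z = real_complex R (cabs z ^+ 2).
Proof.
rewrite cabs2E; case: z => x y; apply/eqP; rewrite eq_complex/=.
by apply/andP; split; apply/eqP; ring.
Qed.

Lemma unitcJ y : unitc y * conjc (unitc y) = 1.
Proof. by rewrite mul_conjc_cabs cabs_unitc expr1n. Qed.

Lemma cper_comp F rho : (forall y, F w @[w --> cexp (Complex rho y)] --> F (cexp (Complex rho y))) ->
  cper (fun y => F (cexp (Complex rho y))).
Proof.
move=> cF y _; apply: (cvg_comp _ _ _ (cF y)).
exact: (cvg_comp _ _ (@cvg_vertical R rho y) (cdiff_continuous (@cdiff_cexp R _))).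
Qed.

Lemma cper_unitc : cper unitc.
Proof.
move=> y _; exact: (cvg_comp _ _ (@cvg_vertical R 0 y) (cdiff_continuous (@cdiff_cexp R _))).
Qed.

Lemma cperX g n : cper g -> cper (fun y => g y ^+ n).
Proof.
by move=> cg y yab; have FF := nbhs_filter y; exact: (cvgcX (n := n) FF (cg _ yab)).
Qed.

Lemma caverageD g h : cper g -> cper h ->
  caverage (fun y => g y + h y) = caverage g + caverage h.
Proof. by move=> cg ch; rewrite /caverage (seg_cintD cg ch) mulrDr. Qed.

Lemma caverageB g h : cper g -> cper h ->
  caverage (fun y => g y - h y) = caverage g - caverage h.
Proof. by move=> cg ch; rewrite /caverage (seg_cintB cg ch) mulrBr. Qed.

Lemma caverageZ k h : cper h -> caverage (fun y => k * h y) = k * caverage h.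
Proof. by move=> ch; rewrite /caverage (seg_cintZ _ ch) mulrCA. Qed.

Lemma caverageJ g : cper g -> caverage (fun y => conjc (g y)) = conjc (caverage g).
Proof.
move=> cg; rewrite /caverage (seg_cintJ cg) rmorphM/=; congr (_ * _).
by apply/eqP; rewrite eq_complex/= oppr0 !eqxx.
Qed.

Lemma caverage_cst k : caverage (fun=> k) = k.
Proof.
rewrite /caverage (seg_cint_cst _ pi_sym) mulrCA -rmorphM/= opprK.
have p0 : (pi : R) != 0 by rewrite gt_eqF.
rewrite (_ : _^-1 * _ = 1) ?rmorph1 ?mulr1//.
by move: p0; move: (pi : R) => p p0; field.
Qed.

Lemma eq_caverage g h : (forall y, g y = h y) -> caverage g = caverage h.
Proof. by move=> gh; rewrite /caverage (eq_seg_cint (g := h)). Qed.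

Lemma cabs_caverage g (M : R) : cper g -> (forall y, cabs (g y) <= M) ->
  cabs (caverage g) <= 2 * M.
Proof.
move=> cg gM; rewrite /caverage cabsM cabs_real ger0_norm; last first.
  by rewrite invr_ge0 mulr_ge0// ltW.
have := seg_cint_bound pi_sym cg (fun x _ => gM x).
rewrite -(ler_pM2l (_ : 0 < (2 * pi : R)^-1)); last by rewrite invr_gt0 mulr_gt0.
move/le_trans; apply; rewrite opprK.
have p0 : (pi : R) != 0 by rewrite gt_eqF.
rewrite (_ : _^-1 * _ = 2 * M)//.
by move: p0; move: (pi : R) => p p0; field.
Qed.

(** The origin is exempted because of the negative powers of z in the Taylor
    coefficients. *)
Definition cdiff_punctured F := forall z, z != 0 -> cabs z < 1 -> cdiff F z.

Lemma cdiff_log F rho y : cdiff_punctured F -> rho < 0 -> cdiff (fun w => F (cexp w)) (Complex rho y).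
Proof.
move=> hF r0; apply: cdiff_comp; first exact: cdiff_cexp.
by apply: hF; rewrite ?cexp_neq0// cabs_cexp expR_lt1.
Qed.

Lemma cper_cdiff F rho : cdiff_punctured F -> rho < 0 -> cper (fun y => F (cexp (Complex rho y))).
Proof.
move=> hF r0; apply: cper_comp => y; apply: cdiff_continuous.
by apply: hF; rewrite ?cexp_neq0// cabs_cexp expR_lt1.
Qed.

(** In logarithmic coordinates the two circles are opposite sides of a
    rectangle on which F o exp is holomorphic; the other two sides cancel by
    periodicity. *)
Lemma caverage_radius F rho rho' : cdiff_punctured F -> rho < 0 -> rho' < 0 ->
  caverage (fun y => F (cexp (Complex rho y))) = caverage (fun y => F (cexp (Complex rho' y))).
Proof.
move=> hF; wlog rr : rho rho' / rho <= rho'.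
  move=> h r0 r0'; have [rr|/ltW rr] := leP rho rho'; first exact: h.
  by apply/esym; exact: h.
move=> r0 r0'; rewrite /caverage; congr (_ * _); apply/eqP.
have := @contour_eq0 R (fun w => F (cexp w)) rho rho' (- pi) pi rr pi_sym.
rewrite /contour (_ : hedge _ _ _ (- pi) = hedge (fun w => F (cexp w)) rho rho' pi); last first.
  by apply: eq_seg_cint => x _; rewrite cexp_period.
rewrite subrr add0r => h; have /eqP : Complex 0 1 * (vedge (fun w => F (cexp w)) rho' (- pi) pi - vedge (fun w => F (cexp w)) rho (- pi) pi) = 0.
  by apply: h => x y /andP[_ xr] _; apply: cdiff_log => //; exact: le_lt_trans r0'.
rewrite mulf_eq0 => /orP[|]; first by rewrite eq_complex/= oner_eq0 andbF.
by rewrite subr_eq0 eq_sym.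
Qed.

(** By [caverage_radius] the average does not depend on the radius, and it is
    small on small circles. *)
Lemma caverage_eq0 F rho (d M : R) : cdiff_punctured F -> rho < 0 -> 0 < d ->
  (forall z, z != 0 -> cabs z < d -> cabs (F z) <= M * cabs z) ->
  caverage (fun y => F (cexp (Complex rho y))) = 0.
Proof.
move=> hF r0 d0 FM.
have M0 : 0 <= M.
  pose t := real_complex R (d / 2).
  have ct : cabs t = d / 2 by rewrite cabs_real ger0_norm// ltW// divr_gt0.
  have t0 : 0 < cabs t by rewrite ct divr_gt0.
  have := FM t; rewrite ct => /(_ _ _); rewrite -(pmulr_lge0 _ t0) ct => h.
  apply: le_trans (h _ _); first exact: cabs_ge0.
    by apply/eqP => e; rewrite e cabs0 ltxx in t0.
  by rewrite ltr_pdivrMr// ltr_pMr//; lra.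
apply/eqP; case: eqVneq => // /cabs_neq0; set c := cabs _ => c0'.
have c0 : 0 < c by rewrite lt_neqAle cabs_ge0 eq_sym c0'.
pose t := Num.min (2^-1 : R) (Num.min (d / 2) (c / (4 * (M + 1)))).
have t0 : 0 < t by rewrite !lt_min invr_gt0 ltr0n !divr_gt0// mulr_gt0//; lra.
have t1 : t < 1 by rewrite !gt_min invf_lt1// ltr1n.
have td : t < d by rewrite gt_min; apply/orP; right; rewrite gt_min; apply/orP; left; lra.
have tc : t <= c / (4 * (M + 1)) by rewrite !ge_min lexx !orbT.
have lt0 : ln t < 0 by rewrite ln_lt0// t0.
have : c <= 2 * (M * t).
  rewrite /c (caverage_radius hF r0 lt0); apply: cabs_caverage; first exact: cper_cdiff.
  have e y : cabs (cexp (Complex (ln t) y)) = t by rewrite cabs_cexp/= lnK.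
  by move=> y; have := FM (cexp (Complex (ln t) y)); rewrite e; apply; rewrite ?cexp_neq0.
rewrite ler_pdivlMr in tc; last by rewrite mulr_gt0//; lra.
by have : 0 < t * M + t + t * M by [nra]; nra.
Qed.

Lemma cdiff_punctured_pow k : cdiff_punctured (fun z => z ^+ k).
Proof. by move=> z _ _; apply: cdiffX; exact: cdiff_id. Qed.

Lemma caverage_unitcX k : caverage (fun y => unitc y ^+ k.+1) = 0.
Proof.
have h := @caverage_eq0 (fun z => z ^+ k.+1) (-1) 1 1 (cdiff_punctured_pow _) (ltrN10 _) ltr01.
have : real_complex R (expR (-1)) ^+ k.+1 * caverage (fun y => unitc y ^+ k.+1) = 0.
  rewrite -caverageZ; last by apply: cperX; exact: cper_unitc.
  rewrite -[RHS]h.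
    by apply: eq_caverage => y; rewrite cexp_polar exprMn.
  move=> z _ z1; rewrite cabsX mul1r exprS ler_piMr ?cabs_ge0//.
  by rewrite exprn_ile1 ?cabs_ge0// ltW.
move/eqP; rewrite mulf_eq0 expf_eq0/= => /orP[|/eqP//].
by rewrite eq_complex/= gt_eqF ?expR_gt0.
Qed.

Lemma caverage_conjX k : caverage (fun y => conjc (unitc y) ^+ k.+1) = 0.
Proof.
rewrite -(conjc0 R) -(caverage_unitcX k) -caverageJ; last by apply: cperX; exact: cper_unitc.
by apply: eq_caverage => y; rewrite rmorphXn.
Qed.

Lemma caverage_ortho n m : (n < m)%N ->
  caverage (fun y => unitc y ^+ n * conjc (unitc y) ^+ m) = 0.
Proof.
move=> nm; rewrite -[RHS](caverage_conjX (m - n).-1); apply: eq_caverage => y.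
rewrite prednK ?subn_gt0// -{1}(subnKC (ltnW nm)) exprD mulrA -exprMn unitcJ expr1n mul1r //.
Qed.

End FourierCircle.

(** * Taylor expansion in the disk *)

Section Taylor.
Context {R : realType}.
Implicit Types (g h : R -> R[i]) (F f : R[i] -> R[i]).

Local Notation e_ := (@unitc R).

Lemma cper_conjX n : cper (fun y => conjc (e_ y) ^+ n).
Proof. by apply: cperX; apply: ccontJ; exact: cper_unitc. Qed.

Lemma cper_coef g n : cper g -> cper (fun y => g y * conjc (e_ y) ^+ n).
Proof. by move=> cg; exact: (ccontM cg (@cper_conjX n)). Qed.

Definition fcoef g n := caverage (fun y => g y * conjc (e_ y) ^+ n).

Lemma bessel_identity (h u a : R[i]) N : a * conjc a = 1 ->
  (h - u * a ^+ N) * conjc (h - u * a ^+ N) =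
  (h * conjc h - conjc u * (h * conjc a ^+ N)) - (u * conjc (h * conjc a ^+ N) - u * conjc u).
Proof.
move=> ab; rewrite rmorphB !rmorphM !rmorphXn/= conjcK; move: (conjc a) ab => b ab.
have abN : a ^+ N * b ^+ N = 1 by rewrite -exprMn ab expr1n.
have -> : (h - u * a ^+ N) * (conjc h - conjc u * b ^+ N) =
    h * conjc h - conjc u * (h * b ^+ N) - (u * (conjc h * a ^+ N) - u * conjc u * (a ^+ N * b ^+ N)).
  by ring.
by rewrite abN mulr1.
Qed.

(** Subtracting the n-th Fourier mode kills the n-th coefficient, leaves the
    later ones unchanged and lowers the mean square by |coefficient|^2. As the
    mean square of h is nonnegative this is Bessel's inequality. *)
Lemma bessel_aux g : cper g -> forall N, exists h, [/\ cper h,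
  forall m, (N <= m)%N -> fcoef h m = fcoef g m &
  caverage (fun y => h y * conjc (h y)) =
  caverage (fun y => g y * conjc (g y)) - \sum_(n < N) fcoef g n * conjc (fcoef g n)].
Proof.
move=> cg; elim=> [|N [h [ch hm hL]]].
  by exists g; split => //; rewrite big_ord0 subr0.
pose u := fcoef g N.
have cX : cper (fun y => e_ y ^+ N) by apply: cperX; exact: cper_unitc.
have cuX : cper (fun y => u * e_ y ^+ N) by exact: (ccontZ (k := u) cX).
have ch' : cper (fun y => h y - u * e_ y ^+ N) by exact: (ccontB ch cuX).
exists (fun y => h y - u * e_ y ^+ N); split => //.
  move=> m Nm; rewrite -hm ?(ltnW Nm)// /fcoef.
  rewrite (@eq_caverage _ _ (fun y => h y * conjc (e_ y) ^+ m - u * (e_ y ^+ N * conjc (e_ y) ^+ m))); last first.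
    by move=> y; ring.
  have c1 := @cper_coef _ m cX.
  by rewrite (caverageB (@cper_coef _ m ch) (ccontZ (k := u) c1)) (caverageZ _ c1) caverage_ortho// mulr0 subr0.
have c1 := @cper_coef _ N ch.
have c2 : cper (fun y => conjc (h y * conjc (e_ y) ^+ N)) by exact: (ccontJ c1).
have c0 : cper (fun y => h y * conjc (h y)) by exact: (ccontM ch (ccontJ ch)).
have eu : caverage (fun y => h y * conjc (e_ y) ^+ N) = u by exact: (hm N (leqnn N)).
rewrite (@eq_caverage _ _ (fun y => (h y * conjc (h y) - conjc u * (h y * conjc (e_ y) ^+ N)) -
   (u * conjc (h y * conjc (e_ y) ^+ N) - u * conjc u))); last first.
  by move=> y; exact: bessel_identity (unitcJ y).
have c3 : cper (fun y => h y * conjc (h y) - conjc u * (h y * conjc (e_ y) ^+ N)).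
  exact: (ccontB c0 (ccontZ (k := conjc u) c1)).
have c4 : cper (fun y => u * conjc (h y * conjc (e_ y) ^+ N) - u * conjc u).
  exact: (ccontB (ccontZ (k := u) c2) (@ccont_cst _ _ _ (u * conjc u))).
rewrite (caverageB c3 c4) (caverageB c0 (ccontZ (k := conjc u) c1)).
rewrite (caverageB (ccontZ (k := u) c2) (@ccont_cst _ _ _ (u * conjc u))).
rewrite (caverageZ _ c1) (caverageZ _ c2) (caverageJ c1) eu caverage_cst hL big_ord_recr/= -/u.
by ring.
Qed.

(** The Riemann-Lebesgue lemma for continuous functions, from Bessel's
    inequality. *)
Lemma fcoef_cvg0 g : cper g -> cabs (fcoef g n) @[n --> \oo] --> (0 : R).
Proof.
move=> cg.
pose B := complex.Re (caverage (fun y => g y * conjc (g y))).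
have bnd N : series (fun n => cabs (fcoef g n) ^+ 2) N <= B.
  rewrite [series _ _]big_mkord; have [h [ch _ hL]] := bessel_aux cg N.
  have : 0 <= complex.Re (caverage (fun y => h y * conjc (h y))).
    rewrite /caverage -seg_cintZ; last exact: (ccontM ch (ccontJ ch)).
    apply: seg_cint_Re_ge0 => x; rewrite mul_conjc_cabs -rmorphM/=.
    by rewrite mulr_ge0 ?sqr_ge0// invr_ge0 mulr_ge0// pi_ge0.
  rewrite hL raddfB/= subr_ge0; apply: le_trans.
  rewrite (eq_bigr (fun n : 'I_N => real_complex R (cabs (fcoef g n) ^+ 2))); last first.
    by move=> i _; exact: mul_conjc_cabs.
  by rewrite -rmorph_sum.
have c2 : cvgn (series (fun n => cabs (fcoef g n) ^+ 2)).
  apply: nondecreasing_is_cvgn.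
    by apply/nondecreasing_seqP => n; rewrite seriesSr/= lerDl sqr_ge0.
  by exists B => _ [n _ <-]; exact: bnd.
have FF : Filter (\oo : set_system nat) by exact: eventually_filter.
have := cvgr_comp FF (@sqrt_continuous R 0) (cvg_series_cvg_0 c2).
by rewrite sqrtr0; under eq_cvg do rewrite sqrtr_sqr ger0_norm ?cabs_ge0//.
Qed.

(** Cauchy's formula on the circle of radius 1/e; any radius would do, by
    [taylor_coefE]. *)
Definition taylor_coef f n : R[i] :=
  caverage (fun y => f (cexp (Complex (-1) y)) * (cexp (Complex (-1) y))^-1 ^+ n).

Lemma holomorphic_cdiff f : holomorphic_on_disk f -> forall z, disk z -> cdiff f z.
Proof. by move=> hf z /hf; exact: derivable_cdiff. Qed.

Lemma cdiff_punctured_coef f n : (forall z, disk z -> cdiff f z) -> cdiff_punctured (fun z => f z * z^-1 ^+ n).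
Proof.
move=> hf z z0 z1; apply: cdiffM; first exact: hf.
by apply: cdiffX; exact: cdiff_inv.
Qed.

Lemma taylor_coefE f n rho : (forall z, disk z -> cdiff f z) -> rho < 0 ->
  taylor_coef f n * real_complex R (expR rho) ^+ n =
  fcoef (fun y => f (cexp (Complex rho y))) n.
Proof.
move=> hf r0; have hF := cdiff_punctured_coef n hf.
rewrite /taylor_coef (caverage_radius hF (ltrN10 _) r0).
rewrite mulrC -caverageZ; last exact: (cper_cdiff hF r0).
apply: eq_caverage => y; rewrite mulrCA; congr (_ * _).
rewrite cexp_polar -exprMn; congr (_ ^+ _).
have e0 : real_complex R (expR rho) != 0 by rewrite eq_complex/= eqxx andbT gt_eqF ?expR_gt0.
rewrite invfM mulrA divff// mul1r.
have u0 : e_ y != 0 by exact: cexp_neq0.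
by apply: (mulfI u0); rewrite divff// unitcJ.
Qed.

Lemma continuous_bounded_near f z : cdiff f z -> exists2 d : R, 0 < d & exists M : R,
  forall w, cabs (w - z) < d -> cabs (f w) <= M.
Proof.
move=> /cdiff_continuous cf; have FF := nbhs_filter z.
move/(@cvgcP R _ _ FF)/cvgrPdist_lt : cf => /(_ 1 ltr01)/near_cabs[d d0 h].
exists d => //; exists (cabs (f z) + 1) => w /h; rewrite sub0r normrN ger0_norm ?cabs_ge0// => h1.
rewrite -(subrK (f z) (f w)) addrC; apply: (le_trans (le_cabsD _ _)).
by rewrite lerD// ltW.
Qed.

(** The Fourier coefficients of negative index on a circle vanish, since
    f(z) z^{k+1} tends to 0 at the origin. *)
Lemma caverage_negative f k rho : (forall z, disk z -> cdiff f z) -> rho < 0 ->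
  caverage (fun y => f (cexp (Complex rho y)) * e_ y ^+ k.+1) = 0.
Proof.
move=> hf r0.
have hF : cdiff_punctured (fun z => f z * z ^+ k.+1).
  by move=> z z0 z1; apply: cdiffM; [exact: hf|apply: cdiffX; exact: cdiff_id].
have [d d0 [M fM]] := continuous_bounded_near (hf 0 (disk0)).
have h : caverage (fun y => f (cexp (Complex rho y)) * cexp (Complex rho y) ^+ k.+1) = 0.
  apply: (@caverage_eq0 R _ _ (Num.min d 1) M hF r0).
    by rewrite lt_min d0 ltr01.
  move=> z z0; rewrite lt_min => /andP[zd z1].
  rewrite cabsM; apply: ler_pM; rewrite ?cabs_ge0//; first by apply: fM; rewrite subr0.
  rewrite cabsX exprS ler_piMr ?cabs_ge0//.
  by rewrite exprn_ile1 ?cabs_ge0// ltW.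
have cc : cper (fun y => f (cexp (Complex rho y)) * e_ y ^+ k.+1).
  have c1 : cper (fun y => f (cexp (Complex rho y))) by apply: cper_cdiff => // z _; exact: hf.
  exact: (ccontM c1 (@cperX _ _ k.+1 (@cper_unitc R))).
have : real_complex R (expR rho) ^+ k.+1 * caverage (fun y => f (cexp (Complex rho y)) * e_ y ^+ k.+1) = 0.
  rewrite -caverageZ// -[RHS]h.
  by apply: eq_caverage => y; rewrite [in X in _ = _ * X]cexp_polar exprMn; ring.
have e0 : real_complex R (expR rho) != 0 by rewrite eq_complex/= eqxx andbT gt_eqF ?expR_gt0.
by move/eqP; rewrite mulf_eq0 expf_eq0 (negPf e0) andbF orFb => /eqP.
Qed.

(** The mean value property: f(z) - f(0) is O(|z|) and so has average 0. *)
Lemma taylor_coef0 f : (forall z, disk z -> cdiff f z) -> taylor_coef f 0 = f 0.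
Proof.
move=> hf; have [Q cQ fQ] := hf 0 (disk0).
have hF : cdiff_punctured (fun z => f z - f 0).
  by move=> z z0 z1; apply: cdiffD; [exact: hf|exact: cdiff_cst].
have [M QM] : exists M : R, exists2 d : R, 0 < d & forall w, cabs w < d -> cabs (Q w) <= M.
  have FF := nbhs_filter (0 : R[i]).
  move/(@cvgcP R _ _ FF)/cvgrPdist_lt : cQ => /(_ 1 ltr01)/near_cabs[d d0 h].
  exists (cabs (Q 0) + 1), d => // w wd; have := h w; rewrite subr0 => /(_ wd).
  rewrite sub0r normrN ger0_norm ?cabs_ge0// => h1.
  rewrite -(subrK (Q 0) (Q w)) addrC; apply: (le_trans (le_cabsD _ _)).
  by rewrite lerD// ltW.
move: QM => [d d0 QM].
have : caverage (fun y => f (cexp (Complex (-1) y)) - f 0) = 0.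
  apply: (@caverage_eq0 R _ _ d M hF (ltrN10 _) d0) => z z0 zd.
  by rewrite fQ addrAC subrr add0r subr0 cabsM ler_wpM2r ?cabs_ge0// QM.
rewrite caverageB; [|by apply: cper_cdiff => // z _; exact: hf|exact: ccont_cst].
rewrite caverage_cst => /eqP; rewrite subr_eq0 => /eqP <-.
by apply: eq_caverage => y; rewrite expr0 mulr1.
Qed.

(** Convergence of the Fourier series at the point z of the circle where g
    has a slope q. The factorisation gives
    coef_{n+1}(g) = r coef_n(q) - z coef_{n+1}(q), so the partial sums
    telescope to c minus a unimodular multiple of z coef_m(q), which tends to
    0 by Riemann-Lebesgue. The same recursion at negative indices, where the
    coefficients of g vanish, shows that those of q have constant modulus,
    hence vanish. *)
Lemma fourier_slope (g q : R -> R[i]) (c z rc : R[i]) : cper q ->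
  rc != 0 -> cabs z = cabs rc -> (forall y, g y = c + q y * (rc * e_ y - z)) ->
  (forall k, caverage (fun y => g y * e_ y ^+ k.+1) = 0) ->
  (\sum_(n < m.+1) fcoef g n * (z / rc) ^+ n) @[m --> \oo] --> c.
Proof.
move=> cq rc0 zr gq gneg.
have cJ : cper (fun y => conjc (q y)) by exact: (ccontJ cq).
have cqX k : cper (fun y => q y * e_ y ^+ k).
  exact: (ccontM cq (@cperX _ _ k (@cper_unitc R))).
pose gm k := caverage (fun y => q y * e_ y ^+ k).
have r0 : cabs rc != 0 by exact: cabs_neq0.
have gmS k : rc * gm k.+2 = z * gm k.+1.
  have cu : cper (fun y => e_ y ^+ k.+1) by apply: cperX; exact: cper_unitc.
  have c2 := @cqX k.+2. have c1 := @cqX k.+1.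
  have := gneg k.
  rewrite (@eq_caverage _ _ (fun y => c * e_ y ^+ k.+1 + (rc * (q y * e_ y ^+ k.+2) - z * (q y * e_ y ^+ k.+1)))); last first.
    by move=> y; rewrite gq [e_ y ^+ k.+2]exprS; ring.
  rewrite (caverageD (ccontZ (k := c) cu) (ccontB (ccontZ (k := rc) c2) (ccontZ (k := z) c1))).
  rewrite (caverageB (ccontZ (k := rc) c2) (ccontZ (k := z) c1)).
  rewrite (caverageZ _ cu) (caverageZ _ c2) (caverageZ _ c1) caverage_unitcX mulr0 add0r => e.
  by apply/eqP; rewrite -subr_eq0; apply/eqP.
(* |gm k| is constant in k and tends to 0 *)
have gm1 : gm 1%N = 0.
  have gmc k : cabs (gm k.+1) = cabs (gm 1%N).
    elim: k => // k <-; have /(congr1 (fun x => cabs x)) := gmS k.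
    by rewrite !cabsM zr => /(mulfI r0).
  have h := fcoef_cvg0 cJ.
  have {}h : cabs (gm 1%N) @[n --> \oo] --> (0 : R).
    rewrite -(cvg_shiftS (fun n => cabs (fcoef (fun y => conjc (q y)) n))) in h.
    apply: cvg_trans h; apply: near_eq_cvg; apply: nearW => n.
    rewrite -(gmc n) -cabs_conjc -(caverageJ (@cqX n.+1)); congr (cabs _).
    by apply: eq_caverage => y; rewrite rmorphM rmorphXn.
  have := cvg_unique (@Rhausdorff R) (cvg_cst _) h => e.
  by apply/eqP; case: eqVneq => // /cabs_neq0; rewrite e eqxx.
pose be n := fcoef q n.
have al0 : fcoef g 0 = c - z * be 0%N.
  have c0 := @cper_coef _ 0 cq. have c1 := @cqX 1%N.
  rewrite /fcoef (@eq_caverage _ _ (fun y => c + (rc * (q y * e_ y ^+ 1) - z * (q y * conjc (e_ y) ^+ 0)))); last first.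
    by move=> y; rewrite gq !expr0 expr1; ring.
  rewrite (caverageD (@ccont_cst _ _ _ c) (ccontB (ccontZ (k := rc) c1) (ccontZ (k := z) c0))).
  rewrite (caverageB (ccontZ (k := rc) c1) (ccontZ (k := z) c0)).
  by rewrite caverage_cst (caverageZ _ c1) (caverageZ _ c0) -/(gm 1%N) gm1 mulr0 sub0r.
have alS n : fcoef g n.+1 = rc * be n - z * be n.+1.
  have c0 := @cper_coef _ n cq. have c1 := @cper_coef _ n.+1 cq. have c2 := @cper_conjX n.+1.
  rewrite /fcoef (@eq_caverage _ _ (fun y => c * (conjc (e_ y) ^+ n.+1) +
     (rc * (q y * conjc (e_ y) ^+ n) - z * (q y * conjc (e_ y) ^+ n.+1)))); last first.
    move=> y; rewrite gq mulrDl; congr (_ + _); have := unitcJ y.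
    move: (e_ y) => a; move: (conjc a) => b ab.
    rewrite (_ : q y * (rc * a - z) * b ^+ n.+1 = rc * (q y * (a * b * b ^+ n)) - z * (q y * b ^+ n.+1)).
      by rewrite ab mul1r.
    by rewrite exprS; ring.
  rewrite (caverageD (ccontZ (k := c) c2) (ccontB (ccontZ (k := rc) c0) (ccontZ (k := z) c1))).
  rewrite (caverageB (ccontZ (k := rc) c0) (ccontZ (k := z) c1)).
  by rewrite (caverageZ _ c0) (caverageZ _ c1) (caverageZ _ c2) caverage_conjX mulr0 add0r.
set om := z / rc.
have zom : z = rc * om by rewrite /om mulrC divfK.
(* the telescoping partial sums *)
have sumE m : \sum_(n < m.+1) fcoef g n * om ^+ n = c - z * (om ^+ m * be m).
  elim: m => [|m ih]; first by rewrite big_ord1 al0 expr0 mulr1 mul1r.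
  rewrite big_ord_recr/= ih alS exprS; clearbody om; rewrite zom.
  by move: (be m) (be m.+1) => b1 b2; ring.
under eq_cvg do rewrite sumE.
have FF : Filter (\oo : set_system nat) by exact: eventually_filter.
have h : om ^+ n * be n @[n --> \oo] --> (0 : R[i]).
  apply/(@cvgcP R _ _ FF); apply: cvg_trans (fcoef_cvg0 cq); apply: near_eq_cvg.
  apply: nearW => n; rewrite subr0 cabsM cabsX.
  have -> : cabs om = 1 by rewrite /om cabsM cabsV zr divff.
  by rewrite expr1n mul1r.
have h2 : c - z * (om ^+ n * be n) @[n --> \oo] --> c - z * 0.
  exact: (cvgcB FF (cvg_cst c) (cvgcM FF (cvg_cst z) h)).
by rewrite mulr0 subr0 in h2.
Qed.

(** On the circle through z, f is continuous and has a slope at z, which is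
    what [fourier_slope] requires. *)
Theorem taylor f : holomorphic_on_disk f -> forall z, disk z ->
  (\sum_(n < m) taylor_coef f n * z ^+ n) @[m --> \oo] --> f z.
Proof.
move=> /holomorphic_cdiff hf z zD.
suff : (\sum_(n < m.+1) taylor_coef f n * z ^+ n) @[m --> \oo] --> f z.
  by rewrite (cvg_shiftS (fun m => \sum_(n < m) taylor_coef f n * z ^+ n)).
have [->|z0] := eqVneq z 0.
  rewrite (_ : (fun m => _) = fun=> f 0); first exact: cvg_cst.
  apply/funext => m; rewrite big_ord_recl big1 ?addr0 ?expr0 ?mulr1 ?taylor_coef0//.
  by move=> i _; rewrite expr0n/= mulr0.
set r := cabs z; have r0 : 0 < r by rewrite lt_neqAle cabs_ge0 eq_sym cabs_neq0.
pose rho := ln r; have rho0 : rho < 0 by rewrite ln_lt0// r0.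
have er : expR rho = r by rewrite lnK.
(* the slope of f at z is continuous on the circle through z, also at z itself *)
have [Q cQ fQ] := hf z zD.
pose q y := Q (cexp (Complex rho y)).
have cq : cper q.
  apply: cper_comp => y; set w := cexp _; have [->//|wz] := eqVneq w z.
  have FF := nbhs_filter w.
  have wD : disk w by rewrite -[disk w]/(is_true (cabs w < 1)) cabs_cexp -[complex.Re _]/rho er.
  have h : (f v - f z) / (v - z) @[v --> w] --> (f w - f z) / (w - z).
    apply: (cvgcM FF).
      exact: (cvgcB FF (cdiff_continuous (hf w wD)) (cvg_cst _)).
    apply: (cvgcV FF); first by rewrite subr_eq0.
    exact: (cvgcB FF (@cvg_id _ _) (cvg_cst _)).
  have Qe v : v != z -> Q v = (f v - f z) / (v - z).
    by move=> vz; rewrite fQ [in RHS]addrAC subrr add0r mulfK// subr_eq0.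
  rewrite (Qe w wz); apply: cvg_trans h; apply: near_eq_cvg.
  apply/near_cabs; exists (cabs (w - z)).
    by rewrite lt_neqAle cabs_ge0 eq_sym andbT cabs_neq0// subr_eq0.
  move=> v vw; rewrite -(Qe v)//; apply/eqP => e.
  by move: vw; rewrite e cabs_distC ltxx.
pose rc := real_complex R r.
have rc0 : rc != 0 by rewrite eq_complex/= eqxx andbT gt_eqF.
have fq y : f (cexp (Complex rho y)) = f z + q y * (rc * e_ y - z).
  by rewrite fQ -/(q y) [in X in _ * (X - z)]cexp_polar er.
have crc : cabs z = cabs rc by rewrite cabs_real gtr0_norm.
have := fourier_slope cq rc0 crc fq (fun k => caverage_negative k hf rho0).
apply: cvg_trans; apply: near_eq_cvg; apply: nearW => m; apply: eq_bigr => n _.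
by rewrite -(taylor_coefE n hf rho0) er -/rc -mulrA -exprMn [rc * _]mulrC divfK.
Qed.

End Taylor.

(** * Dyadic shells and Parseval's identity *)

Section DyadicShells.
Context {R : realType}.
Implicit Types (z x : R[i]) (a : nat -> R[i]) (f : R[i] -> R[i]).
Local Notation lam := (@lebesgue_measure R \x @lebesgue_measure R)%E.

Definition halfpow j : R := 2^-1 ^+ j.

Lemma halfpow_gt0 j : 0 < halfpow j. Proof. by rewrite exprn_gt0// invr_gt0. Qed.

Lemma halfpow_le1 j : halfpow j <= 1.
Proof. by rewrite exprn_ile1// ?invr_ge0// invf_le1// ler1n. Qed.

Lemma halfpowS j : halfpow j.+1 = halfpow j / 2.
Proof. by rewrite /halfpow exprSr. Qed.

(** The dyadic shell j: the points with 1-|x|^2 between 2^{-j-1} and 2^{-j}.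
    Up to constants these are the annuli of hyperbolic width log 2 around
    0. *)
Definition in_shell j x : bool := (halfpow j.+1 < 1 - cabs x ^+ 2 <= halfpow j).

Definition shell j x : R := (in_shell j x)%:R.

Definition inner j : R := Num.sqrt (1 - halfpow j).

Lemma inner_ge0 j : 0 <= inner j. Proof. exact: sqrtr_ge0. Qed.

Lemma inner_sq j : inner j ^+ 2 = 1 - halfpow j.
Proof. by rewrite sqr_sqrtr// subr_ge0 halfpow_le1. Qed.

Lemma inner_lt1 j : inner j < 1.
Proof.
by rewrite -(ltr_pXn2r (ltn0Sn 1)) ?nnegrE ?inner_ge0// inner_sq expr1n gtrBl halfpow_gt0.
Qed.

Lemma lt_inner j x : (cabs x < inner j) = (halfpow j < 1 - cabs x ^+ 2).
Proof.
by rewrite -(ltr_pXn2r (ltn0Sn 1)) ?nnegrE ?inner_ge0 ?cabs_ge0// inner_sq ltrBrDr ltrBrDl addrC.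
Qed.

Lemma shell_ge0 j x : 0 <= shell j x.
Proof. by rewrite /shell; case: in_shell. Qed.

Lemma shell_disk j x : in_shell j x -> cabs x < 1.
Proof.
move=> /andP[h _]; rewrite -(ltr_pXn2r (ltn0Sn 1)) ?nnegrE ?cabs_ge0// expr1n.
by have := halfpow_gt0 j.+1; lra.
Qed.

Lemma shellE j x : (cabs x < inner j.+1)%R%:R = (cabs x < inner j)%R%:R + shell j x :> R.
Proof.
rewrite /shell /in_shell !lt_inner; have := halfpowS j; have := halfpow_gt0 j.
move: (halfpow j) (halfpow j.+1) (1 - cabs x ^+ 2) => h h' p h0 hh.
by case: ltP => h1; case: ltP => h2; rewrite ?addr0 ?add0r ?addrA//=; exfalso; lra.
Qed.

Lemma measurable_shell j : cmeasurable (EFin \o shell j).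
Proof.
have -> : EFin \o shell j = (fun x => (((cabs x < inner j.+1)%R%:R - (cabs x < inner j)%R%:R : R))%:E).
  by apply/funext => x /=; rewrite shellE addrC addKr.
apply/measurable_EFinP; apply: measurable_funB; exact: measurable_cabs_lt.
Qed.

Lemma cint_shell j : cint (EFin \o shell j) = ((halfpow j.+1)%:E * disk_area)%E.
Proof.
have m1 : measurable_fun setT (fun p : plane R => (((cabs (to_complex p) < inner j)%R%:R : R))%:E).
  by apply/measurable_EFinP; exact: measurable_cabs_lt.
have h := cint_disk_radius (inner_ge0 j.+1).
have h0 := cint_disk_radius (inner_ge0 j).
rewrite inner_sq in h; rewrite inner_sq in h0.
have : (cint (fun z => ((cabs z < inner j.+1)%R%:R : R)%:E) =
   cint (fun z => ((cabs z < inner j)%R%:R : R)%:E) + cint (EFin \o shell j))%E.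
  rewrite /cint -(ge0_integralD _ measurableT)//.
  - by apply: eq_integral => p _; rewrite -EFinD -shellE.
  - by move=> p _; rewrite lee_fin shell_ge0.
  - exact: measurable_shell.
rewrite h h0 -(fineK disk_area_fin) -!EFinM => e.
have e' : (cint (EFin \o shell j) = ((1 - halfpow j.+1) * fine disk_area)%:E - ((1 - halfpow j) * fine disk_area)%:E)%E.
  by rewrite e addeAC subee// add0e.
by rewrite e' -EFinB halfpowS; congr EFin; field.
Qed.

Lemma cintegrable_shell j : cintegrable (EFin \o shell j).
Proof.
apply/integrableP; split; first exact: measurable_shell.
have := cint_shell j; rewrite /cint => h.
under eq_integral => p _ do rewrite gee0_abs ?lee_fin ?shell_ge0//.
rewrite h -(fineK disk_area_fin) -EFinM ltry //.
Qed.

Lemma rint_shell j : rint (shell j) = halfpow j.+1 * fine disk_area.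
Proof. by rewrite /rint cint_shell -(fineK disk_area_fin) -EFinM. Qed.

Lemma shell_rot j w z : cabs w = 1 -> shell j (w * z) = shell j z.
Proof. by move=> w1; rewrite /shell /in_shell cabsM w1 mul1r. Qed.

Lemma shell_out j z : inner j.+1 <= cabs z -> shell j z = 0.
Proof.
rewrite leNgt lt_inner /shell /in_shell => /negPf ->//.
Qed.

(** The class of integrands for which all integrals over a shell exist. *)
Definition bounded_on_disk (u : R[i] -> R) :=
  cmeasurable (EFin \o u) /\ exists C, forall x, cabs x < 1 -> `|u x| <= C.

Lemma bounded_integrable j u : bounded_on_disk u -> cintegrable (fun x => (shell j x * u x)%:E).
Proof.
move=> [mu [C uC]]; apply: (cintegrable_dominated (C := C)) => //.
- exact: cintegrable_shell.
move=> z; rewrite /shell; case: (boolP (in_shell j z)) => [|_]; last by rewrite eqxx.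
by move=> /shell_disk z1 _; exact: uC.
Qed.

Lemma bounded_Re (phi : R[i] -> R[i]) C : cmap phi -> (forall x, cabs x < 1 -> cabs (phi x) <= C) ->
  bounded_on_disk (fun x => complex.Re (phi x)).
Proof.
move=> mp pC; split; first exact: cmap_Re.
by exists C => x /pC; apply: le_trans; exact: ler_Re_cabs.
Qed.

Lemma boundedM u v : bounded_on_disk u -> bounded_on_disk v -> bounded_on_disk (fun x => u x * v x).
Proof.
move=> [mu [C uC]] [mv [D vD]]; split.
  by apply/measurable_EFinP; apply: measurable_funM; exact/measurable_EFinP.
exists (C * D) => x x1; rewrite normrM ler_pM//; [exact: uC|exact: vD].
Qed.

Lemma boundedD u v : bounded_on_disk u -> bounded_on_disk v -> bounded_on_disk (fun x => u x + v x).
Proof.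
move=> [mu [C uC]] [mv [D vD]]; split.
  by apply/measurable_EFinP; apply: measurable_funD; exact/measurable_EFinP.
exists (C + D) => x x1; apply: (le_trans (ler_normD _ _)).
by apply: lerD; [exact: uC|exact: vD].
Qed.

Lemma bounded_cabs n : bounded_on_disk (fun x => cabs x ^+ n).
Proof.
split.
  by apply/measurable_EFinP; apply: measurable_funX; exact: (cmap_cabs (@cmap_id R)).
exists 1 => x x1; rewrite ger0_norm ?exprn_ge0 ?cabs_ge0//.
by rewrite exprn_ile1 ?cabs_ge0// ltW.
Qed.

Lemma bounded_cst (c : R) : bounded_on_disk (fun=> c).
Proof. by split; [exact: measurable_cst|exists `|c|]. Qed.

Lemma bounded_monomial (c : R[i]) n : bounded_on_disk (fun x => complex.Re (c * x ^+ n)).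
Proof.
apply: (@bounded_Re _ (cabs c)).
  by apply: cmapM; [exact: cmap_cst|apply: cmapX; exact: cmap_id].
by move=> x x1; rewrite cabsM cabsX ler_piMr ?cabs_ge0// exprn_ile1 ?cabs_ge0// ltW.
Qed.

Definition moment j n : R := rint (fun x => shell j x * cabs x ^+ (2 * n)).

(** Partial sums of a power series; Parseval is proved for them and passed
    to the limit. *)
Definition psum a m x : R[i] := \sum_(n < m) a n * x ^+ n.

Lemma Re_cross (c d : R[i]) k m x : (k < m)%N ->
  complex.Re (conjc (d * x ^+ k) * (c * x ^+ m)) =
  cabs x ^+ (2 * k) * complex.Re ((conjc d * c) * x ^+ (m - k)).
Proof.
move=> km; rewrite (_ : conjc _ * _ = real_complex R (cabs x ^+ (2 * k)) * (conjc d * c * x ^+ (m - k))).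
  by case: (conjc d * c * x ^+ (m - k)) => u v /=; rewrite mul0r subr0.
rewrite rmorphM rmorphXn/= -{1}(subnKC (ltnW km)) exprD exprM rmorphXn/=.
by rewrite -mul_conjc_cabs exprMn; ring.
Qed.

Lemma Re_psum a b m k x :
  complex.Re (conjc (psum a k.+1 x) * (b * x ^+ m)) =
  complex.Re (conjc (psum a k x) * (b * x ^+ m)) + complex.Re (conjc (a k * x ^+ k) * (b * x ^+ m)).
Proof. by rewrite /psum big_ord_recr/= rmorphD mulrDl raddfD. Qed.

(** Monomials of different degrees are orthogonal on a shell, by rotation. *)
Lemma cross_vanish j a b m k : (k <= m)%N ->
  bounded_on_disk (fun x => complex.Re (conjc (psum a k x) * (b * x ^+ m))) /\
  rint (fun x => shell j x * complex.Re (conjc (psum a k x) * (b * x ^+ m))) = 0.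
Proof.
elim: k => [_|k ih km].
  have e x : complex.Re (conjc (psum a 0 x) * (b * x ^+ m)) = 0.
    by rewrite /psum big_ord0 conjc0 mul0r.
  split; first by under eq_fun do rewrite e; exact: bounded_cst.
  rewrite (_ : (fun x => _) = fun=> 0); last by apply/funext => x; rewrite e mulr0.
  by rewrite /rint /cint integral0.
have [i1 i2] := ih (ltnW km).
have e x := Re_cross b (a k) x km.
have b2 : bounded_on_disk (fun x => complex.Re (conjc (a k * x ^+ k) * (b * x ^+ m))).
  by under eq_fun do rewrite e; apply: boundedM; [exact: bounded_cabs|exact: bounded_monomial].
split; first by under eq_fun do rewrite Re_psum; exact: boundedD.
rewrite (_ : (fun x => _) = (fun x => shell j x * complex.Re (conjc (psum a k x) * (b * x ^+ m)) +
   shell j x * complex.Re (conjc (a k * x ^+ k) * (b * x ^+ m)))); last first.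
  by apply/funext => x; rewrite Re_psum mulrDr.
rewrite rintD; [|exact: bounded_integrable|exact: bounded_integrable].
rewrite i2 add0r.
rewrite (_ : (fun x => _) = (fun x => (shell j x * cabs x ^+ (2 * k)) * complex.Re ((conjc (a k) * b) * x ^+ (m - k)))); last first.
  by apply/funext => x; rewrite e mulrA.
apply: (@rint_monomial _ _ (inner j.+1)).
- by rewrite subn_gt0.
- exact: inner_lt1.
- exact: (bounded_integrable j (bounded_cabs (2 * k))).
- by move=> z; rewrite mulr_ge0 ?shell_ge0// exprn_ge0// cabs_ge0.
- by move=> z h; rewrite shell_out// mul0r.
- by move=> w z w1; rewrite shell_rot// cabsM w1 mul1r.
Qed.

Lemma cabs2_psumS a m x : cabs (psum a m.+1 x) ^+ 2 =
  cabs (psum a m x) ^+ 2 + (cabs (a m) ^+ 2 * cabs x ^+ (2 * m) +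
   2 * complex.Re (conjc (psum a m x) * (a m * x ^+ m))).
Proof.
have -> : cabs x ^+ (2 * m) = cabs (x ^+ m) ^+ 2 by rewrite cabsX exprAC exprM.
rewrite -exprMn -cabsM {1}/psum big_ord_recr/= -/(psum a m x).
by move: (psum _ _ _) (a m * _) => [u v] [c d]; rewrite !cabs2E/=; ring.
Qed.

(** Adding one monomial at a time: the cross term vanishes by
    [cross_vanish]. *)
Lemma parseval_poly j a m : bounded_on_disk (fun x => cabs (psum a m x) ^+ 2) /\
  rint (fun x => shell j x * cabs (psum a m x) ^+ 2) = \sum_(n < m) cabs (a n) ^+ 2 * moment j n.
Proof.
elim: m => [|m [ih1 ih2]].
  have e x : cabs (psum a 0 x) ^+ 2 = 0.
    by rewrite /psum big_ord0 cabs0 expr0n.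
  split; first by under eq_fun do rewrite e; exact: bounded_cst.
  rewrite (_ : (fun x => _) = fun=> 0); last by apply/funext => x; rewrite e mulr0.
  by rewrite /rint /cint integral0 big_ord0.
have [b1 r1] := cross_vanish j a (a m) (leqnn m).
have b2 : bounded_on_disk (fun x => 2 * complex.Re (conjc (psum a m x) * (a m * x ^+ m))).
  by apply: boundedM => //; exact: bounded_cst.
have b3 : bounded_on_disk (fun x => cabs (a m) ^+ 2 * cabs x ^+ (2 * m)).
  by apply: boundedM; [exact: bounded_cst|exact: bounded_cabs].
split; first by under eq_fun do rewrite cabs2_psumS; apply: boundedD => //; exact: boundedD.
rewrite (_ : (fun x => _) = (fun x => shell j x * cabs (psum a m x) ^+ 2 +
  (cabs (a m) ^+ 2 * (shell j x * cabs x ^+ (2 * m)) +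
   2 * (shell j x * complex.Re (conjc (psum a m x) * (a m * x ^+ m)))))); last first.
  by apply/funext => x; rewrite cabs2_psumS; ring.
have i1 := bounded_integrable j b1.
have i2 := bounded_integrable j (bounded_cabs (2 * m)).
have i4 : cintegrable (EFin \o (fun x => 2 * (shell j x * complex.Re (conjc (psum a m x) * (a m * x ^+ m))))).
  by under eq_fun do rewrite mulrCA; exact: (bounded_integrable j b2).
have i5 : cintegrable (EFin \o (fun x => cabs (a m) ^+ 2 * (shell j x * cabs x ^+ (2 * m)))).
  by under eq_fun do rewrite mulrCA; exact: (bounded_integrable j b3).
rewrite rintD; [|exact: (bounded_integrable j ih1)|exact: cintegrableD].
by rewrite (rintD i5 i4) (rintZ _ i1) (rintZ _ i2) r1 mulr0 addr0 ih2 big_ord_recr.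
Qed.

Lemma moment_ge0 j n : 0 <= moment j n.
Proof.
rewrite /moment /rint /cint fine_ge0// integral_ge0// => p _.
by rewrite lee_fin mulr_ge0 ?shell_ge0// exprn_ge0// cabs_ge0.
Qed.

End DyadicShells.

(** * Parseval on a shell for a power series *)

Section BesselShell.
Context {R : realType}.
Implicit Types (z x : R[i]) (a : nat -> R[i]) (f : R[i] -> R[i]).
Local Notation lam := (@lebesgue_measure R \x @lebesgue_measure R)%E.

(** Convergence at a point of larger modulus bounds the coefficients by a
    geometric sequence. *)
Lemma psum_bounded a f rho : (forall z, disk z -> psum a m z @[m --> \oo] --> f z) ->
  0 <= rho < 1 -> exists C, forall m x, cabs x <= rho -> cabs (psum a m x) <= C.
Proof.
move=> af /andP[rho0 rho1].
pose r := (rho + 1) / 2.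
have r1 : r < 1 by rewrite /r; lra.
have rr : rho < r by rewrite /r; lra.
have r0 : 0 < r by lra.
have FF : Filter (\oo : set_system nat) by exact: eventually_filter.
have cr : cabs (real_complex R r) = r by rewrite cabs_real gtr0_norm.
have [B hB] : exists B : R, forall n, cabs (a n) * r ^+ n <= B.
  have dr : disk (real_complex R r) by rewrite -[disk _]/(is_true (cabs _ < 1)) cr.
  have h : psum a n.+1 (real_complex R r) - psum a n (real_complex R r) @[n --> \oo] --> (0 : R[i]).
    have h0 := af _ dr; have h1 := h0.
    rewrite -(cvg_shiftS (fun m => psum a m (real_complex R r))) in h1.
    by have := cvgcB FF h1 h0; rewrite subrr.
  have {}h : cabs (a n) * r ^+ n @[n --> \oo] --> (0 : R).
    have := cvg_cabs FF h; rewrite cabs0; apply: cvg_trans; apply: near_eq_cvg.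
    apply: nearW => n; rewrite {1}/psum big_ord_recr/= -/(psum a n _) addrAC subrr add0r.
    by rewrite cabsM cabsX cr.
  have /cvg_seq_bounded[M [_ hM]] : cvgn (fun n => cabs (a n) * r ^+ n) by apply: cvgP h.
  exists (M + 1) => n; have := hM (M + 1); rewrite ltrDl ltr01 => /(_ isT n I).
  by apply: le_trans; exact: ler_norm.
have B0 : 0 <= B by apply: le_trans (hB 0%N); rewrite mulr_ge0 ?cabs_ge0// exprn_ge0// ltW.
pose q := rho / r.
have q0 : 0 <= q by rewrite divr_ge0// ltW.
have q1 : q < 1 by rewrite ltr_pdivrMr// mul1r.
exists (B * (1 - q)^-1) => m x xr.
apply: (le_trans (le_cabs_sum _ _ _)).
apply: (@le_trans _ _ (\sum_(n < m) B * q ^+ n)).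
  apply: ler_sum => n _; rewrite cabsM cabsX.
  have : cabs (a n) * r ^+ n * q ^+ n <= B * q ^+ n by rewrite ler_wpM2r ?exprn_ge0.
  apply: le_trans; rewrite -mulrA -exprMn /q [r * _]mulrC divfK ?gt_eqF//.
  by rewrite ler_wpM2l ?cabs_ge0// lerXn2r ?nnegrE ?cabs_ge0.
rewrite -mulr_sumr ler_wpM2l// -[leRHS]mul1r ler_pdivlMr; last by rewrite subr_gt0.
have e : (\sum_(n < m) q ^+ n) * (1 - q) = 1 - q ^+ m.
  elim: m => [|m ih]; first by rewrite big_ord0 mul0r expr0 subrr.
  by rewrite big_ord_recr/= mulrDl ih exprS; ring.
by rewrite e gerBl exprn_ge0.
Qed.

(** The partial sums converge boundedly on the shell; dropping coefficients
    beyond N gives the inequality. *)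
Lemma parseval_shell a f j : (forall z, disk z -> psum a m z @[m --> \oo] --> f z) ->
  cmeasurable (fun x => (shell j x * cabs (f x) ^+ 2)%:E) /\
  forall N, ((\sum_(n < N) cabs (a n) ^+ 2 * moment j n)%:E <=
    cint (fun x => (shell j x * cabs (f x) ^+ 2)%:E))%E.
Proof.
move=> af.
pose g m (p : plane R) := (shell j (to_complex p) * cabs (psum a m (to_complex p)) ^+ 2)%:E.
pose g' (p : plane R) := (shell j (to_complex p) * cabs (f (to_complex p)) ^+ 2)%:E.
have mg m : measurable_fun setT (g m).
  exact: (cintegrable_cmeas (bounded_integrable j (parseval_poly j a m).1)).
have FF : Filter (\oo : set_system nat) by exact: eventually_filter.
have cg p : setT p -> g m p @[m --> \oo] --> g' p.
  move=> _; rewrite /g /g'; apply: cvg_EFin; first exact: nearW.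
  rewrite /shell; case: (boolP (in_shell j (to_complex p))) => [/shell_disk h|_].
    rewrite mul1r.
    have c := cvg_cabs FF (af _ h).
    rewrite (_ : fine \o _ = fun m => cabs (psum a m (to_complex p)) ^+ 2); last first.
      by apply/funext => m /=; rewrite mul1r.
    rewrite expr2; under eq_cvg do rewrite expr2; exact: (cvgM c c).
  rewrite mul0r (_ : fine \o _ = fun=> 0); first exact: cvg_cst.
  by apply/funext => m /=; rewrite mul0r.
have mg' : measurable_fun setT g'.
  by apply: (emeasurable_fun_cvg _ _ mg) => p; exact: cg.
split=> // N.
have rj : 0 <= (inner j.+1 : R) < 1 by rewrite inner_ge0 inner_lt1.
have [C hC] := psum_bounded af rj.
have hb m p : setT p -> (`|g m p| <= (C ^+ 2 * shell j (to_complex p))%:E)%E.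
  move=> _; rewrite /g abse_EFin lee_fin ger0_norm; last by rewrite mulr_ge0 ?shell_ge0// sqr_ge0.
  rewrite /shell; case: (boolP (in_shell j _)) => [h|_]; last by rewrite mul0r mulr0.
  have C0 : 0 <= C.
    by apply: le_trans (hC 0%N 0 _); [exact: cabs_ge0|rewrite cabs0 inner_ge0].
  rewrite mul1r mulr1 lerXn2r ?nnegrE ?cabs_ge0//.
  by apply: hC; rewrite ltW// lt_inner; case/andP: h.
have ib : lam.-integrable setT (fun p => (C ^+ 2 * shell j (to_complex p))%:E).
  by under eq_fun do rewrite EFinM; exact: (integrableZl measurableT _ (cintegrable_shell j)).
have fb (p : plane R) : setT p -> (C ^+ 2 * shell j (to_complex p))%:E \is a fin_num by [].
have cv := dominated_cvg measurableT mg cg fb ib hb.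
rewrite /cint -/g' -(cvg_lim _ cv)//; apply: lime_ge; first by apply/cvg_ex; eexists; exact: cv.
exists N => // m /= Nm.
have -> : (\int[lam]_x g m x)%E = (rint (fun x => shell j x * cabs (psum a m x) ^+ 2))%:E.
  rewrite /rint fineK//.
  exact: (integrable_fin_num measurableT (bounded_integrable j (parseval_poly j a m).1)).
rewrite (parseval_poly j a m).2 lee_fin -(subnKC Nm) big_split_ord/= lerDl.
by apply: sumr_ge0 => i _; rewrite mulr_ge0 ?sqr_ge0 ?moment_ge0.
Qed.

End BesselShell.

(** * Taylor coefficients and the weighted norm *)

Section WeightBessel.
Context {R : realType}.
Implicit Types (z x : R[i]) (a : nat -> R[i]) (f : R[i] -> R[i]).
Local Notation lam := (@lebesgue_measure R \x @lebesgue_measure R)%E.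

(** The area of the disk in units of pi. *)
Definition disk_mass : R := pi^-1 * fine disk_area.

Lemma fine_disk_area_gt0 : 0 < fine (@disk_area R).
Proof. by apply: fine_gt0; rewrite disk_area_gt0/= -ge0_fin_numE ?disk_area_fin// ltW// disk_area_gt0. Qed.

Lemma disk_mass_gt0 : 0 < disk_mass.
Proof. by rewrite mulr_gt0 ?invr_gt0 ?pi_gt0 ?fine_disk_area_gt0. Qed.

(** The weights c_n of the Cauchy-Schwarz argument, of order
    M / (log_2 n + J), as found in [wshell_block]. *)
Definition coef_weight (M : R) (J n : nat) : R := M * disk_mass / (16 * (up_log 2 n + J + 4)%:R).

Lemma coef_weight_gt0 M J n : 0 < M -> 0 < coef_weight M J n.
Proof.
move=> M0; apply: divr_gt0; apply: mulr_gt0 => //; exact: disk_mass_gt0.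
Qed.

Lemma bernoulli_ge (h : R) n : 0 <= h <= 1 -> 1 - n%:R * h <= (1 - h) ^+ n.
Proof.
move=> /andP[h0 h1]; elim: n => [|n ih]; first by rewrite mul0r subr0 expr0.
rewrite exprS; apply: (@le_trans _ _ ((1 - h) * (1 - n%:R * h))); last first.
  by rewrite ler_wpM2l// subr_ge0.
have : 0 <= n%:R * (h * h) by rewrite !mulr_ge0.
rewrite -natr1; move: (n%:R) => k hk; lra.
Qed.

Lemma pow2_halfpow i : 2 ^+ i * halfpow i = 1 :> R.
Proof. by rewrite /halfpow -exprMn divff// expr1n. Qed.

(** On shells j > log_2 n the function |x|^{2n} is bounded below, by
    Bernoulli's inequality. *)
Lemma moment_lower i n : (n <= 2 ^ i)%N -> fine (@disk_area R) * halfpow i.+2 / 2 <= @moment R i.+1 n.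
Proof.
move=> ni; rewrite -mulrA mulrCA mulrC.
set k := fine disk_area; have k0 : 0 < k := fine_disk_area_gt0.
have h1 := @halfpow_le1 R i.+1; have h0 := @halfpow_gt0 R i.+1.
have bern : 2^-1 <= (1 - halfpow i.+1) ^+ n :> R.
  apply: le_trans (bernoulli_ge n _); last by rewrite ltW.
  have : n%:R * halfpow i <= (1 : R).
    have hp : 0 <= halfpow i :> R by rewrite ltW// halfpow_gt0.
    apply: (@le_trans _ _ (2 ^+ i * halfpow i)); last by rewrite pow2_halfpow.
    by rewrite -natrX ler_wpM2r ?ler_nat.
  rewrite halfpowS; move: (n%:R : R) (halfpow i) => u v uv; lra.
have ic := bounded_integrable i.+1 (@bounded_cabs R (2 * n)).
have is_ := @cintegrable_shell R i.+1.
apply: (@le_trans _ _ (rint (fun x : R[i] => (1 - halfpow i.+1) ^+ n * shell i.+1 x))).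
  rewrite rintZ// rint_shell -/k [leLHS](_ : _ = 2^-1 * (halfpow i.+2 * k)); last by ring.
  by rewrite ler_wpM2r// mulr_ge0// ltW// halfpow_gt0.
rewrite /moment /rint; apply: fine_le.
- by under [X in cint X]eq_fun do rewrite /= EFinM;
     apply: (integrable_fin_num measurableT); exact: integrableZl.
- exact: (integrable_fin_num measurableT ic).
apply: ge0_le_integral => //.
- move=> p _; rewrite lee_fin mulr_ge0 ?shell_ge0// exprn_ge0// subr_ge0 //.
- by apply/measurable_EFinP; apply: measurable_funM => //; apply/measurable_EFinP; exact: measurable_shell.
- exact: (cintegrable_cmeas ic).
move=> p _; rewrite lee_fin mulrC /shell.
case: (boolP (in_shell _ _)) => [/andP[_ h]|_]; last by rewrite !mul0r.
rewrite !mul1r exprM lerXn2r ?nnegrE ?sqr_ge0 ?subr_ge0//; lra.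
Qed.

(** A constant below M times the critical weight on shell j, cut off for j < J. *)
Definition wshell (M : R) J j : R := (J <= j)%N%:R * (M * 2 ^+ j / (j + 3)%:R ^+ 2).

Lemma wshell_ge0 M J j : 0 <= M -> 0 <= wshell M J j.
Proof. by move=> M0; rewrite mulr_ge0// divr_ge0 ?sqr_ge0// mulr_ge0// exprn_ge0. Qed.

(** Keep the shells j between m and 2 m + 3, where m is of order
    log_2 n + J: each contributes about M / m^2 and there are about m of
    them. This is where the critical growth 1/((1-|x|^2) log^2) enters. *)
Lemma wshell_block M J n B : 0 <= M -> (2 * (up_log 2 n + J + 1) + 3 <= B)%N ->
  pi * coef_weight M J n <= \sum_(j < B) wshell M J j * @moment R j n.
Proof.
move=> M0; set m := (up_log 2 n + J + 1)%N => mB.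
have k0 : 0 < fine (@disk_area R) := fine_disk_area_gt0.
have piK : pi * disk_mass = fine (@disk_area R) by rewrite mulrA divff ?mul1r// gt_eqF// pi_gt0.
rewrite /coef_weight -mulrA mulrCA (mulrA pi) piK.
have -> : (up_log 2 n + J + 4 = m + 3)%N by rewrite /m; lia.
rewrite -(big_mkord xpredT (fun j => wshell M J j * moment j n)).
rewrite (big_cat_nat (n := m))//=; [|lia]; rewrite -[leLHS]add0r lerD//.
  by apply: sumr_ge0 => j _; rewrite mulr_ge0 ?wshell_ge0 ?moment_ge0.
rewrite (big_cat_nat (n := m + (m + 3)))//=; [|lia|lia]; rewrite -[leLHS]addr0 lerD//; last first.
  by apply: sumr_ge0 => j _; rewrite mulr_ge0 ?wshell_ge0 ?moment_ge0.
apply: (@le_trans _ _ (\sum_(m <= j < m + (m + 3)) M * fine (@disk_area R) / (16 * (m + 3)%:R ^+ 2))).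
  rewrite big_const_nat iter_addr_0 addKn -mulr_natr.
  have m0 : (m + 3)%:R != 0 :> R by rewrite pnatr_eq0 addnS.
  by rewrite le_eqVlt; apply/orP; left; apply/eqP; field.
apply: ler_sum_nat => j /andP[mj jm].
have [i ji] : exists i, j = i.+1 by exists j.-1; rewrite prednK//; rewrite /m in mj; lia.
have ni : (n <= 2 ^ i)%N.
  apply: (leq_trans (@up_logP 2 n (ltnSn 1))).
  by rewrite leq_exp2l// ; rewrite /m in mj; lia.
have hm := moment_lower ni.
rewrite /wshell (_ : (J <= j)%N = true) ?mul1r; last by rewrite /m in mj; lia.
apply: (@le_trans _ _ (M * 2 ^+ j / (j + 3)%:R ^+ 2 * (fine (@disk_area R) * halfpow i.+2 / 2))); last first.
  apply: ler_wpM2l; last by rewrite ji.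
  by apply: divr_ge0; [rewrite mulr_ge0// exprn_ge0|exact: sqr_ge0].
have -> : M * 2 ^+ j / (j + 3)%:R ^+ 2 * (fine (@disk_area R) * halfpow i.+2 / 2) =
   M * fine (@disk_area R) / (4 * (j + 3)%:R ^+ 2).
  have j0 : (j + 3)%:R != 0 :> R by rewrite pnatr_eq0 addnS.
  have := pow2_halfpow i.+1; rewrite [halfpow i.+2]halfpowS -ji => e.
  apply: (@mulIf _ ((4 * (j + 3)%:R ^+ 2) : R)); first by rewrite mulf_neq0 ?expf_neq0.
  rewrite divfK ?mulf_neq0 ?expf_neq0//.
  rewrite -[RHS]mulr1 -[X in _ = _ * X]e; move: (2 ^+ j) (halfpow j) => u v; field.
  by rewrite natrD in j0.
apply: ler_wpM2l; first by rewrite mulr_ge0// ltW.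
have pos (k : nat) (c : R) : 0 < c -> 0 < c * (k + 3)%:R ^+ 2.
  by move=> c0; rewrite mulr_gt0// exprn_gt0// ltr0n addnS.
rewrite lef_pV2 ?posrE ?pos//.
rewrite (_ : 16 * (m + 3)%:R ^+ 2 = 4 * ((2 * (m + 3))%:R ^+ 2) :> R); last by rewrite natrM; ring.
rewrite ler_wpM2l// lerXn2r ?nnegrE// ler_nat; lia.
Qed.

Lemma in_shell_inj i j x : in_shell i x -> in_shell j x -> i = j.
Proof.
wlog ij : i j / (i <= j)%N.
  by move=> h hi hj; have [/h->//|/ltnW/h ->//] := leqP i j.
move=> /andP[h1 h2] /andP[h3 h4]; apply/eqP; rewrite eqn_leq ij/= leqNgt; apply/negP => ij'.
have : halfpow j <= halfpow i.+1 :> R.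
  by rewrite /halfpow ler_wiXn2l// ?invr_ge0// invf_le1// ler1n.
lra.
Qed.

Lemma sum_shell_le (w : nat -> R) B x (y : R) : 0 <= y ->
  (forall j, in_shell j x -> w j <= y) -> \sum_(j < B) w j * shell j x <= y.
Proof.
move=> y0 wy; case: (pselect (exists j : 'I_B, in_shell j x)) => [[j jx]|nj].
  rewrite (bigD1 j)//= /shell jx mulr1 big1 ?addr0 ?wy// => i ij.
  case: (boolP (in_shell i x)) => [ix|_]; last by rewrite mulr0.
  by move: ij; rewrite -(inj_eq val_inj)/= (in_shell_inj ix jx) eqxx.
rewrite big1// => i _; rewrite /shell; case: (boolP (in_shell i x)) => [ix|_]; last by rewrite mulr0.
by exfalso; apply: nj; exists i.
Qed.

Lemma weighted_sqnorm_ge W f (G : R[i] -> R) : cmeasurable (EFin \o G) -> (forall x, 0 <= G x) ->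
  (forall x, 1 <= cabs x -> G x = 0) ->
  (forall x, disk x -> 0 <= W x) ->
  (forall x, disk x -> G x <= cabs (f x) ^+ 2 * W x) ->
  ((pi^-1)%:E * cint (EFin \o G) <= weighted_sqnorm W f)%E.
Proof.
move=> mG G0 Gout W0 GW.
pose u (x : R[i]) := G x * (1 - cabs x ^+ 2) ^+ 2.
have mu : cmeasurable (EFin \o u).
  apply/measurable_EFinP; apply: measurable_funM; first exact/measurable_EFinP.
  apply: measurable_funX; apply: measurable_funB => //; apply: measurable_funX.
  exact: (cmap_cabs (@cmap_id R)).
have u0 x : 0 <= u x by rewrite mulr_ge0 ?sqr_ge0.
have p0 (x : R[i]) : cabs x < 1 -> (1 - cabs x ^+ 2) ^+ 2 != 0.
  by rewrite disk_cabs2 => h; rewrite expf_neq0// subr_eq0 eq_sym lt_eqF.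
have -> : ((pi^-1)%:E * cint (EFin \o G) = mean_stat u)%E.
  rewrite /mean_stat; congr (_ * _)%E; apply: eq_integral => p _ /=; congr EFin.
  rewrite /u /hypdens; case: ltP => [h|/Gout->]; last by rewrite !mul0r.
  by rewrite mul1r mulfK// p0.
rewrite -area_integral//; apply: le_lower_integral => p /= pd; last first.
  by rewrite lee_fin mulr_ge0 ?sqr_ge0 ?W0.
by rewrite lee_fin /u /bergman_density mulfK ?GW// p0.
Qed.

(** Sum Parseval's inequality over the shells with the minorant of W, exchange
    the sums over shells and over degrees, and apply [wshell_block] to each
    degree. *)
Theorem weighted_bessel W M J a f : 0 <= M -> (forall z, disk z -> 0 <= W z) ->
  (forall j x, (J <= j)%N -> in_shell j x -> M * 2 ^+ j / (j + 3)%:R ^+ 2 <= W x) ->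
  (forall z, disk z -> psum a m z @[m --> \oo] --> f z) ->
  forall N, ((\sum_(n < N) cabs (a n) ^+ 2 * coef_weight M J n)%:E <= weighted_sqnorm W f)%E.
Proof.
move=> M0 W0 WM af N.
pose B := (2 * ((\max_(n < N) up_log 2 n) + J + 1) + 3)%N.
have nB (n : 'I_N) : (2 * (up_log 2 n + J + 1) + 3 <= B)%N.
  by rewrite /B leq_add2r leq_mul2l/= !leq_add2r (leq_bigmax n).
pose g j (x : R[i]) := shell j x * cabs (f x) ^+ 2.
have mg j := (parseval_shell j af).1.
have g0 j x : 0 <= g j x by rewrite mulr_ge0 ?shell_ge0 ?sqr_ge0.
pose G x := \sum_(j < B) wshell M J j * g j x.
have mG : cmeasurable (EFin \o G).
  apply/measurable_EFinP; apply: measurable_sum => j; apply: measurable_funM => //.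
  by apply/measurable_EFinP; exact: (mg j).
have G0 x : 0 <= G x by apply: sumr_ge0 => j _; rewrite mulr_ge0 ?wshell_ge0.
have cG : (cint (EFin \o G) = \sum_(j < B) (wshell M J j)%:E * cint (EFin \o g j))%E.
  rewrite /cint; under eq_integral => p _ do rewrite /= /G -sumEFin.
  rewrite (ge0_integral_sum _ measurableT).
  - apply: eq_bigr => j _; under eq_integral => p _ do rewrite EFinM.
    have h1 p : setT p -> (0 <= (g j (to_complex p))%:E)%E by rewrite lee_fin.
    have h2 : (0 <= (wshell M J j)%:E)%E by rewrite lee_fin wshell_ge0.
    exact: (ge0_integralZl _ measurableT (mg j) h1 h2).
  - by move=> j; apply/measurable_EFinP; apply: measurable_funM => //; apply/measurable_EFinP; exact: (mg j).
  - by move=> j p _; rewrite lee_fin mulr_ge0 ?wshell_ge0.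
apply: le_trans (weighted_sqnorm_ge mG G0 _ W0 _).
- rewrite cG; apply: (@le_trans _ _ ((pi^-1)%:E * \sum_(j < B) (wshell M J j)%:E *
     (\sum_(n < N) cabs (a n) ^+ 2 * moment j n)%:E)%E); last first.
    apply: lee_wpmul2l; first by rewrite lee_fin invr_ge0 pi_ge0.
    apply: lee_sum => j _; apply: lee_wpmul2l; first by rewrite lee_fin wshell_ge0.
    exact: (parseval_shell j af).2.
  under [X in (_ * X)%E]eq_bigr do rewrite -EFinM.
  rewrite sumEFin -EFinM lee_fin ler_pdivlMl ?pi_gt0//.
  under [leRHS]eq_bigr do rewrite mulr_sumr.
  rewrite exchange_big/= mulr_sumr; apply: ler_sum => n _.
  under eq_bigr do rewrite mulrCA.
  by rewrite -mulr_sumr mulrCA ler_wpM2l ?sqr_ge0// wshell_block.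
- move=> x x1; rewrite /G big1// => j _; rewrite /g shell_out ?mul0r ?mulr0//.
  by apply: le_trans x1; rewrite ltW// inner_lt1.
- move=> x xd; rewrite /G (eq_bigr (fun j : 'I_B => cabs (f x) ^+ 2 * (wshell M J j * shell j x))).
    rewrite -mulr_sumr ler_wpM2l ?sqr_ge0//; apply: sum_shell_le; first exact: W0.
    move=> j jx; rewrite /wshell; case: leqP => Jj; last by rewrite mul0r W0.
    by rewrite mul1r WM.
  by move=> j _; rewrite /g; ring.
Qed.

End WeightBessel.

(** * Integrals of shell-wise bounded functions *)

Section ShellBounds.
Context {R : realType}.
Implicit Types (z x : R[i]) (F u : R[i] -> R).
Local Notation lam := (@lebesgue_measure R \x @lebesgue_measure R)%E.

Lemma cint_step (c : nat -> R) B : (forall j, 0 <= c j) ->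
  cint (fun x => (\sum_(j < B) c j * shell j x)%:E) =
  (fine (@disk_area R) * \sum_(j < B) c j * halfpow j.+1)%:E.
Proof.
move=> c0; rewrite /cint; under eq_integral => p _ do rewrite -sumEFin.
have mc j : measurable_fun setT (fun p : plane R => (c j * shell j (to_complex p))%:E).
  apply/measurable_EFinP; apply: measurable_funM => //; apply/measurable_EFinP.
  exact: measurable_shell.
rewrite (ge0_integral_sum _ measurableT)//; last first.
  by move=> j p _; rewrite lee_fin mulr_ge0 ?shell_ge0.
rewrite mulr_sumr -sumEFin; apply: eq_bigr => j _.
under eq_integral => p _ do rewrite EFinM.
have h1 (p : plane R) : setT p -> (0 <= (shell j (to_complex p))%:E)%E by rewrite lee_fin shell_ge0.
have h2 : (0 <= (c j)%:E)%E by rewrite lee_fin.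
rewrite (ge0_integralZl _ measurableT (measurable_shell j) h1 h2).
have := cint_shell (R := R) j; rewrite /cint => ->.
by rewrite -(fineK (@disk_area_fin R)) -!EFinM; congr EFin; ring.
Qed.

(** Shell j has area 2^{-j-1} times the area of the disk. *)
Lemma mean_stat_step (c : nat -> R) B : (forall j, 0 <= c j) ->
  ((pi^-1)%:E * cint (fun x => (\sum_(j < B) c j * 2 ^+ j.+1 * shell j x)%:E) =
  (@disk_mass R * \sum_(j < B) c j)%:E)%E.
Proof.
move=> c0; rewrite (cint_step (c := fun j => c j * 2 ^+ j.+1)); last first.
  by move=> j; rewrite mulr_ge0// exprn_ge0.
rewrite -EFinM mulrA /disk_mass; congr (_ * _)%:E; apply: eq_bigr => j _.
by rewrite -mulrA pow2_halfpow mulr1.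
Qed.

Lemma cmeasurable_hyp u : cmeasurable (EFin \o u) -> cmeasurable (fun x => (u x * hypdens x)%:E).
Proof.
move=> mu; apply/measurable_EFinP; apply: measurable_funM; last exact: measurable_hypdens.
exact/measurable_EFinP.
Qed.

Lemma cmeasurable_step (c : nat -> R) B : cmeasurable (fun x => (\sum_(j < B) c j * shell j x)%:E).
Proof.
apply/measurable_EFinP; apply: measurable_sum => j; apply: measurable_funM => //.
by apply/measurable_EFinP; exact: measurable_shell.
Qed.

Lemma mean_stat_shell_le F (be : nat -> R) B : cmeasurable (EFin \o F) -> (forall x, 0 <= F x) ->
  (forall j, 0 <= be j) ->
  (forall x, cabs x < 1 -> F x != 0 -> exists2 j, (j < B)%N & in_shell j x) ->
  (forall j x, in_shell j x -> F x * (1 - cabs x ^+ 2) ^- 2 <= be j * 2 ^+ j.+1) ->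
  (mean_stat F <= (@disk_mass R * \sum_(j < B) be j)%:E)%E.
Proof.
move=> mF F0 be0 cov bnd; rewrite -mean_stat_step// /mean_stat.
apply: lee_wpmul2l; first by rewrite lee_fin invr_ge0 pi_ge0.
have c0 j : 0 <= be j * 2 ^+ j.+1 by rewrite mulr_ge0// exprn_ge0.
apply: ge0_le_integral => //.
- by move=> p _; rewrite lee_fin mulr_ge0 ?hypdens_ge0.
- exact: cmeasurable_hyp.
- exact: (cmeasurable_step (fun j => be j * 2 ^+ j.+1)).
move=> p _; rewrite lee_fin; set x := to_complex p.
have s0 : 0 <= \sum_(j < B) be j * 2 ^+ j.+1 * shell j x.
  by apply: sumr_ge0 => j _; rewrite mulr_ge0 ?shell_ge0.
rewrite /hypdens; case: ltP => [x1|_]; last by rewrite mul0r mulr0.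
rewrite mul1r; have [->|Fx] := eqVneq (F x) 0; first by rewrite mul0r.
have [j jB jx] := cov x x1 Fx; apply: (le_trans (bnd j x jx)).
rewrite (bigD1 (Ordinal jB))//= /shell jx mulr1 lerDl; apply: sumr_ge0 => i _.
by rewrite mulr_ge0.
Qed.

Lemma mean_stat_shell_ge F (be : nat -> R) B : cmeasurable (EFin \o F) -> (forall x, 0 <= F x) ->
  (forall j, 0 <= be j) ->
  (forall j x, in_shell j x -> be j * 2 ^+ j.+1 <= F x * (1 - cabs x ^+ 2) ^- 2) ->
  ((@disk_mass R * \sum_(j < B) be j)%:E <= mean_stat F)%E.
Proof.
move=> mF F0 be0 bnd; rewrite -mean_stat_step// /mean_stat.
apply: lee_wpmul2l; first by rewrite lee_fin invr_ge0 pi_ge0.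
apply: ge0_le_integral => //.
- by move=> p _; rewrite lee_fin; apply: sumr_ge0 => j _; rewrite !mulr_ge0 ?shell_ge0 ?exprn_ge0.
- exact: (cmeasurable_step (fun j => be j * 2 ^+ j.+1)).
- exact: cmeasurable_hyp.
move=> p _; rewrite lee_fin; set x := to_complex p.
apply: (sum_shell_le (w := fun j => be j * 2 ^+ j.+1)); first by rewrite mulr_ge0 ?hypdens_ge0.
by move=> j jx; rewrite /hypdens (shell_disk jx) mul1r bnd.
Qed.

Lemma shell_cover (rho : R) : 0 <= rho < 1 -> exists B, forall x, cabs x <= rho ->
  exists2 j, (j < B)%N & in_shell j x.
Proof.
move=> /andP[r0 r1].
have d0 : 0 < 1 - rho ^+ 2 by rewrite subr_gt0 expr_lt1.
have [B hB] : exists B, halfpow B < 1 - rho ^+ 2.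
  have : (2^-1 : R) ^+ n @[n --> \oo] --> (0 : R).
    by apply: cvg_expr; rewrite ger0_norm ?invr_ge0// invf_lt1// ltr1n.
  move=> /cvgrPdist_lt/(_ _ d0)[B _ /(_ B (leqnn B))/=].
  by rewrite sub0r normrN ger0_norm ?exprn_ge0 ?invr_ge0// => h; exists B.
exists B => x xr.
have p1 : halfpow B < 1 - cabs x ^+ 2.
  by apply: lt_le_trans hB _; rewrite lerB// lerXn2r ?nnegrE ?cabs_ge0.
have ex : exists n, halfpow n < 1 - cabs x ^+ 2 by exists B.
case: (ex_minnP ex) => m hm mmin; case: m hm mmin => [h _|m hm mmin].
  by move: h; rewrite /halfpow expr0 ltNge gerBl sqr_ge0.
exists m; first exact: mmin.
by rewrite /in_shell hm/= leNgt; apply/negP => /mmin; rewrite ltnn.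
Qed.

(** The constants comparing e^{-d(z,x)} with 1-|x|^2 when |z| <= t. *)
Definition dist_up (t : R) : R := 2 / (1 - t).
Definition dist_low (t : R) : R := (1 - t) / 16.

Lemma expd_le t z x : cabs z <= t < 1 -> disk x ->
  expR (- poincare z x) <= (1 - cabs x ^+ 2) * dist_up t.
Proof.
move=> /andP[zt t1] xd; have zd : disk z by exact: le_lt_trans t1.
have rr := mobius_itv zd xd; rewrite expRN poincareE expR_pdist//.
have := one_sub_cabs2_mobius_le zd xd; move: (cabs (mobius z x)) rr => r /andP[r0 r1] h.
rewrite invf_div; apply: (@le_trans _ _ (1 - r ^+ 2)).
  rewrite ler_pdivrMr; last lra.
  have : 0 <= (1 - r) * (r * (2 + r)) by rewrite !mulr_ge0//; lra.
  lra.
apply: (le_trans h); rewrite ler_wpM2l//; last first.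
  by rewrite ler_pM2l// lef_pV2 ?posrE; lra.
by rewrite subr_ge0 expr_le1// ?cabs_ge0// ltW.
Qed.

Lemma expd_ge t z x : cabs z <= t < 1 -> disk x ->
  (1 - cabs x ^+ 2) * dist_low t <= expR (- poincare z x).
Proof.
move=> /andP[zt t1] xd; have zd : disk z by exact: le_lt_trans t1.
have rr := mobius_itv zd xd; rewrite expRN poincareE expR_pdist//.
have := one_sub_cabs2_mobius_ge zd xd; move: (cabs (mobius z x)) rr => r /andP[r0 r1] h.
have x0 : 0 <= 1 - cabs x ^+ 2 by rewrite subr_ge0 expr_le1// ?cabs_ge0// ltW.
rewrite invf_div; apply: (@le_trans _ _ ((1 - r ^+ 2) / 4)).
  have : (1 - cabs x ^+ 2) * ((1 - t) / 4) <= (1 - cabs x ^+ 2) * ((1 - cabs z) / 4).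
    by rewrite ler_wpM2l//; lra.
  by rewrite /dist_low; lra.
rewrite ler_pdivlMr; last lra.
rewrite (_ : (1 - r ^+ 2) / 4 * (1 + r) = (1 - r) * ((1 + r) ^+ 2 / 4)); last by field.
rewrite ler_piMr//; first lra.
have : (1 - r) * (3 + r) >= 0 by rewrite mulr_ge0//; lra.
lra.
Qed.

Lemma dist_up_ge1 t : 0 <= t < 1 -> 1 <= dist_up t.
Proof. by move=> /andP[t0 t1]; rewrite /dist_up ler_pdivlMr; lra. Qed.

Lemma dist_low_itv t : 0 <= t < 1 -> 0 < dist_low t <= 1.
Proof. by move=> /andP[t0 t1]; rewrite /dist_low; apply/andP; split; lra. Qed.

(** The factor 2^{-sg} by which e^{-sg d(z,x)} decreases from one dyadic shell
    to the next. *)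
Definition shell_ratio (sg : R) : R := expR (- sg * ln 2).

Lemma shell_ratio_gt0 sg : 0 < shell_ratio sg. Proof. exact: expR_gt0. Qed.

Lemma shell_ratio_lt1 sg : 0 < sg -> shell_ratio sg < 1.
Proof. by move=> s0; rewrite expR_lt1 mulNr oppr_lt0 mulr_gt0// ln_gt0// ltr1n. Qed.

Lemma ln_halfpow j : ln (halfpow j) = - j%:R * ln 2 :> R.
Proof.
by rewrite /halfpow lnXn ?invr_gt0// lnV ?posrE// mulNr mulr_natl mulNrn.
Qed.

(** The power sg of the comparison [expd_le], on a shell. *)
Lemma shell_expd_le t z x j sg : cabs z <= t < 1 -> 0 <= sg <= 2 -> in_shell j x ->
  expR (- sg * poincare z x) <= dist_up t ^+ 2 * shell_ratio sg ^+ j.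
Proof.
move=> zt /andP[s0 s2] jx.
have t0 : 0 <= t < 1 by case/andP: zt => zt ->; rewrite (le_trans (cabs_ge0 _) zt).
have C1 := dist_up_ge1 t0; have C0 : 0 < dist_up t by apply: lt_le_trans C1.
have := expd_le zt (shell_disk jx : disk x); move: (poincare z x) => d h.
have {}h : expR (- d) <= halfpow j * dist_up t.
  by apply: (le_trans h); rewrite ler_wpM2r ?(ltW C0)//; case/andP: jx.
have {}h : - d <= - j%:R * ln 2 + ln (dist_up t).
  rewrite -ler_expR expRD lnK ?posrE// -ln_halfpow lnK ?posrE ?halfpow_gt0//.
have -> : - sg * d = sg * (- d) by rewrite mulrN mulNr.
apply: (@le_trans _ _ (expR (sg * (- j%:R * ln 2 + ln (dist_up t))))).
  by rewrite ler_expR ler_wpM2l.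
rewrite mulrDr expRD mulrC; apply: ler_pM; rewrite ?expR_ge0//; last first.
  rewrite /shell_ratio -expRM_natl ler_expR -mulr_natl.
  by move: (ln 2 : R) (j%:R : R) => l k; rewrite le_eqVlt; apply/orP; left; apply/eqP; ring.
rewrite -[X in _ <= X ^+ 2](lnK (_ : dist_up t \is Num.pos)) ?posrE// -expRM_natl ler_expR.
by apply: ler_wpM2r => //; exact: ln_ge0.
Qed.

Lemma shell_expd_ge t z x j sg : cabs z <= t < 1 -> 0 <= sg <= 1 -> in_shell j x ->
  dist_low t * shell_ratio sg ^+ j.+1 <= expR (- sg * poincare z x).
Proof.
move=> zt /andP[s0 s1] jx.
have t0 : 0 <= t < 1 by case/andP: zt => zt ->; rewrite (le_trans (cabs_ge0 _) zt).
have /andP[C0 C1] := dist_low_itv t0.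
have := expd_ge zt (shell_disk jx : disk x); move: (poincare z x) => d h.
have {}h : halfpow j.+1 * dist_low t <= expR (- d).
  by apply: le_trans h; rewrite ler_wpM2r ?(ltW C0)// ltW//; case/andP: jx.
have {}h : - j.+1%:R * ln 2 + ln (dist_low t) <= - d.
  by rewrite -ler_expR expRD lnK ?posrE// -ln_halfpow lnK ?posrE ?halfpow_gt0.
have -> : - sg * d = sg * (- d) by rewrite mulrN mulNr.
apply: (@le_trans _ _ (expR (sg * (- j.+1%:R * ln 2 + ln (dist_low t))))); last first.
  by rewrite ler_expR ler_wpM2l.
rewrite mulrDr expRD mulrC; apply: ler_pM.
- by apply: exprn_ge0; exact: ltW (shell_ratio_gt0 _).
- exact: ltW.
- rewrite /shell_ratio -expRM_natl ler_expR -mulr_natl.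
  by move: (ln 2 : R) (j.+1%:R : R) => l k; rewrite le_eqVlt; apply/orP; left; apply/eqP; ring.
rewrite -[leLHS](lnK (_ : dist_low t \is Num.pos)) ?posrE// ler_expR.
rewrite -subr_ge0 (_ : _ - _ = (1 - sg) * - ln (dist_low t)); last by ring.
by rewrite mulr_ge0 ?subr_ge0// oppr_ge0 ln_le0.
Qed.

Lemma geom_le (y : R) N : 0 <= y < 1 -> \sum_(n < N) y ^+ n <= (1 - y)^-1.
Proof.
move=> /andP[y0 y1]; have p0 : 0 < 1 - y by rewrite subr_gt0.
rewrite -[leRHS]mul1r ler_pdivlMr//.
have -> : (\sum_(n < N) y ^+ n) * (1 - y) = 1 - y ^+ N.
  elim: N => [|m ih]; first by rewrite big_ord0 mul0r expr0 subrr.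
  by rewrite big_ord_recr/= mulrDl ih exprS; ring.
by rewrite gerBl exprn_ge0.
Qed.

Lemma geom_natl_le (y : R) N : 0 <= y < 1 -> \sum_(n < N) n%:R * y ^+ n <= (1 - y) ^- 2.
Proof.
move=> /andP[y0 y1]; have p0 : 0 < 1 - y by rewrite subr_gt0.
have pn : 1 - y != 0 by rewrite gt_eqF.
have e : \sum_(n < N) n%:R * y ^+ n = y / (1 - y) ^+ 2 - y ^+ N * (N%:R / (1 - y) + y / (1 - y) ^+ 2).
  elim: N => [|m ih]; first by rewrite big_ord0 expr0; ring.
  rewrite big_ord_recr/= ih (exprS y m) -[m.+1%:R]natr1; move: (y ^+ m) (m%:R : R) => Y K.
  by field.
rewrite e; apply: (@le_trans _ _ (y / (1 - y) ^+ 2)).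
  by rewrite gerBl mulr_ge0 ?exprn_ge0// addr_ge0// divr_ge0 ?sqr_ge0// ltW.
by rewrite ler_piMl ?invr_ge0 ?sqr_ge0// ltW.
Qed.

(** If log_2 n exceeds j by much, then n is much larger than 2^j and the term n p
    pays for the excess. *)
Lemma up_log_le j n (p : R) : halfpow j.+1 < p -> (up_log 2 n)%:R <= (j + 2)%:R + n%:R * p.
Proof.
move=> hp; have p0 : 0 < p by apply: lt_trans hp; exact: halfpow_gt0.
have np0 : 0 <= n%:R * p by rewrite mulr_ge0// ltW.
have /andP[k1 k2] := truncn_itv np0; set k := Num.truncn _ in k1 k2.
have : (up_log 2 n <= j.+1 + k.+1)%N.
  apply: up_log_min => //; rewrite expnD; apply: (@leq_trans (2 ^ j.+1 * k.+1)).
    rewrite -(ler_nat R) natrM natrX; apply: (@le_trans _ _ (2 ^+ j.+1 * (n%:R * p))).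
      have h1 : 1 <= 2 ^+ j.+1 * p.
        rewrite -[leLHS](pow2_halfpow j.+1); apply: ler_wpM2l; last exact: ltW.
        by rewrite exprn_ge0.
      by rewrite mulrCA ler_peMr.
    by rewrite ler_wpM2l ?exprn_ge0// ltW.
  by rewrite leq_mul2l; apply/orP; right; apply: ltnW; exact: ltn_expl.
rewrite -(ler_nat R) !natrD -[k.+1%:R]natr1 -[j.+1%:R]natr1; move: k1 k2.
move: (n%:R * p) (k%:R : R) (j%:R : R) ((up_log 2 n)%:R : R) => u v w l; lra.
Qed.

(** On shell j the powers |x|^{2n} are negligible beyond n of order 2^j, where
    1/c_n is of order (j+J)/M. Quantitatively, [up_log_le] splits 1/c_n so
    that two geometric sums give the bound. *)
Lemma coef_sum_le M J j N x : 0 < M -> in_shell j x ->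
  \sum_(n < N) (coef_weight M J n)^-1 * cabs x ^+ (2 * n) <=
  16 / (M * @disk_mass R) * (j + J + 7)%:R * 2 ^+ j.+1.
Proof.
move=> M0 jx; have K0 := disk_mass_gt0 (R := R).
have xd := shell_disk jx.
case/andP: (jx) => p1 p2.
set y := cabs x ^+ 2 in p1 p2; set p := 1 - y in p1 p2.
have y0 : 0 <= y by rewrite sqr_ge0.
have hj := halfpow_gt0 (R := R) j.+1.
have p0 : 0 < p by apply: lt_trans p1.
have y1 : 0 <= y < 1 by rewrite y0/=; rewrite /p in p0; lra.
have yp : 1 - y = p by [].
have A0 : 0 <= 16 / (M * @disk_mass R) by apply: divr_ge0 => //; apply: mulr_ge0; exact: ltW.
apply: (@le_trans _ _ (16 / (M * @disk_mass R) * \sum_(n < N) ((j + J + 6)%:R * y ^+ n + p * (n%:R * y ^+ n)))).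
  rewrite mulr_sumr; apply: ler_sum => n _; rewrite exprM -/y.
  rewrite (_ : (coef_weight M J n)^-1 = 16 / (M * @disk_mass R) * (up_log 2 n + J + 4)%:R); last first.
    rewrite /coef_weight invf_div; field.
    by rewrite !gt_eqF.
  rewrite -[leLHS]mulrA; apply: ler_wpM2l => //; rewrite mulrA -mulrDl.
  apply: ler_wpM2r; first exact: exprn_ge0.
  have := up_log_le n p1; rewrite !natrD [p * _]mulrC.
  move: ((up_log 2 n)%:R : R) (n%:R * p) (j%:R : R) (J%:R : R) => u v w l; lra.
rewrite -[leRHS]mulrA; apply: ler_wpM2l => //; rewrite big_split/= -!mulr_sumr.
have g1 := geom_le N y1; have g2 := geom_natl_le N y1; rewrite yp in g1 g2.
apply: (@le_trans _ _ ((j + J + 6)%:R * p^-1 + p * p ^- 2)).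
  by apply: lerD; apply: ler_wpM2l => //; exact: ltW.
have -> : p * p ^- 2 = p^-1 by field; rewrite gt_eqF.
clear g1 g2 y1 yp p2; clearbody p.
have -> : (j + J + 6)%:R / p + p^-1 = (j + J + 7)%:R / p.
  have -> : (j + J + 7)%N = (j + J + 6).+1 by lia.
  by rewrite -natr1 [RHS]mulrDl mul1r.
apply: ler_wpM2l => //; rewrite -(@ler_pM2r _ (halfpow j.+1))// pow2_halfpow.
by rewrite ler_pdivrMl// mulr1 ltW.
Qed.

End ShellBounds.

(** * The variance sum *)

(** Signs of products and quotients of factors of known sign. *)
Ltac pos := repeat first [done | apply: ltW; done | apply: divr_gt0 | apply: divr_ge0
  | apply: mulr_gt0 | apply: mulr_ge0 | apply: exprn_gt0 | apply: exprn_ge0 | apply: addr_ge0].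

Section VarianceBounds.
Context {R : realType}.
Implicit Types (z x : R[i]) (F u : R[i] -> R) (s t a b M : R).
Local Notation lam := (@lebesgue_measure R \x @lebesgue_measure R)%E.

Lemma mean_stat_sum (c : nat -> R) (u : nat -> R[i] -> R) N : (forall n, 0 <= c n) ->
  (forall n x, 0 <= u n x) -> (forall n, cmeasurable (EFin \o u n)) ->
  mean_stat (fun x => \sum_(n < N) c n * u n x) = (\sum_(n < N) (c n)%:E * mean_stat (u n))%E.
Proof.
move=> c0 u0 mu; rewrite /mean_stat.
have mh n := cmeasurable_hyp (mu n).
have h0 n (p : plane R) : setT p -> (0 <= (u n (to_complex p) * hypdens (to_complex p))%:E)%E.
  by move=> _; rewrite lee_fin mulr_ge0 ?hypdens_ge0.
rewrite /cint (eq_integral (fun p => \sum_(n < N) (c n)%:E * (u n (to_complex p) * hypdens (to_complex p))%:E)%E); last first.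
  move=> p _; rewrite mulr_suml -sumEFin; apply: eq_bigr => n _.
  by rewrite -mulrA EFinM.
rewrite (ge0_integral_sum _ measurableT); last 2 first.
- by move=> n; exact: (measurable_funeM _ (mh n)).
- move=> n p _; rewrite -EFinM lee_fin; apply: mulr_ge0 => //.
  by apply: mulr_ge0 => //; exact: hypdens_ge0.
rewrite ge0_sume_distrr; last first.
  move=> n _; apply: integral_ge0 => p _; rewrite -EFinM lee_fin; apply: mulr_ge0 => //.
  by apply: mulr_ge0 => //; exact: hypdens_ge0.
apply: eq_bigr => n _.
have cn : (0 <= (c n)%:E)%E by rewrite lee_fin.
by rewrite (ge0_integralZl _ measurableT (mh n) (h0 n) cn) muleCA.
Qed.

Lemma le_mean_stat u v : cmeasurable (EFin \o u) -> cmeasurable (EFin \o v) ->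
  (forall x, 0 <= u x) -> (forall x, u x <= v x) -> (mean_stat u <= mean_stat v)%E.
Proof.
move=> mu mv u0 uv; apply: lee_wpmul2l; first by rewrite lee_fin invr_ge0 pi_ge0.
apply: ge0_le_integral => //.
- by move=> p _; rewrite lee_fin mulr_ge0 ?hypdens_ge0.
- exact: cmeasurable_hyp.
- exact: cmeasurable_hyp.
- by move=> p _; rewrite lee_fin ler_wpM2r ?hypdens_ge0.
Qed.

Lemma annulus_weight_le_exp s a b z x : annulus_weight s a b z x <= expR (- s * poincare z x).
Proof.
rewrite /annulus_weight; case: (cabs x < 1); rewrite ?mul1r ?mul0r ?expR_ge0//.
by case: (_ && _); rewrite ?mul1r ?mul0r ?expR_ge0.
Qed.

Lemma annulus_weight_cover s a b t z : 0 <= b -> cabs z <= t < 1 -> exists B, forall x, cabs x < 1 ->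
  annulus_weight s a b z x != 0 -> exists2 j, (j < B)%N & in_shell j x.
Proof.
move=> b0 zt.
have t0 : 0 <= t < 1 by case/andP: zt => zt ->; rewrite (le_trans (cabs_ge0 _) zt).
pose rho := Num.max 0 (safe_radius t b).
have r1 : 0 <= rho < 1 by rewrite le_max lexx/= gt_max ltr01 safe_radius_lt1.
have [B hB] := shell_cover r1.
exists B => x _ sx; apply: hB; rewrite leNgt; apply/negP => h.
move/eqP: sx; apply; apply: (@annulus_weight_support R s a b t z b0 zt x).
by apply: le_lt_trans h; rewrite le_max lexx orbT.
Qed.

Lemma cmeasurable_cabsX n : cmeasurable (EFin \o (fun x : R[i] => cabs x ^+ n)).
Proof. exact: (bounded_cabs n).1. Qed.

(** The bound of [variance_sum_le]; as s tends to 1 it is of order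
    (1/M) (J (s-1)^{-1} + (s-1)^{-2}), uniformly for |z| <= t. *)
Definition var_bound t M J s : R := 16 * dist_up t ^+ 4 / M *
  ((J + 7)%:R / (1 - shell_ratio (2 * (s - 1))) + (1 - shell_ratio (2 * (s - 1))) ^- 2).

Lemma radius_itv (t : R) z : cabs z <= t < 1 -> 0 <= t < 1.
Proof. by case/andP => zt ->; rewrite (le_trans (cabs_ge0 _) zt). Qed.

(** On shell j, w^2 is at most a constant times 2^{-2j} q^j with
    q = 2^{-2(s-1)}, hyperbolic area is of order 2^j, and [coef_sum_le] gives
    2^j (j+J)/M. The remaining series in j is a geometric one and its
    derivative. *)
Lemma variance_sum_le t M J s a b z N : cabs z <= t < 1 -> 0 < M -> 1 < s <= 2 -> 0 <= b ->
  (\sum_(n < N) ((coef_weight M J n)^-1)%:E * mean_stat (fun x => (annulus_weight s a b z x ^+ 2 * cabs x ^+ (2 * n))%R)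
     <= (var_bound t M J s)%:E)%E.
Proof.
move=> zt M0 /andP[s1 s2] b0; have t0 := radius_itv zt.
have C1 := dist_up_ge1 t0; have C0 : 0 <= dist_up t by apply: le_trans C1.
have K0 := disk_mass_gt0 (R := R).
have msh : cmeasurable (EFin \o (fun x => annulus_weight s a b z x ^+ 2)).
  by apply/measurable_EFinP; apply: measurable_funX; apply/measurable_EFinP; exact: cmeasurable_annulus_weight.
have mun n : cmeasurable (EFin \o (fun x => annulus_weight s a b z x ^+ 2 * cabs x ^+ (2 * n))).
  apply/measurable_EFinP; apply: measurable_funM; first exact/measurable_EFinP.
  by apply/measurable_EFinP; exact: cmeasurable_cabsX.
have u0 n x : 0 <= annulus_weight s a b z x ^+ 2 * cabs x ^+ (2 * n).
  by rewrite mulr_ge0 ?sqr_ge0// exprn_ge0// cabs_ge0.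
have c0 n : 0 <= (coef_weight M J n)^-1 by rewrite invr_ge0 ltW// coef_weight_gt0.
have e := mean_stat_sum (c := fun n => (coef_weight M J n)^-1) N c0 u0 mun.
pose F x := \sum_(n < N) (coef_weight M J n)^-1 * (annulus_weight s a b z x ^+ 2 * cabs x ^+ (2 * n)).
rewrite -[X in (X <= _)%E]e -/F.
have mF : cmeasurable (EFin \o F).
  apply/measurable_EFinP; apply: measurable_sum => n; apply: measurable_funM => //.
  by apply/measurable_EFinP; exact: mun.
have F0 x : 0 <= F x by apply: sumr_ge0 => n _; rewrite mulr_ge0.
set q := shell_ratio (2 * (s - 1)).
have q01 : 0 <= q < 1 by rewrite ltW ?shell_ratio_gt0//= shell_ratio_lt1// mulr_gt0// subr_gt0.
(* the integrand in hyperbolic measure on shell j, divided by 2^(j+1) *)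
pose be j := dist_up t ^+ 4 * q ^+ j * (16 / (M * disk_mass) * (j + J + 7)%:R).
have be0 j : 0 <= be j.
  have q0 : 0 <= q by case/andP: q01.
  apply: mulr_ge0; first by apply: mulr_ge0; exact: exprn_ge0.
  by apply: mulr_ge0 => //; apply: divr_ge0 => //; apply: mulr_ge0; exact: ltW.
have [B cov] := annulus_weight_cover s a b0 zt.
apply: (@le_trans _ _ (@disk_mass R * \sum_(j < B) be j)%:E).
  apply: mean_stat_shell_le => //.
    move=> x x1 Fx; apply: cov => //; apply: contra_neq Fx => sx0.
    by rewrite /F big1// => n _; rewrite sx0 expr0n mul0r mulr0.
  move=> j x jx; have x1 := shell_disk jx.
  have p0 : 0 < 1 - cabs x ^+ 2 by rewrite subr_gt0 expr_lt1// cabs_ge0.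
  have -> : F x = annulus_weight s a b z x ^+ 2 * \sum_(n < N) (coef_weight M J n)^-1 * cabs x ^+ (2 * n).
    by rewrite mulr_sumr; apply: eq_bigr => n _; rewrite mulrCA.
  have cs := coef_sum_le J N M0 jx.
  have S0 : 0 <= \sum_(n < N) (coef_weight M J n)^-1 * cabs x ^+ (2 * n).
    by apply: sumr_ge0 => n _; rewrite mulr_ge0// exprn_ge0// cabs_ge0.
  have e1 : expR (- (2 * (s - 1)) * poincare z x) <= dist_up t ^+ 2 * q ^+ j.
    by apply: shell_expd_le => //; apply/andP; split; lra.
  have e2 := expd_le zt (x1 : disk x).
  have e3 : annulus_weight s a b z x ^+ 2 <= (dist_up t ^+ 2 * q ^+ j) * ((1 - cabs x ^+ 2) * dist_up t) ^+ 2.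
    apply: (@le_trans _ _ (expR (- s * poincare z x) ^+ 2)).
      by rewrite lerXn2r ?nnegrE ?annulus_weight_ge0 ?expR_ge0// annulus_weight_le_exp.
    rewrite (_ : expR (- s * poincare z x) ^+ 2 =
      expR (- (2 * (s - 1)) * poincare z x) * expR (- poincare z x) ^+ 2); last first.
      by rewrite -!expRM_natl -expRD; congr expR; ring.
    apply: ler_pM; rewrite ?expR_ge0 ?sqr_ge0//.
    rewrite lerXn2r ?nnegrE ?expR_ge0// mulr_ge0// ltW//.
  rewrite mulrAC; apply: (@le_trans _ _ ((dist_up t ^+ 4 * q ^+ j) * (16 / (M * disk_mass) * (j + J + 7)%:R * 2 ^+ j.+1))).
    apply: ler_pM => //; first by rewrite divr_ge0 ?sqr_ge0.
    rewrite ler_pdivrMr ?exprn_gt0//; apply: (le_trans e3).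
    by rewrite le_eqVlt; apply/orP; left; apply/eqP; ring.
  by rewrite /be mulrA.
rewrite lee_fin /var_bound -/q mulr_sumr.
have -> : \sum_(j < B) @disk_mass R * be j = 16 * dist_up t ^+ 4 / M * \sum_(j < B) ((J + 7)%:R * q ^+ j + j%:R * q ^+ j).
  rewrite mulr_sumr; apply: eq_bigr => j _; rewrite /be -addnA natrD.
  by move: (q ^+ j) => Q; field; rewrite !gt_eqF.
apply: ler_wpM2l; first by pos.
rewrite big_split/= -mulr_sumr; apply: lerD; last exact: geom_natl_le.
by apply: ler_wpM2l => //; exact: geom_le.
Qed.

Lemma mean_stat_annulus_weight_le t s a b z : cabs z <= t < 1 -> 1 < s <= 2 -> 0 <= b ->
  (mean_stat (annulus_weight s a b z) <= (@disk_mass R * dist_up t ^+ 3 / (1 - shell_ratio (s - 1)))%:E)%E.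
Proof.
move=> zt /andP[s1 s2] b0; have t0 := radius_itv zt.
have C1 := dist_up_ge1 t0; have C0 : 0 <= dist_up t by apply: le_trans C1.
have K0 := disk_mass_gt0 (R := R).
set q := shell_ratio (s - 1).
have q01 : 0 <= q < 1 by rewrite ltW ?shell_ratio_gt0//= shell_ratio_lt1// subr_gt0.
have [B cov] := annulus_weight_cover s a b0 zt.
apply: (@le_trans _ _ (@disk_mass R * \sum_(j < B) dist_up t ^+ 3 * q ^+ j)%:E).
  apply: (@mean_stat_shell_le _ _ (fun j => dist_up t ^+ 3 * q ^+ j)) => //.
  - exact: cmeasurable_annulus_weight.
  - exact: annulus_weight_ge0.
  - by move=> j; rewrite mulr_ge0 ?exprn_ge0//; case/andP: q01.
  move=> j x jx; have x1 := shell_disk jx.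
  have p0 : 0 < 1 - cabs x ^+ 2 by rewrite subr_gt0 expr_lt1// cabs_ge0.
  have e1 : expR (- (s - 1) * poincare z x) <= dist_up t ^+ 2 * q ^+ j.
    by apply: shell_expd_le => //; apply/andP; split; lra.
  have e2 := expd_le zt (x1 : disk x).
  apply: (@le_trans _ _ ((dist_up t ^+ 2 * q ^+ j) * ((1 - cabs x ^+ 2) * dist_up t) * (1 - cabs x ^+ 2) ^- 2)).
    apply: ler_wpM2r; first by rewrite invr_ge0 sqr_ge0.
    apply: (le_trans (annulus_weight_le_exp _ _ _ _ _)).
    rewrite (_ : - s * poincare z x = - (s - 1) * poincare z x + - poincare z x); last by ring.
    by rewrite expRD; apply: ler_pM; rewrite ?expR_ge0.
  have -> : (dist_up t ^+ 2 * q ^+ j) * ((1 - cabs x ^+ 2) * dist_up t) * (1 - cabs x ^+ 2) ^- 2 =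
     dist_up t ^+ 3 * q ^+ j * (1 - cabs x ^+ 2)^-1.
    by move: (q ^+ j) => Q; field; rewrite gt_eqF.
  apply: ler_wpM2l; first by rewrite mulr_ge0 ?exprn_ge0//; case/andP: q01.
  rewrite -(@ler_pM2r _ (halfpow j.+1)) ?halfpow_gt0// pow2_halfpow ler_pdivrMl// mulr1 ltW//.
  by case/andP: jx.
rewrite lee_fin -[leRHS]mulrA; apply: ler_wpM2l; first exact: ltW.
by rewrite -mulr_sumr; apply: ler_wpM2l; [exact: exprn_ge0|exact: geom_le].
Qed.

Definition exp_weight s z x : R := (cabs x < 1)%R%:R * expR (- s * poincare z x).

Lemma exp_weight_ge0 s z x : 0 <= exp_weight s z x. Proof. by rewrite mulr_ge0 ?expR_ge0. Qed.

Lemma annulus_weight_exp_weight s k z x : disk z -> annulus_weight s 0 k z x = (poincare z x < k)%R%:R * exp_weight s z x.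
Proof.
move=> zd; rewrite /annulus_weight /exp_weight; case: ltP => [x1|_]; last by rewrite !mul0r mulr0.
by rewrite !mul1r poincareE pdist_ge0// mobius_itv.
Qed.

Lemma cvg_annulus_weight_exp_weight s z x : disk z -> annulus_weight s 0 k%:R z x @[k --> \oo] --> exp_weight s z x.
Proof.
move=> zd; have FF : Filter (\oo : set_system nat) by exact: eventually_filter.
apply: cvg_near_cst; exists (Num.truncn (`|poincare z x|)).+1 => // k /= hk.
rewrite annulus_weight_exp_weight//; have -> : poincare z x < k%:R; last by rewrite mul1r.
apply: (le_lt_trans (ler_norm _)).
have /andP[_ h] := truncn_itv (normr_ge0 (poincare z x)).
by apply: lt_le_trans h _; rewrite ler_nat.
Qed.

Lemma cmeasurable_exp_weight s z : disk z -> cmeasurable (EFin \o exp_weight s z).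
Proof.
move=> zd; apply/measurable_EFinP.
apply: (@measurable_fun_cvg _ _ _ _ (fun k (p : plane R) => annulus_weight s 0 k%:R z (to_complex p))) => //.
  by move=> k; apply/measurable_EFinP; exact: cmeasurable_annulus_weight.
by move=> p _; exact: cvg_annulus_weight_exp_weight.
Qed.

Lemma mean_stat_annulus_weight_cvg s z : disk z -> mean_stat (annulus_weight s 0 k%:R z) @[k --> \oo] --> mean_stat (exp_weight s z).
Proof.
move=> zd; rewrite /mean_stat.
apply: cvgeZl => //.
pose g k (p : plane R) := (annulus_weight s 0 k%:R z (to_complex p) * hypdens (to_complex p))%:E.
have nd p : setT p -> {homo g^~ p : k l / (k <= l)%N >-> (k <= l)%E}.
  move=> _ k l kl; rewrite lee_fin; apply: ler_wpM2r; first exact: hypdens_ge0.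
  rewrite !annulus_weight_exp_weight//; apply: ler_wpM2r; first exact: exp_weight_ge0.
  have [h|_] := ltP (poincare z (to_complex p)) k%:R; last by [].
  by rewrite (lt_le_trans h) ?ler_nat.
have mg k : measurable_fun setT (g k) by exact: (cmeasurable_hyp (@cmeasurable_annulus_weight R s 0 k%:R z)).
have g0 k p : setT p -> (0 <= g k p)%E by rewrite lee_fin mulr_ge0 ?hypdens_ge0 ?annulus_weight_ge0.
have := cvg_monotone_convergence (mu := lam) measurableT mg g0 nd.
rewrite /cint (eq_integral (fun p : plane R => (exp_weight s z (to_complex p) * hypdens (to_complex p))%:E))//.
move=> p _; apply: cvg_lim => //; apply: cvg_EFin; first exact: nearW.
by apply: cvgM; [exact: cvg_annulus_weight_exp_weight|exact: cvg_cst].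
Qed.

End VarianceBounds.

(** * The mean, and the variance relative to it *)

Section MeanBounds.
Context {R : realType}.
Implicit Types (z x : R[i]) (F u : R[i] -> R) (s t a b M : R).

Lemma mean_stat_annulus_weight_fin s z : 1 < s -> disk z -> exists C : R, forall a k, 0 <= k -> (mean_stat (annulus_weight s a k z) <= C%:E)%E.
Proof.
move=> s1 zd.
pose s' := Num.min s 2.
have s1' : 1 < s' <= 2 by rewrite lt_min s1 ge_min lexx orbT (_ : 1 < 2)// ltr1n.
have zt : cabs z <= cabs z < 1 by rewrite lexx.
exists (@disk_mass R * dist_up (cabs z) ^+ 3 / (1 - shell_ratio (s' - 1))) => a k k0.
apply: le_trans (mean_stat_annulus_weight_le a zt s1' k0); apply: le_mean_stat.
- exact: cmeasurable_annulus_weight.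
- exact: cmeasurable_annulus_weight.
- exact: annulus_weight_ge0.
move=> x; rewrite /annulus_weight; case: ltP => [x1|_]; last by rewrite !mul0r.
apply: ler_wpM2l => //; apply: ler_wpM2l => //; rewrite ler_expR !mulNr lerN2.
apply: ler_wpM2r; first by rewrite poincareE pdist_ge0// mobius_itv.
by rewrite ge_min lexx.
Qed.

Lemma mean_stat_exp_weight_fin s z : 1 < s -> disk z -> mean_stat (exp_weight s z) \is a fin_num.
Proof.
move=> s1 zd; have [C hC] := mean_stat_annulus_weight_fin s1 zd.
rewrite ge0_fin_numE; last by apply: mean_stat_ge0 => x; exact: exp_weight_ge0.
apply: (@le_lt_trans _ _ C%:E); last by rewrite ltry.
have cv := @mean_stat_annulus_weight_cvg R s z zd; rewrite -(cvg_lim _ cv)//.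
apply: lime_le; first by apply/cvg_ex; eexists; exact: cv.
by apply: nearW => k; exact: hC.
Qed.

(** Each shell contributes at least a constant times q^j, q = 2^{-(s-1)}; for
    s <= 2 finitely many shells already give half of the geometric series. *)
Lemma mean_stat_exp_weight_ge t s z : cabs z <= t < 1 -> 1 < s <= 2 ->
  ((@disk_mass R * dist_low t ^+ 2 / 8 / (1 - shell_ratio (s - 1)))%:E <= mean_stat (exp_weight s z))%E.
Proof.
move=> zt /andP[s1 s2]; have t0 := radius_itv zt.
have /andP[C0 C1] := dist_low_itv t0.
have K0 := disk_mass_gt0 (R := R).
have zd : disk z by case/andP: zt => zt; exact: le_lt_trans.
set q := shell_ratio (s - 1).
have q0 : 0 < q := shell_ratio_gt0 _.
have q1 : q < 1 by rewrite shell_ratio_lt1// subr_gt0.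
have qh : 2^-1 <= q.
  rewrite /q /shell_ratio -[leLHS](lnK (_ : 2^-1 \is Num.pos)) ?posrE// lnV ?posrE// ler_expR mulNr lerN2.
  by rewrite ler_piMl ?ln_ge0 ?ler1n//; lra.
(* B shells carry at least half of the geometric series *)
have [B hB] : exists B, q ^+ B <= 2^-1.
  have : q ^+ n @[n --> \oo] --> (0 : R) by apply: cvg_expr; rewrite ger0_norm// ltW.
  move=> /cvgrPdist_le/(_ 2^-1); rewrite invr_gt0 ltr0n => /(_ isT)[B _ /(_ B (leqnn B))/=].
  by move=> h; exists B; apply: le_trans h; rewrite sub0r normrN; exact: ler_norm.
pose be j := dist_low t ^+ 2 * q ^+ j.+1 / 2.
apply: (@le_trans _ _ (@disk_mass R * \sum_(j < B) be j)%:E); last first.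
  apply: mean_stat_shell_ge.
  - exact: cmeasurable_exp_weight.
  - exact: exp_weight_ge0.
  - by move=> j; rewrite divr_ge0// mulr_ge0// exprn_ge0// ltW.
  move=> j x jx; have x1 := shell_disk jx.
  have p0 : 0 < 1 - cabs x ^+ 2 by rewrite subr_gt0 expr_lt1// cabs_ge0.
  have e1 : dist_low t * q ^+ j.+1 <= expR (- (s - 1) * poincare z x).
    by apply: shell_expd_ge => //; apply/andP; split; lra.
  have e2 := expd_ge zt (x1 : disk x).
  apply: (@le_trans _ _ ((dist_low t * q ^+ j.+1) * ((1 - cabs x ^+ 2) * dist_low t) * (1 - cabs x ^+ 2) ^- 2)); last first.
    apply: ler_wpM2r; first by rewrite invr_ge0 sqr_ge0.
    rewrite /exp_weight x1 mul1r.
    rewrite (_ : - s * poincare z x = - (s - 1) * poincare z x + - poincare z x); last by ring.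
    rewrite expRD; apply: ler_pM => //; first by rewrite mulr_ge0 ?exprn_ge0// ltW.
    by rewrite mulr_ge0// ltW.
  have -> : (dist_low t * q ^+ j.+1) * ((1 - cabs x ^+ 2) * dist_low t) * (1 - cabs x ^+ 2) ^- 2 =
     dist_low t ^+ 2 * q ^+ j.+1 * (1 - cabs x ^+ 2)^-1.
    by move: (q ^+ j.+1) => Q; field; rewrite gt_eqF.
  have -> : be j * 2 ^+ j.+1 = dist_low t ^+ 2 * q ^+ j.+1 * 2 ^+ j.
    by rewrite /be (exprS 2 j); field.
  apply: ler_wpM2l; first by rewrite mulr_ge0 ?exprn_ge0// ltW.
  rewrite -(@ler_pM2r _ (halfpow j)) ?halfpow_gt0// pow2_halfpow mulrC ler_pdivlMr// mul1r.
  by case/andP: jx.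
rewrite lee_fin (_ : disk_mass * dist_low t ^+ 2 / 8 / (1 - q) = disk_mass * (dist_low t ^+ 2 * (8^-1 / (1 - q)))); last by ring.
apply: ler_wpM2l; first exact: (ltW K0).
have -> : \sum_(j < B) be j = dist_low t ^+ 2 * (q / 2 * ((1 - q ^+ B) / (1 - q))).
  have -> : (1 - q ^+ B) / (1 - q) = \sum_(j < B) q ^+ j.
    apply: (@mulIf _ (1 - q)); first by rewrite gt_eqF// subr_gt0.
    rewrite divfK; last by rewrite gt_eqF// subr_gt0.
    elim: B {hB} => [|m ih]; first by rewrite big_ord0 mul0r expr0 subrr.
    by rewrite big_ord_recr/= mulrDl -ih exprS; ring.
  by rewrite mulr_sumr mulr_sumr; apply: eq_bigr => j _; rewrite /be (exprS q j); move: (q ^+ j) => Q; field.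
apply: ler_wpM2l; first exact: exprn_ge0 (ltW C0).
rewrite mulrA; apply: ler_wpM2r; first by rewrite invr_ge0 subr_ge0 ltW.
have : 0 <= (q - 2^-1) * (1 - q ^+ B) by rewrite mulr_ge0//; lra.
move: (q ^+ B) hB => Q hB; lra.
Qed.

(** The mean grows like 1/(s-1), so its square absorbs the leading term of the
    variance bound with the factor 1/M; the term with J is of lower
    order. *)
Lemma variance_over_mean t : 0 <= t < 1 -> exists2 D : R, 0 < D & forall M J s z, 0 < M -> 1 < s <= 2 ->
  cabs z <= t ->
  0 < fine (mean_stat (exp_weight s z)) /\
  var_bound t M J s <= D / M * ((J + 7)%:R * (1 - shell_ratio (s - 1)) + 1) * fine (mean_stat (exp_weight s z)) ^+ 2.
Proof.
move=> t0; have /andP[C0 C1] := dist_low_itv t0; have K0 := disk_mass_gt0 (R := R).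
have CC := dist_up_ge1 t0; have CC0 : 0 < dist_up t by apply: lt_le_trans CC.
pose G := @disk_mass R * dist_low t ^+ 2 / 8.
have G0 : 0 < G by rewrite /G; pos.
exists (16 * dist_up t ^+ 4 / G ^+ 2); first by pos.
move=> M J s z M0 s12 zt; have zt1 : cabs z <= t < 1 by rewrite zt; case/andP: t0.
have zd : disk z by case/andP: zt1 => ?; exact: le_lt_trans.
have fin := mean_stat_exp_weight_fin (proj1 (andP s12)) zd.
have := mean_stat_exp_weight_ge zt1 s12; rewrite -/G -(fineK fin) lee_fin.
set g := fine _; set r := 1 - shell_ratio (s - 1) => hg.
case/andP: (s12) => s1 s2.
have r0 : 0 < r by rewrite subr_gt0 shell_ratio_lt1// subr_gt0.
have g0 : 0 < g by apply: lt_le_trans hg; rewrite divr_gt0.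
split=> //.
have q2 : shell_ratio (2 * (s - 1)) = shell_ratio (s - 1) ^+ 2.
  by rewrite /shell_ratio -expRM_natl; congr expR; ring.
have rq : r <= 1 - shell_ratio (2 * (s - 1)).
  rewrite q2 /r; have := shell_ratio_gt0 (s - 1); move: r0; rewrite /r; move: (shell_ratio _) => q h1 h2.
  have : 0 <= q * (1 - q) by rewrite mulr_ge0// ltW.
  lra.
set w := 1 - shell_ratio (2 * (s - 1)) in rq *.
rewrite /var_bound -/w.
have -> : 16 * dist_up t ^+ 4 / G ^+ 2 / M * ((J + 7)%:R * r + 1) * g ^+ 2 =
  16 * dist_up t ^+ 4 / M * (((J + 7)%:R * r + 1) * (g / G) ^+ 2).
  by field; rewrite !gt_eqF.
apply: ler_wpM2l; first by pos.
have gG : r^-1 <= g / G by rewrite ler_pdivlMr// mulrC.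
have w0 : 0 < w by apply: lt_le_trans rq.
have wr : w^-1 <= r^-1 by rewrite lef_pV2 ?posrE.
apply: (@le_trans _ _ (((J + 7)%:R * r + 1) * (r^-1) ^+ 2)); last first.
  apply: ler_wpM2l; first by rewrite addr_ge0// mulr_ge0// ltW.
  apply: lerXn2r => //; rewrite nnegrE; first by rewrite invr_ge0 ltW.
  by pos.
have -> : ((J + 7)%:R * r + 1) * r^-1 ^+ 2 = (J + 7)%:R / r + r^-1 ^+ 2 by field; rewrite gt_eqF.
apply: lerD; first by apply: ler_wpM2l.
by rewrite -exprVn; apply: lerXn2r => //; rewrite nnegrE invr_ge0 ltW.
Qed.

End MeanBounds.

(** * Super-critical weights on the dyadic shells *)

Section SuperCritical.
Context {R : realType}.
Implicit Types (z x : R[i]) (W : R[i] -> R) (f : R[i] -> R[i]).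

Lemma ln_quot_le (p : R) j : halfpow j.+1 < p -> ln (4 / p) <= (j + 3)%:R.
Proof.
move=> p1; have p0 : 0 < p by apply: lt_trans p1; exact: halfpow_gt0.
have ln2 : ln 2 <= 1 :> R.
  by have := @le_ln1Dx R 1 _; rewrite (_ : 1 + 1 = 2)//; apply; lra.
apply: (@le_trans _ _ (ln ((2 : R) ^+ (j.+1 + 2)))); last first.
  rewrite lnXn// (_ : (j.+1 + 2 = j + 3)%N); last by rewrite addSnnS.
  by rewrite -[leLHS]mulr_natl ler_piMr.
rewrite ler_ln ?posrE ?divr_gt0 ?exprn_gt0// ler_pdivrMr//.
have h1 : 1 <= 2 ^+ j.+1 * p.
  rewrite -[leLHS](pow2_halfpow j.+1); apply: ler_wpM2l; last exact: ltW.
  by rewrite exprn_ge0.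
have e4 : (2 : R) ^+ 2 = 4 by rewrite -natrX.
by rewrite exprD e4 mulrAC -[leLHS]mul1r ler_wpM2r.
Qed.

(** On shell j the critical weight is at least 2^j / (j+3)^2, because
    log (4/(1-|x|^2)) <= j+3 there. *)
Lemma super_critical_shell W (M : R) : super_critical W -> exists J : nat,
  forall J', (J <= J')%N -> forall j x, (J' <= j)%N -> in_shell j x ->
  M * 2 ^+ j / (j + 3)%:R ^+ 2 <= W x.
Proof.
move=> [_ W0 hM]; have [r r1 hr] := hM M.
pose r' := Num.max r 0.
have r'1 : 0 <= r' < 1 by rewrite le_max lexx orbT/= gt_max r1 ltr01.
have d0 : 0 < 1 - r' ^+ 2 by rewrite subr_gt0 expr_lt1//; case/andP: r'1.
have [J hJ] : exists J, halfpow J < 1 - r' ^+ 2.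
  have : (2^-1 : R) ^+ n @[n --> \oo] --> (0 : R).
    by apply: cvg_expr; rewrite ger0_norm ?invr_ge0// invf_lt1// ltr1n.
  move=> /cvgrPdist_lt/(_ _ d0)[B _ /(_ B (leqnn B))/= h].
  by exists B; apply: le_lt_trans h; rewrite sub0r normrN; exact: ler_norm.
exists J => J' JJ' j x Jj jx.
have xd : disk x := shell_disk jx.
case/andP: (jx) => p1 p2.
have hj : halfpow j <= halfpow J :> R.
  by rewrite /halfpow ler_wiXn2l ?invr_ge0// ?invf_le1 ?ler1n// (leq_trans JJ').
have rx : r < cabs x.
  apply: (@le_lt_trans _ _ r'); first by rewrite le_max lexx.
  rewrite -(ltr_pXn2r (ltn0Sn 1)) ?nnegrE ?cabs_ge0//; last by case/andP: r'1.
  lra.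
have := hr x; rewrite rx xd => /(_ isT); rewrite /critical_weight invrK => h.
have Wx := W0 x xd.
move: p1 p2 h; set p := 1 - cabs x ^+ 2 => p1 p2 h.
have p0 : 0 < p by apply: lt_trans p1; exact: halfpow_gt0.
have l0 : 0 <= ln (4 / p).
  rewrite ln_ge0// ler_pdivlMr// mul1r; apply: (le_trans p2).
  by apply: (le_trans (halfpow_le1 _)); rewrite ler1n.
have l1 := ln_quot_le p1.
have hh : M <= W x * (halfpow j * (j + 3)%:R ^+ 2).
  apply: (le_trans (ltW h)); apply: ler_wpM2l => //.
  by apply: ler_pM; rewrite ?sqr_ge0 ?(ltW p0)// lerXn2r ?nnegrE.
have j3 : 0 < (j + 3)%:R ^+ 2 :> R by rewrite exprn_gt0// ltr0n addnS.
rewrite ler_pdivrMr// -(@ler_pM2r _ (halfpow j)) ?halfpow_gt0// -mulrA pow2_halfpow mulr1.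
by apply: (le_trans hh); rewrite le_eqVlt; apply/orP; left; apply/eqP; ring.
Qed.

End SuperCritical.

(** * Statistics of power series *)

Section ComplexStatistics.
Context {R : realType}.
Implicit Types (X : conf R) (z x : R[i]) (w : R[i] -> R) (f h : R[i] -> R[i]) (s a b t : R).

Definition clin_stat w f X rho : R[i] :=
  \sum_(x <- pts X rho) real_complex R ((X x)%:R * w x) * f x.

Lemma clin_stat_ReIm w f X rho : rho < 1 -> supp_in rho w ->
  complex.Re (clin_stat w f X rho) = lin_stat (fun x => w x * complex.Re (f x)) X /\
  complex.Im (clin_stat w f X rho) = lin_stat (fun x => w x * complex.Im (f x)) X.
Proof.
move=> r1 ws.
have ReZ (k : R) (u : R[i]) : complex.Re (real_complex R k * u) = k * complex.Re u.
  by case: u => u v /=; rewrite mul0r subr0.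
have ImZ (k : R) (u : R[i]) : complex.Im (real_complex R k * u) = k * complex.Im u.
  by case: u => u v /=; rewrite mul0r addr0.
split; rewrite (lin_stat_pts X r1) /clin_stat ?raddf_sum/=; try by apply: supp_inM.
  by apply: eq_bigr => x _; rewrite ReZ mulrA.
by apply: eq_bigr => x _; rewrite ImZ mulrA.
Qed.

Lemma clin_stat_psum w X rho (cf : nat -> R[i]) m :
  clin_stat w (psum cf m) X rho = \sum_(n < m) cf n * clin_stat w (fun x => x ^+ n) X rho.
Proof.
rewrite /clin_stat /psum; under eq_bigr do rewrite mulr_sumr.
rewrite exchange_big/=; apply: eq_bigr => n _; rewrite mulr_sumr.
by apply: eq_bigr => x _; rewrite mulrCA.
Qed.

Lemma cvg_sumC (T : Type) (F : set_system T) (FF : Filter F) (I : eqType) (r : seq I)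
    (u : I -> T -> R[i]) (l : I -> R[i]) :
  (forall i, i \in r -> u i @ F --> l i) ->
  (\sum_(i <- r) u i t) @[t --> F] --> \sum_(i <- r) l i.
Proof.
elim: r => [_|i r ih h].
  by under eq_cvg do rewrite big_nil; rewrite big_nil; exact: cvg_cst.
under eq_cvg do rewrite big_cons; rewrite big_cons.
apply: (cvgcD FF); first by apply: h; rewrite mem_head.
by apply: ih => j jr; apply: h; rewrite inE jr orbT.
Qed.

Lemma cvg_clin_stat w f X rho (cf : nat -> R[i]) : rho < 1 ->
  (forall x, disk x -> psum cf m x @[m --> \oo] --> f x) ->
  clin_stat w (psum cf m) X rho @[m --> \oo] --> clin_stat w f X rho.
Proof.
move=> r1 hf; have FF : Filter (\oo : set_system nat) by exact: eventually_filter.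
apply: (cvg_sumC FF) => x; rewrite mem_pts// => /andP[xr _].
by apply: (cvgcM FF (cvg_cst _)); apply: hf; exact: le_lt_trans r1.
Qed.

(** The quadratic polynomial l -> sum c_n^{-1} (u_n c_n l - v_n)^2 is nonnegative;
    evaluate it at its minimum. *)
Lemma cauchy_schwarz_weighted (u v c : nat -> R) N : (forall n, 0 < c n) ->
  (\sum_(n < N) u n * v n) ^+ 2 <= (\sum_(n < N) u n ^+ 2 * c n) * (\sum_(n < N) (c n)^-1 * v n ^+ 2).
Proof.
move=> c0; set A := \sum_(n < N) u n ^+ 2 * c n; set B := \sum_(n < N) (c n)^-1 * v n ^+ 2.
set S := \sum_(n < N) u n * v n.
have A0 : 0 <= A by apply: sumr_ge0 => n _; rewrite mulr_ge0 ?sqr_ge0// ltW.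
have q (l : R) : 0 <= A * l ^+ 2 - S * l *+ 2 + B.
  rewrite (_ : _ + B = \sum_(n < N) (c n)^-1 * (u n * c n * l - v n) ^+ 2).
    by apply: sumr_ge0 => n _; rewrite mulr_ge0 ?sqr_ge0// invr_ge0 ltW.
  rewrite /A /S /B !mulr_suml -sumrMnl -sumrB -big_split/=; apply: eq_bigr => n _.
  by have := c0 n => cn; field; rewrite gt_eqF.
have [A00|A1] := eqVneq A 0.
  rewrite A00 mul0r; have [->|S0] := eqVneq S 0; first by rewrite expr0n.
  have := q ((B + 1) / S); rewrite A00 mul0r sub0r [S * _]mulrC divfK// => h.
  have B0 : 0 <= B by apply: sumr_ge0 => n _; rewrite mulr_ge0 ?sqr_ge0// invr_ge0 ltW.
  exfalso; lra.
have Ap : 0 < A by rewrite lt_neqAle eq_sym A1.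
have := q (S / A); rewrite (_ : _ + B = B - S ^+ 2 / A); last by field.
by rewrite subr_ge0 ler_pdivrMr// mulrC.
Qed.

Definition clin_dev s a b z f X : R[i] :=
  clin_stat (annulus_weight s a b z) f X (safe_radius (cabs z) b) - f z * real_complex R (mean_statr (annulus_weight s a b z)).

Lemma monomial_dev2E s a b z n X : 0 <= b -> disk z ->
  monomial_dev2 s a b z n X = cabs (clin_dev s a b z (fun x => x ^+ n) X) ^+ 2.
Proof.
move=> b0 zd; have zt : cabs z <= cabs z < 1 by rewrite lexx.
have t0 := radius_itv zt.
have [h1 h2] := @clin_stat_ReIm (annulus_weight s a b z) (fun x => x ^+ n) X (safe_radius (cabs z) b)
  (safe_radius_lt1 b0 t0) (@annulus_weight_support R s a b _ z b0 zt).
rewrite /monomial_dev2 cabs2E /clin_dev !raddfB/= -h1 -h2.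
have -> : complex.Re (z ^+ n * real_complex R (mean_statr (annulus_weight s a b z))) = complex.Re (z ^+ n) * mean_statr (annulus_weight s a b z).
  by case: (z ^+ n) => u v /=; rewrite mulr0 subr0.
have -> : complex.Im (z ^+ n * real_complex R (mean_statr (annulus_weight s a b z))) = complex.Im (z ^+ n) * mean_statr (annulus_weight s a b z).
  by case: (z ^+ n) => u v /=; rewrite mulr0 add0r.
by [].
Qed.

(** The bound for the squared deviation, valid for all f in the unit ball
    at once; it no longer involves f. *)
Definition energy (c : nat -> R) s a b z X : \bar R :=
  (\sum_(n <oo) ((c n)^-1 * monomial_dev2 s a b z n X)%:E)%E.

Lemma energy_ge0 c s a b z X : (forall n, 0 < c n) -> (0 <= energy c s a b z X)%E.
Proof.
move=> c0; apply: nneseries_ge0 => n _ _.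
by rewrite lee_fin mulr_ge0 ?monomial_dev2_ge0// invr_ge0 ltW.
Qed.

(** Expand f in its Taylor series, which converges at the finitely many
    particles involved, and apply Cauchy-Schwarz. All coefficient sequences
    are treated at once, for every X. *)
Lemma clin_dev_bound (c : nat -> R) (cf : nat -> R[i]) f (F2 : R) s a b z X :
  (forall n, 0 < c n) -> 0 < F2 ->
  (forall x, disk x -> psum cf m x @[m --> \oo] --> f x) ->
  (forall N, \sum_(n < N) cabs (cf n) ^+ 2 * c n <= F2) ->
  0 <= b -> disk z ->
  ((cabs (clin_dev s a b z f X) ^+ 2)%:E <= F2%:E * energy c s a b z X)%E.
Proof.
move=> c0 F0 hf hF b0 zd.
have zt : cabs z <= cabs z < 1 by rewrite lexx.
have r1 := safe_radius_lt1 b0 (radius_itv zt).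
have Y0 := energy_ge0 s a b z X c0.
have [Yfin|] := boolP (energy c s a b z X \is a fin_num); last first.
  rewrite ge0_fin_numE// -leNgt leye_eq => /eqP ->.
  by rewrite gt0_muley ?leey// lte_fin.
pose Y := fine (energy c s a b z X); rewrite -(fineK Yfin) -/Y -EFinM lee_fin.
have FF : Filter (\oo : set_system nat) by exact: eventually_filter.
have hY N : \sum_(n < N) (c n)^-1 * monomial_dev2 s a b z n X <= Y.
  rewrite -lee_fin /Y fineK// -sumEFin.
  have := @nneseries_lim_ge R (fun n => ((c n)^-1 * monomial_dev2 s a b z n X)%:E) xpredT 0 N.
  rewrite big_mkord; apply => n _; rewrite lee_fin mulr_ge0 ?monomial_dev2_ge0// invr_ge0 ltW//.
have cv : cabs (clin_dev s a b z (psum cf m) X) ^+ 2 @[m --> \oo] --> cabs (clin_dev s a b z f X) ^+ 2.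
  have h1 := @cvg_clin_stat (annulus_weight s a b z) f X _ cf r1 hf.
  have h2 : psum cf m z * real_complex R (mean_statr (annulus_weight s a b z)) @[m --> \oo] -->
      f z * real_complex R (mean_statr (annulus_weight s a b z)).
    exact: (cvgcM FF (hf z zd) (cvg_cst _)).
  have h3 := cvg_cabs FF (cvgcB FF h1 h2).
  by rewrite expr2; under eq_cvg do rewrite expr2; exact: (cvgM h3 h3).
rewrite -(cvg_lim _ cv)//; apply: limr_le; first by apply/cvg_ex; eexists; exact: cv.
apply: nearW => m.
have -> : clin_dev s a b z (psum cf m) X = \sum_(n < m) cf n * clin_dev s a b z (fun x => x ^+ n) X.
  rewrite /clin_dev clin_stat_psum /psum mulr_suml -sumrB; apply: eq_bigr => n _.
  by rewrite mulrBr mulrA.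
apply: (@le_trans _ _ ((\sum_(n < m) cabs (cf n) * cabs (clin_dev s a b z (fun x => x ^+ n) X)) ^+ 2)).
  rewrite lerXn2r ?nnegrE ?cabs_ge0//.
    by apply: sumr_ge0 => n _; rewrite mulr_ge0 ?cabs_ge0.
  by apply: (le_trans (le_cabs_sum _ _ _)); apply: ler_sum => n _; rewrite cabsM.
apply: (le_trans (cauchy_schwarz_weighted (fun n => cabs (cf n)) (fun n => cabs (clin_dev s a b z (fun x => x ^+ n) X)) m c0)).
apply: ler_pM => //.
- by apply: sumr_ge0 => n _; rewrite mulr_ge0 ?sqr_ge0// ltW.
- by apply: sumr_ge0 => n _; rewrite mulr_ge0 ?sqr_ge0// invr_ge0 ltW.
by under eq_bigr do rewrite -monomial_dev2E//; exact: hY.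
Qed.

(** The annuli of the outer series are the truncations with a = k and
    b = k+1. *)
Lemma in_annulus s z x (k : nat) : disk z ->
  ((x \in annulus k z)%:R * expR (- s * poincare z x)) = annulus_weight s k%:R k.+1%:R z x.
Proof.
move=> zd; rewrite /annulus_weight mulrA; congr (_ * _).
rewrite -natrM mulnb; congr (_%:R); congr nat_of_bool.
apply/idP/idP.
  by move=> /set_mem[h1 h2]; apply/andP; split.
by move=> /andP[h1 h2]; apply/mem_set.
Qed.

Lemma g_shell_clin_stat X s z f (k K : nat) : disk z -> (k < K)%N ->
  g_shell X s z f k = clin_stat (annulus_weight s k%:R k.+1%:R z) f X (safe_radius (cabs z) K%:R).
Proof.
move=> zd kK; have zt : cabs z <= cabs z < 1 by rewrite lexx.
have r1 := safe_radius_lt1 (ler0n R K) (radius_itv zt).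
rewrite /g_shell (@fsbig_pts _ _ X (safe_radius (cabs z) K%:R))//.
- rewrite big_mkcond /clin_stat; apply: eq_bigr => x _; rewrite -in_annulus//.
  case: ifP => _; first by rewrite mul1r.
  by rewrite mul0r mulr0 mul0r.
- move=> x [xd /andP[_ h]] _; apply: (safe_radiusP _ zt xd) => //.
  move: h; rewrite poincareE => h; apply: ltW.
  by rewrite -pdist_lt ?mobius_itv// (lt_le_trans h)// ler_nat.
- by move=> x ->; rewrite mul0r mul0r.
Qed.

Lemma annulus_weight_split s (K : nat) z x : disk z -> \sum_(k < K) annulus_weight s k%:R k.+1%:R z x = annulus_weight s 0 K%:R z x.
Proof.
move=> zd; rewrite /annulus_weight -mulr_sumr -mulr_suml.
have [x1|_] := ltP (cabs x) 1; last by rewrite !mul0r.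
congr (_ * (_ * _)).
have d0 : 0 <= poincare z x by rewrite poincareE pdist_ge0// mobius_itv.
rewrite d0/=; elim: K => [|K ih]; first by rewrite big_ord0 ltNge d0.
rewrite big_ord_recr/= ih; case: ltP => h1/=; last by rewrite add0r.
by rewrite (lt_le_trans h1) ?ler_nat// addr0.
Qed.

Lemma series_g_shell X s z f (K : nat) : disk z ->
  series (g_shell X s z f) K = clin_stat (annulus_weight s 0 K%:R z) f X (safe_radius (cabs z) K%:R).
Proof.
move=> zd; rewrite [LHS]big_mkord.
rewrite (eq_bigr (fun k : 'I_K => clin_stat (annulus_weight s k%:R k.+1%:R z) f X (safe_radius (cabs z) K%:R))); last first.
  by move=> k _; exact: g_shell_clin_stat.
rewrite /clin_stat exchange_big/=; apply: eq_bigr => x _.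
by rewrite -mulr_suml -rmorph_sum -mulr_sumr annulus_weight_split.
Qed.

End ComplexStatistics.

(** * Almost sure convergence over the annuli *)

Section RandomSeries.
Context {R : realType}.
Implicit Types (X : conf R) (z x : R[i]) (f : R[i] -> R[i]) (s a b t d V : R) (c : nat -> R).

Lemma cvg_series_geom (u : nat -> R[i]) (C rho : R) : 0 <= rho < 1 ->
  (forall k, cabs (u k) <= C * rho ^+ k) -> cvgn (series u).
Proof.
move=> /andP[r0 r1] uC.
have FF : Filter (\oo : set_system nat) by exact: eventually_filter.
have real (v : nat -> R) : (forall k, `|v k| <= C * rho ^+ k) -> cvgn (series v).
  move=> vC; apply: (@normed_cvg R R v).
  have C0 k : 0 <= C * rho ^+ k by apply: le_trans (vC k).
  apply: (series_le_cvg (v_ := geometric C rho)).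
  - by move=> k; exact: normr_ge0.
  - exact: C0.
  - exact: vC.
  - by apply: is_cvg_geometric_series; rewrite ger0_norm.
have /cvg_ex[l1 h1] : cvgn (series (fun k => complex.Re (u k))).
  by apply: real => k; apply: le_trans (uC k); exact: ler_Re_cabs.
have /cvg_ex[l2 h2] : cvgn (series (fun k => complex.Im (u k))).
  by apply: real => k; apply: le_trans (uC k); exact: ler_Im_cabs.
apply/cvg_ex; exists (Complex l1 l2); apply: (cvg_ReIm FF) => /=.
  by under eq_cvg do rewrite raddf_sum.
by under eq_cvg do rewrite raddf_sum.
Qed.

(** An exponent in (1,s) that also stays below 2, where the variance bound
    applies. *)
Definition mid s : R := (Num.min s 2 + 1) / 2.

Lemma mid_itv s : 1 < s -> 1 < mid s <= 2 /\ mid s < s.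
Proof.
move=> s1; have h : 1 < Num.min s 2 by rewrite lt_min s1 ltr1n.
have h1 : Num.min s 2 <= s by rewrite ge_min lexx.
have h2 : Num.min s 2 <= 2 by rewrite ge_min lexx orbT.
rewrite /mid; move: (Num.min s 2) h h1 h2 => m *.
by split; [apply/andP; split|]; lra.
Qed.

Definition gap s : R := s - mid s.

Lemma gap_gt0 s : 1 < s -> 0 < gap s.
Proof. by move=> /mid_itv[_ h]; rewrite subr_gt0. Qed.

(** On the k-th annulus the weight with exponent s is smaller than the one
    with exponent [mid s] by the factor e^{-k (s - mid s)}. *)
Lemma annulus_weight_gap s (k : nat) z x : 1 < s ->
  annulus_weight s k%:R k.+1%:R z x <= expR (- gap s) ^+ k * annulus_weight (mid s) k%:R k.+1%:R z x.
Proof.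
move=> s1; rewrite /annulus_weight; case: (cabs x < 1); last by rewrite !mul0r mulr0.
case: (boolP (_ && _)) => [/andP[h _]|_]; last by rewrite !mul0r mulr0 mulr0.
rewrite !mul1r -expRM_natl -expRD ler_expR.
have -> : - s * poincare z x = - gap s * poincare z x + - mid s * poincare z x.
  by rewrite /gap; ring.
rewrite lerD2r !mulNr mulrN lerN2 mulrC; apply: ler_wpM2l => //.
by rewrite ltW// gap_gt0.
Qed.

Lemma measurable_energy c s a b z : (forall n, 0 < c n) -> 0 <= a <= b -> disk z ->
  measurable_fun setT (fun X : Conf R => energy c s a b z X).
Proof.
move=> c0 ab zd; apply: (ge0_emeasurable_sum (P := xpredT)).
  by move=> n X _ _; rewrite lee_fin mulr_ge0 ?monomial_dev2_ge0// invr_ge0 ltW.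
by move=> n _; apply/measurable_EFinP; apply: measurable_funM => //; exact: measurable_monomial_dev2.
Qed.

(** The bounds over the annuli, weighted by a growing geometric factor: when
    the sum is finite, the deviation on the k-th annulus decays
    geometrically. *)
Definition shells_energy c s z X : \bar R :=
  (\sum_(k <oo) (expR (gap s) ^+ k)%:E * energy c s k%:R k.+1%:R z X)%E.

Lemma range_succ (k : nat) : 0 <= (k%:R : R) <= k.+1%:R.
Proof. by rewrite ler0n ler_nat leqnSn. Qed.

Lemma measurable_shells_energy c s z : (forall n, 0 < c n) -> disk z ->
  measurable_fun setT (fun X : Conf R => shells_energy c s z X).
Proof.
move=> c0 zd; apply: (ge0_emeasurable_sum (P := xpredT)).
  by move=> n X _ _; rewrite mule_ge0 ?energy_ge0// lee_fin exprn_ge0// expR_ge0.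
by move=> k _; apply: measurable_funeM; apply: measurable_energy => //; exact: range_succ.
Qed.

Variable P : probability (Conf R) R.
Hypothesis hP : determinantal_process P bergman_kernel.

Lemma mean_energy c s a b z (V : \bar R) : (forall n, 0 < c n) -> 0 <= s -> 0 <= a <= b -> disk z ->
  (forall N, \sum_(n < N) ((c n)^-1)%:E * mean_stat (fun x => (annulus_weight s a b z x ^+ 2 * cabs x ^+ (2 * n))%R) <= V)%E ->
  (\int[P]_X energy c s a b z X <= 2%:E * V)%E.
Proof.
move=> c0 s0 ab zd hV.
have ci n : 0 <= (c n)^-1 by rewrite invr_ge0 ltW.
have mt n : measurable_fun setT (fun X : Conf R => (monomial_dev2 s a b z n X)%:E).
  by apply/measurable_EFinP; exact: measurable_monomial_dev2.
rewrite integral_nneseries//; last 2 first.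
- by move=> n; apply/measurable_EFinP; apply: measurable_funM => //; exact: measurable_monomial_dev2.
- by move=> n X _; rewrite lee_fin mulr_ge0 ?monomial_dev2_ge0.
have I0 n : (0 <= \int[P]_X ((c n)^-1 * monomial_dev2 s a b z n X)%:E)%E.
  by apply: integral_ge0 => X _; rewrite lee_fin mulr_ge0 ?monomial_dev2_ge0.
apply: lime_le; first exact: is_cvg_nneseries.
apply: nearW => N; rewrite big_mkord.
apply: le_trans (lee_wpmul2l _ (hV N)) => //; rewrite ge0_sume_distrr; last first.
  by move=> n _; rewrite mule_ge0 ?lee_fin ?mean_stat_ge0// => x; rewrite mulr_ge0 ?sqr_ge0 ?exprn_ge0 ?cabs_ge0.
apply: lee_sum => n _; under eq_integral do rewrite EFinM.
have h0 X : setT X -> (0 <= (monomial_dev2 s a b z n X)%:E)%E by rewrite lee_fin monomial_dev2_ge0.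
have h1 : (0 <= ((c n)^-1)%:E)%E by rewrite lee_fin.
rewrite (ge0_integralZl P measurableT (mt n) h0 h1) muleCA; apply: lee_wpmul2l => //.
exact: (mean_monomial_dev2 hP).
Qed.

(** The k-th energy scales with the square of the factor in
    [annulus_weight_gap], which beats the growing weight; the rest is bounded at the exponent
    [mid s]. *)
Lemma mean_shells_energy c s z V : (forall n, 0 < c n) -> 1 < s -> disk z -> 0 <= V ->
  (forall (k N : nat), \sum_(n < N) ((c n)^-1)%:E *
     mean_stat (fun x => (annulus_weight (mid s) k%:R k.+1%:R z x ^+ 2 * cabs x ^+ (2 * n))%R) <= V%:E)%E ->
  (\int[P]_X shells_energy c s z X <= (2 * V / (1 - expR (- gap s)))%:E)%E.
Proof.
move=> c0 s1 zd V0 hV.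
have q0 : 0 <= expR (- gap s) by exact: expR_ge0.
have q1 : expR (- gap s) < 1 by rewrite expR_lt1 oppr_lt0 gap_gt0.
set q := expR (- gap s) in q0 q1 *.
have ci n : 0 <= (c n)^-1 by rewrite invr_ge0 ltW.
have Y k : (\int[P]_X energy c s k%:R k.+1%:R z X <= 2%:E * ((q ^+ k) ^+ 2 * V)%:E)%E.
  apply: mean_energy => //; [by rewrite ltW// (lt_trans ltr01)|exact: range_succ|].
  move=> N; apply: (@le_trans _ _ (((q ^+ k) ^+ 2)%:E * \sum_(n < N) ((c n)^-1)%:E *
     mean_stat (fun x => (annulus_weight (mid s) k%:R k.+1%:R z x ^+ 2 * cabs x ^+ (2 * n))%R))%E); last first.
    by rewrite [leRHS]EFinM; apply: lee_wpmul2l; [rewrite lee_fin sqr_ge0|exact: hV].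
  have u0 s' n x : 0 <= annulus_weight s' k%:R k.+1%:R z x ^+ 2 * cabs x ^+ (2 * n).
    by rewrite mulr_ge0 ?sqr_ge0 ?exprn_ge0 ?cabs_ge0.
  rewrite ge0_sume_distrr; last by move=> n _; rewrite mule_ge0 ?lee_fin ?mean_stat_ge0.
  have mu s' n : cmeasurable (EFin \o (fun x => annulus_weight s' k%:R k.+1%:R z x ^+ 2 * cabs x ^+ (2 * n))).
    apply/measurable_EFinP; apply: measurable_funM.
      by apply: measurable_funX; apply/measurable_EFinP; exact: cmeasurable_annulus_weight.
    by apply/measurable_EFinP; exact: cmeasurable_cabsX.
  apply: lee_sum => n _; rewrite [leRHS]muleCA; apply: lee_wpmul2l; first by rewrite lee_fin.
  have := mean_stat_sum (c := fun=> (q ^+ k) ^+ 2) (u := fun _ x => annulus_weight (mid s) k%:R k.+1%:R z x ^+ 2 * cabs x ^+ (2 * n)) 1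
    (fun=> sqr_ge0 _) (fun=> u0 _ _) (fun=> mu _ _).
  rewrite big_ord1 => <-; apply: le_mean_stat => //.
    under eq_fun do rewrite big_ord1; apply/measurable_EFinP; apply: measurable_funM => //.
    by apply/measurable_EFinP; exact: (mu (mid s) n).
  move=> x; rewrite big_ord1 mulrA; apply: ler_wpM2r; first by rewrite exprn_ge0// cabs_ge0.
  rewrite -exprMn lerXn2r ?nnegrE ?annulus_weight_ge0 ?mulr_ge0 ?exprn_ge0 ?annulus_weight_ge0//.
  exact: annulus_weight_gap.
have mY k : measurable_fun setT (fun X : Conf R => energy c s k%:R k.+1%:R z X).
  by apply: measurable_energy => //; exact: range_succ.
have e0 k : (0 <= (expR (gap s) ^+ k)%:E)%E by rewrite lee_fin exprn_ge0// expR_ge0.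
rewrite integral_nneseries//; last 2 first.
- by move=> k; exact: measurable_funeM.
- by move=> k X _; rewrite mule_ge0 ?energy_ge0.
apply: lime_le.
  by apply: is_cvg_nneseries => k _ _; apply: integral_ge0 => X _; rewrite mule_ge0 ?energy_ge0.
apply: nearW => N; rewrite big_mkord.
apply: (@le_trans _ _ (\sum_(k < N) (2 * V * q ^+ k)%:E)%E).
  apply: lee_sum => k _.
  rewrite (ge0_integralZl P measurableT (mY k) (fun X _ => energy_ge0 _ _ _ _ _ c0) (e0 k)).
  apply: (le_trans (lee_wpmul2l (e0 k) (Y k))).
  rewrite -!EFinM lee_fin (_ : expR (gap s) ^+ k * _ = 2 * V * q ^+ k * (expR (gap s) * q) ^+ k).
    by rewrite /q -expRD subrr expR0 expr1n mulr1.
  by rewrite exprMn; ring.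
rewrite sumEFin lee_fin -mulr_sumr; apply: ler_wpM2l; first by rewrite mulr_ge0.
by apply: geom_le; rewrite q0.
Qed.

(** Each annulus contributes its deviation and f(z) times its mean; both are
    geometrically small in k. *)
Lemma shells_converge c (cf : nat -> R[i]) f (F2 : R) s z X :
  (forall n, 0 < c n) -> 0 < F2 ->
  (forall x, disk x -> psum cf m x @[m --> \oo] --> f x) ->
  (forall N, \sum_(n < N) cabs (cf n) ^+ 2 * c n <= F2) ->
  1 < s -> disk z -> (shells_energy c s z X < +oo)%E ->
  g_sum_converges X s z f.
Proof.
move=> c0 F0 hf hF s1 zd Tfin.
have e0 (k : nat) : (0 <= (expR (gap s) ^+ k)%:E :> \bar R)%E by rewrite lee_fin exprn_ge0// expR_ge0.
have T0 : (0 <= shells_energy c s z X)%E by apply: nneseries_ge0 => k _ _; rewrite mule_ge0 ?energy_ge0.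
have Tf : shells_energy c s z X \is a fin_num by rewrite ge0_fin_numE.
pose T := fine (shells_energy c s z X).
have T0' : 0 <= T by exact: fine_ge0.
set q := expR (- gap s).
have q0 : 0 <= q by exact: expR_ge0.
have q1 : q < 1 by rewrite expR_lt1 oppr_lt0 gap_gt0.
have YT (k : nat) : (energy c s k%:R k.+1%:R z X <= (q ^+ k * T)%:E)%E.
  have h : ((expR (gap s) ^+ k)%:E * energy c s k%:R k.+1%:R z X <= T%:E)%E.
    rewrite fineK//; have := @nneseries_lim_ge R (fun k => (expR (gap s) ^+ k)%:E * energy c s k%:R k.+1%:R z X)%E xpredT 0 k.+1.
    move=> /(_ (fun k _ _ => mule_ge0 (e0 k) (energy_ge0 _ _ _ _ _ c0))).
    apply: le_trans; rewrite big_nat_recr//=; apply: leeDr.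
    by apply: sume_ge0 => i _; rewrite mule_ge0 ?energy_ge0.
  have := lee_wpmul2l (_ : 0 <= (q ^+ k)%:E)%E h; rewrite lee_fin exprn_ge0// => /(_ isT).
  rewrite muleA -EFinM -exprMn -expRD addNr expR0 expr1n mul1e => /le_trans; apply.
  by rewrite -EFinM.
have [C hC] := mean_stat_annulus_weight_fin (proj1 (andP (proj1 (mid_itv s1)))) zd.
have C0 : 0 <= C.
  by rewrite -lee_fin; apply: le_trans (hC 0 0 (lexx _)); apply: mean_stat_ge0 => x; exact: annulus_weight_ge0.
have mk (k : nat) : 0 <= mean_statr (annulus_weight s k%:R k.+1%:R z) <= q ^+ k * C.
  have h1 : (mean_stat (annulus_weight s k%:R k.+1%:R z) <= (q ^+ k * C)%:E)%E.
    have := mean_stat_sum (c := fun=> q ^+ k) (u := fun _ x => annulus_weight (mid s) k%:R k.+1%:R z x) 1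
      (fun=> exprn_ge0 _ q0) (fun _ x => annulus_weight_ge0 _ _ _ _ x) (fun=> @cmeasurable_annulus_weight R (mid s) k%:R k.+1%:R z).
    rewrite big_ord1 => e.
    apply: (@le_trans _ _ ((q ^+ k)%:E * mean_stat (annulus_weight (mid s) k%:R k.+1%:R z))%E).
      rewrite -e; apply: le_mean_stat.
      - exact: cmeasurable_annulus_weight.
      - under eq_fun do rewrite big_ord1; apply/measurable_EFinP; apply: measurable_funM => //.
        by apply/measurable_EFinP; exact: cmeasurable_annulus_weight.
      - by move=> x; exact: annulus_weight_ge0.
      - by move=> x; rewrite big_ord1; exact: annulus_weight_gap.
    by rewrite EFinM; apply: lee_wpmul2l; [rewrite lee_fin exprn_ge0|exact: hC].
  have h0 : (0 <= mean_stat (annulus_weight s k%:R k.+1%:R z))%E by apply: mean_stat_ge0 => x; exact: annulus_weight_ge0.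
  have fin : mean_stat (annulus_weight s k%:R k.+1%:R z) \is a fin_num.
    by rewrite ge0_fin_numE// (le_lt_trans h1)// ltry.
  by rewrite /mean_statr fine_ge0//= -lee_fin fineK.
(* energies are squares, so the deviation decays with the square root of the ratio *)
pose rho := expR (- (gap s / 2)).
have rq : rho ^+ 2 = q by rewrite /rho -expRM_natl; congr expR; field.
have r0 : 0 <= rho by exact: expR_ge0.
have r1 : rho < 1 by rewrite expR_lt1 oppr_lt0 divr_gt0// gap_gt0.
apply: (@cvg_series_geom _ (Num.sqrt (F2 * T) + cabs (f z) * C) rho); first by rewrite r0.
move=> k; rewrite (g_shell_clin_stat X s f zd (ltnSn k)).
have -> : clin_stat (annulus_weight s k%:R k.+1%:R z) f X (safe_radius (cabs z) k.+1%:R) =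
   clin_dev s k%:R k.+1%:R z f X + f z * real_complex R (mean_statr (annulus_weight s k%:R k.+1%:R z)).
  by rewrite /clin_dev subrK.
apply: (le_trans (le_cabsD _ _)); rewrite mulrDl; apply: lerD.
  have h := @clin_dev_bound R c cf f F2 s k%:R k.+1%:R z X c0 F0 hf hF (ler0n R k.+1) zd.
  have {}h : cabs (clin_dev s k%:R k.+1%:R z f X) ^+ 2 <= F2 * T * (rho ^+ k) ^+ 2.
    rewrite -lee_fin; apply: (le_trans h).
    apply: (le_trans (lee_wpmul2l _ (YT k))); first by rewrite lee_fin ltW.
    by rewrite -EFinM lee_fin exprAC rq -mulrA [T * _]mulrC.
  rewrite -(@ler_pXn2r _ 2)// ?nnegrE ?cabs_ge0 ?mulr_ge0 ?sqrtr_ge0 ?exprn_ge0//.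
  by rewrite exprMn sqr_sqrtr// mulr_ge0// ltW.
rewrite cabsM cabs_real; have /andP[m0 m1] := mk k.
rewrite ger0_norm// -mulrA; apply: ler_wpM2l; first exact: cabs_ge0.
apply: (le_trans m1); rewrite mulrC; apply: ler_wpM2l => //.
by rewrite lerXn2r ?nnegrE// -rq expr2 ler_piMl// ltW.
Qed.

End RandomSeries.

(** * The mean square error *)

Section MeanSquare.
Context {R : realType}.
Implicit Types (X : conf R) (z x : R[i]) (f : R[i] -> R[i]) (s a b t d V : R) (c : nat -> R) (W : R[i] -> R).

(** The energy of the untruncated statistic. The lower limit is chosen because
    Fatou's lemma bounds its mean. *)
Definition limit_energy c s z X : \bar R := limn_einf (fun K => energy c s 0 K%:R z X).

Lemma limit_energy_ge0 c s z X : (forall n, 0 < c n) -> (0 <= limit_energy c s z X)%E.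
Proof.
move=> c0; rewrite /limit_energy limn_einf_lim; apply: lime_ge; first exact: is_cvg_einfs.
by apply: nearW => n; apply: le_ereal_inf_tmp => _ [m /= nm <-]; exact: energy_ge0.
Qed.

Lemma range0 (K : nat) : 0 <= (0 : R) <= K%:R. Proof. by rewrite lexx ler0n. Qed.

Lemma measurable_limit_energy c s z : (forall n, 0 < c n) -> disk z ->
  measurable_fun setT (fun X : Conf R => limit_energy c s z X).
Proof.
move=> c0 zd; under eq_fun do rewrite /limit_energy limn_einf_lim.
apply: (@emeasurable_fun_cvg _ _ _ _ (fun n (X : Conf R) => einfs (fun K => energy c s 0 K%:R z X) n)).
  by apply: measurable_fun_einfs => K; apply: measurable_energy => //; exact: range0.
by move=> X _; exact: is_cvg_einfs.
Qed.

Lemma le_limn_einf (u v : (\bar R)^nat) : (forall n, (u n <= v n)%E) ->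
  (limn_einf u <= limn_einf v)%E.
Proof.
move=> uv; rewrite !limn_einf_lim; apply: lee_lim; [exact: is_cvg_einfs|exact: is_cvg_einfs|].
apply: nearW => n; apply: le_ereal_inf_tmp => _ [m /= nm <-].
by apply: le_trans (uv m); apply: ereal_inf_lbound; exists m.
Qed.

Lemma cvg_mean_statr_exp_weight s z : 1 < s -> disk z -> mean_statr (annulus_weight s 0 k%:R z) @[k --> \oo] --> fine (mean_stat (exp_weight s z)).
Proof.
move=> s1 zd; have h := mean_stat_annulus_weight_cvg (s := s) zd.
by apply: fine_cvg; rewrite fineK ?mean_stat_exp_weight_fin.
Qed.

(** Pass to the limit in [clin_dev_bound] along the truncations d(z,x) < K. *)
Lemma limit_bound c (cf : nat -> R[i]) f (F2 : R) s z X :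
  (forall n, 0 < c n) -> 0 < F2 ->
  (forall x, disk x -> psum cf m x @[m --> \oo] --> f x) ->
  (forall N, \sum_(n < N) cabs (cf n) ^+ 2 * c n <= F2) ->
  1 < s -> disk z -> g_sum_converges X s z f ->
  ((cabs (g_sum_fun X s z f - f z * real_complex R (fine (mean_stat (exp_weight s z)))) ^+ 2)%:E
     <= F2%:E * limit_energy c s z X)%E.
Proof.
move=> c0 F0 hf hF s1 zd cvS.
have FF : Filter (\oo : set_system nat) by exact: eventually_filter.
set l := cabs _ ^+ 2.
have cv : cabs (clin_dev s 0 K%:R z f X) ^+ 2 @[K --> \oo] --> l.
  have h1 : clin_stat (annulus_weight s 0 K%:R z) f X (safe_radius (cabs z) K%:R) @[K --> \oo] --> g_sum_fun X s z f.
    by under eq_cvg do rewrite -series_g_shell//; exact: cvS.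
  have h2 : f z * real_complex R (mean_statr (annulus_weight s 0 K%:R z)) @[K --> \oo] -->
      f z * real_complex R (fine (mean_stat (exp_weight s z))).
    apply: (cvgcM FF (cvg_cst _)); apply: (cvg_ReIm FF) => /=; first exact: cvg_mean_statr_exp_weight.
    exact: cvg_cst.
  have h3 := cvg_cabs FF (cvgcB FF h1 h2).
  by rewrite /l expr2; under eq_cvg do rewrite expr2; exact: (cvgM h3 h3).
have cvE : (cabs (clin_dev s 0 K%:R z f X) ^+ 2 / F2)%:E @[K --> \oo] --> (l / F2)%:E.
  by apply: cvg_EFin; [exact: nearW|exact: (cvgM cv (cvg_cst _))].
have h : ((l / F2)%:E <= limit_energy c s z X)%E.
  rewrite -(cvg_limn_einf_sup cvE).1; apply: le_limn_einf => K.
  have h := @clin_dev_bound R c cf f F2 s 0 K%:R z X c0 F0 hf hF (ler0n R K) zd.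
  have Fi : (0 <= (F2^-1)%:E)%E by rewrite lee_fin invr_ge0 ltW.
  have := lee_wpmul2l Fi h; rewrite muleA -!EFinM mulVf ?gt_eqF// mul1e.
  by rewrite [F2^-1 * _]mulrC.
have F0' : (0 <= F2%:E)%E by rewrite lee_fin ltW.
have := lee_wpmul2l F0' h; rewrite -EFinM.
by rewrite [F2 * _]mulrC divfK ?gt_eqF.
Qed.

(** The two properties of the Taylor coefficients used from here on: the
    expansion and the weighted Bessel inequality. *)
Lemma good_coef W M J f : super_critical W -> 0 <= M ->
  (forall j x, (J <= j)%N -> in_shell j x -> M * 2 ^+ j / (j + 3)%:R ^+ 2 <= W x) ->
  weighted_bergman W f ->
  (forall x, disk x -> psum (taylor_coef f) m x @[m --> \oo] --> f x) /\
  forall N, \sum_(n < N) cabs (taylor_coef f n) ^+ 2 * coef_weight M J n <= fine (weighted_sqnorm W f).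
Proof.
move=> [_ W0 _] M0 hW [hf hfin]; have hx := taylor hf; split => // N.
have h := weighted_bessel M0 W0 hW hx N.
have fin : weighted_sqnorm W f \is a fin_num.
  rewrite ge0_fin_numE//; apply: integral_ge0 => p pd.
  by rewrite lee_fin mulr_ge0 ?sqr_ge0// W0.
by rewrite -lee_fin fineK.
Qed.

Lemma weighted_sqnorm_fine_ge0 W f : super_critical W -> 0 <= fine (weighted_sqnorm W f).
Proof.
move=> [_ W0 _]; apply: fine_ge0; apply: integral_ge0 => p pd.
by rewrite lee_fin mulr_ge0 ?sqr_ge0// W0.
Qed.

Variable P : probability (Conf R) R.
Hypothesis hP : determinantal_process P bergman_kernel.

Lemma g_sum_exp_weight X s z : disk z ->
  g_sum X s z = (\esum_(x in [set: R[i]]) ((X x)%:R * exp_weight s z x)%:E)%E.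
Proof.
move=> zd; apply: eq_esum => x _; congr EFin; rewrite poincareC /exp_weight.
have [->|X0] := eqVneq (X x) 0%N; first by rewrite !mul0r.
have xd : disk x := conf_disk X0.
have -> : (cabs x < 1) = true by exact: xd.
by rewrite mul1r.
Qed.

Lemma g_mean_exp_weight s z : disk z -> g_mean P s z = mean_stat (exp_weight s z).
Proof.
move=> zd; rewrite /g_mean; under eq_integral do rewrite g_sum_exp_weight//.
apply: (first_moment hP); first exact: cmeasurable_exp_weight.
by move=> x; exact: exp_weight_ge0.
Qed.

Lemma ae_lty (u : Conf R -> \bar R) : measurable_fun setT u -> (forall X, 0 <= u X)%E ->
  (\int[P]_X u X < +oo)%E -> {ae P, forall X, (u X < +oo)%E}.
Proof.
move=> mu u0 ufin; have iu : P.-integrable setT u.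
  apply/integrableP; split => //.
  by under eq_integral => X _ do rewrite gee0_abs//.
have := integrable_ae measurableT iu; apply: filterS => X /(_ I).
by rewrite ge0_fin_numE.
Qed.

(** Fatou's lemma and [variance_sum_le], whose bound is uniform in the truncation. *)
Lemma mean_limit_energy t M J s z : cabs z <= t < 1 -> 0 < M -> 1 < s <= 2 ->
  (\int[P]_X limit_energy (coef_weight M J) s z X <= (2 * var_bound t M J s)%:E)%E.
Proof.
move=> zt M0 s12; have zd : disk z by case/andP: zt => h1 h2; exact: le_lt_trans h1 h2.
have c0 n := coef_weight_gt0 J n M0.
have s0 : 0 <= s by case/andP: s12 => h _; rewrite ltW// (lt_trans ltr01).
apply: le_trans (fatou P measurableT _ _) _.
- by move=> K; apply: measurable_energy => //; exact: range0.
- by move=> K X _; exact: energy_ge0.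
rewrite limn_einf_lim; apply: lime_le; first exact: is_cvg_einfs.
apply: nearW => n; apply: (@le_trans _ _ (\int[P]_X energy (coef_weight M J) s 0 n%:R z X)%E).
  by apply: ereal_inf_lbound; exists n => /=.
rewrite EFinM; apply: (mean_energy hP) => //; first exact: range0.
by move=> N; apply: variance_sum_le.
Qed.

Lemma mean_shells_energy_fin M J s z : 0 < M -> 1 < s -> disk z ->
  exists2 C : R, 0 <= C & (\int[P]_X shells_energy (coef_weight M J) s z X <= C%:E)%E.
Proof.
move=> M0 s1 zd; have c0 n := coef_weight_gt0 J n M0.
have zt : cabs z <= cabs z < 1 by rewrite lexx.
have [m12 _] := mid_itv s1.
set V := var_bound (cabs z) M J (mid s).
have V0 : 0 <= V.
  rewrite -lee_fin; apply: le_trans (variance_sum_le J 0 0 zt M0 m12 (lexx 0)).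
  by rewrite big_ord0.
exists (2 * V / (1 - expR (- gap s))).
  apply: divr_ge0; first by rewrite mulr_ge0.
  by rewrite subr_ge0 ltW// expR_lt1 oppr_lt0 gap_gt0.
apply: (mean_shells_energy hP) => // k N; exact: variance_sum_le.
Qed.

Lemma shells_energy_ge0 c s z X : (forall n, 0 < c n) -> (0 <= shells_energy c s z X)%E.
Proof.
move=> c0; apply: nneseries_ge0 => k _ _.
by rewrite mule_ge0 ?energy_ge0// lee_fin exprn_ge0// expR_ge0.
Qed.

Lemma ae_shells_energy M J s z : 0 < M -> 1 < s -> disk z ->
  {ae P, forall X : Conf R, (shells_energy (coef_weight M J) s z X < +oo)%E}.
Proof.
move=> M0 s1 zd; have c0 n := coef_weight_gt0 J n M0.
have [C _ hC] := mean_shells_energy_fin J M0 s1 zd.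
apply: ae_lty; [exact: measurable_shells_energy|by move=> X; exact: shells_energy_ge0|].
by apply: le_lt_trans hC _; rewrite ltry.
Qed.

Lemma converges_of_shells_energy W M J s z X f : super_critical W -> 0 < M ->
  (forall j x, (J <= j)%N -> in_shell j x -> M * 2 ^+ j / (j + 3)%:R ^+ 2 <= W x) ->
  1 < s -> disk z -> (shells_energy (coef_weight M J) s z X < +oo)%E -> weighted_bergman W f ->
  g_sum_converges X s z f.
Proof.
move=> hW M0 hJ s1 zd T fW; have [h1 h2] := good_coef hW (ltW M0) hJ fW.
apply: (@shells_converge R (coef_weight M J) (taylor_coef f) f (fine (weighted_sqnorm W f) + 1)) => //.
- by move=> n; exact: coef_weight_gt0.
- by rewrite ltr_pwDr// weighted_sqnorm_fine_ge0.
- by move=> N; apply: (le_trans (h2 N)); rewrite lerDl.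
Qed.

(** The event that [shells_energy] is finite has probability 1 and does not involve f. *)
Theorem converges_ae W s z : super_critical W -> 1 < s -> disk z ->
  {ae P, forall X : Conf R, forall f, weighted_bergman W f -> g_sum_converges X s z f}.
Proof.
move=> hW s1 zd; have [J hJ] := super_critical_shell 1 hW.
have := ae_shells_energy J ltr01 s1 zd; apply: filterS => X T f fW.
exact: (converges_of_shells_energy hW ltr01 (hJ J (leqnn J)) s1 zd T fW).
Qed.

Lemma unit_ball_le1 W f : super_critical W -> unit_ball W f -> fine (weighted_sqnorm W f) <= 1.
Proof.
move=> hW [_]; rewrite /weighted_norm => h.
have h0 := weighted_sqnorm_fine_ge0 f hW.
rewrite -(sqr_sqrtr h0) expr_le1 ?sqrtr_ge0// ltW//.
Qed.

(** The supremum is controlled by [limit_energy] on the event where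
    [shells_energy] is finite and the outer series converge. On the null
    complement any positive multiple of [shells_energy] dominates everything,
    so no measurability of the supremum enters. *)
Lemma mean_sup_le W t M J s z : super_critical W -> 0 < M ->
  (forall j x, (J <= j)%N -> in_shell j x -> M * 2 ^+ j / (j + 3)%:R ^+ 2 <= W x) ->
  cabs z <= t < 1 -> 1 < s <= 2 -> 0 < fine (mean_stat (exp_weight s z)) ->
  (\int[P]_X ereal_sup
     [set (cabs (g_sum_fun X s z f / real_complex R (fine (g_mean P s z)) - f z) ^+ 2)%:E
       | f in unit_ball W] <= (2 * var_bound t M J s / fine (mean_stat (exp_weight s z)) ^+ 2)%:E)%E.
Proof.
move=> hW M0 hJ zt s12 g0; have zd : disk z by case/andP: zt => h1 h2; exact: le_lt_trans h1 h2.
have s1 : 1 < s by case/andP: s12.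
have c0 n := coef_weight_gt0 J n M0.
set g := fine (mean_stat (exp_weight s z)) in g0 *.
have [C C0 hC] := mean_shells_energy_fin J M0 s1 zd.
(* room for a small multiple of the energy that is infinite on the bad event *)
apply/lee_addgt0Pr => e e0.
pose e' := e / (C + 1).
have C1 : 0 < C + 1 by rewrite ltr_pwDr.
have e'0 : 0 < e' by rewrite divr_gt0.
pose H X := ((g ^- 2)%:E * limit_energy (coef_weight M J) s z X + e'%:E * shells_energy (coef_weight M J) s z X)%E.
have gi : (0 <= (g ^- 2)%:E)%E by rewrite lee_fin invr_ge0 sqr_ge0.
have ei : (0 <= e'%:E)%E by rewrite lee_fin ltW.
have Z0 X : (0 <= limit_energy (coef_weight M J) s z X)%E by exact: limit_energy_ge0.
have T0 X : (0 <= shells_energy (coef_weight M J) s z X)%E by exact: shells_energy_ge0.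
have H0 X : (0 <= H X)%E by rewrite adde_ge0// mule_ge0.
apply: (@le_trans _ _ (\int[P]_X H X)%E).
  apply: le_lower_integral => // X _; apply: ge_ereal_sup => _ [f fB <-].
  have [T|] := ltP (shells_energy (coef_weight M J) s z X) +oo%E; last first.
    rewrite leye_eq => /eqP T; rewrite /H T gt0_muley ?lte_fin// addey ?leey//.
    by rewrite -ltNye (lt_le_trans ltNy0)// mule_ge0.
  have fW := fB.1; have cv := converges_of_shells_energy hW M0 hJ s1 zd T fW.
  have [h1 h2] := good_coef hW (ltW M0) hJ fW.
  have h3 N : \sum_(n < N) cabs (taylor_coef f n) ^+ 2 * coef_weight M J n <= 1.
    by apply: (le_trans (h2 N)); exact: unit_ball_le1.
  have := limit_bound c0 ltr01 h1 h3 s1 zd cv; rewrite mul1e -/g => hb.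
  apply: (@le_trans _ _ ((g ^- 2)%:E * limit_energy (coef_weight M J) s z X)%E); last first.
    by apply: leeDl; rewrite mule_ge0.
  apply: le_trans (lee_wpmul2l gi hb); rewrite -EFinM lee_fin g_mean_exp_weight// -/g.
  have gc : real_complex R g != 0 by rewrite eq_complex/= eqxx andbT gt_eqF.
  have -> : g_sum_fun X s z f / real_complex R g - f z =
     (g_sum_fun X s z f - f z * real_complex R g) / real_complex R g.
    by rewrite mulrBl mulfK.
  by rewrite cabsM cabsV cabs_real gtr0_norm// exprMn exprVn mulrC.
have mZ : measurable_fun setT (fun X : Conf R => limit_energy (coef_weight M J) s z X) by exact: measurable_limit_energy.
have mT : measurable_fun setT (fun X : Conf R => shells_energy (coef_weight M J) s z X) by exact: measurable_shells_energy.
rewrite ge0_integralD//; last 4 first.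
- by move=> X _; rewrite mule_ge0.
- exact: measurable_funeM.
- by move=> X _; rewrite mule_ge0.
- exact: measurable_funeM.
rewrite (ge0_integralZl P measurableT mZ (fun X _ => Z0 X) gi).
rewrite (ge0_integralZl P measurableT mT (fun X _ => T0 X) ei).
apply: leeD.
  apply: (le_trans (lee_wpmul2l gi (mean_limit_energy J zt M0 s12))).
  by rewrite -EFinM lee_fin mulrC.
apply: (le_trans (lee_wpmul2l ei hC)); rewrite -EFinM lee_fin /e' mulrAC ler_pdivrMr//.
by rewrite ler_pM2l// lerDl.
Qed.

End MeanSquare.

(** * The limit as s tends to 1 *)

Section Limit.
Context {R : realType}.
Implicit Types (X : conf R) (z x : R[i]) (f : R[i] -> R[i]) (s a b t d V : R) (c : nat -> R) (W : R[i] -> R).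

Lemma relatively_compact_radius (D : set R[i]) : relatively_compact_in_disk D ->
  exists2 t : R, 0 <= t < 1 & forall z, D z -> cabs z <= t.
Proof.
move=> [pD cD]; have [D0|/set0P [d Dd]] := eqVneq D set0.
  by exists 0; [rewrite lexx ltr01|move=> z; rewrite D0].
have cc : compact (closure D) by rewrite -precompactE.
have [||c cK hc] := @compact_EVT_max _ R (fun z : R[i] => cabs z) (closure D) _ cc.
- by exists d; exact: subset_closure.
- by apply: continuous_subspaceT; exact: continuous_cabs.
exists (cabs c); first by rewrite cabs_ge0; apply: cD; exact: set_mem cK.
by move=> z Dz; apply: hc; apply: mem_set; exact: subset_closure.
Qed.

(** Choose M of order 1/e, then J from the super-critical growth, then s so
    close to 1 that the term with J is negligible. *)
Lemma variance_small W t (e : R) : super_critical W -> 0 <= t < 1 -> 0 < e ->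
  exists M : R, exists J : nat, exists d : R, [/\ 0 < M,
    forall j x, (J <= j)%N -> in_shell j x -> M * 2 ^+ j / (j + 3)%:R ^+ 2 <= W x, 0 < d &
    forall s z, 1 < s < 1 + d -> cabs z <= t ->
      [/\ 1 < s <= 2, 0 < fine (mean_stat (exp_weight s z)) & 2 * var_bound t M J s <= e * fine (mean_stat (exp_weight s z)) ^+ 2]].
Proof.
move=> hW t0 e0; have [D D0 hD] := variance_over_mean t0.
pose M := 4 * D / e.
have M0 : 0 < M by rewrite divr_gt0// mulr_gt0.
have [J hJ] := super_critical_shell M hW.
have J0 : 0 < (J + 7)%:R :> R by rewrite ltr0n addnS.
exists M, J, ((J + 7)%:R * 2)^-1; split=> //; first by move=> j x; exact: hJ.
move=> s z /andP[s1 s2] zt.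
have s12 : 1 < s <= 2.
  rewrite s1/= (le_trans (ltW s2))// -[leRHS]/(1 + 1) lerD2l invf_le1 ?mulr_gt0//.
  by rewrite -natrM ler1n addnS.
have [g0 hV] := hD M J s z M0 s12 zt; split=> //.
have q1 : (J + 7)%:R * (1 - shell_ratio (s - 1)) <= 1.
  have l2 : ln 2 <= 2 :> R by apply: ltW; exact: ln_sublinear.
  have h : 1 - shell_ratio (s - 1) <= (s - 1) * 2.
    have := expR_ge1Dx (- (s - 1) * ln 2); rewrite -/(shell_ratio (s - 1)) mulNr => h.
    rewrite lerBlDr -lerBlDl (le_trans _ h)// lerD2l lerN2.
    by apply: ler_wpM2l => //; rewrite subr_ge0 ltW.
  apply: (le_trans (ler_wpM2l (ltW J0) h)).
  have : s - 1 <= ((J + 7)%:R * 2)^-1 by rewrite lerBlDl ltW.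
  by rewrite -[X in _ <= X]div1r ler_pdivlMr ?mulr_gt0//; rewrite mulrCA.
apply: (@le_trans _ _ (2 * (D / M * (1 + 1) * fine (mean_stat (exp_weight s z)) ^+ 2))).
  apply: ler_wpM2l => //; apply: (le_trans hV); apply: ler_wpM2r; first exact: sqr_ge0.
  by apply: ler_wpM2l; [rewrite ltW// divr_gt0|rewrite lerD2r].
rewrite le_eqVlt; apply/orP; left; apply/eqP; rewrite /M.
by field; rewrite !gt_eqF.
Qed.

Context (P : probability (Conf R) R) (hP : determinantal_process P bergman_kernel).

Lemma mean_sup_limit W (D : set R[i]) : super_critical W -> relatively_compact_in_disk D ->
  sup_ge0 [set (\int[P]_X ereal_sup
         [set (cabs (g_sum_fun X s z f / real_complex R (fine (g_mean P s z))
                     - f z) ^+ 2)%:E | f in unit_ball W])%E | z in D]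
       @[s --> (1 : R)^'+] --> (0 : \bar R)%E.
Proof.
move=> hW hD; have [t t01 ht] := relatively_compact_radius hD.
set u := fun s : R => _ : \bar R.
have u0 s : (0 <= u s)%E by apply: ereal_sup_ubound; left.
have bd (e : R) : 0 < e -> \forall s \near (1 : R)^'+, (u s <= e%:E)%E.
  move=> e0; have [M [J [d [M0 hJ d0 h]]]] := variance_small hW t01 e0.
  have h2 : 1 < 1 + d by rewrite ltrDl.
  near=> s; apply: ge_ereal_sup => _ [->|[z Dz <-]]; first by rewrite lee_fin ltW.
  have s1 : 1 < s < 1 + d.
    by apply/andP; split; near: s; [exact: nbhs_right_gt|exact: nbhs_right_lt].
  have [s12 g0 hV] := h s z s1 (ht z Dz).
  have zt : cabs z <= t < 1 by rewrite ht//; case/andP: t01.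
  apply: (le_trans (mean_sup_le hP hW M0 hJ zt s12 g0)).
  by rewrite lee_fin ler_pdivrMr// exprn_gt0.
have uf : \forall s \near (1 : R)^'+, u s \is a fin_num.
  by apply: filterS (bd 1 ltr01) => s h; rewrite ge0_fin_numE// (le_lt_trans h)// ltry.
apply/fine_cvgP; split=> //; apply/cvgrPdist_le => e e0.
apply: filterS2 uf (bd e e0) => s fs us.
by rewrite /= sub0r normrN ger0_norm ?fine_ge0// -lee_fin fineK.
Unshelve. all: by end_near. Qed.

End Limit.

(** * Joint measurability in the configuration and the point *)

Section JointMeasurability.
Context {R : realType}.
Implicit Types (X : conf R) (z x : R[i]) (s a b t : R) (c : nat -> R).

Definition grid (j : nat) (k : int * int) : R[i] :=
  Complex (k.1%:~R / j.+1%:R) (k.2%:~R / j.+1%:R).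

(** The index of the square of side 1/(j+1) containing p; [grid] is its lower
    left corner. *)
Definition cell (j : nat) (p : plane R) : int * int :=
  (Num.floor (p.1 * j.+1%:R), Num.floor (p.2 * j.+1%:R)).

Lemma measurable_cell j k : measurable (cell j @^-1` [set k]).
Proof.
have h (i : int) : measurable [set x : measurableTypeR R | Num.floor (x * j.+1%:R : R) = i].
  rewrite (_ : mkset _ = setT `&` (fun x : R => x * j.+1%:R) @^-1` `[i%:~R, (i + 1)%:~R[%classic).
    by have m : measurable_fun setT (fun x : measurableTypeR R => x * j.+1%:R : R);
      [exact: measurable_funM|exact: m].
  apply/seteqP; split => x /=; rewrite in_itv/=.
    by move=> <-; split=> //; rewrite floor_itv.
  by move=> [_ h]; apply/floor_def.
case: k => k1 k2.
rewrite (_ : _ @^-1` _ = [set x | Num.floor (x * j.+1%:R : R) = k1] `*` [set x | Num.floor (x * j.+1%:R : R) = k2]).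
  by apply: measurableX; exact: h.
by apply/seteqP; split => -[x y] /=; rewrite /cell/= => -[-> ->].
Qed.

Lemma cvg_floor (x : R) : ((Num.floor (x * j.+1%:R))%:~R / j.+1%:R : R) @[j --> \oo] --> x.
Proof.
apply: (@squeeze_cvgr _ _ _ _ (fun j => x - j.+1%:R^-1) (fun=> x)); last 2 first.
- by rewrite -[X in _ --> X]subr0; apply: cvgB; [exact: cvg_cst|exact: cvg_harmonic].
- exact: cvg_cst.
apply: nearW => j; have j0 : 0 < j.+1%:R :> R by [].
apply/andP; split; last by rewrite ler_pdivrMr// floor_le.
rewrite ler_pdivlMr// mulrBl mulVf ?gt_eqF// lerBlDr.
by have := ltW (floorD1_gt (x * j.+1%:R)); rewrite intrD.
Qed.

Lemma cvg_grid (p : plane R) : grid j (cell j p) @[j --> \oo] --> to_complex p.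
Proof.
have FF : Filter (\oo : set_system nat) by exact: eventually_filter.
by apply: (cvg_ReIm FF) => /=; exact: cvg_floor.
Qed.

Definition in_disk (T : Type) : set (T * plane R) := [set Xp | plane_disk Xp.2].

Lemma measurable_in_disk d (T : measurableType d) : measurable (@in_disk T).
Proof.
rewrite (_ : @in_disk T = setT `*` plane_disk).
  by apply: measurableX => //; exact: measurable_plane_disk.
by apply/seteqP; split => -[X p] //= [].
Qed.

(** A function that is measurable in the first variable and sequentially
    continuous in the second is jointly measurable: round the second variable
    to a finer and finer grid. *)
Lemma caratheodory d (T : measurableType d) (F : T -> R[i] -> R) :
  (forall z, disk z -> measurable_fun setT (F^~ z)) ->
  (forall (X : T) z (u : nat -> R[i]), disk z -> u @ \oo --> z -> F X (u j) @[j --> \oo] --> F X z) ->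
  measurable_fun (@in_disk T) (fun Xp : T * plane R => F Xp.1 (to_complex Xp.2)).
Proof.
move=> mF cF.
pose G z (X : T) := if cabs z < 1 then F X z else 0.
have mG z : measurable_fun setT (G z).
  by rewrite /G; have [h|h] := boolP (cabs z < 1); [exact: mF|exact: measurable_cst].
apply: (@measurable_fun_cvg _ _ _ _ (fun j (Xp : T * plane R) => G (grid j (cell j Xp.2)) Xp.1)).
- move=> j; apply: measurable_funTS => _ B mB; rewrite setTI.
  rewrite (_ : _ @^-1` _ = \bigcup_k ((G (grid j k) @^-1` B) `*` (cell j @^-1` [set k]))).
    apply: countable_bigcupT_measurable => // k; apply: measurableX; last exact: measurable_cell.
    by rewrite -[X in measurable X]setTI; exact: mG.
  apply/seteqP; split => -[X p] /=.
    by move=> h; exists (cell j p).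
  by move=> [k _ /= [h1 h2]]; rewrite h2.
- move=> [X p] pd; have zd : disk (to_complex p) by [].
  have cG : G (grid j (cell j p)) X @[j --> \oo] --> F X (to_complex p).
    have hF := cF X (to_complex p) _ zd (@cvg_grid p).
    apply: (@cvg_trans _ (F X (grid j (cell j p)) @[j --> \oo])); last exact: hF.
    apply: near_eq_cvg.
    have : \forall w \near to_complex p, disk w by exact: open_nbhs_nbhs (conj open_disk zd).
    move=> /(@cvg_grid p)[N _ hN]; exists N => // j Nj.
    by rewrite /G (hN j Nj : cabs _ < 1).
  exact: cG.
Qed.

(** Near z the supports stay in a common compact disk, so this is a finite sum
    of continuous functions. *)
Lemma cvg_lin_stat_approx X m s b q z (u : nat -> R[i]) : 0 <= b -> disk z -> u @ \oo --> z ->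
  lin_stat (approx m s b q (u j)) X @[j --> \oo] --> lin_stat (approx m s b q z) X.
Proof.
move=> b0 zd uz; have FF : Filter (\oo : set_system nat) by exact: eventually_filter.
pose t := (cabs z + 1) / 2.
have t1 : t < 1 by move: (zd : cabs z < 1); rewrite /t; lra.
have zt : cabs z < t by move: (zd : cabs z < 1); rewrite /t; lra.
have tt : cabs z <= t < 1 by rewrite ltW.
have t0 := radius_itv tt.
have s1 := safe_radius_lt1 b0 t0.
rewrite (lin_stat_pts X s1 (@approx_support _ m s b q t z b0 tt)).
have near_u : \forall j \near \oo, cabs (u j) < t.
  by apply: (cvgr_lt (cabs z)) => //; exact: cvg_cabs.
apply: (@cvg_trans _ (\sum_(x <- pts X (safe_radius t b)) (X x)%:R * approx m s b q (u j) x @[j --> \oo])).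
  apply: near_eq_cvg; apply: filterS near_u => j uj.
  have uj' : cabs (u j) <= t < 1 by rewrite ltW.
  by rewrite (lin_stat_pts X s1 (@approx_support _ m s b q t (u j) b0 uj')).
elim: (pts X (safe_radius t b)) => [|x l ih].
  by rewrite big_nil; under eq_cvg do rewrite big_nil; exact: cvg_cst.
rewrite big_cons; under eq_cvg do rewrite big_cons.
apply: cvgD => //; apply: cvgM; first exact: cvg_cst.
rewrite /approx; apply: cvgM; last exact: cvg_cst.
have [xd|_] := boolP (cabs x < 1); last first.
  by rewrite mul0r; under eq_cvg do rewrite mul0r; exact: cvg_cst.
apply: cvgM; first exact: cvg_cst.
exact: (@cvg_core _ _ _ FF u (fun=> x) z x m s b zd xd uz (cvg_cst x)).
Qed.

Lemma cvg_lin_stat_ball X s b q z : 0 <= b -> disk z ->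
  lin_stat (approx m s b q z) X @[m --> \oo] --> lin_stat (ballw s b q z) X.
Proof.
move=> b0 zd; have ht : cabs z <= cabs z < 1 by rewrite lexx.
have s1 : safe_radius (cabs z) b < 1 by apply: safe_radius_lt1; rewrite ?cabs_ge0.
rewrite (lin_stat_pts X s1 (@ball_support _ s b q _ _ b0 ht)).
have -> : (fun m => lin_stat (approx m s b q z) X) =
    (fun m => \sum_(x <- pts X (safe_radius (cabs z) b)) (X x)%:R * approx m s b q z x).
  by apply/funext => m; rewrite (lin_stat_pts X s1 (@approx_support _ m s b q _ _ b0 ht)).
elim: (pts X (safe_radius (cabs z) b)) => [|x l ih].
  by rewrite big_nil; under eq_cvg do rewrite big_nil; exact: cvg_cst.
rewrite big_cons; under eq_cvg do rewrite big_cons.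
by apply: cvgD => //; apply: cvgM; [exact: cvg_cst|exact: cvg_approx_m].
Qed.

Lemma jointly_measurable_ball s b q : 0 <= b -> continuous q ->
  measurable_fun (@in_disk (Conf R)) (fun Xp : Conf R * plane R => lin_stat (ballw s b q (to_complex Xp.2)) Xp.1).
Proof.
move=> b0 cq.
apply: (@measurable_fun_cvg _ _ _ _ (fun m (Xp : Conf R * plane R) => lin_stat (approx m s b q (to_complex Xp.2)) Xp.1)).
- move=> m; apply: (@caratheodory _ (Conf R) (fun X z => lin_stat (approx m s b q z) X)).
    move=> z zd; have ht : cabs z <= cabs z < 1 by rewrite lexx.
    have s1 : safe_radius (cabs z) b < 1 by apply: safe_radius_lt1; rewrite ?cabs_ge0.
    by apply: (@measurable_lin_stat_test _ _ (safe_radius (cabs z) b)) => //;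
      [exact: approx_support|exact: continuous_approx].
  by move=> X z u zd uz; exact: cvg_lin_stat_approx.
by move=> [X p] /= pd; exact: cvg_lin_stat_ball.
Qed.

(** Moebius invariance; in particular the centring terms do not affect joint
    measurability. *)
Lemma mean_stat_annulus_weight_const s a b z : disk z -> mean_stat (annulus_weight s a b z) = mean_stat (annulus_weight s a b 0).
Proof.
pose F x : \bar R := (profile s a b (cabs x))%:E.
have mF : cmeasurable F.
  apply/measurable_EFinP; apply: (measurableT_comp (measurable_profile s a b)).
  exact: (cmap_cabs cmap_id).
have F0 x : (0 <= F x)%E by rewrite lee_fin /profile !mulr_ge0// expR_ge0.
have mob w : disk w -> cint (fun x => (annulus_weight s a b w x * hypdens x)%:E) =
    cint (fun x => F x * (hypdens x)%:E)%E.
  move=> wd; rewrite (ge0_cint_hyp_mobius wd mF F0); congr cint.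
  by apply/funext => y; rewrite profileE// EFinM.
by move=> zd; rewrite /mean_stat (mob z zd) (mob 0 (@disk0 R)).
Qed.

Lemma mean_stat_exp_weight_const s z : 1 < s -> disk z -> mean_stat (exp_weight s z) = mean_stat (exp_weight s 0).
Proof.
move=> s1 zd; have h := mean_stat_annulus_weight_cvg (s := s) zd.
have h0 := mean_stat_annulus_weight_cvg (s := s) (@disk0 R).
have e : (fun k : nat => mean_stat (annulus_weight s 0 k%:R z)) = (fun k : nat => mean_stat (annulus_weight s 0 k%:R 0)).
  by apply/funext => k; exact: mean_stat_annulus_weight_const.
by rewrite e in h; exact: (cvg_unique _ h h0).
Qed.

Lemma jointly_measurable_monomial_dev2 s a b n : 0 <= a <= b ->
  measurable_fun (@in_disk (Conf R)) (fun Xp : Conf R * plane R => monomial_dev2 s a b (to_complex Xp.2) n Xp.1).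
Proof.
move=> ab; have /andP[a0 ab'] := ab; have b0 := le_trans a0 ab'.
have m2 : measurable_fun (@in_disk (Conf R)) (fun Xp : Conf R * plane R => Xp.2).
  by apply: measurable_funTS; exact: measurable_snd.
have part (q : R[i] -> R) : continuous q -> measurable_fun setT (fun p : plane R => q (to_complex p)) ->
   measurable_fun (@in_disk (Conf R)) (fun Xp : Conf R * plane R =>
    (lin_stat (fun x => annulus_weight s a b (to_complex Xp.2) x * q x) Xp.1 -
       q (to_complex Xp.2) * mean_statr (annulus_weight s a b (to_complex Xp.2))) ^+ 2).
  move=> cq mq; apply: measurable_funX; apply: (eq_measurable_fun (fun Xp : Conf R * plane R =>
    lin_stat (ballw s b q (to_complex Xp.2)) Xp.1 + -1 * lin_stat (ballw s a q (to_complex Xp.2)) Xp.1 -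
     q (to_complex Xp.2) * mean_statr (annulus_weight s a b 0))).
    move=> [X p] /set_mem pd; have zd : disk (to_complex p) by [].
    have e1 := @lin_stat_annulus_weight_ball R s a b q (to_complex p) X ab zd.
    have e2 : mean_statr (annulus_weight s a b (to_complex p)) = mean_statr (annulus_weight s a b 0) by rewrite /mean_statr mean_stat_annulus_weight_const.
    by change (lin_stat (ballw s b q (to_complex p)) X + -1 * lin_stat (ballw s a q (to_complex p)) X -
      q (to_complex p) * mean_statr (annulus_weight s a b 0) = lin_stat (fun x0 => annulus_weight s a b (to_complex p) x0 * q x0) X -
     q (to_complex p) * mean_statr (annulus_weight s a b (to_complex p))); rewrite e1 e2.
  apply: measurable_funB.
    apply: measurable_funD; first exact: jointly_measurable_ball.
    by apply: measurable_funM => //; exact: jointly_measurable_ball.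
  by apply: measurable_funM => //; exact: (measurableT_comp mq m2).
have [hr hi] := cmapX n (@cmap_id R).
apply: measurable_funD.
  apply: (part (fun x => complex.Re (x ^+ n))) => //.
  by under eq_fun do rewrite -[_ ^+ n]mul1r; exact: continuous_monomial.
apply: (part (fun x => complex.Im (x ^+ n))) => //.
by under eq_fun do rewrite ImE_Re; exact: continuous_monomial.
Qed.

Lemma jointly_measurable_energy c s a b : (forall n, 0 < c n) -> 0 <= a <= b ->
  measurable_fun (@in_disk (Conf R)) (fun Xp : Conf R * plane R => energy c s a b (to_complex Xp.2) Xp.1).
Proof.
move=> c0 ab; apply: (ge0_emeasurable_sum (P := xpredT)).
  by move=> n X _ _; rewrite lee_fin mulr_ge0 ?monomial_dev2_ge0// invr_ge0 ltW.
by move=> n _; apply/measurable_EFinP; apply: measurable_funM => //; exact: jointly_measurable_monomial_dev2.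
Qed.

Lemma jointly_measurable_shells_energy c s : (forall n, 0 < c n) ->
  measurable_fun (@in_disk (Conf R)) (fun Xp : Conf R * plane R => shells_energy c s (to_complex Xp.2) Xp.1).
Proof.
move=> c0; apply: (ge0_emeasurable_sum (P := xpredT)).
  by move=> n X _ _; rewrite mule_ge0 ?energy_ge0// lee_fin exprn_ge0// expR_ge0.
by move=> k _; apply: measurable_funeM; apply: jointly_measurable_energy => //; exact: range_succ.
Qed.

Lemma jointly_measurable_limit_energy c s : (forall n, 0 < c n) ->
  measurable_fun (@in_disk (Conf R)) (fun Xp : Conf R * plane R => limit_energy c s (to_complex Xp.2) Xp.1).
Proof.
move=> c0; under eq_fun do rewrite /limit_energy limn_einf_lim.
apply: (@emeasurable_fun_cvg _ _ _ _ (fun n (Xp : Conf R * plane R) =>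
   einfs (fun K => energy c s 0 K%:R (to_complex Xp.2) Xp.1) n)).
  by apply: measurable_fun_einfs => K; apply: jointly_measurable_energy => //; exact: range0.
by move=> X _; exact: is_cvg_einfs.
Qed.

End JointMeasurability.

(** * Exchanging almost sure and almost everywhere *)

(** Tonelli's theorem for the indicator of B. *)
Lemma null_sections d1 d2 (T1 : measurableType d1) (T2 : measurableType d2) (R : realType)
  (m1 : {sigma_finite_measure set T1 -> \bar R}) (m2 : {sigma_finite_measure set T2 -> \bar R})
  (B : set (T1 * T2)) : measurable B ->
  (forall y, {ae m1, forall x, ~ B (x, y)}) ->
  {ae m1, forall x, m2 (xsection B x) = 0%E}.
Proof.
move=> mB aeB.
pose f Xp : \bar R := (\1_B Xp)%:E.
have mf : measurable_fun setT f by apply/measurable_EFinP; exact: measurable_indic.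
have f0 Xp : (0 <= f Xp)%E by rewrite lee_fin.
have zero : (\int[m1]_x \int[m2]_y f (x, y) = 0)%E.
  rewrite (fubini_tonelli f mf f0); apply: integral0_eq => y _.
  have -> : (\int[m1]_x f (x, y) = \int[m1]_x (cst 0 x))%E.
    apply: ae_eq_integral => //.
    - exact: (measurableT_comp mf (measurable_pair2 y)).
    - apply: filterS (aeB y) => x h _; rewrite /f indicE memNset//.
  by rewrite integral_cst// mul0e.
have mF : measurable_fun setT (fun x => \int[m2]_y f (x, y))%E.
  exact: (measurable_fun_fubini_tonelli_F (m2 := m2) f mf f0).
have F0 x : (0 <= \int[m2]_y f (x, y))%E by apply: integral_ge0.
have ae0 : ae_eq m1 setT (fun x => \int[m2]_y f (x, y))%E (cst 0%E).
  apply/(ae_eq_integral_abs _ measurableT mF).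
  by rewrite -zero; apply: eq_integral => x _; rewrite gee0_abs.
apply: filterS ae0 => x /(_ I) /= hx.
rewrite -[RHS]hx -[xsection B x]setIT -integral_indic//; last exact: measurable_xsection.
apply: eq_integral => y _; rewrite /f !indicE; congr (_%:R%:E).
by rewrite mem_xsection.
Qed.

Section AlmostEverywhere.
Context {R : realType}.
Implicit Types (X : conf R) (z x : R[i]).
Local Notation lam := (@lebesgue_measure R \x @lebesgue_measure R)%E.

Lemma sigma_finite_plane : sigma_finite setT lam.
Proof.
have /sigma_finiteP[F [TF ndF Foo]] := sigma_finiteT (@lebesgue_measure R).
exists (fun n => F n `*` F n).
  rewrite -setXTT TF predeqE => -[x y]; split; last by move=> [n _ [/= Fx Fy]]; split; exists n.
  move=> [/= [n _ Fnx] [k _ Fky]]; exists (maxn n k) => //; split.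
    by move: x Fnx; exact/subsetPset/ndF/leq_maxl.
  by move: y Fky; exact/subsetPset/ndF/leq_maxr.
move=> k; have [mk fk] := Foo k; split; first exact: measurableX.
by rewrite product_measure1E// lte_mul_pinfty// ge0_fin_numE.
Qed.

(** The set of pairs (X,z) with T(X,z) infinite is measurable and has null
    sections in one direction, hence in the other. *)
Lemma ae_swap (P : probability (Conf R) R) (T : Conf R -> R[i] -> \bar R) :
  measurable_fun (@in_disk R (Conf R)) (fun Xp : Conf R * plane R => T Xp.1 (to_complex Xp.2)) ->
  (forall z, disk z -> {ae P, forall X : Conf R, (T X z < +oo)%E}) ->
  {ae P, forall X : Conf R, {ae area, forall p : plane R,
    plane_disk p -> (T X (to_complex p) < +oo)%E}}.
Proof.
move=> mT aeT.
pose bad : set (Conf R * plane R) := @in_disk R (Conf R) `&` [set Xp | T Xp.1 (to_complex Xp.2) = +oo%E].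
have mbad : measurable bad.
  have := mT (@measurable_in_disk R _ (Conf R)) [set +oo%E] (emeasurable_set1 _).
  by congr measurable; apply/seteqP; split.
have aebad (p : plane R) : {ae P, forall X : Conf R, ~ bad (X, p)}.
  have [pd|npd] := pselect (disk (to_complex p)).
    by apply: filterS (aeT _ pd) => X h [_ /= h2]; rewrite h2 ltxx in h.
  by apply: aeW => X [h _]; exact: npd.
pose L : {sigma_finite_measure set (measurableTypeR R * measurableTypeR R)%type -> \bar R} :=
  HB.pack lam (Measure_isSigmaFinite.Build _ _ _ lam sigma_finite_plane).
have : {ae P, forall X : Conf R, L (xsection bad X) = 0%E} by exact: null_sections mbad aebad.
apply: filterS => X hX.
exists (xsection bad X); split.
- exact: measurable_xsection.
- by change ((pi^-1)%:E * (lam (xsection bad X)) = 0)%E; rewrite hX mule0.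
move=> p /= /not_implyP[pd h]; rewrite /xsection/=; apply: mem_set; split=> //=.
by apply/eqP; rewrite -leye_eq leNgt; exact/negP.
Qed.

End AlmostEverywhere.

(** * The denominator, and pointwise bounds *)

Section Ratio.
Context {R : realType}.
Implicit Types (X : conf R) (z x : R[i]) (f : R[i] -> R[i]) (s a b t : R) (c : nat -> R) (W : R[i] -> R).

Lemma le_g_sum X s z (K : nat) : disk z -> ((lin_stat (annulus_weight s 0 K%:R z) X)%:E <= g_sum X s z)%E.
Proof.
move=> zd; have zt : cabs z <= cabs z < 1 by rewrite lexx.
have s1 := safe_radius_lt1 (ler0n R K) (radius_itv zt).
have su : supp_in (safe_radius (cabs z) K%:R) (annulus_weight s 0 K%:R z).
  by move=> x hx; exact: (@annulus_weight_support R s 0 K%:R _ z (ler0n R K) zt x hx).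
rewrite -(esum_lin_stat X s1 su (@annulus_weight_ge0 R s 0 K%:R z)) g_sum_exp_weight//.
apply: le_esum => x _; rewrite lee_fin; apply: ler_wpM2l => //.
by rewrite annulus_weight_exp_weight// ler_piMl ?exp_weight_ge0// lern1 leq_b1.
Qed.

(** A finite set of points contributes the limit of its truncated
    contributions. *)
Lemma g_sum_le X s z (l : R) : disk z ->
  lin_stat (annulus_weight s 0 K%:R z) X @[K --> \oo] --> l -> (g_sum X s z <= l%:E)%E.
Proof.
move=> zd hl; have zt : cabs z <= cabs z < 1 by rewrite lexx.
rewrite g_sum_exp_weight//; apply: ge_ereal_sup => _ [A [fA _] <-].
rewrite fsbig_finite//= sumEFin lee_fin.
have hA : \sum_(x <- fset_set A) (X x)%:R * annulus_weight s 0 K%:R z x @[K --> \oo] -->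
    \sum_(x <- fset_set A) (X x)%:R * exp_weight s z x.
  elim: (finmap.enum_fset (fset_set A)) => [|x r ih].
    by rewrite big_nil; under eq_cvg do rewrite big_nil; exact: cvg_cst.
  rewrite big_cons; under eq_cvg do rewrite big_cons.
  by apply: cvgD => //; apply: cvgM; [exact: cvg_cst|exact: cvg_annulus_weight_exp_weight].
apply: ler_cvg_to hA hl _; apply: nearW => K; rewrite -lee_fin.
have s1 := safe_radius_lt1 (ler0n R K) (radius_itv zt).
have su : supp_in (safe_radius (cabs z) K%:R) (annulus_weight s 0 K%:R z).
  by move=> x hx; exact: (@annulus_weight_support R s 0 K%:R _ z (ler0n R K) zt x hx).
rewrite -(esum_lin_stat X s1 su (@annulus_weight_ge0 R s 0 K%:R z)).
apply: ereal_sup_ubound; exists A; first by split.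
by rewrite fsbig_finite//= sumEFin.
Qed.

(** The partial sums of the series for f = 1 are the truncated sums, which
    increase to g_X(s,z). *)
Lemma g_sum_fun_one X s z : disk z -> g_sum_converges X s z (fun=> 1) ->
  g_sum_fun X s z (fun=> 1) = real_complex R (fine (g_sum X s z)).
Proof.
move=> zd cv; have zt : cabs z <= cabs z < 1 by rewrite lexx.
have FF : Filter (\oo : set_system nat) by exact: eventually_filter.
set S := g_sum_fun X s z (fun=> 1).
have hS : clin_stat (annulus_weight s 0 K%:R z) (fun=> 1) X (safe_radius (cabs z) K%:R) @[K --> \oo] --> S.
  by under eq_cvg do rewrite -series_g_shell//; exact: cv.
have clin_statE K : clin_stat (annulus_weight s 0 K%:R z) (fun=> 1) X (safe_radius (cabs z) K%:R) = real_complex R (lin_stat (annulus_weight s 0 K%:R z) X).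
  have s1 := safe_radius_lt1 (ler0n R K) (radius_itv zt).
  have su : supp_in (safe_radius (cabs z) K%:R) (annulus_weight s 0 K%:R z).
    by move=> x hx; exact: (@annulus_weight_support R s 0 K%:R _ z (ler0n R K) zt x hx).
  have [h1 h2] := @clin_stat_ReIm R (annulus_weight s 0 K%:R z) (fun=> 1) X _ s1 su.
  apply/eqP; rewrite eq_complex h1 h2/=; apply/andP; split; apply/eqP.
    by congr lin_stat; apply/funext => x; rewrite mulr1.
  rewrite (lin_stat_pts X s1); last by move=> x _; rewrite mulr0.
  by rewrite big1// => x _; rewrite !mulr0.
have hre : lin_stat (annulus_weight s 0 K%:R z) X @[K --> \oo] --> complex.Re S.
  by have := cvg_Re FF hS; under eq_cvg do rewrite clin_statE.
have him : complex.Im S = 0.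
  have := cvg_Im FF hS; under eq_cvg do rewrite clin_statE/=.
  by move=> h; apply: (cvg_unique _ h) => //; exact: cvg_cst.
have e : g_sum X s z = (complex.Re S)%:E.
  have := le_g_sum X s _ zd; have := g_sum_le zd hre.
  case: (g_sum X s z) => [r h1 h2|//|_ /(_ 0%N)//].
  congr EFin; apply/eqP; rewrite eq_le -lee_fin h1/=.
  by apply: (ler_cvg_to hre (cvg_cst _)); apply: nearW => K; rewrite -lee_fin.
by apply/eqP; rewrite e eq_complex/= him !eqxx.
Qed.

(** The squared norm of the constant 1 is the integral of W. *)
Lemma weighted_bergman_one W : super_critical W -> weighted_bergman W (fun=> 1).
Proof.
move=> [iW W0 _]; split; first by move=> z _; exact: derivable_cst.
rewrite /weighted_sqnorm; under eq_integral do rewrite cabs1 expr1n mul1r.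
have /integrableP[_] := iW; congr (_ < _)%E; apply: eq_integral => p /set_mem pd.
by rewrite gee0_abs// lee_fin W0.
Qed.

(** Point evaluation is bounded on A^2(D,W): Cauchy-Schwarz for the Taylor
    series. *)
Lemma point_bound W M J z : super_critical W -> 0 < M ->
  (forall j x, (J <= j)%N -> in_shell j x -> M * 2 ^+ j / (j + 3)%:R ^+ 2 <= W x) ->
  disk z -> exists2 K : R, 0 <= K & forall f F, weighted_bergman W f ->
    fine (weighted_sqnorm W f) <= F -> cabs (f z) <= Num.sqrt F * K.
Proof.
move=> hW M0 hJ zd.
have zt : cabs z <= cabs z < 1 by rewrite lexx.
have [B hB] := shell_cover (radius_itv zt).
have [j _ zj] := hB z (lexx _).
pose C := 16 / (M * @disk_mass R) * (j + J + 7)%:R * 2 ^+ j.+1.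
exists (Num.sqrt C); first exact: sqrtr_ge0.
move=> f F fW hF; have [h1 h2] := good_coef hW (ltW M0) hJ fW.
have F0 : 0 <= F by apply: le_trans hF; exact: weighted_sqnorm_fine_ge0.
have FF : Filter (\oo : set_system nat) by exact: eventually_filter.
rewrite -sqrtrM//; apply: (ler_cvg_to (cvg_cabs FF (h1 z zd)) (cvg_cst _)).
apply: nearW => m; rewrite -[leLHS]ger0_norm ?cabs_ge0// -sqrtr_sqr; apply: ler_wsqrtr.
have c0 n := coef_weight_gt0 J n M0.
apply: (@le_trans _ _ ((\sum_(n < m) cabs (taylor_coef f n) * cabs z ^+ n) ^+ 2)).
  rewrite lerXn2r ?nnegrE ?cabs_ge0//; first by apply: sumr_ge0 => n _; rewrite mulr_ge0 ?exprn_ge0 ?cabs_ge0.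
  apply: (le_trans (le_cabs_sum _ _ _)); apply: ler_sum => n _.
  by rewrite cabsM cabsX.
apply: (le_trans (cauchy_schwarz_weighted (fun n => cabs (taylor_coef f n)) (fun n => cabs z ^+ n) m c0)).
apply: ler_pM.
- by apply: sumr_ge0 => n _; rewrite mulr_ge0 ?sqr_ge0// ltW.
- by apply: sumr_ge0 => n _; rewrite mulr_ge0 ?sqr_ge0// invr_ge0 ltW.
- exact: le_trans (h2 m) hF.
apply: le_trans (coef_sum_le J m M0 zj); apply: ler_sum => n _.
by rewrite -exprM mulnC.
Qed.

End Ratio.

(** * Ratio estimates and the choice of the sequence *)

Section AlmostSure.
Context {R : realType}.
Implicit Types (X : conf R) (z x : R[i]) (f : R[i] -> R[i]) (s a b t : R) (W : R[i] -> R).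
Context (W : R[i] -> R) (hW : super_critical W).

Lemma ratio_bound M J s z X (A : R) : 0 < M ->
  (forall j x, (J <= j)%N -> in_shell j x -> M * 2 ^+ j / (j + 3)%:R ^+ 2 <= W x) ->
  1 < s -> disk z -> 0 < fine (mean_stat (exp_weight s z)) ->
  (shells_energy (coef_weight M J) s z X < +oo)%E ->
  (limit_energy (coef_weight M J) s z X <= (A * fine (mean_stat (exp_weight s z)) ^+ 2)%:E)%E ->
  forall f F, weighted_bergman W f -> 0 < F -> fine (weighted_sqnorm W f) <= F ->
  cabs (g_sum_fun X s z f / real_complex R (fine (mean_stat (exp_weight s z))) - f z) <= Num.sqrt F * Num.sqrt A.
Proof.
move=> M0 hJ s1 zd g0 hT hZ f F fW F0 hF; set g := fine (mean_stat (exp_weight s z)) in g0 hZ *.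
have [h1 h2] := good_coef hW (ltW M0) hJ fW.
have h3 N : \sum_(n < N) cabs (taylor_coef f n) ^+ 2 * coef_weight M J n <= F.
  exact: (le_trans (h2 N)).
have cv := converges_of_shells_energy hW M0 hJ s1 zd hT fW.
have c0 n := coef_weight_gt0 J n M0.
have Fe : (0 <= F%:E)%E by rewrite lee_fin ltW.
have := le_trans (limit_bound c0 F0 h1 h3 s1 zd cv) (lee_wpmul2l Fe hZ).
rewrite -/g -EFinM lee_fin => hb.
have gc : real_complex R g != 0 by rewrite eq_complex/= eqxx andbT gt_eqF.
have -> : g_sum_fun X s z f / real_complex R g - f z =
   (g_sum_fun X s z f - f z * real_complex R g) / real_complex R g.
  by rewrite mulrBl mulfK.
rewrite cabsM cabsV cabs_real gtr0_norm// -sqrtrM ?(ltW F0)// ler_pdivrMr//.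
rewrite -[g in leRHS]gtr0_norm// -sqrtr_sqr -sqrtrM.
  rewrite -[leLHS]ger0_norm ?cabs_ge0// -sqrtr_sqr; apply: ler_wsqrtr.
  by rewrite -mulrA.
have : 0 <= F * (A * g ^+ 2) by apply: le_trans hb; exact: sqr_ge0.
by rewrite mulrA pmulr_lge0// exprn_gt0.
Qed.

Lemma quotient_bound (u v w : R[i]) (e d k : R) : cabs (u - w) <= e -> cabs (v - 1) <= d ->
  d <= 2^-1 -> cabs w <= k -> cabs (u / v - w) <= 2 * (e + k * d).
Proof.
move=> hu hv d2 hw.
have v1 : 2^-1 <= cabs v.
  by have := le_cabsD v (1 - v); rewrite addrC subrK cabs1 (cabs_distC 1 v); lra.
have v0 : v != 0 by apply/eqP => v0; move: v1; rewrite v0 cabs0; lra.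
have -> : u / v - w = ((u - w) - w * (v - 1)) / v.
  by field.
rewrite cabsM cabsV ler_pdivrMr; last by lra.
have h : cabs (u - w - w * (v - 1)) <= e + k * d.
  apply: (le_trans (le_cabsD _ _)); rewrite cabsN cabsM; apply: lerD => //.
  by apply: ler_pM => //; exact: cabs_ge0.
have p : 0 <= e + k * d by apply: le_trans h; exact: cabs_ge0.
apply: (le_trans h); have -> : 2 * (e + k * d) * cabs v = (e + k * d) * (2 * cabs v) by ring.
by apply: ler_peMr => //; lra.
Qed.

(** The bounds 2^{-n-1} 2^{-n} leave room for the growing factor 2^n below,
    and the radii 1 - 1/(n+2) exhaust the disk. *)
Lemma good_sequence : exists Ms : nat -> R, exists Js : nat -> nat, exists s_ : nat -> R,
  [/\ forall n, 0 < Ms n,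
      forall n j x, (Js n <= j)%N -> in_shell j x -> Ms n * 2 ^+ j / (j + 3)%:R ^+ 2 <= W x,
      forall n, 1 < s_ n <= 2,
      s_ n @[n --> \oo] --> (1 : R) &
      forall n z, cabs z <= 1 - (n.+2%:R)^-1 ->
        0 < fine (mean_stat (exp_weight (s_ n) z)) /\
        2 * var_bound (1 - (n.+2%:R)^-1) (Ms n) (Js n) (s_ n) <= 1 / (2 ^ n.+1)%:R / 2 ^+ n * fine (mean_stat (exp_weight (s_ n) z)) ^+ 2].
Proof.
have /choice[p hp] n : exists p : R * nat * R, [/\ 0 < p.1.1,
    forall j x, (p.1.2 <= j)%N -> in_shell j x -> p.1.1 * 2 ^+ j / (j + 3)%:R ^+ 2 <= W x, 0 < p.2 &
    forall s z, 1 < s < 1 + p.2 -> cabs z <= 1 - (n.+2%:R)^-1 ->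
      [/\ 1 < s <= 2, 0 < fine (mean_stat (exp_weight s z)) &
         2 * var_bound (1 - (n.+2%:R)^-1) p.1.1 p.1.2 s <= 1 / (2 ^ n.+1)%:R / 2 ^+ n * fine (mean_stat (exp_weight s z)) ^+ 2]].
  have t01 : 0 <= 1 - (n.+2%:R : R)^-1 < 1.
    by rewrite subr_ge0 invf_le1// ler1n/= ltrBlDr ltrDl invr_gt0.
  have e0 : 0 < 1 / (2 ^ n.+1)%:R / 2 ^+ n :> R by rewrite !divr_gt0// ?exprn_gt0// ltr0n expn_gt0.
  have [M [J [d [h1 h2 h3 h4]]]] := variance_small hW t01 e0.
  by exists (M, J, d).
pose s_ n := 1 + Num.min (p n).2 n.+1%:R^-1 / 2.
have m0 n : 0 < Num.min (p n).2 n.+1%:R^-1.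
  by have [_ _ d0 _] := hp n; rewrite lt_min d0 invr_gt0 ltr0n.
have m1 n : Num.min (p n).2 n.+1%:R^-1 / 2 < Num.min (p n).2 n.+1%:R^-1.
  by rewrite ltr_pdivrMr// mulr2n mulrDr mulr1 ltrDl.
have s1 n : 1 < s_ n < 1 + (p n).2.
  rewrite /s_ ltrDl divr_gt0//= ltrD2l (lt_le_trans (m1 n))// ge_min lexx//.
have z0 n : cabs (0 : R[i]) <= 1 - (n.+2%:R)^-1.
  by rewrite cabs0 subr_ge0 invf_le1// ler1n.
exists (fun n => (p n).1.1), (fun n => (p n).1.2), s_; split.
- by move=> n; have [] := hp n.
- by move=> n; have [] := hp n.
- by move=> n; have [_ _ _ /(_ _ _ (s1 n) (z0 n))[]] := hp n.
- apply: (@squeeze_cvgr _ _ _ _ (fun=> 1) (fun n => 1 + n.+1%:R^-1)); last 2 first.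
  + exact: cvg_cst.
  + by rewrite -[X in _ --> X]addr0; apply: cvgD; [exact: cvg_cst|exact: cvg_harmonic].
  apply: nearW => n; have /andP[/ltW -> _] := s1 n.
  by rewrite /= /s_ lerD2l (le_trans (ltW (m1 n)))// ge_min lexx orbT.
- by move=> n z hz; have [_ _ _ /(_ _ _ (s1 n) hz)[]] := hp n.
Qed.

End AlmostSure.

(** * The almost sure limit *)

Section Final.
Context {R : realType}.
Implicit Types (X : conf R) (z x : R[i]) (f : R[i] -> R[i]) (s a b t : R) (W : R[i] -> R).
Context (P : probability (Conf R) R) (hP : determinantal_process P bergman_kernel).
Context (W : R[i] -> R) (hW : super_critical W).

Lemma cvg_half_pow : (2 ^+ n)^-1 @[n --> \oo] --> (0 : R).
Proof.
have -> : (fun n => (2 ^+ n)^-1 : R) = (fun n => 2^-1 ^+ n) by apply/funext => n; rewrite exprVn.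
by apply: cvg_expr; rewrite ger0_norm// invf_lt1// ltr1n.
Qed.

(** Divide numerator and denominator by the mean; both are then close to
    their limits f(z) and 1, uniformly on bounded sets of f. *)
Lemma ratio_limit (Ms : nat -> R) (Js : nat -> nat) (s_ : nat -> R) X z (C : R) :
  (forall n, 0 < Ms n) ->
  (forall n j x, (Js n <= j)%N -> in_shell j x -> Ms n * 2 ^+ j / (j + 3)%:R ^+ 2 <= W x) ->
  (forall n, 1 < s_ n <= 2) -> disk z ->
  (forall n, 0 < fine (mean_stat (exp_weight (s_ n) z))) ->
  (forall n, (shells_energy (coef_weight (Ms n) (Js n)) (s_ n) z X < +oo)%E) ->
  (\forall n \near \oo, (limit_energy (coef_weight (Ms n) (Js n)) (s_ n) z X <=
     (C / 2 ^+ n * fine (mean_stat (exp_weight (s_ n) z)) ^+ 2)%:E)%E) ->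
  exists2 eta : nat -> R, eta n @[n --> \oo] --> 0 &
    \forall n \near \oo, forall f F, weighted_bergman W f -> 0 < F ->
      fine (weighted_sqnorm W f) <= F ->
      cabs (g_sum_fun X (s_ n) z f / real_complex R (fine (g_sum X (s_ n) z)) - f z)
        <= Num.sqrt F * eta n.
Proof.
move=> M0 hJ s12 zd g0 hT hZ.
have s1 n : 1 < s_ n by case/andP: (s12 n).
have [K K0 hK] := point_bound hW (M0 0%N) (hJ 0%N) zd.
have oneW := weighted_bergman_one hW.
pose F1 := fine (weighted_sqnorm W (fun=> 1)) + 1.
have F10 : 0 < F1 by rewrite ltr_pwDr// weighted_sqnorm_fine_ge0.
have hF1 : fine (weighted_sqnorm W (fun=> 1)) <= F1 by rewrite lerDl.
pose A n := Num.sqrt (C / 2 ^+ n).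
have cA : A n @[n --> \oo] --> 0.
  rewrite -[X in _ --> X](sqrtr0 R) /A.
  apply: (@cvgr_comp R _ _ _ Num.sqrt (fun n => C / 2 ^+ n)); first exact: sqrt_continuous.
  by rewrite -[X in _ --> X](mulr0 C); apply: cvgM; [exact: cvg_cst|exact: cvg_half_pow].
exists (fun n => 2 * (1 + K * Num.sqrt F1) * A n).
  by rewrite -[X in _ --> X](mulr0 (2 * (1 + K * Num.sqrt F1))); apply: cvgM => //; exact: cvg_cst.
have nA : \forall n \near \oo, Num.sqrt F1 * A n < 2^-1.
  have h : Num.sqrt F1 * A n @[n --> \oo] --> Num.sqrt F1 * 0 by apply: cvgM => //; exact: cvg_cst.
  by apply: (cvgr_lt _ h); rewrite mulr0 invr_gt0.
apply: filterS2 hZ nA => n hZn hAn f F fW F0 hF.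
set g := fine (mean_stat (exp_weight (s_ n) z)).
have gc : real_complex R g != 0 by rewrite eq_complex/= eqxx andbT gt_eqF// g0.
have h1 := ratio_bound hW (M0 n) (@hJ n) (s1 n) zd (g0 n) (hT n) hZn fW F0 hF.
have h2 := ratio_bound hW (M0 n) (@hJ n) (s1 n) zd (g0 n) (hT n) hZn oneW F10 hF1.
have cv := converges_of_shells_energy hW (M0 n) (@hJ n) (s1 n) zd (hT n) oneW.
rewrite -(g_sum_fun_one zd cv).
have -> : g_sum_fun X (s_ n) z f / g_sum_fun X (s_ n) z (fun=> 1) =
  (g_sum_fun X (s_ n) z f / real_complex R g) / (g_sum_fun X (s_ n) z (fun=> 1) / real_complex R g).
  by rewrite invf_div mulrA divfK.
apply: (le_trans (quotient_bound h1 h2 (ltW hAn) (hK f F fW hF))).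
by rewrite -/(A n) le_eqVlt; apply/orP; left; apply/eqP; ring.
Qed.

(** The sum over n of 2^n times the normalised energies has finite mean at
    each z, so it is finite almost surely, and then the n-th energy is
    O(2^{-n}). *)
Lemma almost_sure_limit : exists s_ : nat -> R,
     [/\ forall n, 1 < s_ n,
         s_ n @[n --> \oo] --> (1 : R) &
         {ae P, forall X : Conf R, {ae area, forall p : plane R,
            plane_disk p ->
            let z := to_complex p in
            let ratio n f :=
              g_sum_fun X (s_ n) z f
                / real_complex R (fine (g_sum X (s_ n) z)) in
            [/\ forall n f, weighted_bergman W f ->
                  g_sum_converges X (s_ n) z f,
                forall f, weighted_bergman W f ->
                  ratio n f @[n --> \oo] --> f z &
                forall e : R, 0 < e -> \forall n \near \oo,
                  forall f, unit_ball W f -> cabs (ratio n f - f z) < e]}}].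
Proof.
have [Ms [Js [s_ [M0 hJ s12 cs hV]]]] := good_sequence hW.
have s1 n : 1 < s_ n by case/andP: (s12 n).
exists s_; split=> //.
pose t n : R := 1 - (n.+2%:R)^-1.
have t01 n : 0 <= t n < 1.
  by rewrite /t subr_ge0 invf_le1// ler1n/= ltrBlDr ltrDl invr_gt0.
pose c n := coef_weight (Ms n) (Js n).
have c0 n k : 0 < c n k by exact: coef_weight_gt0.
pose G n := fine (mean_stat (exp_weight (s_ n) 0)).
have GE n z : disk z -> fine (mean_stat (exp_weight (s_ n) z)) = G n.
  by move=> zd; rewrite /G (mean_stat_exp_weight_const (s1 n) zd).
have G0 n : 0 < G n.
  by have [] := hV n 0; rewrite // cabs0; case/andP: (t01 n).
(* the indicator discards the finitely many n for which the bound is not available at z *)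
pose w n z : R := (cabs z < t n)%R%:R * (2 ^+ n / G n ^+ 2).
have w0 n z : 0 <= w n z by rewrite mulr_ge0// divr_ge0 ?exprn_ge0// ltW.
pose T X z := (\sum_(n <oo) (w n z)%:E * limit_energy (c n) (s_ n) z X)%E.
have Z0 n X z : (0 <= (w n z)%:E * limit_energy (c n) (s_ n) z X)%E.
  by apply: mule_ge0; [rewrite lee_fin; exact: w0|exact: limit_energy_ge0].
have mT : measurable_fun (@in_disk R (Conf R)) (fun Xp : Conf R * plane R => T Xp.1 (to_complex Xp.2)).
  apply: (ge0_emeasurable_sum (P := xpredT)) => [n Xp _ _|n _]; first exact: Z0.
  apply: emeasurable_funM; last exact: jointly_measurable_limit_energy.
  apply/measurable_EFinP; apply: measurable_funM; last exact: measurable_cst.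
  by apply: measurable_funTS; apply: (measurableT_comp (measurable_cabs_lt (t n)) measurable_snd).
have aeT z : disk z -> {ae P, forall X : Conf R, (T X z < +oo)%E}.
  move=> zd; have mZ n : measurable_fun setT (fun X : Conf R => ((w n z)%:E * limit_energy (c n) (s_ n) z X)%E).
    by apply: measurable_funeM; exact: measurable_limit_energy.
  apply: ae_lty.
  - by apply: (ge0_emeasurable_sum (P := xpredT)) => n *; [exact: Z0|exact: mZ].
  - by move=> X; apply: nneseries_ge0 => n _ _; exact: Z0.
  rewrite integral_nneseries//.
  apply: (@le_lt_trans _ _ (\sum_(n <oo) (1 / (2 ^ n.+1)%:R : R)%:E)%E); last first.
    by apply: (le_lt_trans (epsilon_trick0 xpredT ler01)); rewrite ltry.
  apply: lee_nneseries => [n _ _|n _]; first by apply: integral_ge0 => X _; exact: Z0.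
  have mZ0 : measurable_fun setT (fun X : Conf R => limit_energy (c n) (s_ n) z X) by exact: measurable_limit_energy.
  rewrite (ge0_integralZl P measurableT mZ0); last 2 first.
  - by move=> X _; exact: limit_energy_ge0.
  - by rewrite lee_fin.
  have [zt|zt] := boolP (cabs z < t n); last first.
    by rewrite /w (negbTE zt) mul0r mul0e lee_fin divr_ge0.
  have w0e : (0 <= (w n z)%:E)%E by rewrite lee_fin.
  have zt' : cabs z <= t n < 1 by rewrite ltW//; case/andP: (t01 n).
  apply: (le_trans (lee_wpmul2l w0e (mean_limit_energy hP (Js n) zt' (M0 n) (s12 n)))).
  have [_ h] := hV n z (ltW zt); rewrite GE// in h.
  rewrite -EFinM lee_fin; apply: (le_trans (ler_wpM2l (w0 n z) h)).
  rewrite /w zt !mul1r le_eqVlt; apply/orP; left; apply/eqP.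
  have p0 : (2 : R) ^+ n != 0 by rewrite expf_neq0.
  have q0 : G n ^+ 2 != 0 by rewrite expf_neq0// gt_eqF.
  have id (u v q : R) : v != 0 -> q != 0 -> v / q * (u / v * q) = u.
    by move=> v0 q0'; field; rewrite v0 q0'.
  exact: id.
have aeTs z n : disk z -> {ae P, forall X : Conf R, (shells_energy (c n) (s_ n) z X < +oo)%E}.
  by move=> zd; exact: ae_shells_energy.
have ae1 := ae_swap mT aeT.
have ae2 : {ae P, forall X : Conf R, forall n, {ae area, forall p : plane R,
    plane_disk p -> (shells_energy (c n) (s_ n) (to_complex p) X < +oo)%E}}.
  apply: ae_foralln => n; apply: (@ae_swap R P (fun X z => shells_energy (c n) (s_ n) z X)).
    exact: jointly_measurable_shells_energy.
  by move=> z zd; exact: aeTs.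
apply: filterS2 ae1 ae2 => X hX1 /ae_foralln hX2.
apply: filterS2 hX1 hX2 => p hp1 hp2 pd.
have zd : disk (to_complex p) by [].
move: (hp1 pd) (fun n => hp2 n pd) => {}hp1 {}hp2; move: (to_complex p) zd hp1 hp2 => z zd hp1 hp2.
have g0 n : 0 < fine (mean_stat (exp_weight (s_ n) z)) by rewrite GE.
pose C := fine (T X z).
have T0 : (0 <= T X z)%E by apply: nneseries_ge0 => n _ _; exact: Z0.
have hZ : \forall n \near \oo, (limit_energy (c n) (s_ n) z X <=
     (C / 2 ^+ n * fine (mean_stat (exp_weight (s_ n) z)) ^+ 2)%:E)%E.
  have zt : \forall n \near \oo, cabs z < t n.
    have ch : (n.+2%:R)^-1 @[n --> \oo] --> (0 : R).
      by have := @cvg_harmonic R; rewrite -(cvg_shiftS (harmonic : nat -> R)).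
    have ct : t n @[n --> \oo] --> (1 - 0 : R) by apply: cvgB => //; exact: cvg_cst.
    by apply: (cvgr_gt _ ct); rewrite subr0.
  apply: filterS zt => n zt; rewrite GE//.
  have h : ((w n z)%:E * limit_energy (c n) (s_ n) z X <= C%:E)%E.
    rewrite /C fineK ?ge0_fin_numE//.
    apply: le_trans (nneseries_lim_ge n.+1 _); last by move=> *; exact: Z0.
    by rewrite big_nat_recr//= leeDr// sume_ge0.
  have k0 : (0 <= (G n ^+ 2 / 2 ^+ n)%:E)%E by rewrite lee_fin divr_ge0 ?exprn_ge0// ltW.
  have := lee_wpmul2l k0 h; rewrite muleA -!EFinM.
  rewrite (_ : G n ^+ 2 / 2 ^+ n * w n z = 1); last first.
    have p0 : (2 : R) ^+ n != 0 by rewrite expf_neq0.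
    have q0 : G n ^+ 2 != 0 by rewrite expf_neq0// gt_eqF.
    by rewrite /w zt mul1r mulrA divfK// divff.
  by rewrite mul1e (_ : G n ^+ 2 / 2 ^+ n * C = C / 2 ^+ n * G n ^+ 2)//; ring.
have [eta ceta heta] := ratio_limit M0 hJ s12 zd g0 hp2 hZ.
split.
- by move=> n f fW; exact: (converges_of_shells_energy hW (M0 n) (@hJ n) (s1 n) zd (hp2 n) fW).
- move=> f fW; pose F := fine (weighted_sqnorm W f) + 1.
  have F0 : 0 < F by rewrite ltr_pwDr// weighted_sqnorm_fine_ge0.
  have FF : Filter (\oo : set_system nat) by exact: eventually_filter.
  apply/(cvgcP FF); apply: (@squeeze_cvgr _ _ _ _ (fun=> 0) (fun n => Num.sqrt F * eta n)); last 2 first.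
  + exact: cvg_cst.
  + by rewrite -[X in _ --> X](mulr0 (Num.sqrt F)); apply: cvgM => //; exact: cvg_cst.
  apply: filterS heta => n h; rewrite cabs_ge0/=; apply: h => //.
  by rewrite lerDl.
- move=> e e0; have ne : \forall n \near \oo, eta n < e by exact: (cvgr_lt _ ceta).
  apply: filterS2 heta ne => n h he f fB; apply: le_lt_trans he.
  by rewrite -[leRHS]mul1r -(sqrtr1 R); apply: h => //; [exact: fB.1|exact: unit_ball_le1].
Qed.

End Final.

Theorem theorem1p8 (R : realType) (P : probability (Conf R) R)
    (hP : determinantal_process P bergman_kernel)
    (W : R[i] -> R) (hW : super_critical W) :
  (* g_X(s, z; f) is well defined, simultaneously for all f *)
  (forall (s : R) (z : R[i]), 1 < s -> disk z ->
     {ae P, forall X : Conf R, forall f, weighted_bergman W f ->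
        g_sum_converges X s z f}) /\
  (forall D : set R[i], relatively_compact_in_disk D ->
     sup_ge0 [set (\int[P]_X ereal_sup
         [set (cabs (g_sum_fun X s z f / real_complex R (fine (g_mean P s z))
                     - f z) ^+ 2)%:E | f in unit_ball W])%E | z in D]
       @[s --> (1 : R)^'+] --> (0 : \bar R)%E) /\
  (exists s_ : nat -> R,
     [/\ forall n, 1 < s_ n,
         s_ n @[n --> \oo] --> (1 : R) &
         {ae P, forall X : Conf R, {ae area, forall p : plane R,
            plane_disk p ->
            let z := to_complex p in
            let ratio n f :=
              g_sum_fun X (s_ n) z f
                / real_complex R (fine (g_sum X (s_ n) z)) in
            [/\ forall n f, weighted_bergman W f ->
                  g_sum_converges X (s_ n) z f,
                forall f, weighted_bergman W f ->
                  ratio n f @[n --> \oo] --> f z &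
                forall e : R, 0 < e -> \forall n \near \oo,
                  forall f, unit_ball W f -> cabs (ratio n f - f z) < e]}}]).
Proof.
split; first by move=> s z s1 zd; exact: converges_ae.
split; first by move=> D hD; exact: mean_sup_limit.
exact: almost_sure_limit.
Qed.
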